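(* Let $X$ be a compact translation surface with non-elementary Veech group $\Gamma$ (without elliptic elements). Let $\mathbf f=(f_1,\dots,f_d)$ be a $d$-tuple of primitive, linearly independent elements of $H^1(X,\mathbb Z)$ with $\operatorname{hol}(f_i)=0$ for $i=1,\dots,d$, and let $X_{\mathbf f}$ be the corresponding connected $\mathbb Z^d$-cover of $X$. Let $F^{(1)},\dots,F^{(n)}\subset\ker\operatorname{hol}\subset H^1(X)$ be $\Gamma$-invariant integer subspaces, irreducible over $\mathbb Z$, whose sum $F=\bigoplus_{j=1}^n F^{(j)}$ is direct and contains $f_1,\dots,f_d$. Put $K_j=\ker\rho_{F^{(j)}}<\Gamma$ and suppose that every $K_j$, $j=1,\dots,n$, is non-trivial. If $\Gamma$ is of the first kind (resp. of the second kind), then $K=\ker\rho_F=\bigcap_{j=1}^n K_j$ is of the first kind (resp. of the second kind). In particular, the Veech group of $X_{\mathbf f}$ is of the first kind (resp. of the second kind).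
   Context: A translation surface $X$ is a compact Riemann surface with a nonzero holomorphic $1$-form $\omega$, with a finite set $\Sigma$ of singularities (and possibly marked points). The Veech group of a (possibly infinite) translation surface is the group of derivatives, in $\mathrm{SL}(2,\mathbb R)$, of its orientation-preserving, area-preserving affine automorphisms. The Veech group $\Gamma$ of the compact surface $X$ is a Fuchsian group. It is of the first kind if its limit set is the whole boundary circle of the hyperbolic plane, and of the second kind otherwise; the same terminology is used for subgroups of $\Gamma$ and for the Veech group of the infinite surface $X_{\mathbf f}$. It is non-elementary if its limit set is infinite. Standing convention: $\Gamma$ has no finite order (elliptic) elements (if necessary $\Gamma$ is replaced by a finite-index subgroup with this property). Representations: for $g\in\Gamma$, the corresponding affine automorphism of $X$ with derivative $g$ acts on $H^1(X)=H^1(X,\mathbb R)$ (the Kontsevich--Zorich cocycle), symplectically with respect to the intersection form and preserving $H^1(X,\mathbb Z)$. The affine automorphisms are understood to be chosen so that this defines a representation $\rho_{H^1}:\Gamma\to\mathrm{Sp}(H^1(X,\mathbb Z))$. If $F\subset H^1(X)$ is a $\Gamma$-invariant subspace, $\rho_F$ denotes the representation of $\Gamma$ on $F$ obtained by restriction. An integer subspace of $H^1(X)$ is a subspace defined over $\mathbb Z$, i.e. spanned by elements of $H^1(X,\mathbb Z)$; an invariant integer subspace is irreducible over $\mathbb Z$ if it is nonzero and contains no proper nonzero invariant integer subspace. Holonomy: for $f\in H^1(X)$, $\operatorname{hol}(f)=\int_{\gamma_f}\omega\in\mathbb C$, where $\gamma_f\in H_1(X,\mathbb R)$ is the Poincaré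 dual of $f$. Thus $\ker\operatorname{hol}$ is a codimension $2$ subspace of $H^1(X)$. The condition $\operatorname{hol}(f_i)=0$ for all $i$ is called the zero-drift condition. Covers: $X_{\mathbf f}$ is the connected $\mathbb Z^d$-cover of $X$ defined by $\mathbf f$, i.e. the cover associated with the kernel of the homomorphism $\pi_1(X)\to\mathbb Z^d$, $\gamma\mapsto(f_1(\gamma),\dots,f_d(\gamma))$, endowed with the translation structure pulled back from $X$. *)

(* Defs.v *)
From HB Require Import structures.
From mathcomp Require Import all_boot all_order all_algebra.
From mathcomp Require Import complex.
From mathcomp Require Import all_classical all_reals all_analysis.
Set Implicit Arguments.
Unset Strict Implicit.
Unset Printing Implicit Defensive.
Import Order.TTheory GRing.Theory Num.Theory.
Import numFieldNormedType.Exports.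
Local Open Scope classical_set_scope.
Local Open Scope ring_scope.

(* R[i], viewed as a numClosedFieldType so that it carries the topology that
   the library puts on every numFieldType. *)
Definition cplx (R : realType) : numClosedFieldType := R[i].

Definition toC (R : realType) (x y : R) : cplx R := Complex x y.
Definition reC (R : realType) (z : cplx R) : R := complex.Re z.
Definition imC (R : realType) (z : cplx R) : R := complex.Im z.

(* On dom the 1-form is coef * d(coord). Both functions are total; their values
   outside dom are irrelevant. *)
Record form_chart (R : realType) (X : topologicalType) := FormChart {
  dom : set X;
  coord : X -> cplx R;
  coef : X -> cplx R }.

(* The axioms are kept apart, in translation_surface, so that the data can be
   pulled back to a cover; sing contains the zeros of the 1-form and possibly
   other marked points. *)
Record surface (R : realType) := Surface {
  carrier :> topologicalType;
  atlas : set (form_chart R carrier);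
  sing : set carrier }.

(* g has complex derivative l at x with respect to the coordinate of c, i.e.
   g \o coord^-1 has derivative l at coord x. *)
Definition diff_wrt (R : realType) (X : topologicalType) (c : form_chart R X)
    (x : X) (g : X -> cplx R) (l : cplx R) : Prop :=
  (fun y => (g y - g x) / (coord c y - coord c x)) @ x^' --> l.

Record translation_surface (R : realType) (X : surface R) : Prop := {
  ts_hausdorff : hausdorff_space X;
  ts_compact : compact [set: X];
  ts_connected : connected [set: X];
  ts_dom_open : forall c, atlas c -> open (dom c : set X);
  ts_dom_cover : forall x : X, exists2 c, atlas c & dom c x;
  ts_coord_inj : forall c : form_chart R X, atlas c -> set_inj (dom c) (coord c);
  ts_coord_cont : forall (c : form_chart R X) x, atlas c -> dom c x ->
    {for x, continuous (coord c)};
  ts_coord_open : forall (c : form_chart R X) (V : set X), atlas c ->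
    open V -> V `<=` dom c -> open (coord c @` V);
  ts_transition : forall (c c' : form_chart R X) x, atlas c -> atlas c' ->
    dom c x -> dom c' x ->
    exists2 l, diff_wrt c x (coord c') l & coef c x = coef c' x * l;
  ts_coef_holo : forall (c : form_chart R X) x, atlas c -> dom c x ->
    exists l, diff_wrt c x (coef c) l;
  ts_form_neq0 : exists (c : form_chart R X) x,
    [/\ atlas c, dom c x & coef c x != 0];
  ts_sing_finite : finite_set (@sing R X);
  ts_sing_zeros : forall (c : form_chart R X) x, atlas c -> dom c x ->
    coef c x = 0 -> sing x }.

Definition primitive (R : realType) (X : surface R) (U : set X)
    (zeta : X -> cplx R) : Prop :=
  forall (x : X) (c : form_chart R X), U x -> atlas c -> dom c x ->
    diff_wrt c x zeta (coef c x).

Definition local_primitive (R : realType) (X : surface R) (x : X)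
    (zeta : X -> cplx R) : Prop :=
  exists U : set X, [/\ open U, U x & primitive U zeta].

Record sing_homeo (R : realType) (X : surface R) := SingHomeo {
  hfun : continuousType X X;
  hinv : continuousType X X;
  hfunK : cancel hfun hinv;
  hinvK : cancel hinv hfun;
  hfun_sing : hfun @` @sing R X = @sing R X }.

Definition mx_act (R : realType) (A : 'M[R]_2) (z : cplx R) : cplx R :=
  toC (A 0 0 * reC z + A 0 1 * imC z) (A 1 0 * reC z + A 1 1 * imC z).

(* Away from the singularities the local primitives of the 1-form are exactly
   the translation charts; phi is affine with derivative A in those charts. *)
Definition affine_with_derivative (R : realType) (X : surface R)
    (phi : sing_homeo X) (A : 'M[R]_2) : Prop :=
  forall (x : X) (zeta xi : X -> cplx R), ~ sing x ->
    local_primitive x zeta -> local_primitive (hfun phi x) xi ->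
    exists k : cplx R, \forall y \near x, xi (hfun phi y) = mx_act A (zeta y) + k.

Definition veech_group (R : realType) (X : surface R) : set 'M[R]_2 :=
  [set A | \det A = 1 /\ exists phi : sing_homeo X, affine_with_derivative phi A].

Definition subgroup (R : realType) (G : set 'M[R]_2) : Prop :=
  [/\ G 1, forall g h, G g -> G h -> G (g * h) & forall g, G g -> G (invmx g)].

Definition finite_index (R : realType) (H G : set 'M[R]_2) : Prop :=
  exists s : seq 'M[R]_2,
    forall g, G g -> exists r h, [/\ r \in s, H h & g = r * h].

Definition torsion_free (R : realType) (G : set 'M[R]_2) : Prop :=
  forall g n, G g -> (0 < n)%N -> g ^+ n = 1 -> g = 1.

Definition moebius (R : realType) (g : 'M[R]_2) (z : cplx R) : cplx R :=
  (toC (g 0 0) 0 * z + toC (g 0 1) 0) / (toC (g 1 0) 0 * z + toC (g 1 1) 0).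

(* The isometry from the upper half-plane onto the unit disc. *)
Definition cayley (R : realType) (z : cplx R) : cplx R :=
  (z - toC 0 1) / (z + toC 0 1).

Definition boundary_circle (R : realType) : set (cplx R) :=
  [set z | `|z| = 1].

(* The orbit of the base point i, seen in the open unit disc; being disjoint
   from the boundary circle, it accumulates at each point of the circle that
   lies in its closure. *)
Definition limit_set (R : realType) (G : set 'M[R]_2) : set (cplx R) :=
  boundary_circle (R:=R) `&` closure [set cayley (moebius g (toC 0 1)) | g in G].

Definition first_kind (R : realType) (G : set 'M[R]_2) : Prop :=
  limit_set G = boundary_circle (R:=R).

Definition second_kind (R : realType) (G : set 'M[R]_2) : Prop :=
  ~ first_kind G.

Definition non_elementary (R : realType) (G : set 'M[R]_2) : Prop :=
  infinite_set (limit_set G).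

(* Loops are 1-periodic maps from the line; the base point is the value at 0. *)
Record loop (R : realType) (X : topologicalType) := Loop {
  lfun :> continuousType R X;
  lfun_per : forall t : R, lfun (t + 1) = lfun t }.

Lemma loop_map_per (R : realType) (X Y : topologicalType)
    (phi : continuousType X Y) (g : loop R X) (t : R) :
  (phi \o g) (t + 1) = (phi \o g) t.
Proof. by rewrite /= lfun_per. Qed.

Definition loop_map (R : realType) (X Y : topologicalType)
    (phi : continuousType X Y) (g : loop R X) : loop R Y :=
  @Loop R Y (phi \o g) (loop_map_per phi g).

Definition is_homotopy (R : realType) (X : topologicalType) (g h : loop R X)
    (H : R * R -> X) : Prop :=
  [/\ continuous H, forall s t, H (s, t + 1) = H (s, t),
      forall t, H (0, t) = g t & forall t, H (1, t) = h t].

Definition freely_homotopic (R : realType) (X : topologicalType)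
    (g h : loop R X) : Prop :=
  exists H, is_homotopy g h H.

Definition based_homotopic (R : realType) (X : topologicalType)
    (g h : loop R X) : Prop :=
  exists2 H, is_homotopy g h H & forall s : R, H (s, 0) = g 0.

Definition is_concat (R : realType) (X : topologicalType)
    (g1 g2 g : loop R X) : Prop :=
  g1 0 = g2 0 /\
  forall t : R, 0 <= t <= 1 -> g (t / 2) = g1 t /\ g ((1 + t) / 2) = g2 t.

Definition cochain (R : realType) (X : topologicalType) := loop R X -> R^o.

(* H^1(X; R) = Hom(pi_1(X), R). Homomorphisms to an abelian group are invariant
   under conjugation, hence under free homotopy, which makes a choice of base
   point unnecessary. *)
Definition H1 (R : realType) (X : topologicalType) : set (cochain R X) :=
  [set f | (forall g h, freely_homotopic g h -> f g = f h) /\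
           (forall g1 g2 g, is_concat g1 g2 g -> f g = f g1 + f g2)].

Definition H1Z (R : realType) (X : topologicalType) : set (cochain R X) :=
  [set f | H1 f /\ forall g, f g \is a Num.int].

Definition primitive_class (R : realType) (X : topologicalType)
    (f : cochain R X) : Prop :=
  forall (m : int) (e : cochain R X), H1Z e -> f = m%:~R *: e -> `|m| = 1.

Definition lin_indep (R : realType) (X : topologicalType) (d : nat)
    (f : 'I_d -> cochain R X) : Prop :=
  forall a : 'I_d -> R, \sum_i a i *: f i = 0 -> forall i, a i = 0.

Definition integer_subspace (R : realType) (X : topologicalType)
    (F : set (cochain R X)) : Prop :=
  [/\ F `<=` @H1 R X, F 0,
      forall (a : R) f e, F f -> F e -> F (a *: f + e)
    & forall f, F f -> exists (n : nat) (a : 'I_n -> R) (e : 'I_n -> cochain R X),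
        (forall k, F (e k) /\ H1Z (e k)) /\ f = \sum_k a k *: e k].

Definition sum_space (R : realType) (X : topologicalType) (n : nat)
    (F : 'I_n -> set (cochain R X)) : set (cochain R X) :=
  [set v | exists2 u : 'I_n -> cochain R X,
             forall j, F j (u j) & v = \sum_j u j].

Definition direct_sum (R : realType) (X : topologicalType) (n : nat)
    (F : 'I_n -> set (cochain R X)) : Prop :=
  forall u : 'I_n -> cochain R X,
    (forall j, F j (u j)) -> \sum_j u j = 0 -> forall j, u j = 0.

(* w is the integral of the 1-form along g: prim is a primitive of the 1-form
   along the loop. This makes sense for all continuous loops, including those
   meeting the zeros of the form. *)
Definition is_period (R : realType) (X : surface R) (g : loop R X)
    (w : cplx R) : Prop :=
  exists2 prim : R -> cplx R,
    forall t, exists (zeta : X -> cplx R) (k : cplx R),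
      local_primitive (g t) zeta /\ \forall s \near t, prim s = zeta (g s) + k
  & w = prim 1 - prim 0.

(* Velocity, in a translation chart, at a time where the loop is not at a
   singularity. *)
Definition has_velocity (R : realType) (X : surface R) (g : loop R X) (t : R)
    (u : cplx R) : Prop :=
  ~ sing (g t) /\
  exists2 zeta : X -> cplx R, local_primitive (g t) zeta &
    is_derive t (1 : R) (fun s : R => reC (zeta (g s)) : R) (reC u) /\
    is_derive t (1 : R) (fun s : R => imC (zeta (g s)) : R) (imC u).

Definition crossings (R : realType) (X : topologicalType) (g h : loop R X) :
    set (R * R) :=
  [set st | [/\ 0 <= st.1 < 1, 0 <= st.2 < 1 & g st.1 = h st.2]].

Definition cross (R : realType) (u v : cplx R) : R :=
  reC u * imC v - imC u * reC v.

(* The algebraic intersection number of loops: it is a homology invariant in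
   each variable, and for loops with finitely many intersections, all
   transversal, it is the number of crossings counted with sign. *)
Definition intersection_form (R : realType) (X : surface R)
    (I : loop R X -> loop R X -> R) : Prop :=
  [/\ forall g, @H1 R X (I g), forall h, @H1 R X (I ^~ h)
    & forall (g h : loop R X) (u v : R * R -> cplx R),
        finite_set (crossings g h) ->
        (forall st, crossings g h st ->
           [/\ has_velocity g st.1 (u st), has_velocity h st.2 (v st)
             & cross (u st) (v st) != 0]) ->
        I g h = \sum_(st \in crossings g h) Num.sg (cross (u st) (v st))].

Arguments intersection_form {R} X I.

Definition poincare_dual (R : realType) (X : surface R) (n : nat)
    (a : 'I_n -> R) (g : 'I_n -> loop R X) (f : cochain R X) : Prop :=
  exists2 I, intersection_form X I &
    forall h, f h = \sum_k a k * I (g k) h.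

Arguments poincare_dual {R} X {n} a g f.

Definition hol_is (R : realType) (X : surface R) (f : cochain R X)
    (w : cplx R) : Prop :=
  exists (n : nat) (a : 'I_n -> R) (g : 'I_n -> loop R X) (per : 'I_n -> cplx R),
    [/\ poincare_dual X a g f, forall k, is_period (g k) (per k)
      & w = \sum_k toC (a k) 0 * per k].

Arguments hol_is {R} X f w.

Definition ker_hol (R : realType) (X : surface R) : set (cochain R X) :=
  [set f | H1 f /\ hol_is X f 0].

Arguments ker_hol {R} X.

Definition coh_act (R : realType) (X : surface R) (phi : sing_homeo X)
    (f : cochain R X) : cochain R X :=
  fun g => f (loop_map (hinv phi) g).

(* psi chooses, for each element of G, an affine automorphism with that
   derivative, in such a way that G acts on H^1. Values of psi outside G are
   irrelevant. *)
Definition cohomology_representation (R : realType) (X : surface R)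
    (G : set 'M[R]_2) (psi : 'M[R]_2 -> sing_homeo X) : Prop :=
  (forall g, G g -> affine_with_derivative (psi g) g) /\
  (forall g h f, G g -> G h -> @H1 R X f ->
     coh_act (psi (g * h)) f = coh_act (psi g) (coh_act (psi h) f)).

Definition rep_invariant (R : realType) (X : surface R) (G : set 'M[R]_2)
    (psi : 'M[R]_2 -> sing_homeo X) (F : set (cochain R X)) : Prop :=
  forall g f, G g -> F f -> F (coh_act (psi g) f).

Definition irreducible_over_Z (R : realType) (X : surface R) (G : set 'M[R]_2)
    (psi : 'M[R]_2 -> sing_homeo X) (F : set (cochain R X)) : Prop :=
  F <> [set 0] /\
  forall E : set (cochain R X), E `<=` F -> integer_subspace E ->
    rep_invariant G psi E -> E <> [set 0] -> E = F.

Definition ker_rep (R : realType) (X : surface R) (G : set 'M[R]_2)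
    (psi : 'M[R]_2 -> sing_homeo X) (F : set (cochain R X)) : set 'M[R]_2 :=
  [set g | G g /\ forall f, F f -> coh_act (psi g) f = f].

Definition covering (X Y : topologicalType) (p : continuousType Y X) : Prop :=
  (forall x, exists y, p y = x) /\
  forall x : X, exists (U : set X) (sheets : set (set Y)),
    [/\ open U, U x, p @^-1` U = \bigcup_(V in sheets) V, trivIset sheets id
      & forall V, sheets V ->
          [/\ open V, set_inj V p, p @` V = U
            & forall W, open W -> W `<=` V -> open (p @` W)]].

(* Connected covering whose fundamental group is the kernel of
   (f_1, ..., f_d) : pi_1(X) -> Z^d. *)
Definition abelian_cover (R : realType) (X Y : topologicalType)
    (p : continuousType Y X) (d : nat) (f : 'I_d -> cochain R X) : Prop :=
  [/\ covering p, connected [set: Y]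
    & forall (y : Y) (g : loop R X), g 0 = p y ->
        (forall i, f i g = 0) <->
        exists2 h : loop R Y, h 0 = y & based_homotopic g (loop_map p h)].

Definition pullback (R : realType) (X : surface R) (Y : topologicalType)
    (p : continuousType Y X) : surface R :=
  {| carrier := Y;
     atlas := [set c' | exists (c : form_chart R X) (V : set Y),
       [/\ atlas c, open V, set_inj V p, V `<=` p @^-1` dom c
         & c' = FormChart V (coord c \o p) (coef c \o p)]];
     sing := p @^-1` @sing R X |}.

(* Main.v *)
(* A direction u of the plane is contracted by G when |u g|^2 / |g|^2 tends to 0
   along elements g of G; these directions are the limit points of G. The Veech
   group of a compact surface is discrete: by equicontinuity and compactness, two
   affine maps with bounded, distinct derivatives would send each point into a
   common small disc, and the difference of their developments would be a
   nonconstant single-valued function violating the maximum principle. The set of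
   limit points is minimal among closed invariant sets, so a nontrivial normal
   subgroup has the same limit points as G, and two nontrivial normal subgroups
   meet nontrivially: commutators lie in the intersection. As K is a finite
   intersection of nontrivial normal subgroups, it has the limit points of G.

   An affine automorphism whose derivative is in K fixes the classes f_i, hence
   lifts to the cover, so K is contained in the Veech group V of the cover. It
   remains to see that V lies in finitely many cosets of the Veech group of X. If
   X has singularities, the deck group D, a subgroup of Z^d, has finite index in
   the group of translations of the cover; each conjugate of D by an affine
   automorphism contains D^m for a fixed m, so there are finitely many of them, and
   automorphisms inducing the same conjugate differ by one that descends to X. If X
   has no singularities, a class in H^1 kills each loop with a small period,
   because such a loop can be straightened by translations, so simultaneous
   Diophantine approximation shows that a class with zero holonomy vanishes, and
   d = 0. *)

Require Import Defs.
From HB Require Import structures.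
From mathcomp Require Import all_boot all_order all_algebra.
From mathcomp Require Import complex.
From mathcomp Require Import all_classical all_reals all_analysis.
From mathcomp Require Import ring lra.
Set Implicit Arguments.
Unset Strict Implicit.
Unset Printing Implicit Defensive.
Import Order.TTheory GRing.Theory Num.Theory.
Import numFieldNormedType.Exports.
Local Open Scope classical_set_scope.
Local Open Scope ring_scope.

Local Notation coord := Defs.coord.

(** * Complex numbers as pairs of reals *)

Section Cabs.
Context {R : realType}.
Local Notation C := (cplx R).
Implicit Types z w : C.

(** The limit set is studied on row vectors: nearness of an orbit point to a boundary point is a
    ratio of quadratic forms, so minimality, normal subgroups and commutators become estimates on 2
    by 2 matrices. The first kind passes upwards from K to V, but the second kind does not, and this
    is why cosets are needed: V is contained in finitely many sets m G, a direction u is contracted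
    by m G exactly when u m is contracted by G, and for G of the second kind such directions form a
    closed nowhere dense set, so finitely many of these sets leave a gap. Three obstacles shape the
    geometry. The charts only provide pointwise complex derivatives, so local primitives of the
    1-form rest on Goursat's subdivision argument. The cover is in general not compact, so
    everything local is proved for an abstract disc model shared by the surface and its cover. An
    affine map is described only off the singularities, so its local formula is extended across them
    by continuity and connectedness of the punctured disc. *)

Definition cabs z : R := Num.sqrt (reC z ^+ 2 + imC z ^+ 2).

(** The norm of [cplx R] takes its values in [cplx R]. All estimates are made with the real number
    [cabs z], and this is the bridge between the two. *)
Lemma cabsE z : `|z| = toC (cabs z) 0.
Proof. by rewrite normc_def. Qed.

Lemma cabs_ge0 z : 0 <= cabs z. Proof. exact: sqrtr_ge0. Qed.

Lemma cabs2 z : cabs z ^+ 2 = reC z ^+ 2 + imC z ^+ 2.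
Proof. by rewrite sqr_sqrtr// addr_ge0 ?sqr_ge0. Qed.

Lemma cabs0 : cabs 0 = 0.
Proof. by rewrite /cabs /= expr0n /= addr0 sqrtr0. Qed.

Lemma cabs_eq0 z : (cabs z == 0) = (z == 0).
Proof.
rewrite -(normr_eq0 z) cabsE.
by apply/idP/idP => [/eqP ->|/eqP[->]].
Qed.

Lemma cabs_gt0 z : (0 < cabs z) = (z != 0).
Proof. by rewrite lt_def cabs_ge0 andbT cabs_eq0. Qed.

Lemma cabsM z w : cabs (z * w) = cabs z * cabs w.
Proof.
have : toC (cabs (z * w)) 0 = toC (cabs z) 0 * toC (cabs w) 0.
  by rewrite -!cabsE normrM.
have -> : toC (cabs z) 0 * toC (cabs w) 0 = toC (cabs z * cabs w) 0.
  by congr Complex; rewrite /=; ring.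
by case.
Qed.

Lemma cabsN z : cabs (- z) = cabs z.
Proof. by have := normrN z; rewrite !cabsE => -[]. Qed.

Lemma cabsB z w : cabs (z - w) = cabs (w - z).
Proof. by rewrite -cabsN opprB. Qed.

Lemma cabsD z w : cabs (z + w) <= cabs z + cabs w.
Proof.
have := ler_normD z w; rewrite !cabsE lecE => /andP[_].
by rewrite /=.
Qed.

Lemma cabs_tri z w t : cabs (z - t) <= cabs (z - w) + cabs (w - t).
Proof. by rewrite (le_trans _ (cabsD _ _))// addrA subrK. Qed.

Lemma cabsV z : cabs z^-1 = (cabs z)^-1.
Proof.
have [->|z0] := eqVneq z 0; first by rewrite invr0 cabs0 invr0.
have a0 : cabs z != 0 by rewrite cabs_eq0.
by apply: (mulfI a0); rewrite -cabsM !mulfV// /cabs /= expr1n expr0n /= addr0 sqrtr1.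
Qed.

Lemma cabs_re z : `|reC z| <= cabs z.
Proof.
rewrite -ler_sqr ?nnegrE ?cabs_ge0 ?normr_ge0// cabs2 -normrX ger0_norm ?sqr_ge0//.
by rewrite lerDl sqr_ge0.
Qed.

Lemma cabs_im z : `|imC z| <= cabs z.
Proof.
rewrite -ler_sqr ?nnegrE ?cabs_ge0 ?normr_ge0// cabs2 -normrX ger0_norm ?sqr_ge0//.
by rewrite lerDr sqr_ge0.
Qed.

Lemma cabs_le z : cabs z <= `|reC z| + `|imC z|.
Proof.
rewrite -ler_sqr ?nnegrE ?cabs_ge0 ?addr_ge0// cabs2 sqrrD -!normrX.
rewrite !(ger0_norm (sqr_ge0 _)).
by rewrite -addrA lerD2l lerDr mulrn_wge0// mulr_ge0.
Qed.

Lemma cabs_toC (x : R) : cabs (toC x 0) = `|x|.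
Proof. by rewrite /cabs /= expr0n addr0 sqrtr_sqr. Qed.

Lemma cplxE z : z = toC (reC z) (imC z).
Proof. by case: z. Qed.

Lemma nbhs_cplx z (A : set C) :
  nbhs z A <-> exists2 e : R, 0 < e & forall w, cabs (w - z) < e -> A w.
Proof.
split=> [/nbhs_ballP[e /= e0 eA]|[e e0 eA]].
  (* A radius is here an element of [cplx R]; being positive for the partial order, it has zero
     imaginary part. *)
  move: e0; rewrite ltcE /= => /andP[/eqP i0 r0].
  exists (reC e) => // w wz; apply: eA; rewrite /ball /= distrC cabsE.
  by rewrite ltcE /= i0 eqxx.
apply/nbhs_ballP; exists (toC e 0) => [|w].
  by rewrite /= ltcE /= eqxx.
rewrite /ball /= distrC cabsE ltcE /= => /andP[_ we]; exact: eA.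
Qed.

Lemma closure_cplx z (A : set C) :
  closure A z <-> forall e : R, 0 < e -> exists2 w, A w & cabs (w - z) < e.
Proof.
split=> [cA e e0|h B /nbhs_cplx[e e0 eB]].
  have /cA[w [Aw we]] : nbhs z [set w | cabs (w - z) < e].
    by apply/nbhs_cplx; exists e.
  by exists w.
have [w Aw we] := h _ e0.
by exists w; split => //; exact: eB.
Qed.

Lemma cvg_cplx {T : Type} (F : set_system T) {FF : Filter F} (f : T -> C) z :
  f @ F --> z <-> forall e : R, 0 < e -> \forall x \near F, cabs (f x - z) < e.
Proof.
split=> [fz e e0|h A /nbhs_cplx[e e0 eA]].
  by apply: (fz [set w | cabs (w - z) < e]); apply/nbhs_cplx; exists e.
by apply: filterS (h _ e0) => x; exact: eA.
Qed.

Lemma toC_eq0 (x y : R) : (toC x y == 0) = (x == 0) && (y == 0).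
Proof. by rewrite eq_complex. Qed.

End Cabs.

(** * Limit sets of discrete groups *)

Section PlaneMatrices.
Context {R : realType}.
Implicit Types (g h k : 'M[R]_2) (u v w : R * R) (G H K : set 'M[R]_2).

Lemma mx2_eq g h : g 0 0 = h 0 0 -> g 0 1 = h 0 1 -> g 1 0 = h 1 0 ->
  g 1 1 = h 1 1 -> g = h.
Proof.
move=> h00 h01 h10 h11; apply/matrixP => i j.
have E (k : 'I_2) : k = 0 \/ k = 1.
  by case: k => [[|[|//]] hk]; [left|right]; apply/val_inj.
by have [-> | ->] := E i; have [-> | ->] := E j.
Qed.

Lemma mulmx2E g h i j : (g * h) i j = g i 0 * h 0 j + g i 1 * h 1 j.
Proof.
rewrite mxE big_ord_recl big_ord1.
by congr (_ + g i _ * h _ j); apply/val_inj.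
Qed.

Lemma mx2_1E : ((1 : 'M[R]_2) 0 0 = 1) * ((1 : 'M[R]_2) 0 1 = 0) *
  ((1 : 'M[R]_2) 1 0 = 0) * ((1 : 'M[R]_2) 1 1 = 1).
Proof. by rewrite !mxE. Qed.

Lemma mx2_det g : \det g = g 0 0 * g 1 1 - g 0 1 * g 1 0.
Proof.
rewrite (expand_det_row _ 0) big_ord_recl big_ord1 /cofactor !det_mx11 !mxE /=.
rewrite expr0 expr1 mul1r mulN1r mulrN.
by congr (g _ _ * g _ _ - g _ _ * g _ _); apply/val_inj.
Qed.

Lemma mx2_inv g : \det g = 1 ->
  [/\ invmx g 0 0 = g 1 1, invmx g 0 1 = - g 0 1,
      invmx g 1 0 = - g 1 0 & invmx g 1 1 = g 0 0].
Proof.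
move=> d1.
have gu : g \in unitmx by rewrite unitmxE d1 unitr1.
pose A : 'M[R]_2 := \matrix_(i, j)
  (if i == 0 then if j == 0 then g 1 1 else - g 0 1
   else if j == 0 then - g 1 0 else g 0 0).
have gA : g * A = 1.
  move: d1; rewrite mx2_det => d1.
  apply: mx2_eq; rewrite mulmx2E !mx2_1E !mxE /=; lra.
have -> : invmx g = A.
  by rewrite -[LHS]mulr1 -gA; change (invmx g *m (g *m A) = A); rewrite mulKmx.
by rewrite !mxE.
Qed.

(** Rows, with the action on the right: the orbit point of g is near the boundary point attached to
    u when [ract u g] is short compared with g. *)
Definition ract u g : R * R :=
  (u.1 * g 0 0 + u.2 * g 1 0, u.1 * g 0 1 + u.2 * g 1 1).
Definition nrm2 u : R := u.1 ^+ 2 + u.2 ^+ 2.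
Definition frob g : R := g 0 0 ^+ 2 + g 0 1 ^+ 2 + g 1 0 ^+ 2 + g 1 1 ^+ 2.
Definition wedge u v : R := u.1 * v.2 - u.2 * v.1.

Lemma ractM u g h : ract (ract u g) h = ract u (g * h).
Proof. by congr pair; rewrite /= !mulmx2E; ring. Qed.

Lemma ract1 u : ract u 1 = u.
Proof. by rewrite /ract !mx2_1E !mulr0 !mulr1 addr0 add0r -surjective_pairing. Qed.

Lemma wedge_ract u v g : wedge (ract u g) (ract v g) = \det g * wedge u v.
Proof. by rewrite mx2_det /wedge /ract /=; ring. Qed.

Lemma nrm2_ge0 u : 0 <= nrm2 u.
Proof. by rewrite addr_ge0 ?sqr_ge0. Qed.

Lemma frob_ge0 g : 0 <= frob g.
Proof. by rewrite !addr_ge0 ?sqr_ge0. Qed.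

Lemma nrm2_eq0 u : (nrm2 u == 0) = (u == 0).
Proof.
case: u => x y; rewrite /nrm2 /= paddr_eq0 ?sqr_ge0// !sqrf_eq0.
by [].
Qed.

Lemma nrm2_gt0 u : (0 < nrm2 u) = (u != 0).
Proof. by rewrite lt_def nrm2_ge0 andbT nrm2_eq0. Qed.

Lemma nrm2_ract u g : nrm2 (ract u g) <= nrm2 u * frob g.
Proof.
rewrite /nrm2 /frob /ract /=; rewrite -subr_ge0.
have -> : (u.1 ^+ 2 + u.2 ^+ 2) *
   (g 0 0 ^+ 2 + g 0 1 ^+ 2 + g 1 0 ^+ 2 + g 1 1 ^+ 2) -
   ((u.1 * g 0 0 + u.2 * g 1 0) ^+ 2 + (u.1 * g 0 1 + u.2 * g 1 1) ^+ 2) =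
   (u.2 * g 0 0 - u.1 * g 1 0) ^+ 2 + (u.2 * g 0 1 - u.1 * g 1 1) ^+ 2 by ring.
by rewrite addr_ge0 ?sqr_ge0.
Qed.

Lemma frobM g h : frob (g * h) <= frob g * frob h.
Proof.
have -> : frob (g * h) = nrm2 (ract (g 0 0, g 0 1) h) + nrm2 (ract (g 1 0, g 1 1) h).
  by rewrite /frob /nrm2 !mulmx2E /=; ring.
have -> : frob g * frob h = nrm2 (g 0 0, g 0 1) * frob h + nrm2 (g 1 0, g 1 1) * frob h.
  by rewrite /frob /nrm2 /=; ring.
by rewrite lerD ?nrm2_ract.
Qed.

Lemma frob_inv g : \det g = 1 -> frob (invmx g) = frob g.
Proof. by move=> /mx2_inv[a b c d]; rewrite /frob a b c d; ring. Qed.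

Lemma frob_ge2 g : \det g = 1 -> 2 <= frob g.
Proof.
rewrite mx2_det => d1; rewrite /frob.
have := sqr_ge0 (g 0 0 - g 1 1); have := sqr_ge0 (g 0 1 + g 1 0).
nra.
Qed.

Lemma invmx_detE g : \det g = 1 -> g * invmx g = 1 /\ invmx g * g = 1.
Proof.
move=> d1; have gu : g \in unitmx by rewrite unitmxE d1 unitr1.
by split; [exact: mulmxV | exact: mulVmx].
Qed.

Lemma invmx_det g : \det g = 1 -> \det (invmx g) = 1.
Proof. by rewrite det_inv => ->; rewrite invr1. Qed.

(* The point bdpt u of the circle is a limit point of G exactly when G contracts u
   strongly, relatively to the norms of its elements. *)
Definition limdir G u := u != 0 /\
  forall e : R, 0 < e -> exists2 g, G g & nrm2 (ract u g) <= e * frob g.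

(** The Cayley transform of the real point - u.2 / u.1, that is, of the point whose homogeneous
    coordinates are annihilated by the row u; for u.1 = 0 it is the image of infinity. *)
Definition bdpt u : cplx R :=
  toC ((u.2 ^+ 2 - u.1 ^+ 2) / nrm2 u) (2 * u.1 * u.2 / nrm2 u).

Lemma cayley_orbit g : \det g = 1 -> cayley (moebius g (toC 0 1)) =
  toC ((g 0 0 ^+ 2 + g 0 1 ^+ 2 - g 1 0 ^+ 2 - g 1 1 ^+ 2) / (frob g + 2))
      (- 2 * (g 0 0 * g 1 0 + g 0 1 * g 1 1) / (frob g + 2)).
Proof.
move=> d1; have N2 := frob_ge2 d1; rewrite mx2_det in d1.
rewrite /cayley /moebius.
have -> : toC (g 0 0) 0 * toC 0 1 + toC (g 0 1) 0 = toC (g 0 1) (g 0 0).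
  by congr Complex; rewrite /=; ring.
have -> : toC (g 1 0) 0 * toC 0 1 + toC (g 1 1) 0 = toC (g 1 1) (g 1 0).
  by congr Complex; rewrite /=; ring.
have m0 : toC (g 1 1) (g 1 0) != 0.
  apply/negP; rewrite toC_eq0 => /andP[/eqP c0 /eqP c1].
  by move: d1; rewrite c0 c1 !mulr0 subrr => /esym/eqP; rewrite oner_eq0.
have P0 : frob g + 2 != 0 by rewrite gt_eqF// addr_gt0// (lt_le_trans _ N2).
have e1 : toC (g 0 1) (g 0 0) + toC 0 1 * toC (g 1 1) (g 1 0) =
          toC (g 0 1 - g 1 0) (g 0 0 + g 1 1).
  by congr Complex; rewrite /=; ring.
have e2 : toC (g 0 1) (g 0 0) - toC 0 1 * toC (g 1 1) (g 1 0) =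
          toC (g 0 1 + g 1 0) (g 0 0 - g 1 1).
  by congr Complex; rewrite /=; ring.
have e0 : toC (g 0 1) (g 0 0) + toC 0 1 * toC (g 1 1) (g 1 0) != 0.
  rewrite e1 toC_eq0; apply/negP => /andP[/eqP a /eqP b].
  have : (g 0 1 - g 1 0) ^+ 2 + (g 0 0 + g 1 1) ^+ 2 = 0 by rewrite a b expr0n addr0.
  have -> : (g 0 1 - g 1 0) ^+ 2 + (g 0 0 + g 1 1) ^+ 2 = frob g + 2.
    by rewrite /frob; move: d1; nra.
  by move/eqP; rewrite (negbTE P0).
move: (toC (g 0 1) (g 0 0)) (toC (g 1 1) (g 1 0)) (toC 0 1) m0 e0 e1 e2.
move=> n m i m0 e0 e1 e2.
have -> : (n / m - i) / (n / m + i) = (n - i * m) / (n + i * m).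
  by field; apply/andP.
apply: (canLR (mulfK e0)); rewrite e1 e2.
have -> : g 0 0 ^+ 2 + g 0 1 ^+ 2 - g 1 0 ^+ 2 - g 1 1 ^+ 2 =
  (g 0 1 + g 1 0) * (g 0 1 - g 1 0) + (g 0 0 - g 1 1) * (g 0 0 + g 1 1) by ring.
have -> : -2 * (g 0 0 * g 1 0 + g 0 1 * g 1 1) =
  (g 0 0 - g 1 1) * (g 0 1 - g 1 0) - (g 0 1 + g 1 0) * (g 0 0 + g 1 1) by ring.
have E : frob g + 2 = (g 0 1 - g 1 0) ^+ 2 + (g 0 0 + g 1 1) ^+ 2.
  by rewrite /frob; move: d1; nra.
move: P0; rewrite E {E e1 e2 e0 N2 d1}.
move: (g 0 1 - g 1 0) (g 0 0 + g 1 1) (g 0 1 + g 1 0) (g 0 0 - g 1 1) => a b c d P0.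
by congr Complex; rewrite /=; field.
Qed.

(** This identity replaces hyperbolic geometry by linear algebra: convergence of orbit points to
    [bdpt u] is smallness of the ratio of [nrm2 (ract u g)] to [frob g]. *)
Lemma dist_cayley g u : \det g = 1 -> u != 0 ->
  let z := cayley (moebius g (toC 0 1)) - bdpt u in
  (reC z) ^+ 2 + (imC z) ^+ 2 = 4 * nrm2 (ract u g) / (nrm2 u * (frob g + 2)).
Proof.
move=> d1 u0 z; have N2 := frob_ge2 d1.
have P0 : frob g + 2 != 0 by rewrite gt_eqF// addr_gt0// (lt_le_trans _ N2).
rewrite -nrm2_gt0 in u0.
have -> : reC z = (g 0 0 ^+ 2 + g 0 1 ^+ 2 - g 1 0 ^+ 2 - g 1 1 ^+ 2) / (frob g + 2)
   - (u.2 ^+ 2 - u.1 ^+ 2) / nrm2 u by rewrite /z cayley_orbit.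
have -> : imC z = - 2 * (g 0 0 * g 1 0 + g 0 1 * g 1 1) / (frob g + 2) -
  2 * u.1 * u.2 / nrm2 u by rewrite /z cayley_orbit.
move: u0 P0 d1; clear; rewrite mx2_det /frob /nrm2 /ract /= => u0 P0.
move: (g 0 0) (g 0 1) (g 1 0) (g 1 1) u.1 u.2 u0 P0 => a b c d x y u0 P0 d1.
have u1 : x ^+ 2 + y ^+ 2 != 0 by rewrite gt_eqF.
set S := _ + 2 in P0 *; set n := (x ^+ 2 + y ^+ 2) in u1 *.
set A := a ^+ 2 + _ - _ - _; set p := y ^+ 2 - _; set B := -2 * _.
set Q := (x * a + _) ^+ 2 + _.
(* The squared modulus of the orbit point is (S - 4) / S, by determinant 1; E2 says that the
   boundary point has modulus 1 and E3 computes their scalar product. *)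
have E1 : A ^+ 2 + B ^+ 2 = S * (S - 4).
  have -> : A ^+ 2 + B ^+ 2 = (S - 2) ^+ 2 - 4 * (a * d - b * c) ^+ 2.
    by rewrite /A /B /S; ring.
  by rewrite d1; ring.
have E2 : p ^+ 2 + (2 * x * y) ^+ 2 = n ^+ 2 by rewrite /p /n; ring.
have E3 : A * p + B * (2 * x * y) = n * (S - 2) - 2 * Q.
  by rewrite /A /B /p /n /S /Q; ring.
have -> : (A / S - p / n) ^+ 2 + (B / S - 2 * x * y / n) ^+ 2 =
   (A ^+ 2 + B ^+ 2) / S ^+ 2 + (p ^+ 2 + (2 * x * y) ^+ 2) / n ^+ 2 -
   2 * (A * p + B * (2 * x * y)) / (S * n).
  by move: S n A p B P0 u1 {Q E1 E2 E3} => S n A p B P0 u1; field; apply/andP.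
rewrite E1 E2 E3; move: S n P0 u1 {E1 E2 E3} => S n P0 u1; field.
by apply/andP.
Qed.

Definition scal (c : R) u : R * R := (c * u.1, c * u.2).

Lemma nrm2_scal c u : nrm2 (scal c u) = c ^+ 2 * nrm2 u.
Proof. by rewrite /nrm2 /=; ring. Qed.

Lemma ract_scal c u g : ract (scal c u) g = scal c (ract u g).
Proof. by rewrite /scal /ract /=; congr pair; ring. Qed.

Lemma nrm2D u v : nrm2 (u.1 + v.1, u.2 + v.2) <= 2 * (nrm2 u + nrm2 v).
Proof. by rewrite /nrm2 /=; have := sqr_ge0 (u.1 - v.1); have := sqr_ge0 (u.2 - v.2); nra. Qed.

Lemma ractB u v g : ract (u.1 - v.1, u.2 - v.2) g =
  ((ract u g).1 - (ract v g).1, (ract u g).2 - (ract v g).2).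
Proof. by rewrite /ract /=; congr pair; ring. Qed.

Lemma wedge0_scal u v : u != 0 -> v != 0 -> wedge u v = 0 ->
  exists2 c, c != 0 & v = scal c u.
Proof.
case: u v => [a b] [x y]; rewrite /wedge /= => u0 v0 w0.
have n0 : a ^+ 2 + b ^+ 2 != 0 by rewrite -/(nrm2 (a, b)) nrm2_eq0.
pose c := (a * x + b * y) / (a ^+ 2 + b ^+ 2).
have xE : x = c * a.
  apply: (mulIf n0); rewrite /c mulrAC divfK//.
  have -> : y = (a * y - b * x) * 0 + y by ring.
  by move/eqP: w0; rewrite subr_eq0 => /eqP w0; have := congr1 (fun t => t * b) w0; move=> /=; lra.
have yE : y = c * b.
  apply: (mulIf n0); rewrite /c mulrAC divfK//.
  by have := congr1 (fun t => t * a) w0; move=> /=; lra.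
exists c; last by rewrite /scal /= -xE -yE.
by apply: contraNneq v0 => c0; rewrite xE yE c0 !mul0r.
Qed.

Lemma ract_neq0 u g : \det g = 1 -> u != 0 -> ract u g != 0.
Proof.
move=> d1 u0; apply: contraNneq u0 => ug0.
have := ractM u g (invmx g); rewrite (invmx_detE d1).1 ract1 ug0 => <-.
by rewrite /ract /= !mul0r addr0.
Qed.

Lemma frob_gt0 g : \det g = 1 -> 0 < frob g.
Proof. by move=> /frob_ge2; apply: lt_le_trans. Qed.

Lemma limdir_ract G h u : subgroup G -> (forall g, G g -> \det g = 1) ->
  G h -> limdir G u -> limdir G (ract u h).
Proof.
move=> [_ GM GV] d1 Gh [u0 ul]; split; first exact: ract_neq0 (d1 _ Gh) u0.
have h0 := frob_gt0 (d1 _ Gh); have [hV Vh] := invmx_detE (d1 _ Gh).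
move=> e e0; have [g Gg ug] := ul (e / frob h) (divr_gt0 e0 h0).
exists (invmx h * g); first by apply: GM => //; exact: GV.
rewrite ractM mulrA hV mul1r (le_trans ug)// -mulrA ler_pM2l// ler_pdivrMl//.
by rewrite (le_trans _ (frobM _ _))// mulrA hV mul1r.
Qed.

Lemma limdir_normal K h u : \det h = 1 ->
  (forall k, K k -> K (invmx h * k * h)) ->
  limdir K u -> limdir K (ract u h).
Proof.
move=> d1 KN [u0 ul]; split; first exact: ract_neq0.
have h0 := frob_gt0 d1; have [hV Vh] := invmx_detE d1.
(* One factor [frob h] is lost when h acts on [ract u k], and two more when k is recovered from its
   conjugate. *)
move=> e e0; have [k Kk uk] := ul (e / frob h ^+ 3) (divr_gt0 e0 (exprn_gt0 _ h0)).
exists (invmx h * k * h); first exact: KN.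
rewrite ractM !mulrA hV mul1r -ractM (le_trans (nrm2_ract _ _))//.
rewrite -ler_pdivlMr// (le_trans uk)//.
have kE : k = h * ((invmx h * k * h) * invmx h) by rewrite !mulrA hV mul1r -mulrA hV mulr1.
rewrite -mulrA -[leRHS]mulrA ler_pM2l// ler_pdivrMl ?exprn_gt0//.
have -> : frob h ^+ 3 * (frob (invmx h * k * h) / frob h) =
    frob h * (frob (invmx h * k * h) * frob h) by field; rewrite gt_eqF.
rewrite {1}kE (le_trans (frobM _ _))// ler_pM2l//.
by rewrite (le_trans (frobM _ _))// frob_inv.
Qed.

Lemma limdir_scal G c u : c != 0 -> limdir G u -> limdir G (scal c u).
Proof.
move=> c0 [u0 ul]; have c2 : 0 < c ^+ 2 by rewrite exprn_even_gt0.
split; first by rewrite -nrm2_gt0 nrm2_scal mulr_gt0// nrm2_gt0.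
move=> e e0; have [g Gg ug] := ul (e / c ^+ 2) (divr_gt0 e0 c2).
by exists g => //; rewrite ract_scal nrm2_scal -ler_pdivlMl// mulrA [_^-1 * _]mulrC.
Qed.

Definition closed_dirs (L : set (R * R)) := forall u, u != 0 ->
  (forall e, 0 < e -> exists2 v, L v & nrm2 (u.1 - v.1, u.2 - v.2) <= e) -> L u.

Lemma limdir_closed G : closed_dirs (limdir G).
Proof.
move=> u u0 H; split=> // e e0.
have e4 : 0 < e / 4 by rewrite divr_gt0.
have [v [v0 /(_ _ e4)[g Gg vg]] uv] := H _ e4.
exists g => //.
have -> : ract u g = ((ract (u.1 - v.1, u.2 - v.2) g).1 + (ract v g).1,
                      (ract (u.1 - v.1, u.2 - v.2) g).2 + (ract v g).2).
  by rewrite ractB; case: (ract u g) (ract v g) => [p q] [r s] /=; rewrite !subrK.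
apply: (le_trans (nrm2D _ _)).
have := nrm2_ract (u.1 - v.1, u.2 - v.2) g.
have := ler_wpM2r (frob_ge0 g) uv; lra.
Qed.

(** Cramer's rule: [wedge u v] times an entry of h is a combination of coordinates of the images of
    u and v, and the Cauchy-Schwarz inequality does the rest. So a matrix that shortens two
    independent rows is small. *)
Lemma frob_le_ract u v h : wedge u v ^+ 2 * frob h <=
  (nrm2 u + nrm2 v) * (nrm2 (ract u h) + nrm2 (ract v h)).
Proof.
have CS (x y a b c d : R) : (x * a - y * b) ^+ 2 + (x * c - y * d) ^+ 2 <=
    (x ^+ 2 + y ^+ 2) * (a ^+ 2 + b ^+ 2 + (c ^+ 2 + d ^+ 2)).
  rewrite -subr_ge0.
  have -> : (x ^+ 2 + y ^+ 2) * (a ^+ 2 + b ^+ 2 + (c ^+ 2 + d ^+ 2)) -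
    ((x * a - y * b) ^+ 2 + (x * c - y * d) ^+ 2) =
    (x * b + y * a) ^+ 2 + (x * d + y * c) ^+ 2 by ring.
  by rewrite addr_ge0 ?sqr_ge0.
have := CS v.2 u.2 (ract u h).1 (ract v h).1 (ract u h).2 (ract v h).2.
have := CS v.1 u.1 (ract u h).1 (ract v h).1 (ract u h).2 (ract v h).2.
move=> A B; have {A B} := lerD A B.
have -> : forall X, (v.1 ^+ 2 + u.1 ^+ 2) * X + (v.2 ^+ 2 + u.2 ^+ 2) * X =
  (nrm2 u + nrm2 v) * X by move=> X; rewrite /nrm2; ring.
have -> : forall p q r s, p ^+ 2 + q ^+ 2 + (r ^+ 2 + s ^+ 2) =
  nrm2 (p, r) + nrm2 (q, s) by move=> p q r s; rewrite /nrm2 /=; ring.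
move/(le_trans _); rewrite /nrm2 /frob /wedge /ract /=.
by apply; rewrite le_eqVlt; apply/orP; left; apply/eqP; ring.
Qed.

(** If g contracts u, then the inverse of g stretches a or b by an amount comparable to [frob g].
    The stretched vector y lies in L, and it is nearly parallel to u because [wedge y u] equals the
    wedge of a bounded vector with the short vector [ract u g]. *)
Lemma minimal_dirs G (L : set (R * R)) a b : (forall g, G g -> \det g = 1) ->
  (forall g, G g -> G (invmx g)) ->
  closed_dirs L -> (forall u c, L u -> c != 0 -> L (scal c u)) ->
  (forall u g, L u -> G g -> L (ract u g)) ->
  L a -> L b -> wedge a b != 0 -> limdir G `<=` L.
Proof.
move=> d1 GV Lcl Lsc Lact La Lb ab u [u0 ul]; apply: Lcl => // e e0.
have w0 : 0 < wedge a b ^+ 2 by rewrite exprn_even_gt0.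
set N := nrm2 a + nrm2 b.
have N0 : 0 < N.
  rewrite lt_def addr_ge0 ?nrm2_ge0// andbT; apply: contraNneq ab.
  move/eqP; rewrite paddr_eq0 ?nrm2_ge0// !nrm2_eq0 => /andP[/eqP -> _].
  by rewrite /wedge !mul0r subrr.
set c0 := wedge a b ^+ 2 / (2 * N).
have c00 : 0 < c0 by rewrite divr_gt0// mulr_gt0.
have n0 : 0 < nrm2 u by rewrite nrm2_gt0.
(* The bound [nrm2 u / 2] prevents the multiple of y closest to u from being 0, which is not a
   direction. *)
pose m := Num.min e (nrm2 u / 2).
have m0 : 0 < m by rewrite lt_min e0 divr_gt0.
have d0 : 0 < m * c0 / N by rewrite divr_gt0// mulr_gt0.
have [g Gg ug] := ul _ d0.
have [x [Lx xN xh]] : exists x, [/\ L x, nrm2 x <= N &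
    c0 * frob g <= nrm2 (ract x (invmx g))].
  have := frob_le_ract a b (invmx g); rewrite frob_inv ?d1// -/N => H.
  have [ha|ha] := leP (c0 * frob g) (nrm2 (ract a (invmx g))).
    by exists a; split => //; rewrite /N lerDl nrm2_ge0.
  exists b; split => //; first by rewrite /N lerDr nrm2_ge0.
  rewrite -(ler_pM2l N0).
  have -> : N * (c0 * frob g) = wedge a b ^+ 2 * frob g / 2.
    by rewrite /c0; field; rewrite gt_eqF.
  move: ha; rewrite -(ltr_pM2l N0).
  have -> : N * (c0 * frob g) = wedge a b ^+ 2 * frob g / 2.
    by rewrite /c0; field; rewrite gt_eqF.
  by move: H; lra.
set y := ract x (invmx g) in xh.
have Ly : L y by apply: Lact => //; exact: GV.
have f0 := frob_gt0 (d1 _ Gg).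
have y0 : 0 < nrm2 y by rewrite (lt_le_trans _ xh)// mulr_gt0.
have wyu : wedge y u ^+ 2 <= m * nrm2 y.
  have -> : wedge y u = wedge x (ract u g).
    rewrite -[LHS]mul1r -(d1 _ Gg) -wedge_ract /y ractM.
    by rewrite (invmx_detE (d1 _ Gg)).2 ract1.
  have CS : wedge x (ract u g) ^+ 2 <= nrm2 x * nrm2 (ract u g).
    rewrite -subr_ge0 /wedge /nrm2.
    set p := ract u g.
    have -> : (x.1 ^+ 2 + x.2 ^+ 2) * (p.1 ^+ 2 + p.2 ^+ 2) -
      (x.1 * p.2 - x.2 * p.1) ^+ 2 = (x.1 * p.1 + x.2 * p.2) ^+ 2 by ring.
    exact: sqr_ge0.
  apply: (le_trans CS).
  apply: (@le_trans _ _ (N * (m * c0 / N * frob g))).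
    by apply: ler_pM => //; exact: nrm2_ge0.
  have -> : N * (m * c0 / N * frob g) = m * (c0 * frob g) by field; rewrite gt_eqF.
  by rewrite ler_pM2l.
pose s := (u.1 * y.1 + u.2 * y.2) / nrm2 y.
have key : nrm2 (u.1 - s * y.1, u.2 - s * y.2) = wedge y u ^+ 2 / nrm2 y.
  by rewrite /s /nrm2 /wedge /=; field; rewrite -/(nrm2 y) gt_eqF.
have small : nrm2 (u.1 - s * y.1, u.2 - s * y.2) <= m.
  by rewrite key ler_pdivrMr.
exists (scal s y); last by rewrite (le_trans small)// /m ge_min lexx.
apply: Lsc => //; apply/eqP => s0.
move: small; rewrite s0 !mul0r !subr0 -surjective_pairing => /le_trans /(_ _).
rewrite /m; have : Num.min e (nrm2 u / 2) <= nrm2 u / 2 by rewrite ge_min lexx orbT.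
by move=> A /(_ _ A); move: n0; lra.
Qed.

End PlaneMatrices.

(** * Discrete groups and invariant lines *)

Section LimitDirections.
Context {R : realType}.
Implicit Types (g h k : 'M[R]_2) (u v w : R * R) (G H K : set 'M[R]_2).

(** The form in which discreteness of a group of matrices is used. *)
Definition frob_finite G := forall C : R, finite_set (G `&` [set g | frob g <= C]).

Definition lc (a : R) u (b : R) v : R * R := (a * u.1 + b * v.1, a * u.2 + b * v.2).

Lemma ract_lc a u b v g : ract (lc a u b v) g = lc a (ract u g) b (ract v g).
Proof. by rewrite /ract /lc /=; congr pair; ring. Qed.

Lemma lc_wedge u w v : wedge u w != 0 ->
  v = lc (wedge v w / wedge u w) u (wedge u v / wedge u w) w.
Proof.
by case: v => x y; rewrite /lc /wedge /= => W; congr pair; field.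
Qed.

Lemma frob_le_basis u w : wedge u w != 0 -> exists2 C : R, 0 < C &
  forall g, frob g <= C * (nrm2 (ract u g) + nrm2 (ract w g)).
Proof.
move=> W; have W2 : 0 < wedge u w ^+ 2 by rewrite exprn_even_gt0.
exists ((nrm2 u + nrm2 w + 1) / wedge u w ^+ 2) => [|g].
  by rewrite divr_gt0// ltr_wpDl// addr_ge0 ?nrm2_ge0.
rewrite mulrAC ler_pdivlMr// mulrC (le_trans (frob_le_ract _ _ _))//.
by apply: ler_wpM2r; [rewrite addr_ge0 ?nrm2_ge0 | rewrite lerDl].
Qed.

Lemma wedge_le u v : wedge u v ^+ 2 <= nrm2 u * nrm2 v.
Proof.
rewrite -subr_ge0 /wedge /nrm2.
have -> : (u.1 ^+ 2 + u.2 ^+ 2) * (v.1 ^+ 2 + v.2 ^+ 2) -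
  (u.1 * v.2 - u.2 * v.1) ^+ 2 = (u.1 * v.1 + u.2 * v.2) ^+ 2 by ring.
exact: sqr_ge0.
Qed.

Lemma wedge_scalr u v c : wedge u (scal c v) = c * wedge u v.
Proof. by rewrite /wedge /=; ring. Qed.

Lemma wedgeC u v : wedge u v = - wedge v u.
Proof. by rewrite /wedge; ring. Qed.

Lemma wedgexx u : wedge u u = 0.
Proof. by rewrite /wedge mulrC subrr. Qed.

Lemma wedge_lc u a v b w : wedge u (lc a v b w) = a * wedge u v + b * wedge u w.
Proof. by rewrite /wedge /=; ring. Qed.

Lemma wedge_neq0 u v : wedge u v != 0 -> u != 0 /\ v != 0.
Proof. by split; apply: contraNneq H => ->; rewrite /wedge !(mul0r, mulr0) subrr. Qed.

(** In the basis u, w the matrix of g is triangular, and determinant 1 makes its diagonal entries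
    inverse to each other. *)
Lemma ract_eigen u w g : \det g = 1 -> wedge u w != 0 -> wedge u (ract u g) = 0 ->
  exists l b, [/\ l != 0, ract u g = scal l u & ract w g = lc b u l^-1 w].
Proof.
move=> d1 W f0; have [u0 w0] := wedge_neq0 W.
have [l l0 lE] := wedge0_scal u0 (ract_neq0 d1 u0) f0.
exists l, (wedge (ract w g) w / wedge u w); split=> //.
rewrite {1}(lc_wedge (ract w g) W); congr lc.
apply: (mulIf W); rewrite divfK//; apply: (mulfI l0); rewrite mulrA mulfV// mul1r.
have := wedge_ract u w g; rewrite d1 mul1r => <-.
by rewrite lE /wedge /=; ring.
Qed.

Lemma ract_id u w g : wedge u w != 0 -> ract u g = u -> ract w g = w -> g = 1.
Proof.
move=> W ug wg.
have E x : ract x g = x.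
  by rewrite {1}(lc_wedge x W) ract_lc ug wg -lc_wedge.
have := E (1, 0); have := E (0, 1); rewrite /ract /= !(mul1r, mul0r, add0r, addr0).
by move=> [c d] [a b]; apply: mx2_eq; rewrite mx2_1E.
Qed.

Lemma subgroupX G h n : subgroup G -> G h -> G (h ^+ n).
Proof.
by move=> [G1 GM _] Gh; elim: n => [|n IH]; rewrite ?expr0 ?exprS//; exact: GM.
Qed.

Lemma ractX u l h n : ract u h = scal l u -> ract u (h ^+ n) = scal (l ^+ n) u.
Proof.
move=> E; elim: n => [|n IH].
  by rewrite !expr0 ract1 /scal !mul1r -surjective_pairing.
by rewrite exprS -ractM E ract_scal IH /scal /= !mulrA exprS.
Qed.

Lemma scalK u l g : l != 0 -> \det g = 1 -> ract u g = scal l u ->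
  ract u (invmx g) = scal l^-1 u.
Proof.
move=> l0 d1 E; have : ract (ract u g) (invmx g) = u.
  by rewrite ractM (invmx_detE d1).1 ract1.
rewrite E ract_scal; move: (ract u _) => v <-.
by rewrite /scal /= !mulrA mulVf// !mul1r -surjective_pairing.
Qed.

(* If h scales u by l with |l| > 1 and w by l^-1, and g maps w off its line, the
   conjugates of g by the powers of h are pairwise distinct and bounded. *)
Lemma parabolic_limit G u w l h g : subgroup G -> (forall g, G g -> \det g = 1) ->
  frob_finite G -> wedge u w != 0 -> 1 < l ^+ 2 -> G h ->
  ract u h = scal l u -> ract w h = scal l^-1 w ->
  G g -> wedge u (ract u g) = 0 -> wedge w (ract w g) = 0.
Proof.
move=> sG d1 Gfin W l1 Gh uh wh Gg ug.
have [_ GM GV] := sG.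
have l0 : l != 0 by apply: contraTneq l1 => ->; rewrite expr0n/= ltr10.
have [m [b [m0 mE bE]]] := ract_eigen (d1 _ Gg) W ug.
suff b0 : b = 0 by rewrite bE b0 wedge_lc mul0r add0r /wedge; ring.
apply: contrapT => /eqP b0.
pose gn n := h ^+ n * g * invmx (h ^+ n).
have Gn n : G (h ^+ n) by exact: subgroupX.
have ugn n : ract u (gn n) = scal m u.
  rewrite /gn -!ractM (ractX _ uh) ract_scal mE !ract_scal.
  rewrite (scalK _ (d1 _ (Gn n)) (ractX _ uh)) ?expf_neq0//.
  by rewrite /scal /=; congr pair; field; rewrite expf_neq0.
have wgn n : ract w (gn n) = lc (b * (l ^+ 2) ^- n) u m^-1 w.
  rewrite /gn -!ractM (ractX _ wh) ract_scal bE !ract_scal ract_lc.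
  rewrite (scalK _ (d1 _ (Gn n)) (ractX _ uh)) ?expf_neq0//.
  rewrite (scalK _ (d1 _ (Gn n)) (ractX _ wh)) ?expf_neq0 ?invr_eq0//.
  rewrite /scal /lc /= exprVn -exprM mulnC exprM.
  have ln0 : l ^+ n != 0 by rewrite expf_neq0.
  by congr pair; field; rewrite ?ln0 ?m0. 
have [C C0 HC] := frob_le_basis W.
pose M := C * (m ^+ 2 * nrm2 u + 2 * (b ^+ 2 * nrm2 u + m^-1 ^+ 2 * nrm2 w)).
have bound n : frob (gn n) <= M.
  rewrite (le_trans (HC _))// ler_pM2l// ugn wgn nrm2_scal lerD2l.
  rewrite (le_trans (nrm2D (scal _ u) (scal _ w)))// !nrm2_scal ler_pM2l// lerD2r.
  apply: ler_wpM2r; first exact: nrm2_ge0.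
  rewrite exprMn; apply: ler_piMr; first exact: sqr_ge0.
  rewrite -exprVn -exprM; apply: exprn_ile1; first by rewrite invr_ge0 sqr_ge0.
  by rewrite invf_le1 ?(lt_trans ltr01)// ltW.
have inj : injective gn.
  move=> n p E; have := wgn n; rewrite E wgn => /(congr1 (wedge w)).
  rewrite !wedge_lc => /addIr /mulIf; rewrite wedgeC oppr_eq0 => /(_ W) /(mulfI b0).
  move/invr_inj; move=> H; apply/esym/(ieexprIn _ _ H); first exact: lt_trans ltr01 l1.
  by rewrite gt_eqF.
apply: (@infinite_nat); apply: (@sub_finite_set _ _ (gn @^-1` (G `&` [set g | frob g <= M]))).
  move=> n _; split; last exact: bound.
  by apply: (GM _ _ (GM _ _ _ _)) => //; exact: GV.
by apply: finite_preimage (Gfin M) => n p _ _; exact: inj.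
Qed.

Lemma limdir_bounded G v M : (forall g, G g -> \det g = 1) -> limdir G v ->
  (forall g, G g -> frob g <= M * nrm2 (ract v g)) -> False.
Proof.
move=> d1 [v0 vl] H.
have M0 : 0 < `|M| + 1 by rewrite ltr_pwDr.
have [g Gg vg] := vl (2 * (`|M| + 1))^-1 ltac:(by rewrite invr_gt0 mulr_gt0).
have f0 := frob_gt0 (d1 _ Gg).
have : frob g <= (`|M| + 1) * nrm2 (ract v g).
  rewrite (le_trans (H _ Gg))// ler_wpM2r ?nrm2_ge0//.
  by rewrite (le_trans (ler_norm _))// lerDl.
move/le_trans => /(_ ((`|M| + 1) * ((2 * (`|M| + 1))^-1 * frob g))).
rewrite ler_pM2l// vg => /(_ isT).
have -> : (`|M| + 1) * ((2 * (`|M| + 1))^-1 * frob g) = frob g / 2.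
  by field; rewrite gt_eqF.
by move: f0; lra.
Qed.

Lemma wedge_le_ract u v g : \det g = 1 ->
  wedge v u ^+ 2 <= nrm2 (ract v g) * nrm2 (ract u g).
Proof. by move=> d1; have := wedge_le (ract v g) (ract u g); rewrite wedge_ract d1 mul1r. Qed.

(** Suppose the line of u is invariant. If some h stretches u, then h is hyperbolic and
    [parabolic_limit] makes its second eigenline invariant under G too; then only the two lines can
    be limit directions. If no element stretches u, a limit direction x off the line would give
    [frob g] a bound by a multiple of [nrm2 (ract x g)]. Both cases leave too few limit
    directions. *)
Lemma nonelem_noline G u : subgroup G -> (forall g, G g -> \det g = 1) ->
  frob_finite G ->
  (forall s : seq (R * R), exists2 v, limdir G v & forall w, w \in s -> w != 0 -> wedge v w != 0) ->
  u != 0 -> exists2 g, G g & wedge u (ract u g) != 0.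
Proof.
move=> sG d1 Gfin ne u0; apply: contrapT => nog.
have fixu g : G g -> wedge u (ract u g) = 0.
  by move=> Gg; apply: contrapT => /eqP ug; apply: nog; exists g.
have [_ GM GV] := sG.
pose v := (- u.2, u.1).
have uv : wedge u v != 0.
  have -> : wedge u v = nrm2 u by rewrite /wedge /nrm2 /=; ring.
  by rewrite nrm2_eq0.
have [[h [Gh l1]]|nohyp] := pselect (exists h, G h /\ nrm2 u < nrm2 (ract u h)).
  have [l [b [l0 lE bE]]] := ract_eigen (d1 _ Gh) uv (fixu _ Gh).
  have {}l1 : 1 < l ^+ 2.
    by move: l1; rewrite lE nrm2_scal -{1}[nrm2 u]mul1r ltr_pM2r// nrm2_gt0.
  have ll : 1 - l * l != 0.
    by rewrite subr_eq0; apply: contraTneq l1; rewrite expr2 => <-; rewrite ltxx.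
  (* The eigenvector of h for the eigenvalue 1 / l, normalised to have coefficient 1 on v. *)
  pose w := lc (b / (l^-1 - l)) u 1 v.
  have wh : ract w h = scal l^-1 w.
    by rewrite ract_lc lE bE /w /scal /lc /=; congr pair; field; rewrite l0 mulNr ll.
  have uw : wedge u w != 0.
    by rewrite wedge_lc mul1r wedgexx mulr0 add0r.
  have fixw g (Gg : G g) := parabolic_limit sG d1 Gfin uw l1 Gh lE wh Gg (fixu _ Gg).
  have [x xl xs] := ne [:: u; w].
  have xu : wedge x u != 0 by apply: xs; rewrite ?inE ?eqxx.
  have xw : wedge x w != 0 by apply: xs; rewrite ?inE ?eqxx ?orbT ?(wedge_neq0 uw).2.
  have [C C0 HC] := frob_le_basis uw.
  pose P := nrm2 u * nrm2 w.
  have A0 : 0 < wedge x u ^+ 2 by rewrite exprn_even_gt0.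
  have B0 : 0 < wedge x w ^+ 2 by rewrite exprn_even_gt0.
  apply: (limdir_bounded (M := C * (P / wedge x w ^+ 2 + P / wedge x u ^+ 2)) d1 xl).
  move=> g Gg; rewrite (le_trans (HC g))// -mulrA ler_pM2l// mulrDl.
  have [m [c [m0 mE cE]]] := ract_eigen (d1 _ Gg) uw (fixu _ Gg).
  (* Every g is diagonal in the basis u, w with inverse eigenvalues. Since [wedge_le_ract] bounds
     [nrm2 (ract x g)] from below by the inverse of either factor, each factor is at most a multiple
     of [nrm2 (ract x g)]. *)
  have PE : nrm2 (ract u g) * nrm2 (ract w g) = P.
    have c0 : c = 0.
      have := fixw _ Gg; rewrite cE wedge_lc wedgexx mulr0 addr0.
      by move/eqP; rewrite mulf_eq0 wedgeC oppr_eq0 (negbTE uw) orbF => /eqP.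
    rewrite mE cE c0 -[lc _ _ _ _]/(_, _) !mul0r !add0r -/(scal m^-1 w) !nrm2_scal.
    by rewrite /P; field.
  by apply: lerD; rewrite mulrAC ler_pdivlMr// -PE;
    [rewrite -mulrA|rewrite [nrm2 (ract u g) * _]mulrC -mulrA];
    apply: ler_wpM2l; rewrite ?nrm2_ge0// mulrC wedge_le_ract ?d1.
have [x xl xs] := ne [:: u].
have xu : wedge x u != 0 by apply: xs; rewrite ?inE ?eqxx.
have A0 : 0 < wedge x u ^+ 2 by rewrite exprn_even_gt0.
have [C C0 HC] := frob_le_basis xu.
apply: (limdir_bounded (M := C * (1 + nrm2 u ^+ 2 / wedge x u ^+ 2)) d1 xl) => g Gg.
rewrite (le_trans (HC g))// -mulrA ler_pM2l// mulrDl mul1r lerD2l.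
have ug : nrm2 (ract u g) <= nrm2 u.
  by rewrite leNgt; apply/negP => h; apply: nohyp; exists g.
rewrite (le_trans ug)// mulrAC ler_pdivlMr// expr2 -mulrA.
apply: ler_wpM2l; first exact: nrm2_ge0.
rewrite (le_trans (wedge_le_ract _ _ (d1 _ Gg)))// mulrC.
by apply: ler_wpM2r; first exact: nrm2_ge0.
Qed.

End LimitDirections.

(** * Minimality of the limit set, normal subgroups and nowhere density *)

Section NormalSubgroups.
Context {R : realType}.
Implicit Types (g h k : 'M[R]_2) (u v w : R * R) (G H K : set 'M[R]_2).

(** Not being a limit direction is an open condition, with a contraction constant that is uniform
    nearby. It is stated along a curve of unit speed and in the form that compactness of a segment
    consumes. *)
Lemma limdir_near G (d : R * R) (x : R) (f : R -> R * R) :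
  (forall s t, nrm2 ((f s).1 - (f t).1, (f s).2 - (f t).2) = (s - t) ^+ 2) ->
  ~ limdir G (f x) -> f x != 0 ->
  \forall y \near x & e \near 0^'+,
    forall g, G g -> e * frob g <= nrm2 (ract (f y) g).
Proof.
move=> fi nl f0.
have [e0 [e00 He]] : exists e0, 0 < e0 /\
    forall g, G g -> e0 * frob g < nrm2 (ract (f x) g).
  apply: contrapT => /forallNP nE; apply: nl; split=> // e e0.
  apply: contrapT => nG; apply: (nE e); split=> // g Gg.
  by rewrite ltNge; apply/negP => ?; apply: nG; exists g.
have e4 : 0 < e0 / 4 by rewrite divr_gt0.
exists ([set y | (x - y) ^+ 2 < e0 / 4], [set e | e < e0 / 4]).
  split=> /=.
    have : {for x, continuous (fun y => (x - y) ^+ 2)}.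
      by move=> ?; apply: cvgM; apply: cvgB; (exact: cvg_cst || exact: cvg_id).
    move=> /(_ [set z | z < e0 / 4]); apply.
    by rewrite subrr expr0n; exact: lt_nbhsl.
  by apply: nbhs_right_lt.
case=> y e /= [xy ee] g Gg.
have -> : ract (f y) g = lc 1 (ract (f x) g) (-1)
   (ract ((f x).1 - (f y).1, (f x).2 - (f y).2) g).
  by rewrite ractB /lc; case: (ract _ _) (ract _ _) => [a b] [c d'] /=; congr pair; ring.
have H1 := nrm2_ract ((f x).1 - (f y).1, (f x).2 - (f y).2) g.
rewrite fi in H1.
have := He _ Gg; set p := ract (f x) g; set q := ract _ g in H1 *.
have := nrm2D (lc 1 p (-1) q) q.
have -> : (lc 1 p (-1) q).1 + q.1 = p.1 by rewrite /lc /=; ring.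
have -> : (lc 1 p (-1) q).2 + q.2 = p.2 by rewrite /lc /=; ring.
rewrite -surjective_pairing.
have f0' := frob_ge0 g.
have := ler_wpM2r f0' (ltW xy); have := ler_wpM2r f0' (ltW ee).
by move: H1; lra.
Qed.

(** Without limit directions, compactness of the set of directions, covered by the two segments (x,
    1) and (1, x) with |x| <= 1, yields one e such that no g shortens a vector by more than the
    factor e [frob g] / 2, in squared norm. *)
Lemma limdir_nonempty G : (forall g, G g -> \det g = 1) ->
  (forall C, exists2 g, G g & C < frob g) -> exists u, limdir G u.
Proof.
move=> d1 unb; apply: contrapT => /forallNP nl.
have side (f : R -> R * R) :
    (forall s t, nrm2 ((f s).1 - (f t).1, (f s).2 - (f t).2) = (s - t) ^+ 2) ->
    (forall x, f x != 0) ->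
    exists2 e : R, 0 < e & forall x, -1 <= x <= 1 -> forall g, G g ->
      e * frob g <= nrm2 (ract (f x) g).
  move=> fi f0.
  have /compact_near_coveringP cov := @segment_compact R (-1) 1.
  have {cov}H : \forall e \near 0^'+, `[-1, 1] `<=`
      (fun x => forall g, G g -> e * frob g <= nrm2 (ract (f x) g)).
    by apply: cov => x _; apply: limdir_near.
  have [e [He e0]] := filter_ex (filterI H (nbhs_right_gt (0 : R))).
  by exists e => // x xI; apply: He; rewrite /= in_itv.
have [|x|e1 e10 H1] := side (fun x => (x, 1)).
- by move=> s t; rewrite /nrm2 /=; ring.
- by apply/negP => /eqP[_ /eqP]; rewrite oner_eq0.
have [|x|e2 e20 H2] := side (fun x => (1, x)).
- by move=> s t; rewrite /nrm2 /=; ring.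
- by apply/negP => /eqP[/eqP]; rewrite oner_eq0.
pose e := Num.min e1 e2.
have e0 : 0 < e by rewrite lt_min e10.
have key u g : G g -> nrm2 u * (e * frob g) <= 2 * nrm2 (ract u g).
  move=> Gg; have f0 := frob_ge0 g.
  have [u12|u21] := leP (`|u.1|) (`|u.2|).
    have [u2|u20] := eqVneq u.2 0.
      move: u12; rewrite u2 normr0 normr_le0 => /eqP u1.
      by rewrite /nrm2 u1 u2 !expr0n/= addr0 mul0r mulr_ge0 ?addr_ge0 ?sqr_ge0.
    have uE : u = scal u.2 (u.1 / u.2, 1).
      by case: (u) u20 => a b /= b0; rewrite /scal /= mulr1; congr pair; field.
    rewrite {2}uE ract_scal nrm2_scal.
    have : -1 <= u.1 / u.2 <= 1.
      by rewrite -ler_norml normrM normfV ler_pdivrMr ?normr_gt0// mul1r.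
    move=> /H1 /(_ _ Gg) h1.
    have : nrm2 u * (e * frob g) <= nrm2 u * (e1 * frob g).
      by rewrite ler_wpM2l ?nrm2_ge0// ler_wpM2r// ge_min lexx.
    move=> h0; apply: (le_trans h0).
    have : nrm2 u <= 2 * u.2 ^+ 2.
      have : u.1 ^+ 2 <= u.2 ^+ 2 by rewrite -ler_sqr ?nnegrE// !real_normK ?num_real in u12.
      by rewrite /nrm2; lra.
    move=> h; have := ler_pM (nrm2_ge0 u) (mulr_ge0 (ltW e10) f0) h h1.
    by move=> h'; apply: (le_trans h'); rewrite !mulrA.
  have u10 : u.1 != 0 by rewrite -normr_gt0 (le_lt_trans _ u21).
  have uE : u = scal u.1 (1, u.2 / u.1).
    by case: (u) u10 => a b /= b0; rewrite /scal /= mulr1; congr pair; field.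
  rewrite {2}uE ract_scal nrm2_scal.
  have : -1 <= u.2 / u.1 <= 1.
    by rewrite -ler_norml normrM normfV ler_pdivrMr ?normr_gt0// mul1r ltW.
  move=> /H2 /(_ _ Gg) h1.
  have : nrm2 u * (e * frob g) <= nrm2 u * (e2 * frob g).
    by rewrite ler_wpM2l ?nrm2_ge0// ler_wpM2r// ge_min lexx orbT.
  move=> h0; apply: (le_trans h0).
  have : nrm2 u <= 2 * u.1 ^+ 2.
    have : u.2 ^+ 2 <= u.1 ^+ 2.
      by move/ltW: u21; rewrite -ler_sqr ?nnegrE// !real_normK ?num_real.
    by rewrite /nrm2; lra.
  move=> h; have := ler_pM (nrm2_ge0 u) (mulr_ge0 (ltW e20) f0) h h1.
  by move=> h'; apply: (le_trans h'); rewrite !mulrA.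
have [g Gg gC] := unb (4 / e + 1).
have fe : 4 < e * frob g.
  by rewrite mulrC -ltr_pdivrMr// (lt_trans _ gC)// ltrDl.
have f1 : 1 < frob g by rewrite (le_lt_trans _ gC)// lerDr ltW// divr_gt0.
(* The rows of the inverse of g are carried by g to the unit vectors. Adding the two inequalities
   gives frob g * e * frob g <= 4, against e * frob g > 4 and frob g > 1. *)
have h1 := key (ract (1, 0) (invmx g)) g Gg.
have h2 := key (ract (0, 1) (invmx g)) g Gg.
have := lerD h1 h2; rewrite !ractM (invmx_detE (d1 _ Gg)).2 !ract1 -mulrDl.
have -> : nrm2 (ract (1, 0) (invmx g)) + nrm2 (ract (0, 1) (invmx g)) = frob g.
  by rewrite -(frob_inv (d1 _ Gg)) /nrm2 /frob /ract /=; ring.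
rewrite /nrm2 /= expr1n expr0n /= addr0 add0r mulr1.
by move: fe f1; nra.
Qed.

(** Torsion freeness makes the powers of k pairwise distinct, and discreteness leaves only finitely
    many of them in a bounded set. *)
Lemma limdir_powers G k : subgroup G -> (forall g, G g -> \det g = 1) ->
  frob_finite G -> torsion_free G -> G k -> k <> 1 ->
  forall C, exists n, C < frob (k ^+ n).
Proof.
move=> sG d1 Gfin Gtf Gk k1 C; apply: contrapT => /forallNP H.
have inj : injective (fun n => k ^+ n).
  suff W n p : (n < p)%N -> k ^+ n = k ^+ p -> False.
    by move=> n p E; case: (ltngtP n p) => // /W; [move/(_ E)|move/(_ (esym E))].
  move=> np E; apply: k1; apply: (Gtf _ (p - n)%N) => //; first by rewrite subn_gt0.
  have [_ Vk] := invmx_detE (d1 _ (subgroupX n sG Gk)).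
  by rewrite -[LHS]mul1r -Vk -mulrA -exprD subnKC ?(ltnW np)// -E Vk.
apply: (@infinite_nat); apply: (@sub_finite_set _ _
   ((fun n => k ^+ n) @^-1` (G `&` [set g | frob g <= C]))).
  move=> n _; split; first exact: subgroupX.
  by rewrite /= leNgt; apply/negP; exact: H.
by apply: finite_preimage (Gfin C) => n p _ _; exact: inj.
Qed.

Definition normal_in G K := forall g k, G g -> K k -> K (g * k * invmx g).

Section Fuchsian.
Variable G : set 'M[R]_2.
Hypothesis sG : subgroup G.
Hypothesis d1 : forall g, G g -> \det g = 1.
Hypothesis Gfin : frob_finite G.
Hypothesis Gtf : torsion_free G.
Hypothesis ne : forall s : seq (R * R),
  exists2 v, limdir G v & forall w, w \in s -> w != 0 -> wedge v w != 0.

Let GM g h : G g -> G h -> G (g * h). Proof. by case: sG => _ H _; exact: H. Qed.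
Let GV g : G g -> G (invmx g). Proof. by case: sG => _ _ H; exact: H. Qed.
Let invK g : G g -> invmx (invmx g) = g. Proof. by move=> _; rewrite invmxK. Qed.

Lemma normal_ract K h u : normal_in G K -> G h -> limdir K u -> limdir K (ract u h).
Proof.
move=> KN Gh; apply: (limdir_normal (d1 Gh)) => k Kk.
by have := KN _ _ (GV Gh) Kk; rewrite invK.
Qed.

Lemma minimal_limdir (L : set (R * R)) a : closed_dirs L ->
  (forall u c, L u -> c != 0 -> L (scal c u)) ->
  (forall u g, L u -> G g -> L (ract u g)) ->
  L a -> a != 0 -> limdir G `<=` L.
Proof.
move=> Lcl Lsc Lact La a0; have [g Gg ag] := nonelem_noline sG d1 Gfin ne a0.
exact: (minimal_dirs d1 GV Lcl Lsc Lact La (Lact _ _ La Gg)).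
Qed.

Lemma normal_limdir K k : subgroup K -> K `<=` G -> normal_in G K -> K k -> k <> 1 ->
  limdir G `<=` limdir K.
Proof.
move=> sK KG KN Kk k1.
have dK g : K g -> \det g = 1 by move/KG; exact: d1.
have [u uK] : exists u, limdir K u.
  apply: limdir_nonempty => // C.
  have [n nC] := limdir_powers sG d1 Gfin Gtf (KG _ Kk) k1 C.
  by exists (k ^+ n) => //; exact: subgroupX.
apply: (@minimal_limdir _ u) => //.
- exact: limdir_closed.
- by move=> v c vK c0; exact: limdir_scal.
- by move=> v g vK Gg; exact: normal_ract.
- by case: uK.
Qed.

(** An element a of K that contracts u also contracts [ract u b], because b and a commute. If these
    two rows were independent, a would be small by [frob_le_basis]. *)
Lemma limdir_commute K b u : (forall g, K g -> \det g = 1) -> \det b = 1 ->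
  (forall a, K a -> a * b = b * a) -> limdir K u -> wedge u (ract u b) = 0.
Proof.
move=> dK db comm [u0 ul]; apply: contrapT => /eqP W.
have [C C0 HC] := frob_le_basis W.
have b0 := frob_gt0 db.
have e0 : 0 < (2 * C * (1 + frob b))^-1 by rewrite invr_gt0 !mulr_gt0// addr_gt0.
have [a Ka ua] := ul _ e0; have a0 := frob_gt0 (dK _ Ka).
have := HC a; rewrite ractM -comm// -ractM.
have := nrm2_ract (ract u a) b => H1 H2.
have : frob a <= C * (nrm2 (ract u a) * (1 + frob b)).
  by rewrite (le_trans H2)// ler_pM2l// mulrDr mulr1 lerD2l.
have : nrm2 (ract u a) * (1 + frob b) <=
    (2 * C * (1 + frob b))^-1 * frob a * (1 + frob b).
  by rewrite ler_wpM2r// addr_ge0// ltW.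
rewrite -(ler_pM2l C0) => h1 h2; have := le_trans h2 h1.
have -> : C * ((2 * C * (1 + frob b))^-1 * frob a * (1 + frob b)) = frob a / 2.
  by field; rewrite !gt_eqF// addr_gt0.
by move: a0; lra.
Qed.

(** If the intersection is trivial, all commutators vanish and b commutes with A. Then b fixes every
    limit direction of A, which are those of G; three distinct invariant lines make b scalar, so its
    square is 1, against torsion freeness. *)
Lemma normal_inter A B : subgroup A -> A `<=` G -> normal_in G A ->
  subgroup B -> B `<=` G -> normal_in G B ->
  (exists2 a, A a & a <> 1) -> (exists2 b, B b & b <> 1) ->
  exists2 c, (A `&` B) c & c <> 1.
Proof.
move=> sA AG AN sB BG BN [a Aa a1] [b Bb b1]; apply: contrapT => triv.
have db := d1 (BG _ Bb); have [bV Vb] := invmx_detE db.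
have comm x : A x -> x * b = b * x.
  move=> Ax; have dx := d1 (AG _ Ax); have [xV Vx] := invmx_detE dx.
  have [_ AM AV] := sA; have [_ BM BV] := sB.
  have E : x * b * invmx x * invmx b = 1.
    apply: contrapT => c1; apply: triv; exists (x * b * invmx x * invmx b) => //; split.
      rewrite -!mulrA; apply: AM => //; rewrite mulrA; apply: AN (BG _ Bb) _.
      exact: AV.
    by apply: BM; [apply: BN => //; exact: AG | exact: BV].
  by rewrite -[RHS]mul1r -E !mulrA -(mulrA _ (invmx b) b) Vb mulr1 -(mulrA _ (invmx x) x) Vx mulr1.
have eig u : limdir G u -> wedge u (ract u b) = 0.
  move/(normal_limdir sA AG AN Aa a1); apply: limdir_commute => // g /AG; exact: d1.
have [u ul _] := ne [::].
have [v vl /(_ u (mem_head _ _) ul.1) vu] := ne [:: u].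
have [w wl wuv] := ne [:: u; v].
have wu : wedge w u != 0 by apply: wuv ul.1; rewrite !inE eqxx.
have wv : wedge w v != 0 by apply: wuv vl.1; rewrite !inE eqxx orbT.
have uv : wedge u v != 0 by rewrite wedgeC oppr_eq0.
have [l [c [l0 lE cE]]] := ract_eigen db uv (eig _ ul).
have {c cE}vE : ract v b = scal l^-1 v.
  have := eig _ vl; rewrite cE wedge_lc wedgexx mulr0 addr0 => /eqP.
  rewrite mulf_eq0 (negbTE vu) orbF => /eqP ->.
  by rewrite /lc !mul0r !add0r.
have l2 : l ^+ 2 = 1.
  have := eig _ wl; rewrite {2}(lc_wedge w uv) ract_lc lE vE wedge_lc !wedge_scalr.
  set p := wedge w v / _; set q := wedge u w / _ => E.
  have : (l ^+ 2 - 1) * (wedge w v * wedge w u) = 0.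
    have := congr1 (fun t => t * (wedge u v * l)) E.
    rewrite mul0r => <-; rewrite /p /q [wedge u w]wedgeC; field.
    by rewrite l0 uv.
  move/eqP; rewrite mulf_eq0 subr_eq0 => /orP[/eqP //|].
  by rewrite mulf_eq0 (negbTE wv) (negbTE wu).
apply: b1; apply: (Gtf (n := 2)) => //; first exact: BG.
have lV : l^-1 ^+ 2 = 1 by rewrite exprVn l2 invr1.
apply: (ract_id uv); [rewrite (ractX _ lE) l2|rewrite (ractX _ vE) lV];
  by rewrite /scal !mul1r -surjective_pairing.
Qed.

(** The limit directions that are approximated by non-limit ones form a closed invariant set L. It
    is non-empty as soon as one direction is not a limit, so by minimality it contains every limit
    direction: the limit set is nowhere dense. *)
Lemma limdir_gap : ~ (forall u, u != 0 -> limdir G u) ->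
  forall u e, u != 0 -> 0 < e ->
  exists v, [/\ v != 0, nrm2 (u.1 - v.1, u.2 - v.2) <= e & ~ limdir G v].
Proof.
move=> /existsNP [q /not_implyP[q0 ql]].
pose L := [set u | limdir G u /\ forall e, 0 < e ->
  exists v, [/\ v != 0, nrm2 (u.1 - v.1, u.2 - v.2) <= e & ~ limdir G v]].
have tri u v w e : nrm2 (u.1 - v.1, u.2 - v.2) <= e / 4 ->
    nrm2 (v.1 - w.1, v.2 - w.2) <= e / 4 -> nrm2 (u.1 - w.1, u.2 - w.2) <= e.
  move=> h1 h2; have := nrm2D (u.1 - v.1, u.2 - v.2) (v.1 - w.1, v.2 - w.2).
  by rewrite /= !subrKA; lra.
have [a al _] := ne [::].
have ao : wedge a q != 0.
  by apply/eqP => W; have [c c0 E] := wedge0_scal al.1 q0 W; apply: ql; rewrite E; exact: limdir_scal.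
pose f t := lc (1 - t) q t a.
have f0 t : f t != 0.
  have : wedge a (f t) = (1 - t) * wedge a q by rewrite wedge_lc wedgexx mulr0 addr0.
  have : wedge (f t) q = t * wedge a q.
    by rewrite wedgeC wedge_lc wedgexx mulr0 add0r [wedge q a]wedgeC mulrN opprK.
  have [->|t1] := eqVneq t 1.
    by rewrite mul1r => E _; apply: (wedge_neq0 (v := q) _).1; rewrite E.
  move=> _ E; apply: (wedge_neq0 (u := a) _).2; rewrite E mulf_neq0// subr_eq0.
  by rewrite eq_sym.
have fd s t : nrm2 ((f s).1 - (f t).1, (f s).2 - (f t).2) =
    (s - t) ^+ 2 * nrm2 (a.1 - q.1, a.2 - q.2).
  by rewrite /nrm2 /f /lc /=; ring.
pose D := nrm2 (a.1 - q.1, a.2 - q.2) + 1.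
have D0 : 0 < D by rewrite ltr_wpDl ?nrm2_ge0.
have nearf s t e : 0 < e -> (s - t) ^+ 2 <= e / D ->
    nrm2 ((f s).1 - (f t).1, (f s).2 - (f t).2) <= e.
  move=> e0 st; rewrite fd; have DE : e / D * D = e by rewrite divfK ?gt_eqF.
  rewrite -[leRHS]DE; by apply: ler_pM; rewrite ?sqr_ge0 ?nrm2_ge0// lerDl.
(* The segment f runs from the non-limit q to the limit direction a without meeting 0. Its first
   limit direction, at the infimum of T, is a frontier point. *)
pose T := [set t : R | 0 <= t /\ limdir G (f t)].
have T1 : T 1 by split=> //; rewrite /f /lc subrr !mul0r !add0r !mul1r -surjective_pairing.
have Tinf : has_inf T by split; [exists 1 | exists 0 => t []].
pose t0 := inf T.
have t00 : 0 <= t0 by apply: lb_le_inf; [exists 1 | move=> t []].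
have sq e : 0 < e -> exists2 d : R, 0 < d & d ^+ 2 <= e.
  by move=> e0; exists (Num.sqrt e); rewrite ?sqrtr_gt0// sqr_sqrtr// ltW.
have Tt0 : limdir G (f t0).
  apply: limdir_closed => // e e0; have [d d0 de] := sq _ (divr_gt0 e0 D0).
  have [t [t_ge0 tl] td] := inf_adherent d0 Tinf.
  exists (f t) => //; apply: nearf => //; rewrite (le_trans _ de)//.
  have h1 : t0 <= t by apply: ge_inf; [case: Tinf | split].
  rewrite -sqrrN opprB ler_sqr ?nnegrE ?subr_ge0 ?(ltW d0)//.
  by rewrite lerBlDl ltW.
have t0p : 0 < t0.
  rewrite lt_def t00 andbT; apply/eqP => t0E; apply: ql.
  by move: Tt0; rewrite t0E /f /lc subr0 !mul0r !addr0 !mul1r -surjective_pairing.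
have Lf : L (f t0).
  split=> // e e0; have [d d0 de] := sq _ (divr_gt0 e0 D0).
  pose t := t0 - Num.min d t0.
  have m0 : 0 < Num.min d t0 by rewrite lt_min d0.
  exists (f t); split=> //.
    apply: nearf => //; rewrite /t opprB addrC subrK (le_trans _ de)//.
    by rewrite ler_sqr ?nnegrE ?(ltW m0) ?(ltW d0)// ge_min lexx.
  move=> tl; have : t0 <= t.
    apply: ge_inf; first by case: Tinf.
    by split=> //; rewrite /t subr_ge0 ge_min lexx orbT.
  by rewrite /t; move: m0; lra.
have GL : limdir G `<=` L.
  apply: (@minimal_limdir _ (f t0)) => //.
  - move=> u u0 H; split=> [|e e0].
      by apply: limdir_closed => // e /H[v [vl _] uv]; exists v.
    have e4 : 0 < e / 4 by rewrite divr_gt0.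
    have [v [_ /(_ _ e4)[w [w0 vw wl]]] uv] := H _ e4.
    by exists w; split=> //; exact: tri uv vw.
  - move=> u c [ul H] c0; split=> [|e e0]; first exact: limdir_scal.
    have c2 : 0 < c ^+ 2 by rewrite exprn_even_gt0.
    have [v [v0 uv vl]] := H _ (divr_gt0 e0 c2).
    exists (scal c v); split.
    + by rewrite -nrm2_gt0 nrm2_scal mulr_gt0// nrm2_gt0.
    + have -> : nrm2 ((scal c u).1 - (scal c v).1, (scal c u).2 - (scal c v).2) =
        c ^+ 2 * nrm2 (u.1 - v.1, u.2 - v.2) by rewrite /nrm2 /scal /=; ring.
      by rewrite mulrC -ler_pdivlMr.
    + move=> /(limdir_scal (invr_neq0 c0)).
      by rewrite /scal /= !mulrA mulVf// !mul1r -surjective_pairing.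
  - move=> u g [ul H] Gg; split=> [|e e0]; first exact: limdir_ract.
    have g0 := frob_gt0 (d1 Gg).
    have [v [v0 uv vl]] := H _ (divr_gt0 e0 g0).
    exists (ract v g); split; first exact: ract_neq0 (d1 Gg) v0.
    + by rewrite -ractB (le_trans (nrm2_ract _ _))// -ler_pdivlMr.
    + move=> /(limdir_ract sG d1 (GV Gg)); rewrite ractM.
      by rewrite (invmx_detE (d1 Gg)).1 ract1.
move=> u e u0 e0; have [/GL[_ /(_ _ e0)]//|ul] := pselect (limdir G u).
by exists u; split=> //; rewrite !subrr /nrm2 /= expr0n addr0 ltW.
Qed.

(** A finite form of Baire's argument: nowhere density allows a small disc of directions to be
    shrunk for one m after the other, until no [ract v m] with v in the disc is a limit direction.
    At its centre u the contraction constants are bounded below, over finitely many m. *)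
Lemma limdir_union (s : seq 'M[R]_2) V : (forall A, V A -> \det A = 1) ->
  (forall A, V A -> exists m g, [/\ m \in s, G g & A = m * g]) ->
  ~ (forall u, u != 0 -> limdir G u) -> ~ (forall u, u != 0 -> limdir V u).
Proof.
move=> dV VG nG.
have gap := limdir_gap nG.
have open_gap w : w != 0 -> ~ limdir G w -> exists2 d, 0 < d &
    forall v, nrm2 (w.1 - v.1, w.2 - v.2) <= d -> ~ limdir G v.
  move=> w0 wl; apply: contrapT => H; apply: wl; apply: limdir_closed => // e e0.
  apply: contrapT => nv; apply: H; exists e => // v wv vl.
  by apply: nv; exists v.
have [u [d [u0 d0 H]]] : exists u d, [/\ u != 0, 0 < d & forall m, m \in s -> \det m = 1 ->
    forall v, nrm2 (u.1 - v.1, u.2 - v.2) <= d -> ~ limdir G (ract v m)].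
  elim: s {VG} => [|m s [u [d [u0 d0 IH]]]].
    exists (1, 0), 1; split=> //; by apply/negP => /eqP[/eqP]; rewrite oner_eq0.
  (* A representative of another determinant represents no element of V. *)
  have [dm|dm] := pselect (\det m = 1); last first.
    exists u, d; split=> // m'; rewrite inE => /orP[/eqP -> /dm//|]; exact: IH.
  have m0 := frob_gt0 dm; have [mV Vm] := invmx_detE dm.
  have [w [w0 uw wl]] := gap (ract u m) (d / 4 / frob m) (ract_neq0 dm u0)
    ltac:(by rewrite !divr_gt0).
  have [d' d'0 Hd'] := open_gap _ w0 wl.
  exists (ract w (invmx m)), (Num.min (d / 4) (d' / frob m)); split.
  - exact: ract_neq0 (invmx_det dm) w0.
  - by rewrite lt_min !divr_gt0.
  move=> m' + dm' v; rewrite inE le_min => /orP[/eqP -> | m's] /andP[h1 h2].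
    apply: Hd'; have -> : w = ract (ract w (invmx m)) m by rewrite ractM Vm ract1.
    by rewrite -ractB (le_trans (nrm2_ract _ _))// -ler_pdivlMr.
  apply: IH => //.
  have h3 : nrm2 (u.1 - (ract w (invmx m)).1, u.2 - (ract w (invmx m)).2) <= d / 4.
    have {1 2}-> : u = ract (ract u m) (invmx m) by rewrite ractM mV ract1.
    rewrite -ractB (le_trans (nrm2_ract _ _))// -ler_pdivlMr ?frob_inv//.
  have := nrm2D (u.1 - (ract w (invmx m)).1, u.2 - (ract w (invmx m)).2)
    ((ract w (invmx m)).1 - v.1, (ract w (invmx m)).2 - v.2).
  by move: h1 h3; case: (ract w _) => a b /= h1 h3; rewrite !subrKA; lra.
move=> /(_ u u0)[_ ul].
have [e [e0 He]] : exists e, 0 < e /\ forall m, m \in s -> \det m = 1 ->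
    forall g, G g -> e * frob (m * g) < nrm2 (ract u (m * g)).
  have : forall m, m \in s -> \det m = 1 -> ~ limdir G (ract u m).
    move=> m ms dm; apply: H => //.
    by rewrite !subrr /nrm2 /= expr0n addr0 ltW.
  elim: s {VG H} => [|m s IH] H; first by exists 1.
  have [e [e0 He]] := IH (fun m' ms => H m' (mem_behead (s := m :: s) ms)).
  have [dm|dm] := pselect (\det m = 1); last first.
    by exists e; split=> // m'; rewrite inE => /orP[/eqP -> /dm//|]; exact: He.
  have m0 := frob_gt0 dm.
  have [e' [e'0 He']] : exists e', 0 < e' /\
      forall g, G g -> e' * frob g < nrm2 (ract u (m * g)).
    apply: contrapT => /forallNP nE; apply: (H m (mem_head _ _) dm).
    split=> [|x x0]; first exact: ract_neq0.
    apply: contrapT => nG'; apply: (nE x); split=> // g Gg.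
    rewrite ltNge; apply/negP => h; apply: nG'; exists g => //.
    by rewrite ractM.
  exists (Num.min e (e' / frob m)); split.
    by rewrite lt_min e0 divr_gt0.
  move=> m'; rewrite inE => /orP[/eqP -> _|m's dm'] g Gg.
    apply: le_lt_trans (He' _ Gg).
    apply: (@le_trans _ _ (e' / frob m * (frob m * frob g))).
      apply: ler_pM; rewrite ?frob_ge0 ?frobM//.
        by rewrite le_min ltW//= ltW// divr_gt0.
      by rewrite ge_min lexx orbT.
    by rewrite mulrA divfK ?gt_eqF.
  apply: le_lt_trans (He _ m's dm' _ Gg).
  by apply: ler_wpM2r; rewrite ?frob_ge0// ge_min lexx.
have [A VA uA] := ul _ e0.
have [m [g [ms Gg AE]]] := VG _ VA.
have dm : \det m = 1.
  by have := dV _ VA; rewrite AE det_mulmx (d1 Gg) mulr1.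
have := He _ ms dm _ Gg; rewrite -AE => /(le_lt_trans uA).
by rewrite ltxx.
Qed.

End Fuchsian.

Lemma limit_set_bdpt G u : (forall g, G g -> \det g = 1) -> u != 0 ->
  limit_set G (bdpt u) <-> limdir G u.
Proof.
move=> d1 u0; have n0 : 0 < nrm2 u by rewrite nrm2_gt0.
split=> [[_ /closure_cplx H]|[_ H]].
  split=> // e e0.
  have s0 : 0 < 2 * e / nrm2 u by rewrite divr_gt0// mulr_gt0.
  (* By [dist_cayley] this radius gives 4 * nrm2 (ract u g) < 2 * e * (frob g + 2), and frob g + 2
     <= 2 * frob g. *)
  have [_ [g Gg <-] hg] := H (Num.sqrt (2 * e / nrm2 u)) ltac:(by rewrite sqrtr_gt0).
  exists g => //; have f2 := frob_ge2 (d1 _ Gg).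
  move: hg; rewrite -ltr_sqr ?nnegrE ?cabs_ge0 ?sqrtr_ge0// cabs2 sqr_sqrtr ?(ltW s0)//.
  rewrite dist_cayley ?(d1 _ Gg)// => hg.
  have : 4 * nrm2 (ract u g) < 2 * e * (frob g + 2).
    move: hg; rewrite ltr_pdivrMr; last by rewrite mulr_gt0// ltr_wpDl ?frob_ge0.
    have -> : 2 * e / nrm2 u * (nrm2 u * (frob g + 2)) = 2 * e * (frob g + 2).
      by field; rewrite gt_eqF.
    by [].
  by move: f2 e0; nra.
split.
  rewrite /boundary_circle /= cabsE /cabs /bdpt /reC /imC /=.
  suff -> : ((u.2 ^+ 2 - u.1 ^+ 2) / nrm2 u) ^+ 2 + (2 * u.1 * u.2 / nrm2 u) ^+ 2 = 1.
    by rewrite sqrtr1.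
  rewrite /nrm2; field; rewrite -/(nrm2 u) ?gt_eqF//.
apply/closure_cplx => e e0.
have e1 : 0 < e ^+ 2 * nrm2 u / 8 by rewrite divr_gt0// mulr_gt0// exprn_gt0.
have [g Gg hg] := H _ e1; have f2 := frob_ge2 (d1 _ Gg).
exists (cayley (moebius g (toC 0 1))); first by exists g.
rewrite -ltr_sqr ?nnegrE ?cabs_ge0 ?(ltW e0)// cabs2 dist_cayley ?(d1 _ Gg)//.
rewrite ltr_pdivrMr; last by rewrite mulr_gt0// ltr_wpDl ?frob_ge0.
have f0 : 0 < frob g := lt_le_trans (ltr0Sn R 1) f2.
have p0 : 0 < e ^+ 2 * nrm2 u by rewrite mulr_gt0// exprn_gt0.
by rewrite mulrA; nra.
Qed.

Lemma bdpt_surj z : boundary_circle (R := R) z -> exists2 u, u != 0 & bdpt u = z.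
Proof.
rewrite /boundary_circle /= cabsE => H.
have {H}E : reC z ^+ 2 + imC z ^+ 2 = 1.
  have z1 : cabs z = 1 by case: H.
  by rewrite -cabs2 z1 expr1n.
have [x1|x1] := eqVneq (reC z) (-1).
  exists (1, 0); first by apply/negP => /eqP[/eqP]; rewrite oner_eq0.
  have y0 : imC z = 0.
    by apply/eqP; rewrite -sqrf_eq0; apply/eqP; move: E; rewrite x1; lra.
  rewrite (cplxE z) x1 y0 /bdpt /nrm2 /=.
  by congr toC; rewrite ?expr1n ?expr0n/= ?addr0 ?sub0r ?mulr0 ?mul0r ?divr1.
(* The half-angle formula; this vector vanishes at -1, which is why that point was treated apart. *)
exists (imC z, 1 + reC z).
  by apply: contraNneq x1 => -[_ /eqP]; rewrite addrC addr_eq0.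
have E2 : imC z ^+ 2 = 1 - reC z ^+ 2 by move: E; lra.
have x0 : 1 + reC z != 0 by rewrite addrC addr_eq0.
rewrite [RHS](cplxE z) /bdpt /nrm2 /= E2.
have -> : 1 - reC z ^+ 2 + (1 + reC z) ^+ 2 = 2 * (1 + reC z) by ring.
congr toC; field; rewrite x0//.
Qed.

Lemma first_kindP G : (forall g, G g -> \det g = 1) ->
  first_kind G <-> forall u, u != 0 -> limdir G u.
Proof.
move=> d1; split=> [G1 u u0|H].
  apply/limit_set_bdpt => //; rewrite G1 /boundary_circle /= cabsE.
  suff -> : cabs (bdpt u) = 1 by [].
  have n0 : nrm2 u != 0 by rewrite nrm2_eq0.
  rewrite /cabs /bdpt /reC /imC /=.
  suff -> : ((u.2 ^+ 2 - u.1 ^+ 2) / nrm2 u) ^+ 2 + (2 * u.1 * u.2 / nrm2 u) ^+ 2 = 1.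
    by rewrite sqrtr1.
  by rewrite /nrm2; field.
apply/seteqP; split=> [z []//|z zc].
by have [u u0 <-] := bdpt_surj zc; apply/limit_set_bdpt => //; exact: H.
Qed.

Lemma bdpt_wedge u v : u != 0 -> v != 0 -> wedge u v = 0 -> bdpt u = bdpt v.
Proof.
move=> u0 v0 /(wedge0_scal u0 v0)[c c0 ->].
have n0 : nrm2 u != 0 by rewrite nrm2_eq0.
rewrite /bdpt nrm2_scal /scal /=; congr toC; field; rewrite n0 c0//.
Qed.

Lemma non_elementaryP G : (forall g, G g -> \det g = 1) -> non_elementary G ->
  forall s : seq (R * R),
  exists2 v, limdir G v & forall w, w \in s -> w != 0 -> wedge v w != 0.
Proof.
move=> d1 ne s; apply: contrapT => H; apply: ne.
apply: (@sub_finite_set _ _ (@bdpt R @` [set` s])); last exact: finite_image.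
move=> z zl; have [u u0 uz] := bdpt_surj zl.1.
have ul : limdir G u by apply/(limit_set_bdpt d1 u0); rewrite uz; exact: zl.
have [w ws [w0 uw]] : exists2 w, w \in s & w != 0 /\ wedge u w = 0.
  apply: contrapT => nw; apply: H; exists u => // w ws w0; apply/eqP => uw.
  by apply: nw; exists w.
by exists w => //; rewrite -uz; apply: bdpt_wedge => //; rewrite wedgeC uw oppr0.
Qed.

End NormalSubgroups.

(** * Goursat's theorem *)

Section Goursat.
Context {R : realType}.

Lemma antiderivative (s : R) (k : R -> R) : continuous k ->
  {K : R -> R | forall x, `|x| < s -> is_derive x (1 : R) K (k x)}.
Proof.
move=> kc; apply: cid.
exists (fun x => \int[@lebesgue_measure R]_(t in `[- s, x]) k t) => x.
rewrite ltr_norml => /andP[sx xs].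
have kint : (@lebesgue_measure R).-integrable `[- s, s] (EFin \o k).
  apply: continuous_compact_integrable; first exact: segment_compact.
  by apply: continuous_subspaceT.
have [D E] := continuous_FTC1_closed xs kint sx (kc x).
exact: (DeriveDef D (eq_trans (esym (derive1E _ _)) E)).
Qed.

(** The integrand is compared with an affine function, not a constant, because on the boundary of a
    rectangle it is the whole affine part of a closed form that cancels. *)
Lemma mvt_affine (s : R) (k K : R -> R) (a b al be e : R) :
  (forall x, `|x| < s -> is_derive x (1 : R) K (k x)) ->
  `|a| < s -> `|b| < s -> a <= b ->
  (forall t, a <= t <= b -> `|k t - (al + be * t)| <= e) ->
  `|K b - K a - al * (b - a) - be * (b ^+ 2 - a ^+ 2) / 2| <= e * (b - a).
Proof.
move=> Kd sa sb ab H.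
have ins x : a <= x <= b -> `|x| < s.
  move: sa sb; rewrite !ltr_norml => /andP[A1 _] /andP[_ B2] /andP[x1 x2].
  by rewrite (lt_le_trans A1 x1) (le_lt_trans x2 B2).
pose L := fun x : R => K x - (al * x + be / 2 * (x * x)).
have Ld x : a <= x <= b -> is_derive x (1 : R) L (k x - (al + be * x)).
  move=> /ins /Kd Kx.
  have D1 : is_derive x (1 : R) (al \*: @id R) (al *: (1 : R)) by exact: is_deriveZ.
  have D2 : is_derive x (1 : R) ((be / 2) \*: (@id R * @id R))
      ((be / 2) *: (x *: (1 : R) + x *: (1 : R))) by apply: is_deriveZ; exact: is_deriveM.
  have D3 := is_deriveB Kx (is_deriveD D1 D2).
  by apply: (is_derive_eq D3); rewrite /GRing.scale /=; field.
have [||c cab] := @MVT_segment R L (fun x => k x - (al + be * x)) a b ab.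
- move=> x; rewrite in_itv /= => /andP[x1 x2].
  by apply: Ld; rewrite !ltW.
- have : forall x, a <= x <= b -> {for x, continuous L}.
    by move=> x /Ld Lx; apply: differentiable_continuous; apply/derivable1_diffP; exact: ex_derive.
  move=> cL; apply/subspace_continuousP => x /=; rewrite in_itv /= => xab.
  exact: cvg_within_filter (cL _ xab).
move=> E.
have -> : K b - K a - al * (b - a) - be * (b ^+ 2 - a ^+ 2) / 2 = L b - L a.
  by rewrite /L; field.
rewrite E normrM (ger0_norm (x := b - a)) ?subr_ge0//.
by apply: ler_wpM2r; rewrite ?subr_ge0//; apply: H; rewrite in_itv in cab.
Qed.

Definition frechet (f : R -> R -> R) (x y a b : R) := forall e : R, 0 < e ->
  exists2 d : R, 0 < d & forall x' y', `|x' - x| < d -> `|y' - y| < d ->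
    `|f x' y' - f x y - a * (x' - x) - b * (y' - y)| <= e * (`|x' - x| + `|y' - y|).

(* Integral of P dx + Q dy along the boundary of [a, b] x [c, d], when A y and
   B x are antiderivatives of P( . , y) and Q(x, . ). *)
Definition rect_form (A B : R -> R -> R) a b c d : R :=
  (A c b - A c a) + (B b d - B b c) - (A d b - A d a) - (B a d - B a c).

Section Rectangles.
Variables (s : R) (P Q A B : R -> R -> R).
Hypothesis Ad : forall y x, `|x| < s -> is_derive x (1 : R) (A y) (P x y).
Hypothesis Bd : forall x y, `|y| < s -> is_derive y (1 : R) (B x) (Q x y).
(** The shared coefficient b is the closedness condition dP/dy = dQ/dx. The derivatives exist
    pointwise and are not assumed continuous, so Green's formula is out of reach. *)
Hypothesis closedPQ : forall x y, `|x| < s -> `|y| < s ->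
  exists a b c, frechet P x y a b /\ frechet Q x y b c.

Local Notation rect := (rect_form A B).

(** The affine parts of P and Q at (x, y) form a closed form and contribute nothing. The remainders
    are at most e (w + h), integrated over a boundary of length 2 (w + h). *)
Lemma rect_local x y e : `|x| < s -> `|y| < s -> 0 < e ->
  exists2 dl : R, 0 < dl & forall a w c h, 0 <= w < dl -> 0 <= h < dl ->
    `|a| < s -> `|a + w| < s -> `|c| < s -> `|c + h| < s ->
    a <= x <= a + w -> c <= y <= c + h ->
    `|rect a (a + w) c (c + h)| <= 2 * e * (w + h) ^+ 2.
Proof.
move=> xs ys e0; have [p [q [r [FP FQ]]]] := closedPQ xs ys.
have [d1 d10 H1] := FP _ e0; have [d2 d20 H2] := FQ _ e0.
exists (Num.min d1 d2) => [|a w c h]; first by rewrite lt_min d10.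
rewrite !lt_min => /andP[w0 /andP[w1 w2]] /andP[h0 /andP[h1 h2]].
move=> as1 as2 cs1 cs2 /andP[ax xa] /andP[cy yc].
have inx t : a <= t <= a + w -> `|t - x| <= w.
  by move=> /andP[t1 t2]; rewrite ler_norml; apply/andP; split; lra.
have iny t : c <= t <= c + h -> `|t - y| <= h.
  by move=> /andP[t1 t2]; rewrite ler_norml; apply/andP; split; lra.
have aw : a <= a + w by rewrite lerDl.
have ch : c <= c + h by rewrite lerDl.
have bP y' : c <= y' <= c + h ->
    `|A y' (a + w) - A y' a - (P x y - p * x + q * (y' - y)) * (a + w - a)
      - p * ((a + w) ^+ 2 - a ^+ 2) / 2| <= e * (w + h) * (a + w - a).
  move=> /iny yy; apply: (mvt_affine (Ad y')) => // t /inx tt.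
  have := H1 t y' (le_lt_trans tt w1) (le_lt_trans yy h1).
  have -> : P t y' - P x y - p * (t - x) - q * (y' - y) =
     P t y' - (P x y - p * x + q * (y' - y) + p * t) by ring.
  by move=> hh; rewrite (le_trans hh)// ler_pM2l// lerD.
have bQ x' : a <= x' <= a + w ->
    `|B x' (c + h) - B x' c - (Q x y - r * y + q * (x' - x)) * (c + h - c)
      - r * ((c + h) ^+ 2 - c ^+ 2) / 2| <= e * (w + h) * (c + h - c).
  move=> /inx yy; apply: (mvt_affine (Bd x')) => // t /iny tt.
  have := H2 x' t (le_lt_trans yy w2) (le_lt_trans tt h2).
  have -> : Q x' t - Q x y - q * (x' - x) - r * (t - y) =
     Q x' t - (Q x y - r * y + q * (x' - x) + r * t) by ring.
  by move=> h'; rewrite (le_trans h')// ler_pM2l// lerD.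
have := bP c; have := bP (c + h); have := bQ a; have := bQ (a + w).
rewrite !lexx !lerDl w0 h0 /= => /(_ isT) E1 /(_ isT) E2 /(_ isT) E3 /(_ isT) E4.
move: E1 E2 E3 E4; rewrite !ler_norml /rect_form.
move=> /andP[? ?] /andP[? ?] /andP[? ?] /andP[? ?]; apply/andP; split; nra.
Qed.

Lemma rect_split a w c h : rect a (a + w) c (c + h) =
  rect a (a + w / 2) c (c + h / 2) + rect (a + w / 2) (a + w) c (c + h / 2) +
  rect a (a + w / 2) (c + h / 2) (c + h) + rect (a + w / 2) (a + w) (c + h / 2) (c + h).
Proof. by rewrite /rect_form; ring. Qed.

(** Goursat's subdivision: if the integral had absolute value m > 0, repeated quartering would
    select nested rectangles with integrals at least m / 4 ^ n, more than [rect_local] permits near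
    their common point. *)
Lemma rect0 a w c h : 0 <= w -> 0 <= h ->
  `|a| < s -> `|a + w| < s -> `|c| < s -> `|c + h| < s ->
  rect a (a + w) c (c + h) = 0.
Proof.
move=> w0 h0 as1 as2 cs1 cs2; apply/eqP/negPn/negP; rewrite -normr_gt0.
set m := `| _ | => m0.
pose wn n := w / 2 ^+ n; pose hn n := h / 2 ^+ n.
have wn0 n : 0 <= wn n by rewrite divr_ge0// exprn_ge0.
have hn0 n : 0 <= hn n by rewrite divr_ge0// exprn_ge0.
have wnS n : wn n = wn n.+1 + wn n.+1 by rewrite /wn exprS; field; rewrite expf_neq0.
have hnS n : hn n = hn n.+1 + hn n.+1 by rewrite /hn exprS; field; rewrite expf_neq0.
pose good n (p : R * R) := m / 4 ^+ n <=
  `|rect p.1 (p.1 + wn n) p.2 (p.2 + hn n)|.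
have step n p : good n p -> {q | good n.+1 q &
    (p.1 <= q.1 /\ q.1 + wn n.+1 <= p.1 + wn n) /\
    (p.2 <= q.2 /\ q.2 + hn n.+1 <= p.2 + hn n)}.
  move=> gp; apply: cid2; apply: contrapT => nq.
  have sub i j : (i = 0 \/ i = 1) -> (j = 0 \/ j = 1) ->
     `|rect (p.1 + i * wn n.+1) (p.1 + i * wn n.+1 + wn n.+1)
            (p.2 + j * hn n.+1) (p.2 + j * hn n.+1 + hn n.+1)| < m / 4 ^+ n.+1.
    move=> hi hj; rewrite ltNge; apply/negP => h'; apply: nq.
    exists (p.1 + i * wn n.+1, p.2 + j * hn n.+1); first exact: h'.
    rewrite /= (wnS n) (hnS n); have := wn0 n.+1; have := hn0 n.+1.
    by case: hi hj => -> [] -> ? ?; split; split; lra.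
  move: gp; rewrite /good rect_split.
  have -> : wn n / 2 = wn n.+1 by rewrite (wnS n); field.
  have -> : hn n / 2 = hn n.+1 by rewrite (hnS n); field.
  apply/negP; rewrite -ltNge.
  have Ew : p.1 + wn n.+1 + wn n.+1 = p.1 + wn n by rewrite -addrA -(wnS n).
  have Eh : p.2 + hn n.+1 + hn n.+1 = p.2 + hn n by rewrite -addrA -(hnS n).
  have tri (x y z t u : R) : `|x| < u -> `|y| < u -> `|z| < u -> `|t| < u ->
      `|x + y + z + t| < u + u + (u + u).
    move=> xu yu zu tu; rewrite addrA.
    by do 3 (apply: (le_lt_trans (ler_normD _ _)); apply: ltrD => //).
  have -> : m / 4 ^+ n = m / 4 ^+ n.+1 + m / 4 ^+ n.+1 + (m / 4 ^+ n.+1 + m / 4 ^+ n.+1).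
    by rewrite exprS; field; rewrite expf_neq0.
  apply: tri.
  - by have := sub 0 0 (or_introl erefl) (or_introl erefl); rewrite !mul0r !addr0.
  - by have := sub 1 0 (or_intror erefl) (or_introl erefl); rewrite mul0r mul1r addr0 Ew.
  - by have := sub 0 1 (or_introl erefl) (or_intror erefl); rewrite mul0r mul1r addr0 Eh.
  - by have := sub 1 1 (or_intror erefl) (or_intror erefl); rewrite !mul1r Ew Eh.
have g0 : good 0%N (a, c) by rewrite /good /= /wn /hn !expr0 !divr1.
pose sq := fix sq n : {p | good n p} :=
  if n is n'.+1 then let: exist p gp := sq n' in
    exist _ (s2val (step n' p gp)) (s2valP (step n' p gp))
  else exist _ (a, c) g0.
pose p n := sval (sq n).
have pg n : good n (p n) := svalP (sq n).
have pS n : ((p n).1 <= (p n.+1).1 /\ (p n.+1).1 + wn n.+1 <= (p n).1 + wn n) /\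
    ((p n).2 <= (p n.+1).2 /\ (p n.+1).2 + hn n.+1 <= (p n).2 + hn n).
  rewrite /p [sq n.+1]/=; case: (sq n) => q gq; exact: (s2valP' (step n q gq)).
have w00 : wn 0%N = w by rewrite /wn expr0 divr1.
have h00 : hn 0%N = h by rewrite /hn expr0 divr1.
have mono (f g : nat -> R) : (forall n, f n <= f n.+1) -> (forall n, g n.+1 <= g n) ->
    (forall n, f n <= g n) -> exists x, forall n, f n <= x <= g n.
  move=> fi gd fg.
  have hs : has_sup (range f).
    split; first by exists (f 0%N), 0%N.
    exists (g 0%N) => _ [n _ <-]; apply: (le_trans (fg n)).
    by elim: n => // n IH; exact: le_trans (gd n) IH.
  have fm i j : (i <= j)%N -> f i <= f j.
    by move/subnK <-; elim: (j - i)%N => // d IH; rewrite addSn; exact: le_trans IH (fi _).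
  have gm i j : (i <= j)%N -> g j <= g i.
    by move/subnK <-; elim: (j - i)%N => // d IH; rewrite addSn; exact: le_trans (gd _) IH.
  exists (sup (range f)) => n; apply/andP; split.
    by apply: ub_le_sup; [case: hs | exists n].
  apply: ge_sup; first by case: hs.
  move=> _ [j _ <-]; have [nj|/ltnW jn] := leqP n j.
    by apply: (le_trans (fg j)); exact: gm.
  by apply: (le_trans (fm _ _ jn)); exact: fg.
have [x xp] := mono (fun n => (p n).1) (fun n => (p n).1 + wn n)
  (fun n => (pS n).1.1) (fun n => (pS n).1.2) (fun n => ltac:(by rewrite lerDl)).
have [y yp] := mono (fun n => (p n).2) (fun n => (p n).2 + hn n)
  (fun n => (pS n).2.1) (fun n => (pS n).2.2) (fun n => ltac:(by rewrite lerDl)).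
have ina n : a <= (p n).1 /\ (p n).1 + wn n <= a + w.
  elim: n => [|n [IH1 IH2]]; first by rewrite /p /= w00.
  by split; [exact: le_trans IH1 (pS n).1.1 | exact: le_trans (pS n).1.2 IH2].
have inc n : c <= (p n).2 /\ (p n).2 + hn n <= c + h.
  elim: n => [|n [IH1 IH2]]; first by rewrite /p /= h00.
  by split; [exact: le_trans IH1 (pS n).2.1 | exact: le_trans (pS n).2.2 IH2].
have ins t u v : `|u| < s -> `|v| < s -> u <= t <= v -> `|t| < s.
  rewrite !ltr_norml => /andP[A1 _] /andP[_ B2] /andP[x1 x2].
  by rewrite (lt_le_trans A1 x1) (le_lt_trans x2 B2).
have xs : `|x| < s by apply: (ins _ _ _ as1 as2); have := xp 0%N; rewrite /p /= w00.
have ys : `|y| < s by apply: (ins _ _ _ cs1 cs2); have := yp 0%N; rewrite /p /= h00.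
(* Chosen so that 2 * e * (w + h) ^+ 2 is at most m / 2; the term 1 only keeps the denominator
   positive. *)
pose e := m / (4 * ((w + h) ^+ 2 + 1)).
have e0 : 0 < e by rewrite divr_gt0// mulr_gt0// ltr_wpDl ?sqr_ge0.
have [dl dl0 H] := rect_local xs ys e0.
have [n nw nh] : exists2 n, wn n < dl & hn n < dl.
  have [N _ Nb] := nbhs_infty_ger ((w + h) / dl).
  have h1 : (w + h) <= N%:R * dl by rewrite -ler_pdivrMr//; exact: (Nb N (leqnn N)).
  have h2 : N%:R * dl < dl * 2 ^+ N.
    by rewrite mulrC ltr_pM2l// -natrX ltr_nat ltn_expl.
  have h3 := le_lt_trans h1 h2.
  by exists N; rewrite ltr_pdivrMr ?exprn_gt0// (le_lt_trans _ h3)// ?lerDl ?lerDr.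
have [a1 a2] := ina n; have [c1 c2] := inc n.
have := H (p n).1 (wn n) (p n).2 (hn n).
rewrite wn0 hn0 nw nh xp yp => /(_ isT isT).
move=> /(_ (ins _ _ _ as1 as2 _)) /(_ (ins _ _ _ as1 as2 _)).
move=> /(_ _ _ (ins _ _ _ cs1 cs2 _) (ins _ _ _ cs1 cs2 _) isT isT) H'.
have : m / 4 ^+ n <= 2 * e * (wn n + hn n) ^+ 2.
  have [W0 H0] := (wn0 n, hn0 n).
  apply: (le_trans (pg n)); apply: H'; apply/andP; split => //.
  - by rewrite (le_trans _ a2)// lerDl.
  - by rewrite (le_trans a1)// lerDl.
  - by rewrite (le_trans _ c2)// lerDl.
  - by rewrite (le_trans c1)// lerDl.
have -> : (wn n + hn n) ^+ 2 = (w + h) ^+ 2 / 4 ^+ n.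
  have -> : 4 ^+ n = (2 ^+ n) ^+ 2 :> R by rewrite -exprM mulnC exprM; congr (_ ^+ _); ring.
  by rewrite /wn /hn; field; rewrite expf_neq0.
rewrite mulrA ler_pM2r ?invr_gt0 ?exprn_gt0//.
have -> : 2 * e * (w + h) ^+ 2 = m / 2 * ((w + h) ^+ 2 / ((w + h) ^+ 2 + 1)).
  by rewrite /e; field; rewrite gt_eqF// ltr_wpDl ?sqr_ge0.
have : (w + h) ^+ 2 / ((w + h) ^+ 2 + 1) <= 1.
  by rewrite ler_pdivrMr ?ltr_wpDl ?sqr_ge0// mul1r lerDl.
have : 0 <= (w + h) ^+ 2 / ((w + h) ^+ 2 + 1).
  by rewrite divr_ge0 ?addr_ge0 ?sqr_ge0.
by move: m0; nra.
Qed.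

Lemma rect00 a b c d : `|a| < s -> `|b| < s -> `|c| < s -> `|d| < s ->
  rect a b c d = 0.
Proof.
have ord a' b' c' d' : a' <= b' -> c' <= d' ->
    `|a'| < s -> `|b'| < s -> `|c'| < s -> `|d'| < s -> rect a' b' c' d' = 0.
  move=> ab cd sa sb sc sd.
  have := @rect0 a' (b' - a') c' (d' - c').
  by rewrite ![_ + (_ - _)]addrC !subrK !subr_ge0; exact.
have swap1 a' b' c' d' : rect a' b' c' d' = - rect b' a' c' d'.
  by rewrite /rect_form; ring.
have swap2 a' b' c' d' : rect a' b' c' d' = - rect a' b' d' c'.
  by rewrite /rect_form; ring.
move=> sa sb sc sd.
have [ab|/ltW ba] := leP a b; have [cd|/ltW dc] := leP c d; first exact: ord.
- by rewrite swap2 ord// oppr0.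
- by rewrite swap1 ord// oppr0.
- by rewrite swap1 swap2 ord// !oppr0.
Qed.

Lemma frechet_cont (f : R -> R -> R) x y a b e : frechet f x y a b -> 0 < e ->
  exists2 d : R, 0 < d & forall x' y', `|x' - x| < d -> `|y' - y| < d ->
    `|f x' y' - f x y| <= e.
Proof.
move=> ff e0; have [d d0 H] := ff _ ltr01.
pose M := 2 * (1 + `|a| + `|b|).
have M0 : 0 < M by rewrite mulr_gt0// -addrA ltr_pwDl// addr_ge0.
exists (Num.min d (e / M)) => [|x' y']; first by rewrite lt_min d0 divr_gt0.
rewrite !lt_min => /andP[x1 x2] /andP[y1 y2]; have := H _ _ x1 y1.
rewrite mul1r => H'.
have E : f x' y' - f x y = (f x' y' - f x y - a * (x' - x) - b * (y' - y)) +
  a * (x' - x) + b * (y' - y) by ring.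
rewrite E (le_trans (ler_normD _ _))// (le_trans (lerD (ler_normD _ _) (lexx _)))//.
rewrite !normrM; rewrite ltr_pdivlMr// in x2; rewrite ltr_pdivlMr// in y2.
move: x2 y2 H'; rewrite /M.
move: (normr_ge0 a) (normr_ge0 b) (normr_ge0 (x' - x)) (normr_ge0 (y' - y)); nra.
Qed.

Lemma mvt_cst (k K : R -> R) a b al e :
  (forall x, `|x| < s -> is_derive x (1 : R) K (k x)) -> `|a| < s -> `|b| < s ->
  (forall t, `|t - a| <= `|b - a| -> `|k t - al| <= e) ->
  `|K b - K a - al * (b - a)| <= e * `|b - a|.
Proof.
move=> Kd sa sb H.
wlog ab : / a <= b.
  move=> W; have [/W //|ba] := leP a b.
  have := @mvt_affine s k K b a al 0 e Kd sb sa (ltW ba).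
  rewrite !mul0r subr0 => W'.
  have N : `|b - a| = a - b by rewrite ler0_norm ?opprB// subr_le0 ltW.
  rewrite N in H *; rewrite -normrN.
  have -> : - (K b - K a - al * (b - a)) = K a - K b - al * (a - b) by ring.
  apply: W' => t tb; rewrite mul0r addr0; apply: H.
  by rewrite ler0_norm ?subr_le0; move: tb ba; lra.
have := @mvt_affine s k K a b al 0 e Kd sa sb ab.
have N : `|b - a| = b - a by rewrite ger0_norm// subr_ge0.
rewrite N in H *; rewrite !mul0r subr0; apply => t tb.
rewrite mul0r addr0; apply: H.
by rewrite ger0_norm ?subr_ge0; move: tb; lra.
Qed.

Lemma potential : exists F : R -> R -> R, forall x y, `|x| < s -> `|y| < s ->
  frechet F x y (P x y) (Q x y).
Proof.
(* The integral along the horizontal axis and then vertically. The vanishing integral over the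
   rectangle [x0, x] x [0, y0] moves the horizontal increment up to height y0. *)
exists (fun x y => A 0 x - A 0 0 + B x y - B x 0) => x0 y0 xs ys e e0.
have s0 : `|0 : R| < s by rewrite normr0 (le_lt_trans _ xs).
have [a [b [c [FP FQ]]]] := closedPQ xs ys.
have [d1 d10 H1] := frechet_cont FP e0; have [d2 d20 H2] := frechet_cont FQ e0.
exists (Num.min (Num.min d1 d2) (Num.min (s - `|x0|) (s - `|y0|))).
  by rewrite !lt_min d10 d20 !subr_gt0 xs ys.
move=> x y; rewrite !lt_min => /andP[/andP[x1 x2] /andP[x3 _]] /andP[/andP[y1 y2] /andP[_ y3]].
have xs' : `|x| < s.
  by rewrite -(subrK x0 x) (le_lt_trans (ler_normD _ _))// -ltrBrDr.
have ys' : `|y| < s.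
  by rewrite -(subrK y0 y) (le_lt_trans (ler_normD _ _))// -ltrBrDr.
have := rect00 xs xs' s0 ys; rewrite /rect_form => E.
have -> : A 0 x - A 0 0 + B x y - B x 0 - (A 0 x0 - A 0 0 + B x0 y0 - B x0 0) -
    P x0 y0 * (x - x0) - Q x0 y0 * (y - y0) =
  (A y0 x - A y0 x0 - P x0 y0 * (x - x0)) + (B x y - B x y0 - Q x0 y0 * (y - y0)).
  by move: E; lra.
rewrite (le_trans (ler_normD _ _))// [leRHS]mulrDr; apply: lerD.
  apply: (mvt_cst (Ad y0)) => // t tx; apply: H1; first exact: le_lt_trans tx x1.
  by rewrite subrr normr0.
by apply: (mvt_cst (Bd x)) => // t ty; apply: H2 => //; exact: le_lt_trans ty y2.
Qed.
End Rectangles.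

Definition clamp (a b x : R) : R := Num.max a (Num.min b x).

Lemma clamp_id a b x : a <= x <= b -> clamp a b x = x.
Proof. by move=> /andP[h1 h2]; rewrite /clamp (min_idPr h2) (max_idPr h1). Qed.

Lemma clamp_itv a b x : a <= b -> a <= clamp a b x <= b.
Proof. by move=> ab; rewrite /clamp le_max lexx /= ge_max ab ge_min lexx. Qed.

Lemma clamp_continuous a b : continuous (clamp a b).
Proof.
move=> x; rewrite /clamp.
under eq_fun do rewrite maxr_absE minr_absE.
have mc : (b + y - `|b - y|) / 2 @[y --> x] --> (b + x - `|b - x|) / 2.
  apply: cvgMl; apply: cvgB; first by apply: cvgD; [exact: cvg_cst | exact: cvg_id].
  by apply: cvg_norm; apply: cvgB; [exact: cvg_cst | exact: cvg_id].
apply: cvgMl; apply: cvgD.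
  by apply: cvgD; [exact: cvg_cst | exact: mc].
by apply: cvg_norm; apply: cvgB; [exact: cvg_cst | exact: mc].
Qed.

(** Clamping both arguments to [-s, s] makes P and Q continuous along entire lines, as
    [antiderivative] asks, without changing them on the open square. The margin s < r keeps the
    clamped points in the domain. *)
Lemma goursat_potential (r s : R) (P Q : R -> R -> R) : 0 < s -> s < r ->
  (forall x y, `|x| < r -> `|y| < r ->
     exists a b c, frechet P x y a b /\ frechet Q x y b c) ->
  exists F : R -> R -> R, forall x y, `|x| < s -> `|y| < s ->
    frechet F x y (P x y) (Q x y).
Proof.
move=> s0 sr H.
pose cP x y := P (clamp (- s) s x) (clamp (- s) s y); pose cQ x y := Q (clamp (- s) s x) (clamp (- s) s y).
have ss : - s <= s by lra.
have cr x : `|clamp (- s) s x| < r by rewrite (le_lt_trans _ sr)// ler_norml clamp_itv.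
have cid x : `|x| < s -> clamp (- s) s x = x.
  by rewrite ltr_norml => /andP[x1 x2]; apply: clamp_id; rewrite !ltW.
have ceq (f : R -> R -> R) x y a b : `|x| < s -> `|y| < s -> frechet f x y a b ->
    frechet (fun x y => f (clamp (- s) s x) (clamp (- s) s y)) x y a b.
  move=> xs ys ff e e0; have [d d0 Hd] := ff _ e0.
  exists (Num.min d (Num.min (s - `|x|) (s - `|y|))).
    by rewrite !lt_min d0 !subr_gt0 xs ys.
  move=> x' y'; rewrite !lt_min => /and3P[x1 x2 _] /and3P[y1 _ y2].
  rewrite !cid//; first exact: Hd.
    by rewrite -(subrK y y') (le_lt_trans (ler_normD _ _))// -ltrBrDr.
  by rewrite -(subrK x x') (le_lt_trans (ler_normD _ _))// -ltrBrDr.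
have fc (f : R -> R -> R) x y a b : frechet f x y a b ->
    {for x, continuous (f ^~ y)} /\ {for y, continuous (f x)}.
  move=> ff; split; apply/cvgrPdist_le => e e0; have [d d0 Hd] := frechet_cont ff e0.
    near=> t; rewrite distrC; apply: Hd; last by rewrite subrr normr0.
    by rewrite distrC; near: t; apply: cvgr_dist_lt => //; exact: cvg_id.
  near=> t; rewrite distrC; apply: Hd; first by rewrite subrr normr0.
  by rewrite distrC; near: t; apply: cvgr_dist_lt => //; exact: cvg_id.
have cPc y : continuous (cP ^~ y).
  move=> x; have [a [b [c [FP _]]]] := H _ _ (cr x) (cr y).
  exact: (cvg_comp _ _ (@clamp_continuous (- s) s x) (fc _ _ _ _ _ FP).1).
have cQc x : continuous (cQ x).
  move=> y; have [a [b [c [_ FQ]]]] := H _ _ (cr x) (cr y).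
  exact: (cvg_comp _ _ (@clamp_continuous (- s) s y) (fc _ _ _ _ _ FQ).2).
have [F HF] := @potential s cP cQ (fun y => sval (antiderivative s (cPc y)))
  (fun x => sval (antiderivative s (cQc x)))
  (fun y => svalP (antiderivative s (cPc y)))
  (fun x => svalP (antiderivative s (cQc x)))
  ltac:(by move=> x y xs ys; have [a [b [c [FP FQ]]]] := H _ _ (lt_trans xs sr) (lt_trans ys sr);
    exists a, b, c; split; exact: ceq).
exists F => x y xs ys; have := HF x y xs ys.
by rewrite /cP /cQ !cid.
Unshelve. all: by end_near.
Qed.

End Goursat.

(** * Plane topology and complex derivatives *)

(** The form in which connectedness is used throughout: a property that is locally constant along A
    propagates from one point to all of A. *)
Lemma connected_clopen (T : topologicalType) (A S : set T) a :
  connected A -> A a -> S a ->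
  (forall x, A x -> S x -> \forall y \near x, A y -> S y) ->
  (forall x, A x -> ~ S x -> \forall y \near x, A y -> ~ S y) ->
  A `<=` S.
Proof.
move=> cA Aa Sa So Sc x Ax.
suff E : A `&` S = A by move: Ax; rewrite -E => -[].
apply: cA.
- by exists a.
- exists (interior [set z | A z -> S z]); first exact: open_interior.
  apply/seteqP; split=> y [Ay]; first by move=> Sy; split=> //; exact: So.
  by move=> /nbhs_singleton /(_ Ay).
- exists (~` interior [set z | A z -> ~ S z]); first by apply: open_closedC; exact: open_interior.
  apply/seteqP; split=> y [Ay Sy]; split=> //.
    by move=> /nbhs_singleton /(_ Ay).
  by apply: contrapT => nS; apply: Sy; exact: Sc.
Qed.

Lemma compact_finite_cover (T : topologicalType) (A : set T) (V : T -> set T) :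
  compact A -> (forall x, A x -> nbhs x (V x)) ->
  exists s : seq T, (forall x, x \in s -> A x) /\
    forall y, A y -> exists2 x, x \in s & V x y.
Proof.
move=> /compact_near_coveringP cA nV.
(* The filter of all sufficiently large finite families of points of A, to be fed to near-covering
   compactness. *)
pose F : set_system (seq T) := [set P : set (seq T) | exists s0 : seq T,
  (forall x, x \in s0 -> A x) /\
  forall s : seq T, (forall x, x \in s0 -> x \in s) -> (forall x, x \in s -> A x) -> P s].
have FF : Filter F.
  split; first by exists [::].
    move=> P Q [s [sA sP]] [t [tA tQ]]; exists (s ++ t); split.
      by move=> x; rewrite mem_cat => /orP[/sA|/tA].
    by move=> r rs rA; split; [apply: sP|apply: tQ] => // x xs; apply: rs;
      rewrite mem_cat xs ?orbT.
  by move=> P Q PQ [s [sA sP]]; exists s; split=> // t st tA; apply: PQ; exact: sP.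
pose P (s : seq T) (y : T) := exists2 x, x \in s & V x y.
have nF : F [set s | A `<=` P s].
  apply: (cA _ F P FF) => x Ax.
  exists (V x, [set s : seq T | x \in s]).
    split; first exact: nV.
    by exists [:: x]; split=> [y|s xs _]; [rewrite inE => /eqP->|apply: xs; rewrite inE].
  by move=> [y t] /= [Vy xt]; exists x.
have [s [sA sP]] := nF.
by exists s; split=> // y Ay; exact: (sP s (fun x => id) sA).
Qed.

Section PlaneTopology.
Context {R : realType}.
Local Notation C := (cplx R).
Implicit Types (z w : C) (F : C -> C).

Lemma toC_continuous : continuous (fun p : R * R => toC p.1 p.2 : C).
Proof.
move=> p; apply/cvg_cplx => e e0.
have e2 : 0 < e / 2 by rewrite divr_gt0.
near=> q; apply: (le_lt_trans (cabs_le _)).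
have h1 : `|q.1 - p.1| < e / 2.
  rewrite distrC; near: q.
  have : fst @ nbhs p --> p.1 by exact: cvg_fst.
  by move=> /cvgr_dist_lt; exact.
have h2 : `|q.2 - p.2| < e / 2.
  rewrite distrC; near: q.
  have : snd @ nbhs p --> p.2 by exact: cvg_snd.
  by move=> /cvgr_dist_lt; exact.
rewrite [reC _]/= [imC _]/=.
by move: h1 h2; lra.
Unshelve. all: by end_near. Qed.

Definition cball z (r : R) : set C := [set w | cabs (w - z) < r].

Lemma cball_nbhs z r : 0 < r -> nbhs z (cball z r).
Proof. by move=> r0; apply/nbhs_cplx; exists r. Qed.

Lemma cball_open z r : open (cball z r).
Proof.
move=> w /= wr; apply/nbhs_cplx; exists (r - cabs (w - z)); first by rewrite subr_gt0.
by move=> v vw; rewrite /cball /= (le_lt_trans (cabs_tri _ w _))// -ltrBrDr.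
Qed.

Lemma cabs_continuous : continuous (@cabs R).
Proof.
move=> z; apply/(@cvgrPdist_lt _ _ _ (nbhs z) (nbhs_filter z)) => e e0.
apply/nbhs_cplx; exists e => // w we.
apply: le_lt_trans we; rewrite ler_norml; apply/andP; split.
  by rewrite lerNl opprB lerBlDl -{1}(subrK z w) addrC cabsD.
by rewrite lerBlDl -{1}(subrK w z) -(cabsB z) addrC cabsD.
Qed.

Lemma compact_cdisc (r : R) : compact [set z : C | cabs z <= r].
Proof.
apply: (@subclosed_compact _ _ ((fun p : R * R => toC p.1 p.2 : C) @` (`[- r, r] `*` `[- r, r]))).
- have -> : [set z : C | cabs z <= r] = @cabs R @^-1` [set x | x <= r] by [].
  by apply: closed_comp; [move=> *; exact: cabs_continuous | exact: closed_le].
- apply: continuous_compact.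
    by apply: continuous_subspaceT; exact: toC_continuous.
  by apply: compact_setX; exact: segment_compact.
- move=> z /= zr; exists (reC z, imC z); last by rewrite /= -cplxE.
  rewrite /= !in_itv /= -!ler_norml.
  by rewrite (le_trans (cabs_re _)) ?(le_trans (cabs_im _)).
Qed.

Definition cline z w (t : R) : C := z + toC t 0 * (w - z).

Lemma cline0 z w : cline z w 0 = z.
Proof. by rewrite /cline mul0r addr0. Qed.

Lemma cline1 z w : cline z w 1 = w.
Proof. by rewrite /cline mul1r addrC subrK. Qed.

Lemma cline_dist z w s t : cabs (cline z w s - cline z w t) = `|s - t| * cabs (w - z).
Proof.
have -> : cline z w s - cline z w t = toC (s - t) 0 * (w - z).
  rewrite /cline.
  have -> : toC (s - t) 0 = toC s 0 - toC t 0 :> C by congr Complex; rewrite /= ?subr0.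
  by ring.
by rewrite cabsM cabs_toC.
Qed.

Lemma cline_continuous z w : continuous (cline z w).
Proof.
move=> t; apply/cvg_cplx => e e0; have c0 := cabs_ge0 (w - z).
have e1 : 0 < e / (cabs (w - z) + 1) by rewrite divr_gt0// ltr_wpDl.
near=> s; rewrite cline_dist.
have : `|s - t| < e / (cabs (w - z) + 1).
  by rewrite distrC; near: s; apply: cvgr_dist_lt => //; exact: cvg_id.
rewrite ltr_pdivlMr ?ltr_wpDl// => h; apply: le_lt_trans h.
by rewrite ler_wpM2l// lerDl.
Unshelve. all: by end_near. Qed.

Definition convex_cset (A : set C) := forall z w t, A z -> A w -> 0 <= t <= 1 -> A (cline z w t).

Lemma convex_connected (A : set C) : convex_cset A -> connected A.
Proof.
move=> cA; have [[z Az]|] := pselect (exists z, A z); last first.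
  move=> /forallNP n0; suff -> : A = set0 by exact: connected0.
  by apply/seteqP; split=> x // /n0.
have -> : A = \bigcup_(w in A) (cline z w @` `[0, 1]).
  apply/seteqP; split=> w.
    by move=> Aw; exists w => //; exists 1; rewrite ?cline1//= in_itv /= ler01 lexx.
  by move=> [v Av [t]]; rewrite /= in_itv /= => t01 <-; exact: cA.
apply: bigcup_connected.
  by exists z => w Aw; exists 0; rewrite ?cline0//= in_itv /= lexx ler01.
move=> w Aw; apply: connected_continuous_connected; first exact: segment_connected.
by apply: continuous_subspaceT; exact: cline_continuous.
Qed.

Lemma cline_re z w t : reC (cline z w t) = (1 - t) * reC z + t * reC w.
Proof. by case: z w => [a b] [c d] /=; rewrite mul0r subr0; ring. Qed.

Lemma cline_im z w t : imC (cline z w t) = (1 - t) * imC z + t * imC w.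
Proof. by case: z w => [a b] [c d] /=; rewrite mul0r addr0; ring. Qed.

Lemma cball_convex z r : convex_cset (cball z r).
Proof.
move=> v w t vr wr /andP[t0 t1]; rewrite /cball /=.
have -> : cline v w t - z = toC (1 - t) 0 * (v - z) + toC t 0 * (w - z).
  have -> : toC (1 - t) 0 = 1 - toC t 0 :> C by congr Complex; rewrite /= ?subr0.
  by rewrite /cline; ring.
rewrite (le_lt_trans (cabsD _ _))// !cabsM !cabs_toC !ger0_norm ?subr_ge0//.
move: vr wr; rewrite /cball /=.
have [->|t1'] := eqVneq t 1; first by rewrite subrr mul0r add0r mul1r.
have : 0 < 1 - t by rewrite subr_gt0 lt_neqAle t1' t1.
move=> u0 vr wr; have := ltr_pM2l u0 (cabs (v - z)) r; rewrite vr => h.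
have := ler_wpM2l t0 (ltW wr); move: h; lra.
Qed.

Lemma cball_connected z r : connected (cball z r).
Proof. by apply: convex_connected; exact: cball_convex. Qed.

(** Four open half-discs, bounded by the two axes, cover the punctured disc; they are convex and
    overlap along a chain. *)
Lemma punctured_connected r : connected (cball 0 r `\ (0 : C)).
Proof.
have [r0|r0] := leP r 0.
  suff -> : cball 0 r `\ (0 : C) = set0 by exact: connected0.
  apply/seteqP; split=> z // [].
  by rewrite /cball /= subr0 ltNge (le_trans r0)// cabs_ge0.
have half (P : C -> R) : (forall z w t, P (cline z w t) = (1 - t) * P z + t * P w) ->
    connected (cball 0 r `&` [set z | 0 < P z]).
  move=> PA; apply: convex_connected => z w t [zr Pz] [wr Pw] t01; split.
    exact: cball_convex.
  rewrite /= PA; move: t01 Pz Pw => /= /andP[t0 t1] Pz Pw.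
  have [->|t1'] := eqVneq t 1; first by rewrite subrr mul0r add0r mul1r.
  by rewrite ltr_pwDl ?mulr_gt0 ?mulr_ge0 ?(ltW Pw)// subr_gt0 lt_neqAle t1' t1.
pose H1 := cball (0 : C) r `&` [set z | 0 < reC z].
pose H2 := cball (0 : C) r `&` [set z | 0 < imC z].
pose H3 := cball (0 : C) r `&` [set z | 0 < - reC z].
pose H4 := cball (0 : C) r `&` [set z | 0 < - imC z].
have -> : cball 0 r `\ (0 : C) = (H1 `|` H2) `|` (H3 `|` H4).
  apply/seteqP; split=> z.
    move=> [zr /eqP]; rewrite (cplxE z) toC_eq0 negb_and /H1 /H2 /H3 /H4 /= -(cplxE z).
    by rewrite !oppr_gt0; case: (ltgtP (reC z) 0); case: (ltgtP (imC z) 0) => //= *; tauto.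
  move=> [[]|[]] [zr /= P0]; split=> // z0; move: P0; rewrite z0 /= ?oppr0 ltxx//.
have pt a b : `|a| < r / 2 -> `|b| < r / 2 -> cball 0 r (toC a b).
  move=> ha hb; rewrite /cball /= subr0 (le_lt_trans (cabs_le _))//=; move: ha hb; lra.
have q0 : 0 < r / 4 by rewrite divr_gt0.
have q1 : `|r / 4| < r / 2 by rewrite gtr0_norm//; lra.
have q2 : `|- (r / 4)| < r / 2 by rewrite normrN.
apply: connectedU; last 2 first.
- apply: connectedU; [|apply: half => *; exact: cline_re|apply: half => *; exact: cline_im].
  by exists (toC (r / 4) (r / 4)); split; split => //=; exact: pt.
- apply: connectedU; [|apply: half => *; rewrite cline_re; ring|apply: half => *; rewrite cline_im; ring].
  by exists (toC (- (r / 4)) (- (r / 4))); split; split => /=; rewrite ?opprK//; exact: pt.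
exists (toC (r / 4) (- (r / 4))); split; [left|right]; split => /=; rewrite ?opprK//; exact: pt.
Qed.

End PlaneTopology.

(** * Complex derivatives and primitives *)

Section ComplexDerivative.
Context {R : realType}.
Local Notation C := (cplx R).
Implicit Types (z w l : C) (F h : C -> C).

Definition cderiv F z l := forall e : R, 0 < e -> exists2 d : R, 0 < d &
  forall w, cabs (w - z) < d -> cabs (F w - F z - l * (w - z)) <= e * cabs (w - z).

Lemma cderiv_cont F z l e : cderiv F z l -> 0 < e -> exists2 d : R, 0 < d &
  forall w, cabs (w - z) < d -> cabs (F w - F z) < e.
Proof.
move=> Fl e0; have [d d0 H] := Fl _ ltr01.
have l0 := cabs_ge0 l.
have m0 : 0 < e / (2 + cabs l) by rewrite divr_gt0// ltr_wpDr.
exists (Num.min d (e / (2 + cabs l))) => [|w]; first by rewrite lt_min d0.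
rewrite lt_min => /andP[/H h1 h2].
rewrite -(subrK (l * (w - z)) (F w - F z)) (le_lt_trans (cabsD _ _))// cabsM.
move: h2; rewrite ltr_pdivlMr; last by rewrite ltr_wpDr.
by have := cabs_ge0 (w - z); move: h1; nra.
Qed.

Lemma continuous_cplxP F z : {for z, continuous F} <->
  forall e : R, 0 < e -> exists2 d : R, 0 < d &
    forall w, cabs (w - z) < d -> cabs (F w - F z) < e.
Proof.
split=> [/(@cvg_cplx _ _ _ (nbhs_filter z)) H e /H /nbhs_cplx//|H].
by apply/(@cvg_cplx _ _ _ (nbhs_filter z)) => e /H Hd; apply/nbhs_cplx.
Qed.

Lemma cderiv_continuous F z l : cderiv F z l -> {for z, continuous F}.
Proof.
by move=> Fl; apply/continuous_cplxP => e; exact: (cderiv_cont Fl).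
Qed.

Lemma cderivB F h z l m : cderiv F z l -> cderiv h z m ->
  cderiv (fun w => F w - h w) z (l - m).
Proof.
move=> Fl hm e e0; have e2 : 0 < e / 2 by rewrite divr_gt0.
have [d d0 H] := Fl _ e2; have [d' d'0 H'] := hm _ e2.
exists (Num.min d d') => [|w]; first by rewrite lt_min d0.
rewrite lt_min => /andP[/H a /H' b].
have -> : F w - h w - (F z - h z) - (l - m) * (w - z) =
  (F w - F z - l * (w - z)) + - (h w - h z - m * (w - z)) by ring.
by rewrite (le_trans (cabsD _ _))// cabsN; move: a b; lra.
Qed.

Lemma cderiv_ext F h z l : (\forall w \near z, F w = h w) -> cderiv F z l -> cderiv h z l.
Proof.
move=> /nbhs_cplx[d d0 E] Fl e e0; have [d' d'0 H] := Fl _ e0.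
exists (Num.min d d') => [|w]; first by rewrite lt_min d0.
rewrite lt_min => /andP[wd /H]; rewrite !E//.
by rewrite subrr cabs0.
Qed.

(** A substitute for the open mapping theorem: moving z by t eta / l moves F by t eta up to half of
    its size, so a value of F at a non-critical point can be improved towards any target. *)
Lemma cderiv_dir F z l (eta : C) (d : R) : cderiv F z l -> l != 0 -> eta != 0 -> 0 < d ->
  exists w t, [/\ 0 < t < 1, cabs (w - z) < d &
    cabs (F w - F z - toC t 0 * eta) <= t * cabs eta / 2].
Proof.
move=> Fl l0 eta0 d0.
have cl : 0 < cabs l by rewrite cabs_gt0.
have ce : 0 < cabs eta by rewrite cabs_gt0.
have [d' d'0 H] := Fl (cabs l / 2) ltac:(by rewrite divr_gt0).
pose m := Num.min d d'.
have m0 : 0 < m by rewrite lt_min d0.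
pose t := Num.min (1 / 2) (m * cabs l / cabs eta / 2).
have t0 : 0 < t by rewrite lt_min !divr_gt0// mulr_gt0.
have t1 : t < 1 by rewrite gt_min ltr_pdivrMr// mul1r ltr1n.
exists (z + toC t 0 * eta / l), t.
have E : z + toC t 0 * eta / l - z = toC t 0 * eta / l by rewrite addrC addKr.
have E2 : cabs (toC t 0 * eta / l) = t * cabs eta / cabs l.
  by rewrite !cabsM cabsV cabs_toC gtr0_norm.
have lt : t * cabs eta / cabs l < m.
  have : t <= m * cabs l / cabs eta / 2 by rewrite ge_min lexx orbT.
  rewrite ler_pdivlMr// ler_pdivlMr// => h.
  rewrite ltr_pdivrMr//.
  have : 0 < m * cabs l by rewrite mulr_gt0.
  have : 0 < t * cabs eta by rewrite mulr_gt0.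
  move: h; lra.
split; first by rewrite t0 t1.
  by rewrite E E2 (lt_le_trans lt)// /m ge_min lexx.
have := H (z + toC t 0 * eta / l); rewrite E E2.
have -> : l * (toC t 0 * eta / l) = toC t 0 * eta by field.
have ltd : t * cabs eta / cabs l < d' by rewrite (lt_le_trans lt)// ge_min lexx orbT.
move=> /(_ ltd) hh; apply: (le_trans hh).
rewrite le_eqVlt; apply/orP; left; apply/eqP; field; by rewrite gt_eqF.
Qed.

Lemma cderiv_isolated F z l : cderiv F z l -> l != 0 ->
  exists2 d : R, 0 < d & forall w, cabs (w - z) < d -> F w = F z -> w = z.
Proof.
move=> Fl l0; have cl : 0 < cabs l by rewrite cabs_gt0.
have [d d0 H] := Fl (cabs l / 2) ltac:(by rewrite divr_gt0).
exists d => // w /H + E; rewrite E subrr add0r cabsN cabsM => h.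
apply/eqP; rewrite -subr_eq0 -cabs_eq0; apply/eqP/le_anti; rewrite cabs_ge0 andbT.
by rewrite -(pmulr_rle0 _ cl); have := mulr_ge0 (ltW cl) (cabs_ge0 (w - z)); move: h; lra.
Qed.

Lemma real_deriv (f : R -> R) (t a : R) :
  (forall e : R, 0 < e -> exists2 d : R, 0 < d & forall s, `|s - t| < d ->
    `|f s - f t - a * (s - t)| <= e * `|s - t|) ->
  is_derive t (1 : R) f a.
Proof.
move=> H.
have L : h^-1 *: (f (h *: (1 : R) + t) - f t) @[h --> 0^'] --> a.
  apply/cvgrPdist_le => e e0; have [d d0 Hd] := H _ e0.
  have dn : (0 : R)^' [set h | `|h| < d].
    have : nbhs (0 : R) [set h : R | `|h| < d].
      by apply: filterS (nbhsx_ballx (0 : R) d d0) => h; rewrite /ball /= sub0r normrN.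
    exact: nbhs_dnbhs.
  have n0 : (0 : R)^' [set h | h != 0] by exact: withinT.
  apply: filterS2 dn n0 => h hd h0.
  have := Hd (h *: (1 : R) + t); rewrite {1}/GRing.scale /= mulr1 addrK => /(_ hd).
  rewrite /GRing.scale /= mulr1 addrK => K.
  have hp : 0 < `|h| by rewrite normr_gt0.
  rewrite -(ler_pM2r hp) -normrM.
  suff -> : (a - h^-1 * (f (h + t) - f t)) * h = - (f (h + t) - f t - a * h).
    by rewrite normrN.
  by field.
by apply: DeriveDef; [apply/cvg_ex; exists a | apply/cvg_lim].
Qed.

Lemma reC_mulJ z : reC (z * toC (reC z) (- imC z)) = cabs z ^+ 2.
Proof. by rewrite cabs2; case: z => a b /=; ring. Qed.

Lemma reCB z w : reC (z - w) = reC z - reC w.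
Proof. by case: z w => [a b] [c d]. Qed.

Lemma reC_toCM (t : R) z : reC (toC t 0 * z) = t * reC z.
Proof. by case: z => a b /=; rewrite mul0r subr0. Qed.

Lemma imCB z w : imC (z - w) = imC z - imC w.
Proof. by case: z w => [a b] [c d]. Qed.

Lemma reCM z w : reC (z * w) = reC z * reC w - imC z * imC w.
Proof. by case: z w => [a b] [c d]. Qed.

Lemma imCM z w : imC (z * w) = reC z * imC w + imC z * reC w.
Proof. by case: z w => [a b] [c d]. Qed.

Lemma mean_value F h z0 r a M : (forall z, cball z0 r z -> cderiv F z (h z)) ->
  (forall z, cball z0 r z -> cabs (h z - a) <= M) ->
  forall z w, cball z0 r z -> cball z0 r w ->
  cabs (F w - F z - a * (w - z)) <= M * cabs (w - z).
Proof.
move=> Fd hM z w zB wB.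
set c := F w - F z - a * (w - z).
have [c0|c0] := eqVneq (cabs c) 0.
  by rewrite c0 mulr_ge0 ?cabs_ge0// (le_trans _ (hM _ zB))// cabs_ge0.
have cp : 0 < cabs c by rewrite lt_def c0 cabs_ge0.
(* Multiplication by the conjugate of the total error c reduces the claim to the real mean value
   theorem: the real part of c times j is the square of [cabs c]. *)
pose j := toC (reC c) (- imC c).
have cj : cabs j = cabs c by rewrite /cabs /= sqrrN.
pose G t := F (cline z w t) - F z - a * (cline z w t - z).
have inB (t : R) : 0 <= t <= 1 -> cball z0 r (cline z w t) by exact: cball_convex.
pose f t := reC (G t * j); pose f' t := reC ((h (cline z w t) - a) * (w - z) * j).
have fd (t : R) : 0 <= t <= 1 -> is_derive t (1 : R) f (f' t).
  move=> t01; apply: real_deriv => e e0.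
  pose D := cabs (w - z) * cabs c + 1.
  have D0 : 0 < D by rewrite ltr_wpDl// mulr_ge0 ?cabs_ge0.
  have [d d0 H] := Fd _ (inB _ t01) _ (divr_gt0 e0 D0).
  have D1 : 0 < d / (cabs (w - z) + 1) by rewrite divr_gt0// ltr_wpDl ?cabs_ge0.
  exists (d / (cabs (w - z) + 1)) => // s.
  rewrite ltr_pdivlMr ?ltr_wpDl ?cabs_ge0// => st.
  have ds : cabs (cline z w s - cline z w t) < d.
    by rewrite cline_dist (le_lt_trans _ st)// ler_wpM2l// lerDl.
  have := H _ ds.
  have stE : cline z w s - cline z w t = toC (s - t) 0 * (w - z).
    have -> : toC (s - t) 0 = toC s 0 - toC t 0 :> C by congr Complex; rewrite /= ?subr0.
    by rewrite /cline; ring.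
  have -> : f s - f t - f' t * (s - t) =
    reC ((F (cline z w s) - F (cline z w t) - h (cline z w t) * (cline z w s - cline z w t)) * j).
    rewrite /f /f' [_ * (s - t)]mulrC -reC_toCM -!reCB /G; congr reC.
    have -> : cline z w s - z = (cline z w t - z) + (cline z w s - cline z w t) by ring.
    by rewrite stE; ring.
  move=> K; rewrite (le_trans (cabs_re _))// cabsM cj.
  rewrite (le_trans (ler_wpM2r (cabs_ge0 c) K))// cline_dist.
  have -> : e / D * (`|s - t| * cabs (w - z)) * cabs c =
      e * `|s - t| * (cabs (w - z) * cabs c / D) by field; rewrite gt_eqF.
  rewrite -[leRHS]mulr1 ler_wpM2l ?mulr_ge0// ?(ltW e0)//.
  by rewrite ler_pdivrMr// mul1r /D lerDl.
have [||x x01] := @MVT_segment R f f' 0 1 ler01.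
- by move=> x; rewrite in_itv /= => /andP[x0 x1]; apply: fd; rewrite !ltW.
- apply/subspace_continuousP => x /=; rewrite in_itv /= => x01.
  apply: cvg_within_filter; apply: (@differentiable_continuous R R^o R^o).
  by apply/derivable1_diffP; have D := fd _ x01; exact: ex_derive.
rewrite subr0 mulr1 /f /G cline0 cline1 !subrr mulr0 subr0 mul0r [reC 0]/= subr0.
rewrite -/c reC_mulJ => E.
have : cabs c ^+ 2 <= M * cabs (w - z) * cabs c.
  rewrite E /f' (le_trans (ler_norm _))// (le_trans (cabs_re _))// !cabsM cj.
  rewrite ler_wpM2r ?cabs_ge0// ler_wpM2r ?cabs_ge0//.
  by apply: hM; apply: inB; rewrite in_itv in x01.
by rewrite expr2 ler_pM2r.
Qed.

Lemma cderiv0_cst F z0 r : (forall z, cball z0 r z -> cderiv F z 0) ->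
  forall z w, cball z0 r z -> cball z0 r w -> F z = F w.
Proof.
move=> Fd z w zB wB.
have := @mean_value F (cst 0) z0 r 0 0 Fd _ z w zB wB.
rewrite !mul0r subr0 => /(_ _) H; apply/esym/eqP; rewrite -subr_eq0 -cabs_eq0.
by apply/eqP/le_anti; rewrite cabs_ge0 andbT; apply: H => y _; rewrite /cst subrr cabs0.
Qed.

Lemma cderiv_local_inj F h z r : 0 < r -> (forall w, cball z r w -> cderiv F w (h w)) ->
  {for z, continuous h} -> h z != 0 ->
  exists2 d : R, 0 < d & d <= r /\ forall u v, cball z d u -> cball z d v ->
    cabs (h z) / 2 * cabs (u - v) <= cabs (F u - F v).
Proof.
move=> r0 Fd hc hz; have ch : 0 < cabs (h z) by rewrite cabs_gt0.
have [d d0 H] := (continuous_cplxP _ _).1 hc (cabs (h z) / 2) ltac:(by rewrite divr_gt0).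
pose m := Num.min d r; exists m; first by rewrite lt_min d0.
have mr : m <= r by rewrite ge_min lexx orbT.
have md : m <= d by rewrite ge_min lexx.
split=> // u v uB vB.
have := @mean_value F h z m (h z) (cabs (h z) / 2) _ _ v u vB uB.
move=> /(_ _ _) K; have {}K : cabs (F u - F v - h z * (u - v)) <= cabs (h z) / 2 * cabs (u - v).
  apply: K => w wB; first by apply: Fd; apply: lt_le_trans mr.
  by apply/ltW/H; apply: lt_le_trans md.
have : cabs (h z * (u - v)) <= cabs (F u - F v) + cabs (F u - F v - h z * (u - v)).
  by rewrite -{1}(subKr (F u - F v) (h z * (u - v))) (le_trans (cabsD _ _))// cabsN.
by rewrite cabsM; move: K; lra.
Qed.

(** With h = u + i v, the Cauchy-Riemann equations make u dx - v dy and v dx + u dy closed, and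
    their potentials are the two parts of the primitive. The square of half-side r / 2 lies in the
    disc, and [goursat_potential] needs a margin, hence r / 3. *)
Lemma cderiv_primitive h r : 0 < r ->
  (forall z, cball 0 r z -> exists l, cderiv h z l) ->
  exists F, forall z, cball 0 (r / 3) z -> cderiv F z (h z).
Proof.
move=> r0 hd.
pose u x y := reC (h (toC x y)); pose v x y := imC (h (toC x y)).
have dist (x y x' y' : R) : cabs (toC x' y' - toC x y) <= `|x' - x| + `|y' - y|.
  exact: cabs_le.
have fr (x y : R) : `|x| < r / 2 -> `|y| < r / 2 -> exists a b,
    frechet u x y a (- b) /\ frechet v x y b a.
  move=> xr yr; have [l hl] := hd (toC x y) ltac:(by rewrite /cball /= subr0;
    rewrite (le_lt_trans (cabs_le _))//=; move: xr yr; lra).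
  exists (reC l), (imC l).
  have K e : 0 < e -> exists2 d : R, 0 < d & forall x' y', `|x' - x| < d -> `|y' - y| < d ->
      cabs (h (toC x' y') - h (toC x y) - l * (toC x' y' - toC x y)) <=
      e * (`|x' - x| + `|y' - y|).
    move=> e0; have [d d0 H] := hl _ e0; exists (d / 2); first by rewrite divr_gt0.
    move=> x' y' xd yd; apply: (le_trans (H _ _)).
      by rewrite (le_lt_trans (dist _ _ _ _))//; move: xd yd; lra.
    by rewrite ler_wpM2l ?(ltW e0).
  split=> e e0; have [d d0 H] := K _ e0; exists d => // x' y' xd yd;
    apply: le_trans (H _ _ xd yd).
    apply: le_trans (cabs_re _); rewrite /u.
    case: (h _) (h _) (l) => [a b] [c d'] [p q] /=.
    by rewrite le_eqVlt; apply/orP; left; apply/eqP; congr `| _ |; ring.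
  apply: le_trans (cabs_im _); rewrite /v.
  case: (h _) (h _) (l) => [a b] [c d'] [p q] /=.
  by rewrite le_eqVlt; apply/orP; left; apply/eqP; congr `| _ |; ring.
have frN (f : R -> R -> R) x y a b : frechet f x y a b ->
    frechet (fun x y => - f x y) x y (- a) (- b).
  move=> ff e e0; have [d d0 H] := ff _ e0; exists d => // x' y' xd yd.
  rewrite (le_trans _ (H _ _ xd yd))// -normrN le_eqVlt; apply/orP; left; apply/eqP.
  by congr `| _ |; ring.
have r32 : r / 3 < r / 2 by lra.
have r3 : 0 < r / 3 by rewrite divr_gt0.
have [U HU] := @goursat_potential R _ _ u (fun x y => - v x y) r3 r32
  ltac:(by move=> x y xr yr; have [a [b [Hu Hv]]] := fr _ _ xr yr;
    exists a, (- b), (- a); split => //; exact: frN).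
have [V HV] := @goursat_potential R _ _ v u r3 r32
  ltac:(by move=> x y xr yr; have [a [b [Hu Hv]]] := fr _ _ xr yr;
    exists b, a, (- b); split).
exists (fun z => toC (U (reC z) (imC z)) (V (reC z) (imC z))) => z.
rewrite /cball /= subr0 => zr e e0.
have xs : `|reC z| < r / 3 := le_lt_trans (cabs_re _) zr.
have ys : `|imC z| < r / 3 := le_lt_trans (cabs_im _) zr.
have e4 : 0 < e / 4 by rewrite divr_gt0.
have [d1 d10 H1] := HU _ _ xs ys _ e4; have [d2 d20 H2] := HV _ _ xs ys _ e4.
exists (Num.min d1 d2) => [|w]; first by rewrite lt_min d10.
rewrite lt_min => /andP[w1 w2].
have rew : `|reC w - reC z| <= cabs (w - z) by rewrite -reCB; exact: cabs_re.
have imw : `|imC w - imC z| <= cabs (w - z).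
  have -> : imC w - imC z = imC (w - z) by case: (w) (z) => [a b] [c d].
  exact: cabs_im.
have := H1 _ _ (le_lt_trans rew w1) (le_lt_trans imw w1).
have := H2 _ _ (le_lt_trans rew w2) (le_lt_trans imw w2).
move=> K2 K1; apply: (le_trans (cabs_le _)).
rewrite !reCB !imCB reCM imCM ![reC (toC _ _)]/= ![imC (toC _ _)]/=.
move: K1 K2; rewrite /u /v -(cplxE z).
set A1 := (X in `|X| <= _ -> _); set A2 := (X in _ -> `|X| <= _ -> _) => K1 K2.
set B1 := (X in `|X| + _ <= _); set B2 := (X in _ + `|X| <= _).
have -> : B1 = A1 by rewrite /B1 /A1; ring.
have -> : B2 = A2 by rewrite /B2 /A2; ring.
have := ler_wpM2l (ltW e4) rew; have := ler_wpM2l (ltW e4) imw.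
by move: K1 K2; rewrite !mulrDr; lra.
Qed.

End ComplexDerivative.

(** * Disc models of translation surfaces *)

Section DiscModels.
Context {R : realType}.
Local Notation C := (cplx R).

Lemma diff_wrtP (X : topologicalType) (c : form_chart R X) x g l :
  diff_wrt c x g l <-> forall e : R, 0 < e -> \forall y \near x, y != x ->
    cabs ((g y - g x) / (coord c y - coord c x) - l) < e.
Proof.
rewrite /diff_wrt; split=> [/cvg_cplx H e /H|H].
  by rewrite near_withinE.
by apply/cvg_cplx => e /H; rewrite near_withinE.
Qed.

Definition prim_at (S : surface R) (x : S) (zeta : S -> C) :=
  forall c : form_chart R S, atlas c -> dom c x -> diff_wrt c x zeta (coef c x).

(* kap parametrizes a neighbourhood of x by a disc centred at 0, and h dz is the
   1-form in this parameter. *)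
Record disc_model (S : surface R) (x : S) (r : R) (kap : C -> S) (h : C -> C) : Prop := {
  dm_gt0 : 0 < r;
  dm_0 : kap 0 = x;
  dm_cont : forall z, cball 0 r z -> {for z, continuous kap};
  dm_inj : forall z w, cball 0 r z -> cball 0 r w -> kap z = kap w -> z = w;
  dm_open : forall O, open O -> O `<=` cball 0 r -> open (kap @` O);
  dm_holo : forall z, cball 0 r z -> exists l, cderiv h z l;
  dm_reg : forall z, cball 0 r z -> z != 0 -> ~ sing (kap z) /\ h z != 0;
  dm_sing : ~ sing x -> h 0 != 0;
  dm_prim : forall zeta z, cball 0 r z ->
    (prim_at (kap z) zeta <-> cderiv (zeta \o kap) z (h z)) }.

(** Possessed by compact translation surfaces and by their possibly infinite covers; local results
    are derived from it alone so as to hold on both. *)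
Definition locally_modelled (S : surface R) :=
  forall x : S, exists r kap h, disc_model x r kap h.

Lemma cball_sub (z : C) r r' : r' <= r -> cball z r' `<=` cball z r.
Proof. by move=> rr w; rewrite /cball /= => /lt_le_trans; apply. Qed.

Lemma cball_center (z : C) (r : R) : 0 < r -> cball z r z.
Proof. by rewrite /cball /= subrr cabs0. Qed.

Lemma disc_shrink (S : surface R) (x : S) r kap h r' : disc_model x r kap h ->
  0 < r' -> r' <= r -> disc_model x r' kap h.
Proof.
move=> M r'0 r'r; have sub := @cball_sub 0 _ _ r'r.
split => //.
- exact: dm_0 M.
- by move=> z /sub; exact: (dm_cont M).
- by move=> z w /sub zB /sub; exact: (dm_inj M).
- by move=> O Oo OB; apply: (dm_open M) => // z /OB /sub.
- by move=> z /sub; exact: (dm_holo M).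
- by move=> z /sub; exact: (dm_reg M).
- exact: (dm_sing M).
- by move=> zeta z /sub; exact: (dm_prim M).
Qed.

Lemma disc_shrink_in (S : surface R) (x : S) r kap h (D : set S) :
  disc_model x r kap h -> nbhs x D ->
  exists r', [/\ 0 < r', r' <= r & forall z, cball 0 r' z -> D (kap z)].
Proof.
move=> M nD; have r0 := dm_gt0 M.
have /nbhs_cplx[d d0 H] : nbhs (0 : C) (kap @^-1` D).
  by apply: (dm_cont M (cball_center 0 r0)); rewrite (dm_0 M).
exists (Num.min d r); split; rewrite ?lt_min ?d0 ?ge_min ?lexx ?orbT//.
by move=> z; rewrite /cball /= lt_min => /andP[/H].
Qed.

Lemma disc_image_open (S : surface R) (x : S) r kap h r' : disc_model x r kap h ->
  r' <= r -> open (kap @` cball 0 r').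
Proof. by move=> M r'r; apply: (dm_open M); [exact: cball_open | exact: cball_sub]. Qed.

Section TranslationSurfaces.
Variables (X : surface R) (hX : translation_surface X).

Lemma surface_model : locally_modelled X.
Proof.
move=> x; have [c ac dcx] := ts_dom_cover hX x.
(* The other singularities are removed, so that only the centre of the disc can be one. *)
pose V := dom c `&` ~` (@sing R X `\ x).
have Vo : open V.
  apply: openI; first exact: ts_dom_open hX _ ac.
  apply: closed_openC.
  apply: (accessible_finite_set_closed.1 (hausdorff_accessible (ts_hausdorff hX))).
  by apply: sub_finite_set (ts_sing_finite hX) => y [].
have Vx : V x by split=> // -[_]; exact.
have Vd : V `<=` dom c by move=> y [].
set a := coord c x.
have [r r0 Hr] : exists2 r : R, 0 < r & forall w : C, cabs (w - a) < r -> (coord c @` V) w.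
  apply/nbhs_cplx; apply: open_nbhs_nbhs; split; first exact: ts_coord_open hX _ _ ac Vo Vd.
  by exists x.
(* The local inverse of the chart, recentred at x; the default x is taken only outside the disc. *)
pose kap (z : C) : X := xget x [set y | V y /\ coord c y = a + z].
have kP z : cball 0 r z -> V (kap z) /\ coord c (kap z) = a + z.
  rewrite /cball /= subr0 => zr; have [y Vy yE] := Hr (a + z) ltac:(by rewrite addrC addKr).
  by rewrite /kap; case: xgetP => // /(_ y) []; split.
have kK y : V y -> cball 0 r (coord c y - a) -> kap (coord c y - a) = y.
  move=> Vy yB; have [V1 E1] := kP _ yB.
  apply: (ts_coord_inj hX ac); rewrite ?inE; [exact: Vd|exact: Vd|].
  by rewrite E1 addrC subrK.
have k0 : kap 0 = x.
  by have := kK x Vx; rewrite -/a subrr; apply; exact: cball_center.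
have kc z : cball 0 r z -> {for z, continuous kap}.
  move=> zB A /nbhs_interior nA; have [V1 E1] := kP _ zB.
  have Wo : open (A^° `&` V) by apply: openI => //; exact: open_interior.
  have : nbhs (a + z) (coord c @` (A^° `&` V)).
    apply: open_nbhs_nbhs; split.
      by apply: (ts_coord_open hX ac Wo) => y [_ /Vd].
    by exists (kap z) => //; split => //; exact: nbhs_singleton nA.
  move=> /nbhs_cplx[d d0 Hd]; have [d' d'0 Hd'] := (nbhs_cplx z _).1 (cball_open zB).
  apply/nbhs_cplx; exists (Num.min d d') => [|w]; first by rewrite lt_min d0.
  rewrite lt_min => /andP[w1 /Hd' wB].
  have [y [/interior_subset Ay Vy] yE] := Hd (a + w) ltac:(by rewrite addrAC opprD !addrA subrr sub0r addrC).
  have kw : kap w = y.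
    have wE : w = coord c y - a by rewrite yE addrC addKr.
    by rewrite wE kK// -wE.
  by change (A (kap w)); rewrite kw.
have dw (g : X -> C) l z : cball 0 r z ->
    diff_wrt c (kap z) g l <-> cderiv (g \o kap) z l.
  move=> zB; have [V1 E1] := kP _ zB; split.
    move=> /diff_wrtP H e e0; have /(kc z zB) /nbhs_cplx[d d0 Hd] := H _ e0.
    have [d' d'0 Hd'] := (nbhs_cplx z _).1 (cball_open zB).
    exists (Num.min d d') => [|w]; first by rewrite lt_min d0.
    rewrite lt_min => /andP[w1 /Hd' wB].
    have [->|wz] := eqVneq w z; first by rewrite !subrr mulr0 subrr cabs0 mulr0.
    have wz0 : w - z != 0 by rewrite subr_eq0.
    have [V2 E2] := kP _ wB.
    have := Hd w w1; rewrite /= E1 E2.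
    have -> : a + w - (a + z) = w - z by ring.
    have -> : g (kap w) - g (kap z) - l * (w - z) =
      ((g (kap w) - g (kap z)) / (w - z) - l) * (w - z) by field.
    rewrite cabsM => K; apply: ler_wpM2r; first exact: cabs_ge0.
    apply/ltW/K; apply/eqP => kE; move/eqP: wz; apply.
    by apply: (addrI a); rewrite -E1 -E2 kE.
  move=> H; apply/diff_wrtP => e e0.
  have [d d0 Hd] := H _ (divr_gt0 e0 (ltr0Sn R 1)).
  have [d' d'0 Hd'] := (nbhs_cplx z _).1 (cball_open zB).
  have m0 : 0 < Num.min d d' by rewrite lt_min d0.
  have nV : nbhs (kap z) V by apply: open_nbhs_nbhs; split.
  have nc : nbhs (kap z) [set y | cabs (coord c y - (a + z)) < Num.min d d'].
    have cc := ts_coord_cont hX ac (Vd _ V1).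
    by apply: filterS ((cvg_cplx _ _).1 cc _ m0) => y; rewrite E1.
  apply: filterS2 nV nc => y Vy /=; rewrite lt_min => /andP[y1 y2] yz.
  set w := coord c y - a.
  have wzE : w - z = coord c y - (a + z) by rewrite /w; ring.
  have wB : cball 0 r w by apply: Hd'; rewrite wzE.
  have wy : kap w = y by exact: kK.
  have wz0 : w - z != 0.
    by rewrite subr_eq0; apply: contraNneq yz => <-; rewrite wy.
  have := Hd w; rewrite wzE => /(_ y1); rewrite -wzE /= wy E1.
  have -> : coord c y - (a + z) = w - z by [].
  have -> : g y - g (kap z) - l * (w - z) =
      ((g y - g (kap z)) / (w - z) - l) * (w - z) by field.
  rewrite cabsM ler_pM2r ?cabs_gt0// => K; apply: le_lt_trans K _.
  by move: e0; lra.
have reg z : cball 0 r z -> ~ sing (kap z) -> coef c (kap z) != 0.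
  move=> /kP[V1 _] ns; apply/eqP => /(ts_sing_zeros hX ac (Vd _ V1)); exact: ns.
exists r, kap, (coef c \o kap); split => //.
- move=> z w zB wB E; apply: (addrI a).
  by rewrite -(kP _ zB).2 -(kP _ wB).2 E.
- move=> O Oo OB; rewrite openE => y [z Oz <-]; have zB := OB _ Oz; have [V1 E1] := kP _ zB.
  have [d d0 Hd] := (nbhs_cplx z _).1 (Oo _ Oz).
  have nV : nbhs (kap z) V by apply: open_nbhs_nbhs; split.
  have nc : nbhs (kap z) [set y | cabs (coord c y - (a + z)) < d].
    have cc := ts_coord_cont hX ac (Vd _ V1).
    by apply: filterS ((cvg_cplx _ _).1 cc _ d0) => y'; rewrite E1.
  change (nbhs (kap z) (kap @` O)); apply: filterS2 nV nc => y' Vy' /= y'd.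
  have Oy : O (coord c y' - a).
    by apply: Hd; rewrite -addrA -opprD.
  by exists (coord c y' - a) => //; apply: kK => //; exact: OB.
- move=> z zB; have [V1 E1] := kP _ zB.
  have [l Hl] := ts_coef_holo hX ac (Vd _ V1).
  by exists l; apply/(dw _ _ _ zB).
- move=> z zB z0; have ns : ~ sing (kap z).
    have [[_ nV] E1] := kP _ zB => s; apply: nV; split=> // kx.
    by move: E1; rewrite kx -/a -{1}[a]addr0 => /addrI /esym/eqP; exact/negP.
  by split=> //; exact: reg.
- by move=> ns; apply: reg; [exact: cball_center | rewrite k0].
move=> zeta z zB; have [V1 E1] := kP _ zB.
rewrite -dw//; split=> [H|H c' ac' dc']; first by apply: H => //; exact: Vd.
have [l Hl ->] := ts_transition hX ac' ac dc' (Vd _ V1).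
have : (fun y => ((zeta y - zeta (kap z)) / (coord c y - coord c (kap z))) *
  ((coord c y - coord c (kap z)) / (coord c' y - coord c' (kap z)))) @ (kap z)^' --> coef c (kap z) * l.
  by apply: cvgM; [exact: H | exact: Hl].
apply: cvg_trans; apply: near_eq_cvg; rewrite near_withinE.
have nV : nbhs (kap z) V by apply: open_nbhs_nbhs; split.
apply: filterS nV => y Vy yz.
have cy : coord c y - coord c (kap z) != 0.
  rewrite subr_eq0; apply: contraNneq yz => E; apply/eqP.
  by apply: (ts_coord_inj hX ac); rewrite ?inE//; exact: Vd.
by rewrite mulrA divfK.
Qed.

End TranslationSurfaces.
End DiscModels.

(** * Coverings through their local sections *)

Section Sheets.
Context {X Y : topologicalType}.
Variable p : continuousType Y X.

Record sheet (U : set X) (V : set Y) (s : X -> Y) : Prop := {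
  sh_openU : open U;
  sh_openV : open V;
  sh_s : forall x, U x -> V (s x) /\ p (s x) = x;
  sh_p : forall y, V y -> U (p y) /\ s (p y) = y;
  sh_cont : forall x, U x -> {for x, continuous s} }.

Hypothesis cp : covering p.

Let pc (y : Y) : {for y, continuous p}.
Proof. exact: (@cts_fun _ _ p y). Qed.

Lemma covering_even (x : X) : exists U, [/\ open U, U x &
  forall y, U (p y) -> exists V s, sheet U V s /\ V y].
Proof.
have [U [sh [Uo Ux pU _ Hsh]]] := cp.2 x; exists U; split => // y Uy.
have : (p @^-1` U) y by [].
rewrite pU => -[V shV Vy]; have [Vo Vi VU Vop] := Hsh _ shV.
pose s x' := xget y [set y' | V y' /\ p y' = x'].
have sP x' : U x' -> V (s x') /\ p (s x') = x'.
  rewrite -VU => -[y' Vy' px']; rewrite /s; case: xgetP => [z _ []//|/(_ y')[]].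
  by split.
have sK y' : V y' -> s (p y') = y'.
  move=> Vy'; have Up : U (p y') by rewrite -VU; exists y'.
  by have [V1 E1] := sP _ Up; apply: Vi; rewrite ?inE.
exists V, s; split=> //; split => //.
- by move=> y' Vy'; split; [rewrite -VU; exists y' | exact: sK].
- move=> x' Ux' A /nbhs_interior nA; have [V1 E1] := sP _ Ux'.
  have Wo : open (A^° `&` V) by apply: openI => //; exact: open_interior.
  have nW : nbhs x' (p @` (A^° `&` V)).
    apply: open_nbhs_nbhs; split; first by apply: Vop => // z [].
    by exists (s x') => //; split=> //; exact: nbhs_singleton nA.
  apply: filterS nW => _ [z [/interior_subset Az Vz] <-].
  by change (A (s (p z))); rewrite sK.
Qed.

Lemma covering_sheet (y : Y) : exists U V s, sheet U V s /\ V y.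
Proof.
by have [U [_ Uy /(_ y Uy)[V [s H]]]] := covering_even (p y); exists U, V, s.
Qed.

Lemma covering_hausdorff : hausdorff_space X -> hausdorff_space Y.
Proof.
move=> hX y y' cl.
have pyy : p y = p y'.
  apply: hX => A B nA nB.
  have [z [Az Bz]] := cl _ _ (pc nA) (pc nB).
  by exists (p z).
have [U [sh [Uo Ux pU tr Hsh]]] := cp.2 (p y).
have : (p @^-1` U) y by []. have : (p @^-1` U) y' by rewrite /preimage /= -pyy.
rewrite pU => -[V' sV' V'y'] [V sV Vy].
have [Vo Vi _ _] := Hsh _ sV; have [Vo' _ _ _] := Hsh _ sV'.
have [z [Vz Vz']] := cl V V' (open_nbhs_nbhs (conj Vo Vy)) (open_nbhs_nbhs (conj Vo' V'y')).
have VV : V = V' by apply: (tr V V' sV sV'); exists z.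
by apply: Vi; rewrite ?inE// VV.
Qed.

Lemma covering_open (W : set Y) : open W -> open (p @` W).
Proof.
move=> Wo; rewrite openE => _ [y Wy <-].
have [U [V [s [S Vy]]]] := covering_sheet y; have [Uy sy] := sh_p S Vy.
have nU : nbhs (p y) U by apply: open_nbhs_nbhs; split=> //; exact: sh_openU S.
have nW : nbhs (p y) (s @^-1` W).
  by apply: (sh_cont S Uy); rewrite sy; apply: open_nbhs_nbhs; split.
change (nbhs (p y) (p @` W)); apply: filterS2 nU nW => x Ux Wx.
by exists (s x) => //; exact: (sh_s S Ux).2.
Qed.

End Sheets.

Section PullbackModel.
Context {R : realType}.
Local Notation C := (cplx R).
Variables (X : surface R) (Y : topologicalType) (p : continuousType Y X).
Hypothesis hX : translation_surface X.
Hypothesis cp : covering p.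
Local Notation S := (pullback p).

Let pc (y : Y) : {for y, continuous p}.
Proof. exact: (@cts_fun _ _ p y). Qed.

Lemma diff_wrt_pullback (c : form_chart R X) (V' : set Y) U V s (y : Y) zeta l :
  sheet p U V s -> V y ->
  diff_wrt (FormChart V' (coord c \o p) (coef c \o p)) y zeta l <->
  diff_wrt c (p y) (zeta \o s) l.
Proof.
move=> sh Vy; have [Uy sy] := sh_p sh Vy.
have nV : nbhs y V by apply: open_nbhs_nbhs; split=> //; exact: sh_openV sh.
have nU : nbhs (p y) U by apply: open_nbhs_nbhs; split=> //; exact: sh_openU sh.
split=> /diff_wrtP H; apply/diff_wrtP => e /H {}H.
  have {}H : nbhs (s (p y)) [set y0 | y0 != y ->
    cabs ((zeta y0 - zeta y) / (coord c (p y0) - coord c (p y)) - l) < e] by rewrite sy.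
  have := sh_cont sh Uy H; apply: filterS2 nU => x Ux /= Hx xy.
  have [Vx px] := sh_s sh Ux.
  have := Hx; rewrite px sy; apply; apply: contraNneq xy => <-.
  by rewrite px.
have := pc H; apply: filterS2 nV => y' Vy' /= Hy yy.
have [Uy' sy'] := sh_p sh Vy'.
have := Hy; rewrite sy' sy; apply; apply: contraNneq yy => E.
by rewrite -sy' E sy.
Qed.

Lemma prim_at_pullback U V s (y : Y) zeta : sheet p U V s -> V y ->
  @prim_at R S y zeta <-> prim_at (p y) (zeta \o s).
Proof.
move=> sh Vy; have [Uy sy] := sh_p sh Vy; split=> H.
  move=> c ac dc.
  (* Charts of the pullback atlas require a domain on which p is injective; the sheet V provides
     one. *)
  pose V' := V `&` p @^-1` dom c.
  pose c' := FormChart V' (coord c \o p) (coef c \o p) : form_chart R Y.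
  apply/(diff_wrt_pullback c V' zeta (coef c (p y)) sh Vy).
  apply: (H c'); last by split.
  exists c, V'; split=> //.
  - apply: openI; first exact: sh_openV sh.
    by apply: open_comp; [move=> *; exact: pc | exact: ts_dom_open hX _ ac].
  - move=> a b; rewrite !inE => -[Va _] [Vb _] E.
    by rewrite -(sh_p sh Va).2 E (sh_p sh Vb).2.
  - by move=> z [].
move=> c' [c [V' [ac V'o V'i V'd ->]]] /= V'y.
apply/(diff_wrt_pullback c V' zeta (coef c (p y)) sh Vy).
by apply: H => //; exact: V'd.
Qed.

Lemma pullback_model : locally_modelled S.
Proof.
move=> y; have [r [kap [h M]]] := surface_model hX (p y).
have [U [V [s [sh Vy]]]] := covering_sheet cp y; have [Uy sy] := sh_p sh Vy.
have [r' [r'0 r'r HU]] := disc_shrink_in M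
  (open_nbhs_nbhs (conj (sh_openU sh) Uy)).
have {r r'r}M := disc_shrink M r'0 r'r.
have sP z : cball 0 r' z -> V (s (kap z)) /\ p (s (kap z)) = kap z.
  by move=> /HU; exact: sh_s.
exists r', (s \o kap), h; split => //.
- by rewrite /= (dm_0 M).
- by move=> z zB; apply: continuous_comp; [exact: dm_cont M _ zB | exact: sh_cont sh _ (HU _ zB)].
- move=> z w zB wB /= E; apply: (dm_inj M zB wB).
  by rewrite -(sP _ zB).2 -(sP _ wB).2 E.
- move=> O Oo OB.
  have -> : (s \o kap) @` O = V `&` p @^-1` (kap @` O).
    apply/seteqP; split=> y'.
      by move=> [z Oz <-]; have [V1 E1] := sP _ (OB _ Oz); split=> //; exists z.
    move=> [Vy' [z Oz zE]]; exists z => //=.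
    by rewrite zE (sh_p sh Vy').2.
  apply: openI; first exact: sh_openV sh.
  by apply: open_comp; [move=> *; exact: pc | exact: dm_open M _ Oo OB].
- exact: dm_holo M.
- by move=> z zB z0; have := dm_reg M zB z0; rewrite /= (sP _ zB).2.
- exact: dm_sing M.
- move=> zeta z zB; have [V1 E1] := sP _ zB.
  by rewrite (prim_at_pullback zeta sh V1) E1 (dm_prim M).
Qed.

End PullbackModel.

(** * Affine maps *)

Section Primitives.
Context {R : realType}.
Local Notation C := (cplx R).
Variable S : surface R.
Hypothesis mS : locally_modelled S.

Lemma nbhs_model (x : S) r kap h z (A : set S) : disc_model x r kap h -> cball 0 r z ->
  nbhs (kap z) A <-> nbhs z (kap @^-1` A).
Proof.
move=> M zB; split; first exact: dm_cont M _ zB A.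
move=> /nbhs_interior nA.
have Oo : open ((kap @^-1` A)^° `&` cball 0 r).
  by apply: openI; [exact: open_interior | exact: cball_open].
have OK := dm_open M Oo (fun z zz => zz.2).
have : nbhs (kap z) (kap @` ((kap @^-1` A)^° `&` cball 0 r)).
  apply: open_nbhs_nbhs; split => //.
  by exists z => //; split=> //; exact: nbhs_singleton nA.
by apply: filterS => _ [w [/interior_subset Aw _] <-].
Qed.

Lemma prim_at_continuous (x : S) zeta : prim_at x zeta -> {for x, continuous zeta}.
Proof.
have [r [kap [h M]]] := mS x.
have zB := cball_center (0 : C) (dm_gt0 M).
rewrite -(dm_0 M) => /(dm_prim M zeta zB) /cderiv_continuous zc A nA.
by apply/(nbhs_model (zeta @^-1` A) M zB); exact: zc.
Qed.

Lemma primitive_prim_at (U : set S) zeta x : primitive U zeta -> U x -> prim_at x zeta.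
Proof. by move=> H Ux c; exact: H. Qed.

Lemma local_primitive_prim_at (x : S) zeta : local_primitive x zeta -> prim_at x zeta.
Proof. by move=> [U [_ Ux /primitive_prim_at]]; apply. Qed.

Lemma local_primitive_near (x : S) zeta : local_primitive x zeta ->
  \forall y \near x, local_primitive y zeta.
Proof.
move=> [U [Uo Ux H]]; have : nbhs x U by apply: open_nbhs_nbhs; split.
by apply: filterS => y Uy; exists U.
Qed.

Lemma good_disc (x : S) (D : set S) : nbhs x D ->
  exists r kap h F zeta, [/\ disc_model x r kap h,
    (forall z, cball 0 r z -> D (kap z)),
    (forall z, cball 0 r z -> cderiv F z (h z)),
    (forall z, cball 0 r z -> zeta (kap z) = F z) &
    (forall z, cball 0 r z -> prim_at (kap z) zeta)].
Proof.
move=> nD; have [r0 [kap [h M0]]] := mS x.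
have [F HF] := cderiv_primitive (dm_gt0 M0) (dm_holo M0).
have [r1 [r10 r1r HD]] := disc_shrink_in M0 nD.
pose r := Num.min r1 (r0 / 3).
have rp : 0 < r by rewrite lt_min r10 divr_gt0// (dm_gt0 M0).
have r3 : r <= r0 / 3 by rewrite ge_min lexx orbT.
have rr1 : r <= r1 by rewrite ge_min lexx.
have M := disc_shrink M0 rp (le_trans rr1 r1r).
pose zeta (y : S) : C := F (xget 0 [set z | cball 0 r z /\ kap z = y]).
have zE z : cball 0 r z -> zeta (kap z) = F z.
  move=> zB; rewrite /zeta; case: xgetP => [w _ [wB E]|/(_ z)[]]; last by split.
  by rewrite (dm_inj M wB zB E).
exists r, kap, h, F, zeta; split => //.
- by move=> z /(cball_sub rr1); exact: HD.
- by move=> z /(cball_sub r3); exact: HF.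
move=> z zB; apply/(dm_prim M zeta zB).
apply: cderiv_ext (HF _ (cball_sub r3 zB)).
have : nbhs z (cball 0 r) by apply: open_nbhs_nbhs; split=> //; exact: cball_open.
by apply: filterS => w wB; rewrite /= zE.
Qed.

Lemma local_primitive_ex (x : S) : exists zeta, local_primitive x zeta.
Proof.
have [r [kap [h [F [zeta [M _ _ _ H]]]]]] := good_disc (@filterT _ (nbhs x) _).
exists zeta, (kap @` cball 0 r); split.
- exact: disc_image_open M (lexx _).
- by exists 0; [exact: cball_center (dm_gt0 M) | exact: dm_0 M].
- by move=> _ c [z zB <-]; exact: H.
Qed.

Lemma prim_near_cst (x : S) zeta xi : local_primitive x zeta -> local_primitive x xi ->
  \forall y \near x, xi y - zeta y = xi x - zeta x.
Proof.
move=> /local_primitive_near Lz /local_primitive_near Lx.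
have [r0 [kap [h M0]]] := mS x.
have [r [rp rr H]] := disc_shrink_in M0 (filterI Lz Lx).
have M := disc_shrink M0 rp rr.
have zB := cball_center (0 : C) (dm_gt0 M).
rewrite -(dm_0 M); apply/(nbhs_model _ M zB).
have : nbhs (0 : C) (cball 0 r) by exact: cball_nbhs.
apply: filterS => w wB /=.
apply: (@cderiv0_cst _ (fun z => xi (kap z) - zeta (kap z)) 0 r) => // z zB'.
have [Hz Hx] := H _ zB'; rewrite -[0](subrr (h z)); apply: cderivB.
  by apply/(dm_prim M xi zB'); exact: local_primitive_prim_at.
by apply/(dm_prim M zeta zB'); exact: local_primitive_prim_at.
Qed.

Lemma prim_connected (U : set S) zeta xi x y : connected U ->
  (forall z, U z -> local_primitive z zeta) -> (forall z, U z -> local_primitive z xi) ->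
  U x -> U y -> xi y - zeta y = xi x - zeta x.
Proof.
move=> cU Hz Hx Ux Uy.
apply: (@connected_clopen _ U [set y | xi y - zeta y = xi x - zeta x] x) => //.
  by move=> z Uz /= zE; apply: filterS (prim_near_cst (Hz _ Uz) (Hx _ Uz)) => w -> _.
by move=> z Uz /= zE; apply: filterS (prim_near_cst (Hz _ Uz) (Hx _ Uz)) => w -> _.
Qed.

Lemma connected_nbhd (x : S) (D : set S) : nbhs x D ->
  exists V, [/\ open V, V x, connected V, V `<=` D &
    forall y, V y -> y != x -> ~ sing y].
Proof.
move=> nD; have [r0 [kap [h M0]]] := mS x.
have [r [rp rr H]] := disc_shrink_in M0 nD; have M := disc_shrink M0 rp rr.
exists (kap @` cball 0 r); split.
- exact: disc_image_open M (lexx _).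
- by exists 0; [exact: cball_center | exact: dm_0 M].
- apply: connected_continuous_connected; first exact: cball_connected.
  by apply: continuous_in_subspaceT => z; rewrite inE => zB; exact: dm_cont M _ zB.
- by move=> _ [z zB <-]; exact: H.
- move=> _ [z zB <-] zx; apply: (dm_reg M zB _).1.
  by apply: contraNneq zx => ->; rewrite (dm_0 M).
Qed.

Lemma prim_inj (x : S) zeta : ~ sing x -> local_primitive x zeta ->
  exists2 U, nbhs x U & forall y y', U y -> U y' -> zeta y = zeta y' -> y = y'.
Proof.
move=> nx Lz; have [r0 [kap [h M0]]] := mS x.
have [r [rp rr H]] := disc_shrink_in M0 (local_primitive_near Lz).
have M := disc_shrink M0 rp rr; have zB := cball_center (0 : C) rp.
have [l hl] := dm_holo M zB.
have Hd z : cball 0 r z -> cderiv (zeta \o kap) z (h z).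
  by move=> zB'; apply/(dm_prim M zeta zB'); apply: local_primitive_prim_at; exact: H.
have h0 := dm_sing M nx.
have [d d0 [dr Hi]] := cderiv_local_inj rp Hd (cderiv_continuous hl) h0.
exists (kap @` cball 0 d).
  apply: open_nbhs_nbhs; split; first exact: disc_image_open M dr.
  by exists 0; [exact: cball_center | exact: dm_0 M].
move=> _ _ [u uB <-] [v vB <-] E; congr kap.
have := Hi u v uB vB; rewrite /= E subrr cabs0 pmulr_rle0; last first.
  by rewrite divr_gt0// cabs_gt0.
move=> uv; apply/eqP; rewrite -subr_eq0 -cabs_eq0; apply/eqP/le_anti.
by rewrite uv cabs_ge0.
Qed.

End Primitives.

Section RealLinearMaps.
Context {R : realType}.
Local Notation C := (cplx R).
Implicit Types (A B : 'M[R]_2) (z w : C).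

Lemma mx_actD A z w : mx_act A (z + w) = mx_act A z + mx_act A w.
Proof. by case: z w => [a b] [c d]; congr Complex => /=; ring. Qed.

Lemma mx_actB A z w : mx_act A (z - w) = mx_act A z - mx_act A w.
Proof. by case: z w => [a b] [c d]; congr Complex => /=; ring. Qed.

Lemma mx_actM A B z : mx_act (A * B) z = mx_act A (mx_act B z).
Proof. by case: z => a b; rewrite /mx_act !mulmx2E /=; congr Complex => /=; ring. Qed.

Lemma mx_act1 z : mx_act 1 z = z.
Proof. by case: z => a b; rewrite /mx_act !mx2_1E /=; congr Complex => /=; ring. Qed.

Lemma mx_act_subl A B z : mx_act (A - B) z = mx_act A z - mx_act B z.
Proof. by case: z => a b; rewrite /mx_act !mxE; congr Complex => /=; ring. Qed.

Lemma mx_act_le A z : cabs (mx_act A z) ^+ 2 <= frob A * cabs z ^+ 2.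
Proof.
rewrite !cabs2; case: z => x y; rewrite /frob /mx_act /=.
move: (A 0 0) (A 0 1) (A 1 0) (A 1 1) => a b c d.
rewrite -subr_ge0.
have -> : (a ^+ 2 + b ^+ 2 + c ^+ 2 + d ^+ 2) * (x ^+ 2 + y ^+ 2) -
  ((a * x + b * y) ^+ 2 + (c * x + d * y) ^+ 2) =
  (a * y - b * x) ^+ 2 + (c * y - d * x) ^+ 2 by ring.
by rewrite addr_ge0 ?sqr_ge0.
Qed.

Lemma mx_act_bound A z M : 0 <= M -> frob A <= M ^+ 2 -> cabs (mx_act A z) <= M * cabs z.
Proof.
move=> M0 AM; rewrite -ler_sqr ?nnegrE ?cabs_ge0 ?mulr_ge0 ?cabs_ge0//.
by rewrite (le_trans (mx_act_le _ _))// exprMn ler_wpM2r ?sqr_ge0.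
Qed.

End RealLinearMaps.

(** * Affine maps near singularities and their rigidity *)

Section AffineMaps.
Context {R : realType}.
Local Notation C := (cplx R).

(** Differences eliminate the translation constant of [affine_with_derivative], and phi is a plain
    map between two surfaces, so that lifts to a cover and maps induced on the base are treated
    alike. *)
Definition affine_map (S T : surface R) (phi : S -> T) (A : 'M[R]_2) :=
  forall (x : S) zeta xi, ~ sing x -> local_primitive x zeta ->
    local_primitive (phi x) xi ->
    \forall y \near x, xi (phi y) - xi (phi x) = mx_act A (zeta y - zeta x).

Lemma affine_mapP (S : surface R) (phi : sing_homeo S) A :
  affine_with_derivative phi A <-> affine_map (hfun phi) A.
Proof.
split=> H x zeta xi nx Lz Lx.
  have [k Hk] := H _ _ _ nx Lz Lx; have kx := nbhs_singleton Hk.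
  by apply: filterS Hk => y ->; rewrite kx mx_actB; ring.
exists (xi (hfun phi x) - mx_act A (zeta x)).
by apply: filterS (H _ _ _ nx Lz Lx) => y; rewrite mx_actB => /eqP;
  rewrite subr_eq => /eqP ->; ring.
Qed.

Section Pair.
Variables (S T : surface R).
Hypotheses (mS : locally_modelled S) (mT : locally_modelled T).

(** At a singular x, read in a disc model, the difference between xi after phi and A applied to zeta
    is locally constant off the centre. The punctured disc is connected, so the difference is
    constant there, and by continuity also at the centre. *)
Lemma affine_map_sing (phi : S -> T) A x zeta xi : continuous phi -> affine_map phi A ->
  local_primitive x zeta -> local_primitive (phi x) xi ->
  \forall y \near x, xi (phi y) - xi (phi x) = mx_act A (zeta y - zeta x).
Proof.
move=> cphi aff Lz Lx.
have [r0 [kap [h M0]]] := mS x.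
have [r [rp rr H]] := disc_shrink_in M0
  (filterI (local_primitive_near Lz) (cphi x _ (local_primitive_near Lx))).
have M := disc_shrink M0 rp rr; have zB := cball_center (0 : C) rp.
pose g z := xi (phi (kap z)) - mx_act A (zeta (kap z)).
have gn z : cball 0 r z -> z != 0 -> \forall w \near z, g w = g z.
  move=> zB' z0; have [Lz' Lx'] := H _ zB'.
  have := aff _ _ _ (dm_reg M zB' z0).1 Lz' Lx'.
  move=> /(nbhs_model _ M zB'); apply: filterS => w /=.
  by rewrite mx_actB /g => /eqP; rewrite subr_eq => /eqP ->; ring.
pose q : C := toC (r / 2) 0.
have qB : cball 0 r q.
  by rewrite /cball /= subr0 cabs_toC gtr0_norm ?divr_gt0// ltr_pdivrMr// ltr_pMr// ltr1n.
have q0 : q != 0 by rewrite toC_eq0 eqxx andbT gt_eqF// divr_gt0.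
have gc z : cball 0 r z -> z != 0 -> g z = g q.
  move=> zB' z0.
  apply: (@connected_clopen _ (cball 0 r `\ (0 : C)) [set z | g z = g q] q) => //.
  - exact: punctured_connected.
  - by split=> //; exact/eqP.
  - move=> w [wB /eqP w0] /= wE; apply: filterS (gn w wB w0) => v -> _; exact: wE.
  - move=> w [wB /eqP w0] /= wE; apply: filterS (gn w wB w0) => v -> _; exact: wE.
  - by split=> //; exact/eqP.
have [Lz0 Lx0] := H _ zB.
have gcont : {for 0, continuous g}.
  have c1 : {for 0, continuous (fun z => xi (phi (kap z)))}.
    apply: continuous_comp; last first.
      by apply: (prim_at_continuous mT); exact: local_primitive_prim_at Lx0.
    by apply: continuous_comp; [exact: dm_cont M _ zB | exact: cphi].
  have c2 : {for 0, continuous (fun z => zeta (kap z))}.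
    apply: continuous_comp; first exact: dm_cont M _ zB.
    by apply: (prim_at_continuous mS); exact: local_primitive_prim_at Lz0.
  apply/continuous_cplxP => e e0; have e2 : 0 < e / 2 by rewrite divr_gt0.
  pose m := Num.sqrt (frob A) + 1.
  have m0 : 0 < m by rewrite ltr_wpDl ?sqrtr_ge0.
  have mA : frob A <= m ^+ 2.
    rewrite -{1}(sqr_sqrtr (frob_ge0 A)) ler_sqr ?nnegrE ?sqrtr_ge0 ?(ltW m0)//.
    by rewrite lerDl.
  have [d1 d10 H1] := (continuous_cplxP _ _).1 c1 _ e2.
  have [d2 d20 H2] := (continuous_cplxP _ _).1 c2 _ (divr_gt0 e2 m0).
  exists (Num.min d1 d2) => [|w]; first by rewrite lt_min d10.
  rewrite lt_min => /andP[/H1 w1 /H2 w2].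
  have -> : g w - g 0 = (xi (phi (kap w)) - xi (phi (kap 0))) +
    - mx_act A (zeta (kap w) - zeta (kap 0)) by rewrite mx_actB /g; ring.
  rewrite (le_lt_trans (cabsD _ _))// cabsN [ltRHS]splitr ltrD//.
  rewrite (le_lt_trans (mx_act_bound _ (ltW m0) mA))//.
  by rewrite mulrC -ltr_pdivlMr.
have g0 : g 0 = g q.
  apply/eqP; rewrite -subr_eq0 -cabs_eq0; apply/negPn/negP => gq.
  have gp : 0 < cabs (g 0 - g q) by rewrite lt_def gq cabs_ge0.
  have [d d0 Hd] := (continuous_cplxP _ _).1 gcont _ gp.
  pose m := Num.min d r / 2; have m0 : 0 < m by rewrite divr_gt0// lt_min d0.
  have mm : m < Num.min d r by rewrite /m ltr_pdivrMr// ltr_pMr ?ltr1n// lt_min d0.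
  have mE : cabs (toC m 0 - 0) = m by rewrite subr0 cabs_toC gtr0_norm.
  have := Hd (toC m 0); rewrite mE => /(_ (lt_le_trans mm _)).
  rewrite ge_min lexx => /(_ isT); rewrite gc.
  - by rewrite cabsB ltxx.
  - by rewrite /cball /= mE (lt_le_trans mm)// ge_min lexx orbT.
  - by rewrite toC_eq0 eqxx andbT gt_eqF.
rewrite -(dm_0 M); apply/(nbhs_model _ M zB).
apply: filterS (cball_nbhs 0 rp) => z zB' /=.
have : g z = g 0 by have [->//|z0] := eqVneq z 0; rewrite gc// g0.
by rewrite mx_actB /g => /eqP; rewrite subr_eq => /eqP ->; ring.
Qed.

(** At a regular point the local primitive is injective, so agreement spreads. Regularity of x0
    matters: two affine maps with the same derivative may agree at a cone point and differ by a
    rotation around it. *)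
Lemma affine_map_eq (phi psi : S -> T) A x0 : hausdorff_space T ->
  connected [set: S] -> continuous phi -> continuous psi ->
  (forall x, ~ sing x -> ~ sing (phi x)) -> (forall x, ~ sing x -> ~ sing (psi x)) ->
  affine_map phi A -> affine_map psi A -> ~ sing x0 -> phi x0 = psi x0 -> phi = psi.
Proof.
move=> hT cS cphi cpsi sphi spsi aphi apsi nx0 E0.
have loc x : ~ sing x -> phi x = psi x -> \forall y \near x, phi y = psi y.
  move=> nx E; have [zeta Lz] := local_primitive_ex mS x.
  have [xi Lx] := local_primitive_ex mT (phi x).
  have [U nU Ui] := prim_inj mT (sphi _ nx) Lx.
  have nU' : nbhs (psi x) U by rewrite -E.
  have H1 := aphi _ _ _ nx Lz Lx.
  have H2 : \forall y \near x, xi (psi y) - xi (psi x) = mx_act A (zeta y - zeta x).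
    by apply: apsi => //; rewrite -E.
  have n1 : nbhs x (phi @^-1` U) := cphi x _ nU.
  have n2 : nbhs x (psi @^-1` U) := cpsi x _ nU'.
  apply: filterS (filterI (filterI H1 H2) (filterI n1 n2)).
  move=> y [[h1 h2] [u1 u2]]; apply: (Ui _ _ u1 u2).
  by move: h1; rewrite -h2 E => /addIr.
have lim x : (forall B, nbhs x B -> exists2 y, B y & phi y = psi y) -> phi x = psi x.
  move=> H; apply: hT => P Q nP nQ.
  have n1 : nbhs x (phi @^-1` P) := cphi x _ nP.
  have n2 : nbhs x (psi @^-1` Q) := cpsi x _ nQ.
  have [y [Py Qy] yE] := H _ (filterI n1 n2).
  by exists (phi y); split=> //; rewrite yE.
(* Taking the interior makes openness automatic; only closedness needs the geometry. *)
pose E : set S := interior [set y | phi y = psi y].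
suff ET : [set: S] `<=` E by apply/funext => x; exact: nbhs_singleton (ET x I).
apply: (@connected_clopen _ _ E x0) => //.
- by apply: loc.
- move=> x _ Ex; apply: filterS (nbhs_interior Ex) => y Ey _; exact: Ey.
move=> x _ nEx; apply: contrapT => H.
have HE B : nbhs x B -> exists2 y, B y & E y.
  move=> nB; apply: contrapT => nBE; apply: H; apply: filterS nB => y By _ Ey.
  by apply: nBE; exists y.
have Ex : phi x = psi x.
  by apply: lim => B /HE[y By Ey]; exists y => //; exact: nbhs_singleton Ey.
(* At a singularity primitives need not be injective. Agreement is spread over the punctured disc
   from one point w, and the centre is covered by [Ex]. *)
apply: nEx; have [sx|nx] := pselect (sing x); last exact: loc.
have [r [kap [h M]]] := mS x; have rp := dm_gt0 M; have zB := cball_center (0 : C) rp.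
have [_ [z zB' <-] Ez] := HE (kap @` cball 0 r)
  (open_nbhs_nbhs (conj (disc_image_open M (lexx _)) (ex_intro2 _ _ 0 zB (dm_0 M)))).
have [w wB [w0 Ew]] : exists2 w, cball 0 r w & w != 0 /\ E (kap w).
  have [z0|] := eqVneq z 0; last by exists z.
  have := nbhs_interior Ez; move=> /(nbhs_model _ M zB') /nbhs_cplx[d d0 Hd].
  pose m := Num.min d r / 2; have m0 : 0 < m by rewrite divr_gt0// lt_min d0.
  have mm : m < Num.min d r by rewrite /m ltr_pdivrMr// ltr_pMr ?ltr1n// lt_min d0.
  have mE : cabs (toC m 0 - 0) = m by rewrite subr0 cabs_toC gtr0_norm.
  exists (toC m 0); first by rewrite /cball /= mE (lt_le_trans mm)// ge_min lexx orbT.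
  split; first by rewrite toC_eq0 eqxx andbT gt_eqF.
  by apply: Hd; rewrite z0 mE (lt_le_trans mm)// ge_min lexx.
have PE : cball 0 r `\ (0 : C) `<=` [set z | E (kap z)].
  apply: (@connected_clopen _ _ _ w) => //.
  - exact: punctured_connected.
  - by split=> //; exact/eqP.
  - move=> v [vB _] /= Ev; have := nbhs_interior Ev.
    by move=> /(nbhs_model _ M vB); apply: filterS => u Eu _.
  move=> v [vB /eqP v0] /= nEv; apply: contrapT => HH; apply: nEv.
  apply: loc; first exact: (dm_reg M vB v0).1.
  apply: lim => B /(nbhs_model _ M vB) nB; apply: contrapT => nBE; apply: HH.
  apply: filterS nB => u Bu _ Eu; apply: nBE; exists (kap u) => //.
  exact: nbhs_singleton Eu.
change (nbhs x [set y | phi y = psi y]).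
rewrite -(dm_0 M); apply/(nbhs_model _ M zB).
apply: filterS (cball_nbhs 0 rp) => v vB /=.
have [->|v0] := eqVneq v 0; first by rewrite (dm_0 M).
by apply: nbhs_singleton (PE v _); split=> //; exact/eqP.
Qed.

End Pair.

Lemma affine_map_comp (S T U : surface R) (phi : S -> T) (psi : T -> U) A B :
  locally_modelled T -> continuous phi -> (forall x, ~ sing x -> ~ sing (phi x)) ->
  affine_map phi A -> affine_map psi B -> affine_map (psi \o phi) (B * A).
Proof.
move=> mT cphi sphi aphi apsi x zeta xi nx Lz Lx.
have [eta Le] := local_primitive_ex mT (phi x).
have H1 := aphi _ _ _ nx Lz Le.
have H2 : nbhs x (phi @^-1` [set y | xi (psi y) - xi (psi (phi x)) =
    mx_act B (eta y - eta (phi x))]) := cphi _ _ (apsi _ _ _ (sphi _ nx) Le Lx).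
by apply: filterS2 H1 H2 => y h1 h2; rewrite /= h2 h1 mx_actM.
Qed.

Lemma affine_map_inv (S T : surface R) (phi : S -> T) (phi' : T -> S) A :
  cancel phi phi' -> cancel phi' phi -> continuous phi' ->
  (forall x, ~ sing x -> ~ sing (phi' x)) -> \det A = 1 ->
  affine_map phi A -> affine_map phi' (invmx A).
Proof.
move=> K K' cphi sphi d1 aphi x zeta xi nx Lz Lx.
have := aphi (phi' x) xi zeta (sphi _ nx) Lx; rewrite K' => /(_ Lz) H.
have {}H : nbhs x (phi' @^-1` [set y | zeta (phi y) - zeta x =
    mx_act A (xi y - xi (phi' x))]) := cphi _ _ H.
apply: filterS H => y; rewrite /= K' => ->.
by rewrite -mx_actM (invmx_detE d1).2 mx_act1.
Qed.

Lemma affine_map_id (S : surface R) : locally_modelled S -> affine_map (@id S) 1.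
Proof.
move=> mS x zeta xi nx Lz Lx.
apply: filterS (prim_near_cst mS Lz Lx) => y E; rewrite mx_act1.
have -> : xi y = (xi y - zeta y) + zeta y by ring.
by rewrite E; ring.
Qed.

End AffineMaps.

(** * Discreteness of the Veech group *)

Lemma seq_argmax {R : realType} (T : eqType) (g : T -> R) (s : seq T) x0 : x0 \in s ->
  exists2 x, x \in s & forall y, y \in s -> g y <= g x.
Proof.
elim: s x0 => [//|a s IH] x0 _.
have [->|] := eqVneq s [::].
  by exists a; rewrite ?mem_head// => y; rewrite inE => /eqP ->.
case: s IH => [//|b s] IH _; have [x xs H] := IH b (mem_head _ _).
have [ax|xa] := leP (g a) (g x).
  exists x; first by rewrite in_cons xs orbT.
  by move=> y; rewrite in_cons => /orP[/eqP ->//|/H].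
exists a; first by rewrite mem_head.
move=> y; rewrite in_cons => /orP[/eqP ->//|/H yx].
exact: le_trans yx (ltW xa).
Qed.

Lemma compact_max {R : realType} (T : topologicalType) (K : set T) (H : T -> R) :
  compact K -> K !=set0 -> (forall x, K x -> {for x, continuous H}) ->
  exists2 x, K x & forall y, K y -> H y <= H x.
Proof.
move=> cK [x0 Kx0] Hc; apply: contrapT => nmax.
have ex x : exists y, K x -> K y /\ H x < H y.
  have [Kx|] := pselect (K x); last by exists x.
  apply: contrapT => /forallNP nE; apply: nmax; exists x => // y Ky.
  by rewrite leNgt; apply/negP => xy; apply: (nE y).
pose t x := sval (cid (ex x)).
have tP x : K x -> K (t x) /\ H x < H (t x) := svalP (cid (ex x)).
have [s [sK sc]] := @compact_finite_cover _ K (fun x => [set y | H y < H (t x)]) cK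
  (fun x Kx => Hc x Kx _ (open_nbhs_nbhs (conj (@open_lt _ (H (t x))) (tP x Kx).2))).
have [x1 x1s _] := sc _ Kx0.
have [x xs xmax] := @seq_argmax _ _ (H \o t) s _ x1s.
have [y ys yx] := sc _ (tP _ (sK _ xs)).1.
by have := xmax _ ys; rewrite leNgt /= yx.
Qed.

Lemma avoid_seq {R : realType} (s : seq R) (a b : R) : a < b ->
  exists2 x, a <= x <= b & x \notin s.
Proof.
elim: s a b => [|c s IH] a b ab; first by exists a; rewrite ?lexx ?(ltW ab).
pose m := (a + b) / 2.
have am : a < m by rewrite midf_lt.
have mb : m < b by rewrite midf_lt.
pose m1 := (a + m) / 2.
have am1 : a < m1 by rewrite midf_lt.
have m1m : m1 < m by rewrite midf_lt.
have [cm|mc] := leP c m1.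
  have [x /andP[x1 x2] xs] := IH _ _ mb.
  exists x; first by rewrite (le_trans (ltW am) x1).
  by rewrite inE negb_or xs andbT gt_eqF// (le_lt_trans cm)// (lt_le_trans m1m).
have [x /andP[x1 x2] xs] := IH _ _ am1.
exists x; first by rewrite x1 (le_trans x2)// ltW// (lt_trans m1m).
by rewrite inE negb_or xs andbT lt_eqF// (le_lt_trans x2).
Qed.

Section PlaneMaximum.
Context {R : realType}.
Local Notation C := (cplx R).

Lemma cdist_continuous (F : C -> C) a z : {for z, continuous F} ->
  {for z, continuous (fun w => cabs (F w - a) : R)}.
Proof.
move=> Fc; apply: (@continuous_comp _ _ _ (fun w => F w - a) (@cabs R)).
  apply/continuous_cplxP => e e0; have [d d0 H] := (continuous_cplxP _ _).1 Fc _ e0.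
  by exists d => // w /H; rewrite opprD addrACA subrr addr0.
exact: cabs_continuous.
Qed.

Lemma reC_continuous (F : C -> C) z : {for z, continuous F} ->
  {for z, continuous (fun w => reC (F w) : R)}.
Proof.
move=> Fc; apply/(@cvgrPdist_lt _ _ _ (nbhs z) (nbhs_filter z)) => e e0.
have [d d0 H] := (continuous_cplxP _ _).1 Fc _ e0.
apply/nbhs_cplx; exists d => // w /H wz.
by rewrite distrC -reCB (le_lt_trans (cabs_re _)).
Qed.

Lemma compact_circle (r : R) : compact [set z : C | cabs z = r].
Proof.
apply: (@subclosed_compact _ _ _ _ (@compact_cdisc R r)) => [|z /= ->//].
have -> : [set z : C | cabs z = r] = @cabs R @^-1` [set r] by [].
by apply: closed_comp; [move=> *; exact: cabs_continuous | exact: closed_eq].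
Qed.

(* If Re F <= 0, every a near 0 with a <> 0 is omitted by F on a small disc: the
   omitted values form a clopen subset of a punctured disc, because the point of
   the disc where F is closest to an omitted a must be the critical point 0. *)
Lemma no_local_max (F h : C -> C) (r : R) : 0 < r ->
  (forall z, cball 0 r z -> cderiv F z (h z)) ->
  (forall z, cball 0 r z -> z != 0 -> h z != 0) -> F 0 = 0 ->
  (forall z, cball 0 r z -> reC (F z) <= 0) -> False.
Proof.
move=> r0 Fd h0 F0 Fle.
have Flt z : cball 0 r z -> z != 0 -> reC (F z) < 0.
  move=> zB z0; rewrite lt_neqAle Fle// andbT; apply/negP => /eqP Fz.
  have [d d0 Hd] := (nbhs_cplx z _).1 (cball_open zB).
  have o1 : (toC 1 0 : C) != 0 by rewrite toC_eq0 oner_eq0.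
  have [w [t [/andP[t0 t1] wz Hw]]] := cderiv_dir (Fd _ zB) (h0 _ zB z0) o1 d0.
  have := Fle _ (Hd _ wz); apply/negP; rewrite -ltNge.
  have := le_trans (cabs_re _) Hw.
  have E1 : reC (toC t 0 * toC 1 0 : C) = t by rewrite /= mulr1 mul0r subr0.
  rewrite (reCB (F w - F z)) (reCB (F w)) Fz subr0 E1.
  rewrite cabs_toC normr1 [t * 1]mulr1 ler_norml => /andP[+ _].
  by move: t0; lra.
pose q := r / 2.
have q0 : 0 < q by rewrite divr_gt0.
have qr : q < r by rewrite /q ltr_pdivrMr// ltr_pMr// ltr1n.
have inB z : cabs z <= q -> cball 0 r z.
  by move=> zq; rewrite /cball /= subr0 (le_lt_trans zq).
have Fc z : cabs z <= q -> {for z, continuous F}.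
  by move=> /inB /Fd; exact: cderiv_continuous.
(* On the circle of radius q the real part of F is at most - eta, so F - a is there larger than a
   when [cabs a] < eta / 2. A minimum of [cabs (F z - a)] below [cabs a] is therefore interior. *)
have [eta eta0 Heta] : exists2 eta : R, 0 < eta & forall z, cabs z = q -> eta <= - reC (F z).
  have [|z zq|zm zmq Hm] := @compact_max R _ _ (fun z => reC (F z)) (@compact_circle q).
  - by exists (toC q 0); rewrite /= cabs_toC gtr0_norm.
  - by apply/reC_continuous/Fc; rewrite -zq lexx.
  exists (- reC (F zm)) => [|z zq].
    rewrite oppr_gt0; apply: Flt; first by apply: inB; rewrite zmq.
    by rewrite -cabs_eq0 zmq gt_eqF.
  by rewrite lerN2; exact: Hm.
have e2 : 0 < eta / 2 by rewrite divr_gt0.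
pose P := [set a : C | forall z, cabs z <= q -> F z <> a].
have key a z : cball 0 (eta / 2) a -> a != 0 -> P a -> cabs z <= q -> cabs a <= cabs (F z - a).
  rewrite /cball /= subr0 => aB a0 Pa zq.
  have [|z1 z1q|zm zmq Hm] := @compact_max R _ _ (fun z => - cabs (F z - a)) (@compact_cdisc R q).
  - by exists 0; rewrite /= cabs0 ltW.
  - by apply: continuousN; apply: cdist_continuous; exact: Fc.
  have {}Hm z' : cabs z' <= q -> cabs (F zm - a) <= cabs (F z' - a).
    by move=> /Hm; rewrite lerN2.
  apply: le_trans (Hm _ zq); rewrite leNgt; apply/negP => lt.
  have zm0 : zm != 0 by apply: contraTneq lt => ->; rewrite F0 sub0r cabsN ltxx.
  have zmq' : cabs zm < q.
    rewrite lt_neqAle zmq andbT; apply/negP => /eqP /Heta hh.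
    have := cabs_re (F zm - a); rewrite reCB ler_norml => /andP[h1 _].
    have := cabs_re a; rewrite ler_norml => /andP[h2 _].
    by move: hh h1 h2 lt aB; lra.
  have d0 : 0 < q - cabs zm by rewrite subr_gt0.
  have eta1 : a - F zm != 0.
    by rewrite subr_eq0; apply/eqP => E; exact: (Pa _ zmq).
  have [w [t [/andP[t0 t1] wz Hw]]] := cderiv_dir (Fd _ (inB _ zmq)) (h0 _ (inB _ zmq) zm0) eta1 d0.
  have wq : cabs w <= q.
    by rewrite -(subrK zm w) (le_trans (cabsD _ _))// -lerBrDr ltW.
  have := Hm _ wq; apply/negP; rewrite -ltNge.
  have -> : F w - a = (F w - F zm - toC t 0 * (a - F zm)) + toC (1 - t) 0 * (F zm - a).
    have -> : toC (1 - t) 0 = 1 - toC t 0 :> C by congr Complex; rewrite /= ?subr0.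
    by ring.
  rewrite (le_lt_trans (cabsD _ _))// cabsM cabs_toC ger0_norm ?subr_ge0 ?(ltW t1)//.
  have : 0 < cabs (a - F zm) by rewrite cabs_gt0.
  by move: Hw; rewrite (cabsB a); move: t0; nra.
have e4 : 0 < eta / 4 by rewrite divr_gt0.
(* A positive real value, omitted because the real part of F is never positive. *)
pose a0 : C := toC (eta / 4) 0.
have a0B : cball 0 (eta / 2) a0.
  by rewrite /cball /= subr0 cabs_toC gtr0_norm//; move: eta0; lra.
have a00 : a0 != 0 by rewrite toC_eq0 eqxx andbT gt_eqF.
have PP : cball 0 (eta / 2) `\ (0 : C) `<=` P.
  apply: (@connected_clopen _ _ _ a0).
  - exact: punctured_connected.
  - by split=> //; exact/eqP.
  - by move=> z /inB /Fle + E; rewrite E /= leNgt e4.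
  - move=> a [aB /eqP a1] Pa.
    have ap : 0 < cabs a by rewrite cabs_gt0.
    apply/nbhs_cplx; exists (cabs a) => // b ba _ z zq E.
    by have := key a z aB a1 Pa zq; rewrite E leNgt ba.
  move=> a [aB /eqP a1] nPa.
  have ap : 0 < cabs a / 2 by rewrite divr_gt0// cabs_gt0.
  have {nPa}[z zq zE] : exists2 z, cabs z <= q & F z = a.
    by apply: contrapT => nz; apply: nPa => z zq zE; apply: nz; exists z.
  apply/nbhs_cplx; exists (cabs a / 2) => // b ba [bB /eqP b0] Pb.
  have := key b z bB b0 Pb zq; rewrite zE cabsB => hh.
  have := cabsD (a - b) b; rewrite subrK (cabsB a).
  by move: ba hh ap; lra.
(* But F is continuous and nonzero off 0, so it does take small nonzero values. *)
have [d d0 Hd] := (continuous_cplxP _ _).1 (Fc 0 ltac:(by rewrite cabs0 ltW)) _ e2.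
pose m := Num.min d q / 2.
have m0 : 0 < m by rewrite divr_gt0// lt_min d0.
have mm : m < Num.min d q by rewrite /m ltr_pdivrMr// ltr_pMr ?ltr1n// lt_min d0.
have mE : cabs (toC m 0 : C) = m by rewrite cabs_toC gtr0_norm.
have mq : cabs (toC m 0 : C) <= q by rewrite mE ltW// (lt_le_trans mm)// ge_min lexx orbT.
have mz : (toC m 0 : C) != 0 by rewrite toC_eq0 eqxx andbT gt_eqF.
apply: (PP (F (toC m 0)) _ (toC m 0)) => //; split.
  rewrite /cball /=; have := Hd (toC m 0); rewrite F0; apply.
  by rewrite subr0 mE (lt_le_trans mm)// ge_min lexx.
by move=> E; have := Flt _ (inB _ mq) mz; rewrite E ltxx.
Qed.

End PlaneMaximum.

Section GoodNeighbourhoods.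
Context {R : realType}.
Local Notation C := (cplx R).

(** In a closed annulus the solutions of F z = F 0 are isolated, hence finite in number by
    compactness. A radius that avoids their moduli gives a circle on which F stays away from F 0. *)
Lemma level_radius (F h : C -> C) (r : R) : 0 < r ->
  (forall z, cball 0 r z -> cderiv F z (h z)) ->
  (forall z, cball 0 r z -> z != 0 -> h z != 0) ->
  exists q c : R, [/\ 0 < q, q < r, 0 < c &
    forall z, cabs z = q -> c <= cabs (F z - F 0)].
Proof.
move=> r0 Fd h0.
pose a := r / 4; pose b := r / 2.
have a0 : 0 < a by rewrite divr_gt0.
have ab : a < b by rewrite /a /b; lra.
have br : b < r by rewrite /b; lra.
have inB z : cabs z <= b -> cball 0 r z.
  by move=> zb; rewrite /cball /= subr0 (le_lt_trans zb).
pose K := [set z : C | a <= cabs z <= b].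
have Kc : compact K.
  apply: (@subclosed_compact _ _ _ _ (@compact_cdisc R b)) => [|z /= /andP[]//].
  have -> : K = (@cabs R @^-1` [set x | a <= x]) `&` (@cabs R @^-1` [set x | x <= b]).
    by apply/seteqP; split=> z /=; [move=> /andP[] | move=> [h1 h2]; apply/andP].
  by apply: closedI; apply: closed_comp; do ?[by move=> *; exact: cabs_continuous];
    [exact: closed_ge | exact: closed_le].
pose V z := [set w | F w = F 0 -> w = z].
have [s [sK sc]] : exists s : seq C, (forall x, x \in s -> K x) /\
    forall y, K y -> exists2 x, x \in s & V x y.
  apply: compact_finite_cover => // z /andP[az zb].
  have zB := inB _ zb.
  have z0 : z != 0 by rewrite -cabs_gt0 (lt_le_trans a0).
  have [E|nE] := eqVneq (F z) (F 0).
    have [d d0 Hd] := cderiv_isolated (Fd _ zB) (h0 _ zB z0).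
    by apply/nbhs_cplx; exists d => // w wd; rewrite /V /= -E; exact: Hd.
  have nEp : 0 < cabs (F z - F 0) by rewrite cabs_gt0 subr_eq0.
  have [d d0 Hd] := cderiv_cont (Fd _ zB) nEp.
  apply/nbhs_cplx; exists d => // w /Hd + E.
  by rewrite E cabsB ltxx.
have [q /andP[aq qb] qs] := avoid_seq (map (@cabs R) s) ab.
have q0 : 0 < q by exact: lt_le_trans aq.
have nF z : cabs z = q -> F z != F 0.
  move=> zq; apply/eqP => E; have Kz : K z by rewrite /K /= zq aq.
  have [x xs /(_ E) zx] := sc _ Kz.
  by move/negP: qs; apply; apply/mapP; exists x => //; rewrite -zx.
have [|z zq|zm zmq Hm] := @compact_max R _ _ (fun z => - cabs (F z - F 0)) (@compact_circle _ q).
- by exists (toC q 0); rewrite /= cabs_toC gtr0_norm.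
- apply: continuousN; apply: cdist_continuous; apply: (@cderiv_continuous _ F z (h z)).
  by apply: Fd; apply: inB; rewrite zq.
exists q, (cabs (F zm - F 0)); split=> //.
- exact: le_lt_trans br.
- by rewrite cabs_gt0 subr_eq0 nF.
- by move=> z /Hm; rewrite lerN2.
Qed.

Variable S : surface R.
Hypothesis mS : locally_modelled S.
Hypothesis hS : hausdorff_space S.

(** The value of zeta plays the role of a distance to x: a point carried out of O must first reach
    the frontier, where zeta differs from its central value by at least c. *)
Record good_nbhd (x : S) (O : set S) (zeta : S -> C) (c : R) : Prop := {
  gn_open : open O;
  gn_x : O x;
  gn_connected : connected O;
  gn_gt0 : 0 < c;
  gn_compact : compact (closure O);
  gn_prim : forall y, closure O y -> local_primitive y zeta;
  gn_front : forall y, closure O y -> ~ O y -> c <= cabs (zeta y - zeta x);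
  gn_reg : forall y, closure O y -> y != x -> ~ sing y }.

Lemma good_nbhd_ex (x : S) (D : set S) : nbhs x D ->
  exists O zeta c, good_nbhd x O zeta c /\ closure O `<=` D.
Proof.
move=> nD; have [r [kap [h [F [zeta [M HD HF HzF Hz]]]]]] := good_disc mS nD.
have rp := dm_gt0 M; have zB := cball_center (0 : C) rp.
have [q [c [q0 qr c0 Hc]]] := level_radius rp HF (fun z zB z0 => (dm_reg M zB z0).2).
have inB z : cabs z <= q -> cball 0 r z.
  by move=> zb; rewrite /cball /= subr0 (le_lt_trans zb).
pose O := kap @` cball 0 q.
pose K := kap @` [set z | cabs z <= q].
have Kc : compact K.
  apply: continuous_compact; last exact: compact_cdisc.
  by apply: continuous_in_subspaceT => z; rewrite inE => /inB; exact: dm_cont M _.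
have OK : closure O `<=` K.
  apply: subset_trans (compact_closed hS Kc); apply: closureS.
  by move=> _ [z zq <-]; exists z => //=; move: zq; rewrite /cball /= subr0 => /ltW.
have Lp z : cabs z <= q -> local_primitive (kap z) zeta.
  move=> /inB zB'; exists (kap @` cball 0 r); split.
  - exact: disc_image_open M (lexx _).
  - by exists z.
  - by move=> _ c' [w wB <-]; exact: Hz.
exists O, zeta, c; split; last by move=> y /OK[z /inB zq <-]; exact: HD.
split => //.
- exact: disc_image_open M (ltW qr).
- by exists 0; [exact: cball_center | exact: dm_0 M].
- apply: connected_continuous_connected; first exact: cball_connected.
  apply: continuous_in_subspaceT => z; rewrite inE => zq; apply: dm_cont M _ _.
  exact: (cball_sub (ltW qr)).
- exact: subclosed_compact (@closed_closure _ O) Kc OK.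
- by move=> y /OK[z zq <-]; exact: Lp.
- move=> y /OK[z zq <-] nO; rewrite -(dm_0 M) !HzF//; last exact: inB.
  apply: Hc; apply/eqP; rewrite eq_le zq /= leNgt; apply/negP => lt.
  by apply: nO; exists z => //; rewrite /cball /= subr0.
- move=> y /OK[z zq <-] yx; apply: (dm_reg M (inB _ zq) _).1.
  by apply: contraNneq yx => ->; rewrite (dm_0 M).
Qed.

End GoodNeighbourhoods.

Section Trapping.
Context {R : realType}.
Local Notation C := (cplx R).
Variables (S T : surface R).
Hypotheses (mS : locally_modelled S) (mT : locally_modelled T).

(* A connected set on which zeta varies little cannot be carried across the
   frontier of a good neighbourhood, where the primitive is far from its central
   value. *)
Lemma trapping (phi : S -> T) A x (V : set S) zeta z (O : set T) xi c d M :
  continuous phi -> affine_map phi A -> frob A <= M ^+ 2 -> 0 < M ->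
  connected V -> V x -> (forall u, V u -> local_primitive u zeta) ->
  (forall u, V u -> cabs (zeta u - zeta x) < d) ->
  good_nbhd z O xi c -> M * d <= c / 2 ->
  O (phi x) -> cabs (xi (phi x) - xi z) < c / 2 ->
  forall u, V u -> O (phi u) /\ xi (phi u) - xi (phi x) = mx_act A (zeta u - zeta x).
Proof.
move=> cphi aphi AM M0 cV Vx Lz zd gn Md Ox xz.
pose P u := O (phi u) /\ xi (phi u) - xi (phi x) = mx_act A (zeta u - zeta x).
have rel u : V u -> closure O (phi u) -> \forall y \near u,
    xi (phi y) - xi (phi u) = mx_act A (zeta y - zeta u).
  by move=> Vu Ou; apply: affine_map_sing => //; [exact: Lz | exact: gn_prim gn _ Ou].
suff : V `<=` P by [].
apply: (@connected_clopen _ _ _ x) => //.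
- by split=> //; rewrite !subrr; congr Complex => /=; rewrite !mulr0 addr0.
- move=> u Vu [Ou Eu].
  have nO : nbhs u (phi @^-1` O).
    by apply: cphi; apply: open_nbhs_nbhs; split=> //; exact: gn_open gn.
  apply: filterS2 nO (rel u Vu (subset_closure Ou)) => y Oy Ey Vy; split=> //.
  have -> : xi (phi y) - xi (phi x) = (xi (phi y) - xi (phi u)) + (xi (phi u) - xi (phi x)) by ring.
  by rewrite Ey Eu -mx_actD; congr mx_act; ring.
move=> u Vu nPu; apply: contrapT => H; apply: nPu.
have HB B : nbhs u B -> exists2 y, B y & V y /\ P y.
  move=> nB; apply: contrapT => nBP; apply: H; apply: filterS nB => y By Vy Py.
  by apply: nBP; exists y.
have cO : closure O (phi u).
  move=> B nB; have nB' : nbhs u (phi @^-1` B) := cphi u _ nB.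
  by have [y By [_ [Oy _]]] := HB _ nB'; exists (phi y).
have [y Ey [Vy [_ Py]]] := HB _ (rel u Vu cO).
have Eu : xi (phi u) - xi (phi x) = mx_act A (zeta u - zeta x).
  have -> : xi (phi u) - xi (phi x) = (xi (phi y) - xi (phi x)) - (xi (phi y) - xi (phi u)) by ring.
  by rewrite Ey Py -mx_actB; congr mx_act; ring.
split=> //; apply: contrapT => nO.
have := gn_front gn cO nO; apply/negP; rewrite -ltNge.
have -> : xi (phi u) - xi z = (xi (phi u) - xi (phi x)) + (xi (phi x) - xi z) by ring.
rewrite (le_lt_trans (cabsD _ _))// [ltRHS]splitr Eu ler_ltD//.
rewrite (le_trans (mx_act_bound _ (ltW M0) AM))// (le_trans _ Md)// ler_pM2l// ltW//.
exact: zd.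
Qed.

End Trapping.

Lemma fun_choice (T U : Type) (P : T -> U -> Prop) :
  (forall x, exists y, P x y) -> exists f, forall x, P x (f x).
Proof.
by move=> H; exists (fun x => sval (cid (H x))) => x; exact: svalP (cid (H x)).
Qed.

(** Two members of the refined family that meet lie in a common Q z, so that local primitives on
    them can both be compared with one primitive on Q z. For a finite cover by sets P i whose
    closures lie in Q i, the neighbourhood V x stays in Q i if x is in that closure, and misses the
    closure otherwise. *)
Lemma star_refinement (T : topologicalType) (Q : T -> set T) :
  hausdorff_space T -> compact [set: T] -> (forall x, open (Q x) /\ Q x x) ->
  exists V : T -> set T, (forall x, nbhs x (V x)) /\
    forall x y, V x `&` V y !=set0 -> exists z, V x `|` V y `<=` Q z.
Proof.
move=> hT cT Qo.
have reg x : exists P, [/\ open P, P x & closure P `<=` Q x].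
  have nQ : nbhs x (Q x) by apply: open_nbhs_nbhs; exact: Qo.
  have [P nP PQ] := @compact_regular T x setT hT cT (@filterT _ (nbhs x) _) _ nQ.
  exists (P^°); split; first exact: open_interior.
    exact: nbhs_singleton (nbhs_interior nP).
  by apply: subset_trans PQ; apply: closureS; exact: interior_subset.
pose P x := sval (cid (reg x)).
have PP x : [/\ open (P x), P x x & closure (P x) `<=` Q x] := svalP (cid (reg x)).
have [s [_ sc]] : exists s : seq T, (forall x, x \in s -> setT x) /\
    forall y, setT y -> exists2 x, x \in s & P x y.
  by apply: compact_finite_cover => // x _; apply: open_nbhs_nbhs; have [] := PP x.
pose V x := [set y | forall i, i \in s ->
  (closure (P i) x -> Q i y) /\ (~ closure (P i) x -> ~ closure (P i) y)].
exists V; split=> [x|x y [w [Vx Vy]]].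
  rewrite /V; elim: (s) => [|i t IH]; first exact: filterS (@filterT _ (nbhs x) _).
  have [cx|ncx] := pselect (closure (P i) x).
    have nQ : nbhs x (Q i).
      apply: open_nbhs_nbhs; split; first exact: (Qo i).1.
      by have [_ _] := PP i; apply.
    by apply: filterS2 IH nQ => y H Qy j; rewrite in_cons => /orP[/eqP ->|/H].
  have nC : nbhs x (~` closure (P i)).
    apply: open_nbhs_nbhs; split=> //; apply: closed_openC; exact: closed_closure.
  by apply: filterS2 IH nC => y H Cy j; rewrite in_cons => /orP[/eqP ->|/H].
have [i si Pw] := sc w I; exists i.
have cw : closure (P i) w by exact: subset_closure.
have cx : closure (P i) x by apply: contrapT => n; exact: (Vx i si).2 n cw.
have cy : closure (P i) y by apply: contrapT => n; exact: (Vy i si).2 n cw.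
by move=> v [Vv|Vv]; [exact: (Vv i si).1 | exact: (Vv i si).1].
Qed.

Lemma pigeonhole (T : choiceType) (U : finType) (E : set T) (f : T -> U) :
  infinite_set E -> exists a b, [/\ E a, E b, a <> b & f a = f b].
Proof.
move=> iE; apply: contrapT => H; apply: iE.
have inj a b : E a -> E b -> f a = f b -> a = b.
  by move=> Ea Eb fab; apply: contrapT => ab; apply: H; exists a, b.
pose g (a : T) := if a \in E then Some (f a) else None.
apply: (@sub_finite_set _ _ (g @^-1` [set x | x != None])).
  by move=> a Ea; rewrite /= /g mem_set.
apply: finite_preimage; last exact: finite_finset.
move=> a b; rewrite !inE /= /g; case: ifP => // /set_mem Ea _; case: ifP => // /set_mem Eb _.
by move=> [/inj]; exact.
Qed.

Section Discreteness.
Context {R : realType}.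
Local Notation C := (cplx R).
Variable X : surface R.
Hypothesis hX : translation_surface X.
Let mX := surface_model hX.

(** By compactness H attains its maximum, and in a disc model there it is the real part of a
    non-constant holomorphic function, against [no_local_max]. *)
Lemma no_real_primitive (H : X -> R) (c : C) : c != 0 ->
  (forall x zeta, local_primitive x zeta ->
    \forall y \near x, H y - H x = reC (c * (zeta y - zeta x))) -> False.
Proof.
move=> c0 HH.
have Hc (x : X) : {for x, continuous H}.
  have [zeta Lz] := local_primitive_ex mX x.
  have zc := prim_at_continuous mX (local_primitive_prim_at Lz).
  apply/cvgrPdist_lt => e e0.
  have e1 : 0 < e / cabs c by rewrite divr_gt0// cabs_gt0.
  apply: filterS2 (HH _ _ Lz) ((cvg_cplx _ _).1 zc _ e1) => y Hy zy.
  rewrite distrC Hy (le_lt_trans (cabs_re _))// cabsM mulrC -ltr_pdivlMr ?cabs_gt0//.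
have [c1 [x1 [_ _ _]]] := ts_form_neq0 hX.
have [x _ Hx] := @compact_max R X setT H (ts_compact hX) (ex_intro _ x1 I) (fun x _ => Hc x).
have [zeta Lz] := local_primitive_ex mX x.
have [r0 [kap [h M0]]] := mX x.
have [r [rp rr HD]] := disc_shrink_in M0 (filterI (local_primitive_near Lz) (HH _ _ Lz)).
have M := disc_shrink M0 rp rr; have zB := cball_center (0 : C) rp.
apply: (@no_local_max R (fun z => c * (zeta (kap z) - zeta (kap 0))) (fun z => c * h z) r rp).
- move=> z zB' e e0; have e1 : 0 < e / cabs c by rewrite divr_gt0// cabs_gt0.
  have [d d0 Hd] := (dm_prim M zeta zB').1 (local_primitive_prim_at (HD _ zB').1) _ e1.
  exists d => // w /Hd /=.
  have -> : c * (zeta (kap w) - zeta (kap 0)) - c * (zeta (kap z) - zeta (kap 0)) -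
      c * h z * (w - z) = c * (zeta (kap w) - zeta (kap z) - h z * (w - z)) by ring.
  rewrite cabsM => K; rewrite (le_trans (ler_wpM2l (cabs_ge0 c) K))//.
  by rewrite le_eqVlt; apply/orP; left; apply/eqP; field; rewrite cabs_eq0.
- by move=> z zB' z0; rewrite mulf_neq0// (dm_reg M zB' z0).2.
- by rewrite subrr mulr0.
- by move=> z zB'; rewrite (dm_0 M) -(HD _ zB').2 subr_le0 Hx.
Qed.

Lemma no_affine_to_plane (del : X -> C) (N : 'M[R]_2) :
  (forall x zeta, local_primitive x zeta ->
    \forall y \near x, del y - del x = mx_act N (zeta y - zeta x)) -> N = 0.
Proof.
move=> H; apply: contrapT => N0.
have row (a b : R) (L : C -> R) : (forall z w, L (z - w) = L z - L w) ->
    (forall z, L (mx_act N z) = a * reC z + b * imC z) -> a = 0 /\ b = 0.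
  move=> LB LN; apply: contrapT => ab.
  (* The real linear form a x + b y is the real part of (a - i b) (x + i y). *)
  have c0 : (toC a (- b) : C) != 0.
    by rewrite toC_eq0 oppr_eq0; apply/negP => /andP[/eqP a0 /eqP b0]; apply: ab.
  apply: (no_real_primitive (H := L \o del) c0) => x zeta Lz.
  apply: filterS (H _ _ Lz) => y E; rewrite /= -LB E LN reCM /=; ring.
have [a0 b0] := row (N 0 0) (N 0 1) (@reC R) (@reCB R) (fun z => erefl).
have [c0 d0] := row (N 1 0) (N 1 1) (@imC R) (@imCB R) (fun z => erefl).
by apply: N0; apply: mx2_eq; rewrite !mxE.
Qed.

Lemma veech_frob_finite : frob_finite (veech_group X).
Proof.
move=> K0; apply: contrapT => inf.
have hXh := ts_hausdorff hX; have cX := ts_compact hX.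
pose M := Num.max K0 0 + 1.
have M1 : 1 <= M by rewrite lerDr le_max lexx orbT.
have M0 : 0 < M by rewrite (lt_le_trans ltr01).
have MK : K0 <= M ^+ 2.
  apply: (@le_trans _ _ M); last by rewrite expr2 ler_peMr// ltW.
  by apply: (@le_trans _ _ (Num.max K0 0)); rewrite ?le_max ?lexx// lerDl.
have [Q HQ] : exists Q : X -> set X * (X -> C), forall x,
    [/\ open (Q x).1, (Q x).1 x & primitive (Q x).1 (Q x).2].
  apply: (@fun_choice _ _ (fun x q => [/\ open q.1, q.1 x & primitive q.1 q.2])) => x.
  by have [zeta [U H]] := local_primitive_ex mX x; exists (U, zeta).
have [V [nV starV]] := star_refinement hXh cX (Q := fun x => (Q x).1)
  (fun x => let: And3 a b _ := HQ x in conj a b).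
have [g Hg] : exists g : X -> set X * (X -> C) * R, forall x,
    good_nbhd x (g x).1.1 (g x).1.2 (g x).2 /\ closure (g x).1.1 `<=` V x.
  apply: (@fun_choice _ _ (fun x q => good_nbhd x q.1.1 q.1.2 q.2 /\ closure q.1.1 `<=` V x)) => x.
  by have [N [z [c H]]] := good_nbhd_ex mX hXh (nV x); exists (N, z, c).
pose O x := (g x).1.1; pose ze x := (g x).1.2; pose c x := (g x).2.
have gn x : good_nbhd x (O x) (ze x) (c x) := (Hg x).1.
have subOV (x : X) : O x `<=` V x by move=> y /subset_closure /(Hg x).2.
(* The developed difference of two points does not depend on the neighbourhood chosen to measure it.
   This is the purpose of the star refinement. *)
have diffE i j a b : O i a -> O j a -> O i b -> O j b ->
    ze i b - ze i a = ze j b - ze j a.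
  move=> ia ja ib jb.
  have [k kQ] := starV i j (ex_intro _ a (conj (subOV _ _ ia) (subOV _ _ ja))).
  have [Qo _ Qp] := HQ k.
  have LQ z : (Q k).1 z -> local_primitive z (Q k).2 by move=> Qz; exists (Q k).1.
  have E l a' b' : (forall z, O l z -> (Q k).1 z) -> O l a' -> O l b' ->
      ze l b' - ze l a' = (Q k).2 b' - (Q k).2 a'.
    move=> lQ la lb.
    have := @prim_connected _ _ mX (O l) (Q k).2 (ze l) a' b' (gn_connected (gn l))
      (fun z Oz => LQ _ (lQ _ Oz)) (fun z Oz => gn_prim (gn l) (subset_closure Oz)) la lb.
    move=> E; have -> : ze l b' = (ze l b' - (Q k).2 b') + (Q k).2 b' by ring.
    by rewrite E; ring.
  by rewrite (E i)// ?(E j)// => z Oz; apply: kQ; [right | left]; exact: subOV.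
have [sz [_ szc]] : exists s : seq X, (forall x, x \in s -> setT x) /\
    forall y, setT y -> exists2 x, x \in s & (fun z => O z `&`
      [set y | cabs (ze z y - ze z z) < c z / 2]) x y.
  apply: compact_finite_cover => // z _; apply: filterI.
    by apply: open_nbhs_nbhs; split; [exact: gn_open (gn z) | exact: gn_x (gn z)].
  have zc := prim_at_continuous mX (local_primitive_prim_at
    (gn_prim (gn z) (subset_closure (gn_x (gn z))))).
  by apply: (cvg_cplx _ _).1 zc _ _; rewrite divr_gt0// (gn_gt0 (gn z)).
have [cm cm0 cmP] : exists2 cm : R, 0 < cm & forall z, z \in sz -> cm <= c z.
  elim: (sz) => [|z s [e e0 He]]; first by exists 1.
  exists (Num.min e (c z)); first by rewrite lt_min e0 (gn_gt0 (gn z)).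
  move=> y; rewrite in_cons => /orP[/eqP ->|/He ey]; rewrite ge_min ?lexx ?orbT//.
  by rewrite ey.
(* A variation rho of zeta in the source becomes at most M * rho = cm / 2 in the target, the margin
   that [trapping] allows. *)
pose rho := cm / 2 / M.
have rho0 : 0 < rho by rewrite !divr_gt0.
have [W HW] : exists W : X -> set X * (X -> C), forall x,
    [/\ nbhs x (W x).1, (W x).1 x, connected (W x).1,
     (forall u, (W x).1 u -> local_primitive u (W x).2) &
     forall u, (W x).1 u -> cabs ((W x).2 u - (W x).2 x) < rho].
  apply: (@fun_choice X (set X * (X -> C))%type (fun x q => [/\ nbhs x q.1, q.1 x, connected q.1,
     (forall u, q.1 u -> local_primitive u q.2) &
     forall u, q.1 u -> cabs (q.2 u - q.2 x) < rho])) => x.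
  have [zeta Lz] := local_primitive_ex mX x.
  have zc := prim_at_continuous mX (local_primitive_prim_at Lz).
  have [U [Uo Ux Uc UD _]] := connected_nbhd mX
    (filterI (local_primitive_near Lz) ((cvg_cplx _ _).1 zc _ rho0)).
  exists (U, zeta); split=> //=.
  - by apply: open_nbhs_nbhs.
  - by move=> u /UD[].
  - by move=> u /UD[].
have [sx [_ sxc]] : exists s : seq X, (forall x, x \in s -> setT x) /\
    forall y, setT y -> exists2 x, x \in s & (fun x => (W x).1) x y.
  by apply: compact_finite_cover => // x _; have [] := HW x.
pose E := veech_group X `&` [set g | frob g <= K0].
have [ph Hph] : exists ph : 'M[R]_2 -> sing_homeo X, forall A, E A ->
    affine_map (hfun (ph A)) A.
  have [phi0 _] : exists phi : sing_homeo X, True.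
    apply: contrapT => H; apply: inf; apply: (@sub_finite_set _ _ set0) => // A [[_ [phi _]] _].
    by apply: H; exists phi.
  have ex A : exists phi : sing_homeo X, E A -> affine_map (hfun phi) A.
    have [[[_ [phi /affine_mapP Hp]] _]|nE] := pselect (E A); first by exists phi.
    by exists phi0.
  exists (fun A => sval (cid (ex A))) => A; exact: svalP (cid (ex A)).
have zi (A : 'M[R]_2) x : exists2 z, z \in sz &
    O z (hfun (ph A) x) /\ cabs (ze z (hfun (ph A) x) - ze z z) < c z / 2.
  by have [z zs [a b]] := szc (hfun (ph A) x) I; exists z.
pose zz A x := s2val (cid2 (zi A x)).
have zzP A x : zz A x \in sz := s2valP (cid2 (zi A x)).
have zzO A x := s2valP' (cid2 (zi A x)).
(* A map is coded by the neighbourhoods into which it sends the finitely many test points sx.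
   Infinitely many derivatives of bounded norm would give two different ones with the same code. *)
pose code A := [ffun i : 'I_(size sx) => index (zz A (tnth (in_tuple sx) i)) sz : nat].
have codelt A i : (index (zz A (tnth (in_tuple sx) i)) sz < size sz)%N by rewrite index_mem.
pose code' A := [ffun i : 'I_(size sx) => Ordinal (codelt A i)].
have [A [B [EA EB AB cAB]]] := pigeonhole code' inf.
apply: AB; apply/eqP; rewrite -subr_eq0; apply/eqP.
have cphi A' : continuous (hfun (ph A')).
  by move=> x; exact: (@cts_fun _ _ (hfun (ph A')) x).
have same x : exists z, O z (hfun (ph A) x) /\ O z (hfun (ph B) x).
  have [y ys Wy] := sxc x I; have [nW Wyy cW LW dW] := HW y.
  have zAB : zz A y = zz B y.
    have /tnthP[i yi] : y \in in_tuple sx by [].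
    have := congr1 (fun f : {ffun 'I_(size sx) -> 'I_(size sz)} => val (f i)) cAB.
    rewrite !ffunE /= -yi => ii.
    by rewrite -(nth_index y (zzP A y)) -(nth_index y (zzP B y)) ii.
  have trap A' : E A' -> O (zz A' y) (hfun (ph A') x).
    move=> EA'; have [inO d1] := zzO A' y.
    apply: (trapping mX mX (@cphi A') (Hph _ EA') (le_trans EA'.2 MK) M0 cW Wyy LW dW (gn _) _ inO d1 Wy).1.
    rewrite /rho mulrC divfK ?gt_eqF// ler_pM2r ?invr_gt0//.
    by apply: cmP; exact: zzP.
  by exists (zz A y); split; [exact: trap | rewrite zAB; exact: trap].
pose k x := sval (cid (same x)).
have kP x : O (k x) (hfun (ph A) x) /\ O (k x) (hfun (ph B) x) := svalP (cid (same x)).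
(* The difference of the two developed images; by [diffE] the choice of k x does not affect it, and
   it is locally affine with linear part A - B. *)
pose del x := ze (k x) (hfun (ph A) x) - ze (k x) (hfun (ph B) x).
apply: (@no_affine_to_plane del) => x zeta Lz.
have [kOa kOb] := kP x.
have nO A' : O (k x) (hfun (ph A') x) -> nbhs x (hfun (ph A') @^-1` O (k x)).
  by move=> Oz; apply: cphi; apply: open_nbhs_nbhs; split=> //; exact: gn_open (gn _).
have rel A' : E A' -> O (k x) (hfun (ph A') x) -> \forall y \near x,
    ze (k x) (hfun (ph A') y) - ze (k x) (hfun (ph A') x) = mx_act A' (zeta y - zeta x).
  move=> EA' Oz; apply: affine_map_sing => //; first exact: Hph.
  exact: gn_prim (gn (k x)) _ (subset_closure Oz).
apply: filterS (filterI (filterI (nO _ kOa) (nO _ kOb)) (filterI (rel _ EA kOa) (rel _ EB kOb))).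
move=> y [[ya yb] [ra rb]]; have [kya kyb] := kP y.
have -> : del y = ze (k x) (hfun (ph A) y) - ze (k x) (hfun (ph B) y).
  exact: diffE.
by rewrite mx_act_subl -ra -rb /del; ring.
Qed.

End Discreteness.

(** * Paths, loops and lifts to the cover *)

Section Pasting.
Context {R : realType} {T : topologicalType}.

Lemma comp_continuous (A B D : topologicalType) (u : A -> B) (v : B -> D) :
  continuous u -> continuous v -> continuous (fun t => v (u t)).
Proof. by move=> uc vc t; exact: continuous_comp (uc t) (vc (u t)). Qed.

Lemma pasting (f g : R -> T) (u : R -> R) : continuous f -> continuous g -> continuous u ->
  (forall t, u t = 0 -> f t = g t) -> continuous (fun t => if 0 <= u t then f t else g t).
Proof.
move=> fc gc uc fg t A.
case: (ltgtP (u t) 0) => [ut|ut|ut]; rewrite ?ut ?lexx => nA.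
- have n1 : nbhs t (u @^-1` [set x | x < 0]).
    by apply: uc; apply: open_nbhs_nbhs; split=> //; exact: open_lt.
  have n2 : nbhs t (g @^-1` A) := gc t _ nA.
  by apply: filterS2 n1 n2 => s /= us As; rewrite leNgt us.
- have n1 : nbhs t (u @^-1` [set x | 0 < x]).
    by apply: uc; apply: open_nbhs_nbhs; split=> //; exact: open_gt.
  have n2 : nbhs t (f @^-1` A) := fc t _ nA.
  by apply: filterS2 n1 n2 => s /= us As; rewrite (ltW us).
have n2 : nbhs t (f @^-1` A) := fc t _ nA.
have n3 : nbhs t (g @^-1` A) by apply: gc; rewrite -fg.
by apply: filterS2 n2 n3 => s /= As Bs; case: ifP.
Qed.

Definition mk_cont (f : R -> T) (fc : continuous f) : continuousType R T :=
  HB.pack f (isContinuous.Build _ _ f fc).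

Definition joined (x y : T) := exists g : R -> T, [/\ continuous g, g 0 = x & g 1 = y].

Definition pcat (g1 g2 : R -> T) (t : R) : T :=
  if 0 <= 1 / 2 - t then g1 (2 * t) else g2 (2 * t - 1).

Lemma pcat_continuous (g1 g2 : R -> T) : continuous g1 -> continuous g2 -> g1 1 = g2 0 ->
  continuous (pcat g1 g2).
Proof.
move=> c1 c2 E; apply: (@pasting (fun t => g1 (2 * t)) (fun t => g2 (2 * t - 1)) (fun t => 1 / 2 - t)).
- by apply: comp_continuous c1 => t; apply: cvgMr; exact: cvg_id.
- by apply: comp_continuous c2 => t; apply: cvgB; [apply: cvgMr; exact: cvg_id | exact: cvg_cst].
- by move=> t; apply: cvgB; [exact: cvg_cst | exact: cvg_id].
move=> t /eqP; rewrite subr_eq0 => /eqP <-.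
by rewrite mul1r mulfV// subrr.
Qed.

Lemma pcat0 (g1 g2 : R -> T) : pcat g1 g2 0 = g1 0.
Proof. by rewrite /pcat subr0 divr_ge0// mulr0. Qed.

Lemma pcat1 (g1 g2 : R -> T) : pcat g1 g2 1 = g2 1.
Proof.
rewrite /pcat ifF; first by rewrite mulr1; congr g2; ring.
by apply/negbTE; rewrite -ltNge subr_lt0 ltr_pdivrMr// mul1r ltr1n.
Qed.

Lemma joined_trans x y z : joined x y -> joined y z -> joined x z.
Proof.
move=> [g1 [c1 h10 h11]] [g2 [c2 h20 h21]]; exists (pcat g1 g2); split.
- by apply: pcat_continuous => //; rewrite h11 h20.
- by rewrite pcat0.
- by rewrite pcat1.
Qed.

End Pasting.
Arguments joined R {T}.

Lemma coincidence (T Z : topologicalType) (A : set T) (a b : T -> Z) t0 :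
  hausdorff_space Z -> connected A -> continuous a -> continuous b ->
  (forall t, A t -> a t = b t -> \forall s \near t, A s -> a s = b s) ->
  A t0 -> a t0 = b t0 -> forall t, A t -> a t = b t.
Proof.
move=> hZ cA ca cb loc At0 E0; apply: (@connected_clopen _ A [set t | a t = b t] t0) => //.
move=> t At nE; apply: contrapT => H; apply: nE; apply: hZ => P Q nP nQ.
have n1 : nbhs t (a @^-1` P) := ca t _ nP.
have n2 : nbhs t (b @^-1` Q) := cb t _ nQ.
apply: contrapT => nPQ; apply: H; apply: filterS2 n1 n2 => t' Pt Qt _ E'.
by apply: nPQ; exists (a t'); split=> //; rewrite E'.
Qed.

Section PathConnected.
Context {R : realType}.
Local Notation C := (cplx R).

Lemma model_path (S : surface R) (x : S) r kap h z w : disc_model x r kap h ->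
  cball 0 r z -> cball 0 r w ->
  exists g : R -> S, [/\ continuous g, g 0 = kap z, g 1 = kap w &
    forall t, (kap @` cball 0 r) (g t)].
Proof.
move=> M zB wB.
have inB t : cball 0 r (cline z w (clamp 0 1 t)).
  by apply: cball_convex => //; apply: clamp_itv; exact: ler01.
exists (fun t => kap (cline z w (clamp 0 1 t))); split.
- move=> t; apply: (@continuous_comp _ _ _ (fun t => cline z w (clamp 0 1 t)) kap).
    by apply: continuous_comp; [exact: clamp_continuous | exact: cline_continuous].
  exact: dm_cont M _ (inB t).
- by rewrite clamp_id ?cline0// lexx ler01.
- by rewrite clamp_id ?cline1// lexx ler01.
- by move=> t; exists (cline z w (clamp 0 1 t)).
Qed.

(** That the joining paths remain in U is what continuity of lifted maps requires. *)
Lemma locally_joined (S : surface R) : locally_modelled S -> forall (x : S) D, nbhs x D ->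
  exists U, [/\ open U, U x, U `<=` D & forall y z, U y -> U z ->
    exists g : R -> S, [/\ continuous g, g 0 = y, g 1 = z & forall t, U (g t)]].
Proof.
move=> mS x D nD; have [r0 [kap [h M0]]] := mS x.
have [r [rp rr HD]] := disc_shrink_in M0 nD; have M := disc_shrink M0 rp rr.
exists (kap @` cball 0 r); split.
- exact: disc_image_open M (lexx _).
- by exists 0; [exact: cball_center | exact: dm_0 M].
- by move=> _ [z zB <-]; exact: HD.
- by move=> _ _ [z zB <-] [w wB <-]; exact: model_path M zB wB.
Qed.

Lemma all_joined (S : surface R) : locally_modelled S -> connected [set: S] ->
  forall x y : S, joined R x y.
Proof.
move=> mS cS x y.
have loc (z : S) : \forall w \near z, joined R z w /\ joined R w z.
  have [U [Uo Uz _ H]] := locally_joined mS (@filterT S (nbhs z) _).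
  have nU : nbhs z U by apply: open_nbhs_nbhs.
  apply: filterS nU => w Uw.
  have [g [c h0 h1 _]] := H _ _ Uz Uw; have [g' [c' h0' h1' _]] := H _ _ Uw Uz.
  by split; [exists g | exists g'].
apply: (@connected_clopen S setT [set y | joined R x y] x) => //.
- by rewrite /= /joined; exists (fun=> x); split=> //; exact: cst_continuous.
- by move=> z _ xz; apply: filterS (loc z) => w [zw _] _; exact: joined_trans xz zw.
- move=> z _ nxz; apply: filterS (loc z) => w [_ wz] _ xw.
  by apply: nxz; exact: joined_trans xw wz.
Qed.

End PathConnected.

(** * Lifting paths and homotopies *)

Section Lifting.
Context {R : realType} {X Y : topologicalType}.
Variable p : continuousType Y X.
Hypothesis cp : covering p.
Hypothesis hY : hausdorff_space Y.

Lemma lift_unique (T : topologicalType) (A : set T) (a b : T -> Y) t0 :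
  connected A -> continuous a -> continuous b -> (forall t, A t -> p (a t) = p (b t)) ->
  A t0 -> a t0 = b t0 -> forall t, A t -> a t = b t.
Proof.
move=> cA ca cb pab; apply: (coincidence hY cA ca cb) => t At E.
have [U [V [s [sh Va]]]] := covering_sheet cp (a t).
have nV : nbhs (a t) V by apply: open_nbhs_nbhs; split=> //; exact: sh_openV sh.
have n1 : nbhs t (a @^-1` V) := ca t _ nV.
have n2 : nbhs t (b @^-1` V) by apply: cb; rewrite -E.
apply: filterS2 n1 n2 => t' V1 V2 At'.
by rewrite -(sh_p sh V1).2 -(sh_p sh V2).2 pab.
Qed.

(** The path is stopped at time T by [clamp], so that every partial lift is defined on the whole
    line. The times T up to which a lift exists form a clopen part of the unit interval. *)
Lemma path_lift (g : R -> X) y : continuous g -> p y = g 0 ->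
  exists c : R -> Y, [/\ continuous c, c 0 = y & forall t, 0 <= t <= 1 -> p (c t) = g t].
Proof.
move=> gc py.
pose P T := exists c : R -> Y, [/\ continuous c, c 0 = y & forall t, p (c t) = g (clamp 0 T t)].
have restr T T' : 0 <= T' -> T' <= T -> P T -> P T'.
  move=> T0 TT [c [cc c0 pc]]; exists (c \o clamp 0 T'); split.
  - by move=> t; apply: continuous_comp; [exact: clamp_continuous | exact: cc].
  - by rewrite /= clamp_id ?lexx.
  - move=> t /=; rewrite pc (clamp_id (b := T))//.
    by have /andP[-> /le_trans->] := @clamp_itv R 0 T' t T0.
have step T0 : 0 <= T0 -> exists2 e : R, 0 < e & forall T T', 0 <= T -> T <= T' ->
    `|T - T0| < e -> `|T' - T0| < e -> P T -> P T'.
  move=> T00; have [U [Uo Ug Us]] := covering_even cp (g T0).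
  have : nbhs T0 (g @^-1` U) by apply: gc; apply: open_nbhs_nbhs.
  move=> /nbhs_ballP[e e0 He]; exists e => // T T' T_0 TT' Te Te' [c [cc c0 pc]].
  have inU t : T <= t <= T' -> U (g t).
    move=> /andP[t1 t2]; apply: He; rewrite /ball /= distrC.
    by move: Te Te'; rewrite !ltr_norml => /andP[? ?] /andP[? ?]; apply/andP; split; lra.
  have pT : p (c T) = g T by rewrite pc clamp_id// T_0 lexx.
  have [V [s [sh Vc]]] := Us (c T) ltac:(by rewrite pT; apply: inU; rewrite lexx TT').
  pose d t := s (g (clamp T T' t)).
  have cU t : U (g (clamp T T' t)) by apply: inU; exact: clamp_itv.
  exists (fun t => if 0 <= T - t then c t else d t); split.
  - apply: (@pasting _ _ c d (fun t => T - t)) => //.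
    + move=> t; apply: continuous_comp; last exact: sh_cont sh _ (cU t).
      by apply: continuous_comp; [exact: clamp_continuous | exact: gc].
    + by move=> t; apply: cvgB; [exact: cvg_cst | exact: cvg_id].
    + move=> t /eqP; rewrite subr_eq0 => /eqP <-.
      by rewrite /d clamp_id ?lexx// -pT (sh_p sh Vc).2.
  - by rewrite subr0 T_0.
  - move=> t; rewrite subr_ge0; have [tT|Tt] := leP t T.
      rewrite pc; congr g; rewrite /clamp (min_idPr tT).
      by rewrite (min_idPr (le_trans tT TT')).
    rewrite /d (sh_s sh (cU t)).2; congr g.
    rewrite /clamp !(max_idPr _)// le_min ?(le_trans T_0 TT') ?(le_trans T_0 (ltW Tt))//.
    by rewrite TT' ltW.
have P0 : P 0.
  exists (cst y); split=> // [t|t]; first exact: cvg_cst.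
  by rewrite /= py /clamp; congr g; apply/esym/max_idPl; rewrite ge_min lexx.
have [c [cc c0 pc]] : P 1.
  suff H : `[(0 : R), 1]%classic `<=` P by apply: H; rewrite /= in_itv /= ler01 lexx.
  apply: (@connected_clopen R `[0, 1]%classic P 0) => //.
  - exact: segment_connected.
  - by rewrite /= in_itv /= ler01 lexx.
  - move=> T; rewrite /= in_itv /= => /andP[T0 _] PT; have [e e0 He] := step T T0.
    apply/nbhs_ballP; exists e => //= T'; rewrite /ball /= distrC => Te /=.
    rewrite in_itv /= => /andP[T'0 _].
    have [TT'|/ltW T'T] := leP T T'; last exact: restr T'T PT.
    by apply: He PT => //; rewrite subrr normr0.
  - move=> T; rewrite /= in_itv /= => /andP[T0 _] nPT; have [e e0 He] := step T T0.
    apply/nbhs_ballP; exists e => //= T'; rewrite /ball /= distrC => Te /=.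
    rewrite in_itv /= => /andP[T'0 _] PT'; apply: nPT.
    have [TT'|/ltW T'T] := leP T T'; first exact: restr TT' PT'.
    by apply: He PT' => //; rewrite subrr normr0.
exists c; split=> // t t01; by rewrite pc clamp_id.
Qed.

(** The lifts K s come from separate choices and are continuous only in t. Joint continuity is
    derived by propagation from t = 0; it makes the endpoint locally constant in s, since its
    projection does not move. *)
Lemma homotopy_lift (H : R * R -> X) (K : R -> R -> Y) (h0 : R -> Y) :
  continuous H -> continuous h0 -> (forall s, continuous (K s)) ->
  (forall s, K s 0 = h0 s) -> (forall s t, 0 <= t <= 1 -> p (K s t) = H (s, t)) ->
  (forall s, H (s, 1) = H (0, 1)) -> forall s, K s 1 = K 0 1.
Proof.
move=> Hc h0c Kc K0 pK H1 s1.
(* Q s t: the lifts are jointly continuous at (s, t). *)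
pose Q s t := forall A, nbhs (K s t) A -> exists2 e : R, 0 < e &
  forall s' t', `|s' - s| < e -> `|t' - t| < e -> 0 <= t' <= 1 -> A (K s' t').
(* Near (s0, t0) the homotopy stays in an evenly covered set, so once the lifts at one time lie in a
   single sheet they coincide with its section applied to H. *)
have box s0 t0 : 0 <= t0 <= 1 -> exists2 e : R, 0 < e &
   (forall t1, 0 <= t1 <= 1 -> `|t1 - t0| < e -> Q s0 t1 ->
    forall t, 0 <= t <= 1 -> `|t - t0| < e -> Q s0 t) /\ (t0 = 0 -> Q s0 t0).
  move=> t01; have [U [Uo Ug Us]] := covering_even cp (H (s0, t0)).
  have : nbhs (s0, t0) (H @^-1` U) by apply: Hc; apply: open_nbhs_nbhs.
  move=> [[N J] /= [/nbhs_ballP[e1 e10 He1] /nbhs_ballP[e2 e20 He2]] NJ].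
  pose e := Num.min e1 e2; have e0 : 0 < e by rewrite lt_min e10.
  have inU s t : `|s - s0| < e -> `|t - t0| < e -> U (H (s, t)).
    rewrite !lt_min => /andP[s1' _] /andP[_ t2]; apply: (NJ (s, t)); split => /=.
      by apply: He1; rewrite /ball /= distrC.
    by apply: He2; rewrite /ball /= distrC.
  pose J1 := [set t : R | 0 <= t <= 1 /\ `|t - t0| < e].
  have J1c : connected J1.
    apply/connected_intervalP => a b [/andP[a0 a1] a2] [/andP[b0 b1] b2] t /andP[at' tb].
    split; first by rewrite (le_trans a0 at') (le_trans tb b1).
    by move: a2 b2; rewrite !ltr_norml => /andP[? ?] /andP[? ?]; apply/andP; split; lra.
  have s00 : `|s0 - s0| < e by rewrite subrr normr0.
  have spread V s t1 e' : sheet p U V s -> 0 < e' -> e' <= e -> J1 t1 ->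
      (forall s', `|s' - s0| < e' -> V (K s' t1)) ->
      forall s', `|s' - s0| < e' -> forall t, J1 t -> K s' t = s (H (s', t)).
    move=> sh e'0 e'e [t101 t1e] HV s' s's t [t01' te].
    have s'e := lt_le_trans s's e'e.
    pose lo := Num.min t t1; pose hi := Num.max t t1.
    have lohi : lo <= hi by rewrite /lo /hi ge_min le_max lexx.
    have cJ x : lo <= x <= hi -> J1 x.
      rewrite /lo /hi; move: t01' t101 te t1e; rewrite /J1 /= !ltr_norml.
      move=> /andP[? ?] /andP[? ?] /andP[? ?] /andP[? ?].
      by rewrite ge_min le_max => /andP[/orP[?|?] /orP[?|?]]; split; apply/andP; split; lra.
    have cJ' x : J1 (clamp lo hi x) by apply: cJ; exact: clamp_itv.
    have HU x : U (H (s', clamp lo hi x)) by apply: inU => //; exact: (cJ' x).2.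
    have tlh : lo <= t <= hi by rewrite /lo /hi ge_min le_max lexx.
    have t1lh : lo <= t1 <= hi by rewrite /lo /hi ge_min le_max lexx !orbT.
    have E := @lift_unique R `[lo, hi] (K s') (fun x => s (H (s', clamp lo hi x))) t1.
    rewrite E //.
    - by rewrite clamp_id.
    - exact: segment_connected.
    - move=> x; apply: continuous_comp; last exact: sh_cont sh _ (HU x).
      apply: continuous_comp; last exact: Hc.
      apply: (@cvg_pair _ _ _ (nbhs x) (nbhs s') (nbhs (clamp lo hi x))).
        exact: cvg_cst.
      exact: clamp_continuous.
    - move=> x; rewrite /= in_itv /= => xlh.
      by rewrite (sh_s sh (HU x)).2 clamp_id// pK//; exact: (cJ _ xlh).1.
    - rewrite clamp_id//; have V1 := HV _ s's.
      by rewrite -(sh_p sh V1).2 pK.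
  have fromV V s t1 e' : sheet p U V s -> 0 < e' -> e' <= e -> J1 t1 ->
      (forall s', `|s' - s0| < e' -> V (K s' t1)) -> forall t, J1 t -> Q s0 t.
    move=> sh e'0 e'e J1t1 HV t J1t A nA.
    have KE := spread V s t1 e' sh e'0 e'e J1t1 HV.
    have s0e' : `|s0 - s0| < e' by rewrite subrr normr0.
    have Ut := inU s0 t s00 J1t.2.
    have nA' : nbhs (s (H (s0, t))) A by rewrite -KE.
    have nH : nbhs (s0, t) (H @^-1` (s @^-1` A)).
      by apply: Hc; exact: sh_cont sh _ Ut A nA'.
    move: nH => [[N' J'] /= [/nbhs_ballP[d1 d10 Hd1] /nbhs_ballP[d2 d20 Hd2]] NJ'].
    pose d3 := e - `|t - t0|; have d30 : 0 < d3 by rewrite subr_gt0; exact: J1t.2.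
    exists (Num.min (Num.min d1 e') (Num.min d2 d3)); first by rewrite !lt_min d10 e'0 d20.
    move=> s' t'; rewrite !lt_min => /andP[/andP[a1 a2] _] /andP[_ /andP[b1 b2]] t'01.
    have J1t' : J1 t'.
      split=> //; rewrite -(subrK t t') -addrA (le_lt_trans (ler_normD _ _))//.
      by rewrite -ltrBrDr.
    rewrite KE//; apply: (NJ' (s', t')); split=> /=.
      by apply: Hd1; rewrite /ball /= distrC.
    by apply: Hd2; rewrite /ball /= distrC.
  exists e => //; split.
    move=> t1 t101 t1e Q1 t t01' te.
    have J1t1 : J1 t1 by [].
    have Ut1 := inU s0 t1 s00 t1e.
    have [V [s [sh Vk]]] := Us (K s0 t1) ltac:(by rewrite pK).
    have nV : nbhs (K s0 t1) V by apply: open_nbhs_nbhs; split=> //; exact: sh_openV sh.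
    have [d d0 Hd] := Q1 V nV.
    have e'0 : 0 < Num.min d e by rewrite lt_min d0 e0.
    have e'e : Num.min d e <= e by rewrite ge_min lexx orbT.
    apply: (fromV V s t1 _ sh e'0 e'e J1t1) => //.
    by move=> s'; rewrite lt_min => /andP[s'd _]; apply: Hd => //; rewrite subrr normr0.
  move=> t00.
  have J1t0 : J1 t0 by split=> //; rewrite subrr normr0.
  have [V [s [sh Vk]]] := Us (K s0 t0) ltac:(by rewrite pK//; apply: inU => //; exact: J1t0.2).
  have nV : nbhs (h0 s0) V.
    by apply: open_nbhs_nbhs; split; [exact: sh_openV sh | rewrite -K0 -t00].
  have /nbhs_ballP[d d0 Hd] : nbhs s0 (h0 @^-1` V) := h0c s0 V nV.
  have e'0 : 0 < Num.min d e by rewrite lt_min d0 e0.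
  have e'e : Num.min d e <= e by rewrite ge_min lexx orbT.
  apply: (fromV V s t0 _ sh e'0 e'e J1t0) => //.
  move=> s'; rewrite lt_min => /andP[s'd _]; rewrite t00 K0.
  by apply: Hd; rewrite /ball /= distrC.
have QA s t : 0 <= t <= 1 -> Q s t.
  suff QH : `[(0 : R), 1]%classic `<=` Q s by move=> t01; apply: QH; rewrite /= in_itv.
  apply: (@connected_clopen R `[0, 1]%classic (Q s) 0) => //.
  - exact: segment_connected.
  - by rewrite /= in_itv /= ler01 lexx.
  - by have [e e0 [_ H0]] := box s 0 ltac:(by rewrite ler01 lexx); exact: H0.
  - move=> t'; rewrite /= in_itv /= => t'01 Qt'; have [e e0 [He _]] := box s t' t'01.
    apply/nbhs_ballP; exists e => //= t2; rewrite /ball /= distrC => t2e.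
    rewrite in_itv /= => t201; apply: (He t') => //; by rewrite subrr normr0.
  - move=> t'; rewrite /= in_itv /= => t'01 nQt'; have [e e0 [He _]] := box s t' t'01.
    apply/nbhs_ballP; exists e => //= t2; rewrite /ball /= distrC => t2e.
    rewrite in_itv /= => t201 Qt2; apply: nQt'; apply: (He t2) => //; by rewrite subrr normr0.
have l01 : 0 <= (1 : R) <= 1 by rewrite ler01 lexx.
have loc s0 : \forall s \near s0, K s 1 = K s0 1.
  have [U [V [s [sh Vk]]]] := covering_sheet cp (K s0 1).
  have nV : nbhs (K s0 1) V by apply: open_nbhs_nbhs; split=> //; exact: sh_openV sh.
  have [e e0 He] := QA s0 1 l01 V nV.
  apply/nbhs_ballP; exists e => //= s'; rewrite /ball /= distrC => s'e.
  have V1 : V (K s' 1) by apply: He => //; rewrite subrr normr0.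
  by rewrite -(sh_p sh V1).2 -(sh_p sh Vk).2 !pK// H1 -(H1 s0).
apply: (@connected_clopen R setT [set s | K s 1 = K 0 1] 0) => //.
- by apply/connected_intervalP.
- by move=> s _ E; apply: filterS (loc s) => s' E' _; exact: etrans E' E.
- by move=> s _ nE; apply: filterS (loc s) => s' E' _ E2; apply: nE; exact: etrans (esym E') E2.
Qed.

End Lifting.

Section Periodization.
Context {R : realType}.

Definition frac (t : R) : R := t - (Num.floor t)%:~R.

Lemma floor_bounds (t : R) : (Num.floor t)%:~R <= t /\ t < (Num.floor t)%:~R + 1.
Proof. by have /andP[? ?] := floor_itv t; split=> //; rewrite -(intrD _ _ 1). Qed.

Lemma frac_itv t : 0 <= frac t <= 1.
Proof. by rewrite /frac; have [? ?] := floor_bounds t; apply/andP; split; lra. Qed.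

Lemma frac_period t : frac (t + 1) = frac t.
Proof. by rewrite /frac floorDrz ?rpred1// floor1 intrD; ring. Qed.

Lemma frac_id t : 0 <= t -> t < 1 -> frac t = t.
Proof.
move=> t0 t1; rewrite /frac (@floor_def _ t 0) ?subr0//.
by rewrite t0 add0r.
Qed.

Lemma frac1 : frac 1 = 0.
Proof. by rewrite -[1]add0r frac_period frac_id// ltr01. Qed.

Lemma frac_continuous (T : topologicalType) (a : R -> T) : continuous a -> a 0 = a 1 ->
  continuous (fun t => a (frac t)).
Proof.
move=> ac a01 t A; set n : R := (Num.floor t)%:~R => nA.
(* Near t the periodised path is given by these two branches, which match at the integer n because a
   0 = a 1. *)
pose u s := if 0 <= s - n then a (s - n) else a (s - n + 1).
have uc : continuous u.
  apply: (@pasting _ _ (fun s => a (s - n)) (fun s => a (s - n + 1)) (fun s => s - n)).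
  - by apply: comp_continuous ac => s; apply: cvgB; [exact: cvg_id | exact: cvg_cst].
  - apply: comp_continuous ac => s; apply: cvgD; last exact: cvg_cst.
    by apply: cvgB; [exact: cvg_id | exact: cvg_cst].
  - by move=> s; apply: cvgB; [exact: cvg_id | exact: cvg_cst].
  - by move=> s ->; rewrite add0r.
have nt : n <= t < n + 1 by have [? ?] := floor_bounds t; apply/andP.
have E s : `|s - t| < n + 1 - t -> n - 1 < s -> a (frac s) = u s.
  rewrite ltr_norml => /andP[_ s1] s2; rewrite /u /frac subr_ge0.
  have [ns|sn] := leP n s.
    by rewrite (@floor_def _ s (Num.floor t))// ns intrD; lra.
  rewrite (@floor_def _ s (Num.floor t - 1)); last first.
    by rewrite subrK intrB -/n; apply/andP; split; lra.
  by rewrite intrB -/n; congr a; ring.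
have ut : u t = a (frac t) by rewrite /u subr_ge0 (andP nt).1.
have n1 : nbhs t (u @^-1` A) by apply: uc; rewrite ut.
have n2 : nbhs t (ball t (n + 1 - t)) by apply: nbhsx_ballx; rewrite subr_gt0 (andP nt).2.
have n3 : nbhs t [set s : R | n - 1 < s].
  apply: open_nbhs_nbhs; split; first exact: open_gt.
  by rewrite /=; move: nt => /andP[? ?]; lra.
apply: filterS3 n1 n2 n3 => s As st ns; rewrite /= E //.
by move: st; rewrite /ball /= distrC.
Qed.

End Periodization.

Section Loops.
Context {R : realType} {X : topologicalType}.
Implicit Types g : loop R X.

Definition path_loop (a : R -> X) (ac : continuous a) (a01 : a 0 = a 1) : loop R X :=
  @Loop R X (mk_cont (frac_continuous ac a01)) (fun t => congr1 a (frac_period t)).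

Lemma path_loopE a ac a01 t : 0 <= t <= 1 -> @path_loop a ac a01 t = a t.
Proof.
move=> /andP[t0]; rewrite le_eqVlt => /orP[/eqP->|t1] /=; first by rewrite frac1.
by rewrite frac_id.
Qed.

Lemma loop_frac g t : g t = g (frac t).
Proof.
have P (n : nat) s : g (s + n%:R) = g s.
  by elim: n s => [|n IH] s; rewrite ?addr0// -natr1 addrA lfun_per.
rewrite /frac; case: (Num.floor t) => n.
  by transitivity (g (t - n%:R + n%:R)); [rewrite subrK | exact: P].
by rewrite NegzE mulrNz opprK; apply/esym/(P n.+1).
Qed.

Lemma loop_eq g g' : (forall t, 0 <= t <= 1 -> g t = g' t) -> g =1 g'.
Proof. by move=> E t; rewrite loop_frac E ?frac_itv// -loop_frac. Qed.

Lemma loop01 g : g 1 = g 0.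
Proof. by rewrite -[1]add0r lfun_per. Qed.

Lemma lcont g : continuous g.
Proof. by move=> t; exact: cts_fun. Qed.
Arguments lcont : clear implicits.

Lemma homotopy_ext g g' : g =1 g' -> based_homotopic g g'.
Proof.
move=> E; exists (fun st => g st.2); last by [].
split=> //.
- have c2 : continuous (@snd R R) by move=> st; exact: cvg_snd.
  exact: comp_continuous c2 (lcont g).
- by move=> s t; exact: lfun_per.
Qed.

Lemma H1_ext f g g' : @H1 R X f -> g =1 g' -> f g = f g'.
Proof. by move=> [fh _] /homotopy_ext[H H1 _]; apply: fh; exists H. Qed.

Lemma H1_cst f g x : @H1 R X f -> (forall t, g t = x) -> f g = 0.
Proof.
move=> [_ fc] gx; have : f g = f g + f g.
  by apply: fc; split=> [//|t _]; rewrite !gx.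
by move=> /eqP; rewrite -subr_eq0 opprD addrA subrr add0r oppr_eq0 => /eqP.
Qed.

(** A loop that factors through the line is contracted by scaling [sigma] to 0. *)
Lemma H1_null f g (sigma : R -> R) g' : @H1 R X f -> continuous sigma ->
  (forall t, sigma (t + 1) = sigma t) -> (forall t, g' t = g (sigma t)) -> f g' = 0.
Proof.
move=> fH sc sp E.
pose k := @path_loop (fun=> g 0) (@cst_continuous _ _ _) erefl.
rewrite -(@H1_cst f k (g 0))//; apply/esym/fH.1.
exists (fun st => g (st.1 * sigma st.2)); split.
- have c2 : continuous (fun st : R * R => st.1 * sigma st.2).
    move=> st; apply: cvgM; first exact: cvg_fst.
    by apply: (@continuous_comp _ _ _ (@snd R R) sigma); [exact: cvg_snd | exact: sc].
  exact: comp_continuous c2 (lcont g).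
- by move=> s t; rewrite /= sp.
- by move=> t; rewrite /= mul0r.
- by move=> t; rewrite /= mul1r E.
Qed.

Lemma cat_ex g1 g2 : g1 0 = g2 0 -> exists g, is_concat g1 g2 g.
Proof.
move=> E; have pc : continuous (pcat g1 g2).
  by apply: pcat_continuous; [exact: lcont | exact: lcont | rewrite loop01].
have p01 : pcat g1 g2 0 = pcat g1 g2 1 by rewrite pcat0 pcat1 loop01.
exists (path_loop pc p01); split=> // t /andP[t0 t1]; split.
  rewrite path_loopE; last by apply/andP; split; lra.
  by rewrite /pcat ifT; [congr (g1 _); field | lra].
rewrite path_loopE; last by apply/andP; split; lra.
rewrite /pcat; case: ifPn => [|_]; last by congr (g2 _); field.
move=> H; have -> : t = 0 by lra.
by rewrite addr0 mulrA mulr1 divff// loop01.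
Qed.

Lemma loop_rev_per g t : (fun s => g (- s)) (t + 1) = (fun s => g (- s)) t.
Proof. by rewrite /= opprD -(lfun_per g (- t - 1)) subrK. Qed.

Lemma loop_rev_cont g : continuous (fun t => g (- t)).
Proof. 
have c2 : continuous (fun t : R => - t) by move=> t; apply: cvgN; exact: cvg_id.
exact: comp_continuous c2 (lcont g). Qed.

Definition loop_rev g : loop R X := @Loop R X (mk_cont (@loop_rev_cont g)) (loop_rev_per g).

Lemma loop_revE g t : loop_rev g t = g (1 - t).
Proof. by rewrite /= addrC lfun_per. Qed.

Lemma H1_rev f g : @H1 R X f -> f (loop_rev g) = - f g.
Proof.
move=> fH; have rev0 : g 0 = loop_rev g 0 by rewrite /= oppr0.
(* The tent function from 0 up to 1 and back: g followed by its reverse is g composed with it, so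
   [H1_null] applies. *)
pose w (t : R) : R := pcat id (fun s : R => 1 - s) t.
have wc : continuous w.
  apply: pcat_continuous; rewrite ?subr0//; first by move=> t; exact: cvg_id.
  by move=> t; apply: cvgB; [exact: cvg_cst | exact: cvg_id].
have w01 : w 0 = w 1 by rewrite /w pcat0 pcat1 subrr.
have [h [_ gh]] := cat_ex rev0.
apply/eqP; rewrite -addr_eq0 addrC -(fH.2 _ _ h)//.
apply/eqP; apply: (@H1_null f g (fun t => w (frac t)) h fH).
- exact: frac_continuous.
- by move=> t; rewrite frac_period.
move=> t; rewrite loop_frac; move: (frac t) (frac_itv t) => s /andP[s0 s1].
rewrite /w /pcat subr_ge0; have [s12|s12] := leP s (1 / 2).
  by rewrite -(gh (2 * s) _).1; [congr (h _); field | apply/andP; split; lra].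
have -> : s = (1 + (2 * s - 1)) / 2 by field.
rewrite (gh (2 * s - 1) _).2; last by apply/andP; split; lra.
by rewrite loop_revE; congr (g _); field.
Qed.

End Loops.
Arguments lcont {R X} g.

(** * Monodromy and lifting of maps *)

Section AbelianCover.
Context {R : realType} {X Y : topologicalType}.
Variable p : continuousType Y X.

Definition lifts (y : Y) (g : R -> X) (z : Y) := exists c : R -> Y,
  [/\ continuous c, c 0 = y, c 1 = z & forall t, 0 <= t <= 1 -> p (c t) = g t].

Lemma pcont : continuous p.
Proof. by move=> y; exact: cts_fun. Qed.

Lemma lifts_p y g z : lifts y g z -> p y = g 0 /\ p z = g 1.
Proof.
by move=> [c [_ <- <- pc]]; split; apply: pc; rewrite ?lexx ?ler01.
Qed.

Lemma lifts_cat y z w (g1 g2 g : loop R X) : is_concat g1 g2 g ->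
  lifts y g1 z -> lifts z g2 w -> lifts y g w.
Proof.
move=> [_ gE] [c1 [cc1 c10 c11 pc1]] [c2 [cc2 c20 c21 pc2]].
exists (pcat c1 c2); split.
- by apply: pcat_continuous => //; rewrite c11 c20.
- by rewrite pcat0.
- by rewrite pcat1.
move=> t /andP[t0 t1]; rewrite /pcat subr_ge0; have [t12|t12] := leP t (1 / 2).
  have t01 : 0 <= 2 * t <= 1 by apply/andP; split; lra.
  by rewrite pc1// -(gE _ t01).1; congr (g _); field.
have t01 : 0 <= 2 * t - 1 <= 1 by apply/andP; split; lra.
by rewrite pc2// -(gE _ t01).2; congr (g _); field.
Qed.

Lemma lifts_rev y z (g : loop R X) : lifts y g z -> lifts z (loop_rev g) y.
Proof.
move=> [c [cc c0 c1 pc]]; exists (fun t => c (1 - t)); split.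
- by apply: comp_continuous cc => t; apply: cvgB; [exact: cvg_cst | exact: cvg_id].
- by rewrite subr0.
- by rewrite subrr.
by move=> t /andP[t0 t1]; rewrite loop_revE pc//; apply/andP; split; lra.
Qed.

Lemma lifts_map (Phi : Y -> Y) (phi : X -> X) y g z : continuous Phi ->
  (forall w, p (Phi w) = phi (p w)) -> lifts y g z -> lifts (Phi y) (phi \o g) (Phi z).
Proof.
move=> Pc PE [c [cc <- <- pc]]; exists (fun t => Phi (c t)); split=> //.
  exact: comp_continuous cc Pc.
by move=> t t01; rewrite PE pc.
Qed.

Hypothesis Ypath : forall y z : Y, joined R y z.

Lemma loop_between y z : p y = p z -> exists g : loop R X, lifts y g z.
Proof.
move=> E; have [c [cc c0 c1]] := Ypath y z.
have pc : continuous (fun t => p (c t)) := comp_continuous cc pcont.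
have pc01 : p (c 0) = p (c 1) by rewrite c0 c1.
by exists (path_loop pc pc01), c; split=> // t t01; rewrite path_loopE.
Qed.

Hypothesis cp : covering p.
Hypothesis hY : hausdorff_space Y.

Lemma lifts_ex y (g : R -> X) : continuous g -> p y = g 0 -> exists z, lifts y g z.
Proof. by move=> gc /(path_lift cp gc)[c [cc c0 pc]]; exists (c 1), c. Qed.

Lemma lifts_inj y g z z' : lifts y g z -> lifts y g z' -> z = z'.
Proof.
move=> [c [cc c0 <- pc]] [c' [cc' c0' <- pc']].
suff H : forall t, `[0, (1 : R)]%classic t -> c t = c' t.
  by apply: H; rewrite /= in_itv /= lexx ler01.
apply: (@lift_unique X Y p cp hY R _ c c' 0) => //.
- exact: segment_connected.
- by move=> t; rewrite /= in_itv /= => t01; rewrite pc ?pc'.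
- by rewrite /= in_itv /= lexx ler01.
- by rewrite c0 c0'.
Qed.

Context {d : nat} {f : 'I_d -> cochain R X}.
Hypothesis fH : forall i, @H1 R X (f i).
Hypothesis ac : abelian_cover p f.

(** A loop killed by the classes is homotopic to the projection of a closed loop, and lifting the
    homotopy fixes the endpoint, so its own lift closes up. *)
Lemma lifts_closed y (g : loop R X) z : lifts y g z -> (forall i, f i g = 0) <-> z = y.
Proof.
move=> L; have [py pz] := lifts_p L; have [_ _ acP] := ac.
have := acP y g (esym py) => -[H1 H2]; split.
  move=> /H1[h h0 [H [Hc Hp H0 H1'] Hb]].
  have Kex s : exists c : R -> Y, [/\ continuous c, c 0 = y &
      forall t, 0 <= t <= 1 -> p (c t) = H (s, t)].
    apply: (path_lift cp); last by rewrite Hb.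
    have ec : continuous (fun t : R => (s, t)).
      move=> t; apply: (@cvg_pair _ _ _ (nbhs t) (nbhs s) (nbhs t)); last exact: cvg_id.
      exact: cvg_cst.
    exact: comp_continuous ec Hc.
  have [K KP] := fun_choice Kex.
  have E : K 1 1 = K 0 1.
    apply: (@homotopy_lift R X Y p cp hY H K (cst y)) => //.
    - exact: cst_continuous.
    - by move=> s; have [] := KP s.
    - by move=> s; have [] := KP s.
    - by move=> s; have [] := KP s.
    - by move=> s; rewrite -[1 in LHS]add0r -[X in _ = H (_, X)]add0r !Hp !Hb.
  have L0 : lifts y g (K 0 1).
    by have [c c0 pc] := KP 0; exists (K 0); split=> // t t01; rewrite pc// H0.
  have L1 : lifts y (loop_map p h) (K 1 1).
    by have [c c0 pc] := KP 1; exists (K 1); split=> // t t01; rewrite pc// H1'.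
  have L2 : lifts y (loop_map p h) y.
    by exists h; split=> //; [exact: lcont | rewrite loop01].
  by rewrite (lifts_inj L L0) -E (lifts_inj L1 L2).
move=> zy; apply: H2; move: L; rewrite zy => -[c [cc c0 c1 pc]].
have c01 : c 0 = c 1 by rewrite c0 c1.
exists (path_loop cc c01); first by rewrite path_loopE ?lexx ?ler01.
apply: homotopy_ext; apply: loop_eq => t t01.
by rewrite -pc// -(path_loopE cc c01 t01).
Qed.

Lemma lifts_eq y (g g' : loop R X) z z' : lifts y g z -> lifts y g' z' ->
  (forall i, f i g = f i g') <-> z = z'.
Proof.
move=> L L'; have Lr := lifts_rev L.
have E : loop_rev g 0 = g' 0 by rewrite loop_revE subr0 -(lifts_p L').1 (lifts_p L).1 loop01.
have [h hc] := cat_ex E; have Lh := lifts_cat hc Lr L'.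
have fh i : f i h = f i g' - f i g by rewrite ((fH i).2 _ _ _ hc) H1_rev// addrC.
have [A B] := lifts_closed Lh; split.
  by move=> fg; apply/esym/A => i; rewrite fh fg subrr.
move=> zz' i; apply/eqP; rewrite eq_sym -subr_eq0 -fh; apply/eqP.
by apply: B; rewrite zz'.
Qed.

Hypothesis Yloc : forall (y : Y) D, nbhs y D ->
  exists U, [/\ open U, U y, U `<=` D & forall z w, U z -> U w ->
    exists g : R -> Y, [/\ continuous g, g 0 = z, g 1 = w & forall t, U (g t)]].

(** The lifting criterion: Phi z is the endpoint of the lift, from y1, of the image under phi of a
    path from y0 to z. *)
Lemma map_lift (phi : continuousType X X) y0 y1 :
  (forall i g, f i (loop_map phi g) = f i g) -> p y1 = phi (p y0) ->
  exists Phi : Y -> Y, [/\ continuous Phi, Phi y0 = y1 & forall z, p (Phi z) = phi (p z)].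
Proof.
move=> fphi py1.
pose rel z w := exists c e : R -> Y, [/\ continuous c, continuous e, c 0 = y0 /\ c 1 = z,
  e 0 = y1 /\ e 1 = w & forall t, 0 <= t <= 1 -> p (e t) = phi (p (c t))].
have phic : continuous phi by move=> x; exact: cts_fun.
have rel_ex z : exists w, rel z w.
  have [c [cc c0 c1]] := Ypath y0 z.
  have gc : continuous (fun t => phi (p (c t))).
    exact: comp_continuous (comp_continuous cc pcont) phic.
  have [e [ec e0 pe]] := path_lift cp gc (y := y1) ltac:(by rewrite /= c0).
  by exists (e 1), c, e.
have rel_p z w : rel z w -> p w = phi (p z).
  by move=> [c [e [_ _ [_ <-] [_ <-] pe]]]; apply: pe; rewrite ler01 lexx.
have l01 : 0 <= (1 : R) <= 1 by rewrite ler01 lexx.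
(* Two paths from y0 to z form a closed loop, which the classes kill; phi preserves the classes, so
   the image loop lifts to a closed K. Its first half is e and its second half e' reversed, and they
   meet at time 1 / 2. *)
have rel_inj z w w' : rel z w -> rel z w' -> w = w'.
  move=> [c [e [cc ec [c0 c1] [e0 e1] pe]]] [c' [e' [cc' ec' [c0' c1'] [e0' e1'] pe']]].
  pose back (a : R -> Y) t := a (1 - t).
  have backc a : continuous a -> continuous (back a).
    by move=> ac'; apply: comp_continuous ac' => t; apply: cvgB; [exact: cvg_cst | exact: cvg_id].
  have bc0 : c 1 = back c' 0 by rewrite /back subr0 c1 c1'.
  have lc : continuous (pcat c (back c')) by apply: pcat_continuous => //; exact: backc.
  have l0 : pcat c (back c') 0 = y0 by rewrite pcat0.
  have l1 : pcat c (back c') 1 = y0 by rewrite pcat1 /back subrr.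
  have lE : pcat c (back c') 0 = pcat c (back c') 1 by rewrite l0 l1.
  pose g := loop_map p (path_loop lc lE).
  have Lg : lifts y0 g y0.
    exists (pcat c (back c')); split=> // t t01.
    by rewrite /g /loop_map -(path_loopE lc lE t01).
  have g0 : forall i, f i g = 0 by apply/(lifts_closed Lg).
  have phig0 : phi (g 0) = p y1 by rewrite py1 -(lifts_p Lg).1.
  have [k Lk] := @lifts_ex y1 (loop_map phi g) (@lcont R X _) (esym phig0).
  have ky1 : k = y1 by apply/(lifts_closed Lk) => i; rewrite fphi.
  case: Lk => K [Kc K0 K1 pK].
  have gE t : 0 <= t <= 1 -> g t = p (pcat c (back c') t).
    by move=> t01; rewrite /g /loop_map -(path_loopE lc lE t01).
  have half1 t : `[0, (1 / 2 : R)]%classic t -> K t = e (2 * t).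
    apply: (@lift_unique X Y p cp hY R _ K (fun t => e (2 * t)) 0) => //.
    - exact: segment_connected.
    - by apply: comp_continuous ec => s; apply: cvgMr; exact: cvg_id.
    - move=> s; rewrite /= in_itv /= => /andP[s0 s1].
      rewrite pK; last by apply/andP; split; lra.
      transitivity (phi (p (pcat c (back c') s))).
        by rewrite -gE//; apply/andP; split; lra.
      by rewrite /pcat subr_ge0 s1 pe//; apply/andP; split; lra.
    - by rewrite /= in_itv /=; apply/andP; split; lra.
    - by rewrite mulr0 e0.
  have half2 t : `[(1 / 2 : R), 1]%classic t -> K t = e' (2 - 2 * t).
    apply: (@lift_unique X Y p cp hY R _ K (fun t => e' (2 - 2 * t)) 1) => //.
    - exact: segment_connected.
    - apply: comp_continuous ec' => s; apply: cvgB; first exact: cvg_cst.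
      by apply: cvgMr; exact: cvg_id.
    - move=> s; rewrite /= in_itv /= => /andP[s0 s1].
      rewrite pK; last by apply/andP; split; lra.
      transitivity (phi (p (pcat c (back c') s))).
        by rewrite -gE//; apply/andP; split; lra.
      rewrite pe'; last by apply/andP; split; lra.
      rewrite /pcat subr_ge0; have [s12|_] := leP s (1 / 2).
        have -> : s = 1 / 2 by lra.
        have -> : 2 * (1 / 2) = 1 :> R by field.
        by rewrite c1 -c1'; congr (phi (p (c' _))); ring.
      by rewrite /back; congr (phi (p (c' _))); ring.
    - by rewrite /= in_itv /=; apply/andP; split; lra.
    - by rewrite mulr1 subrr K1 ky1 e0'.
  have in1 : `[0, (1 / 2 : R)]%classic (1 / 2) by rewrite /= in_itv /=; apply/andP; split; lra.
  have in2 : `[(1 / 2 : R), 1]%classic (1 / 2) by rewrite /= in_itv /=; apply/andP; split; lra.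
  have := half1 _ in1; rewrite (half2 _ in2).
  have -> : 2 * (1 / 2) = 1 :> R by field.
  have -> : 2 - 1 = 1 :> R by ring.
  by rewrite e1 e1' => ->.
have [Phi PhiP] := fun_choice rel_ex; exists Phi.
have PhiE z : p (Phi z) = phi (p z) by exact: rel_p.
split=> //; last first.
  apply: rel_inj (PhiP y0) _; exists (fun=> y0), (fun=> y1).
  by split=> //; exact: cst_continuous.
move=> z A nA.
have [U [V [s [sh Vw]]]] := covering_sheet cp (Phi z).
have Uz : U (phi (p z)) by rewrite -PhiE; exact: (sh_p sh Vw).1.
have nU : nbhs z (fun z' => U (phi (p z'))).
  apply: (comp_continuous pcont phic); apply: open_nbhs_nbhs; split=> //.
  exact: sh_openU sh.
have [W [Wo Wz WU Wpath]] := Yloc nU.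
have E z' : W z' -> Phi z' = s (phi (p z')).
  move=> Wz'; have [g [gc g0 g1 gW]] := Wpath _ _ Wz Wz'.
  apply: rel_inj (PhiP z') _.
  have [c [e [cc ec [c0 c1] [e0 e1] pe]]] := PhiP z.
  have sE : s (phi (p (g 0))) = Phi z by rewrite g0 -PhiE (sh_p sh Vw).2.
  exists (pcat c g), (pcat e (fun t => s (phi (p (g t))))); split.
  - by apply: pcat_continuous => //; rewrite c1 g0.
  - apply: pcat_continuous => //; last by rewrite e1 sE.
    move=> t; apply: continuous_comp; last by apply: (sh_cont sh); exact/WU/gW.
    exact: (comp_continuous (comp_continuous gc pcont) phic).
  - by rewrite pcat0 pcat1.
  - by rewrite pcat0 pcat1 g1.
  move=> t /andP[t0 t1]; rewrite /pcat subr_ge0; have [t12|t12] := leP t (1 / 2).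
    by apply: pe; apply/andP; split; lra.
  by rewrite (sh_s sh (WU _ (gW _))).2.
have n1 : nbhs z W by apply: open_nbhs_nbhs.
have n2 : nbhs z (fun z' => A (s (phi (p z')))).
  have c3 : {for z, continuous (fun z' => s (phi (p z')))}.
    apply: (@continuous_comp _ _ _ (fun z' => phi (p z')) s); last exact: (sh_cont sh).
    exact: (comp_continuous pcont phic).
  by apply: c3; rewrite -E.
by apply: filterS2 n1 n2 => z' /E /= -> .
Qed.

End AbelianCover.

(** * Translations of the cover *)

Section PullbackTransfer.
Context {R : realType}.
Local Notation C := (cplx R).

Lemma prim_at_near (S : surface R) (x : S) (zeta xi : S -> C) :
  (\forall y \near x, zeta y = xi y) -> prim_at x zeta -> prim_at x xi.
Proof.
move=> E P c cA cx; apply/diff_wrtP => e e0; have /diff_wrtP/(_ e e0) H := P c cA cx.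
have Ex := nbhs_singleton E; by apply: filterS2 E H => y <-; rewrite Ex.
Qed.

Context {X : surface R} {Y : topologicalType}.
Variable p : continuousType Y X.
Hypothesis hX : translation_surface X.
Hypothesis cp : covering p.
Local Notation S := (pullback p).

Lemma local_primitive_down U V s (y : Y) zeta : sheet p U V s -> V y ->
  @local_primitive R S y zeta -> local_primitive (p y) (zeta \o s).
Proof.
move=> sh Vy [W [Wo Wy Wp]]; exists (p @` (W `&` V)); split.
- by apply: covering_open => //; apply: openI => //; exact: sh_openV sh.
- by exists y.
- move=> x c [y' [Wy' Vy'] <-] cA cx.
  have /(prim_at_pullback hX _ sh Vy') : @prim_at R S y' zeta by move=> c' *; exact: Wp.
  exact.
Qed.

Lemma local_primitive_up (y : Y) (zeta : X -> C) :
  local_primitive (p y) zeta -> @local_primitive R S y (zeta \o p).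
Proof.
move=> [W [Wo Wy Wp]]; have [U [V [s [sh Vy]]]] := covering_sheet cp y.
exists (p @^-1` W `&` V); split.
- apply: openI; last exact: sh_openV sh.
  by apply: open_comp => // z _; exact: pcont.
- by [].
- move=> z c [Wz Vz] cA cz.
  suff : @prim_at R S z (zeta \o p) by exact.
  apply/(prim_at_pullback hX _ sh Vz).
  have P : prim_at (p z) zeta by move=> c' *; exact: Wp.
  apply: prim_at_near P; have Uz := (sh_p sh Vz).1.
  have nU : nbhs (p z) U by apply: open_nbhs_nbhs; split=> //; exact: sh_openU sh.
  by apply: filterS nU => u Uu; rewrite /= (sh_s sh Uu).2.
Qed.

Lemma affine_up (phi : X -> X) (Phi : Y -> Y) A : continuous Phi ->
  (forall z, p (Phi z) = phi (p z)) -> affine_map phi A -> @affine_map R S S Phi A.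
Proof.
move=> Pc PE pA y zeta xi ny zP xP.
have [U [V [s [sh Vy]]]] := covering_sheet cp y.
have [U' [V' [s' [sh' Vy']]]] := covering_sheet cp (Phi y).
have zP' := local_primitive_down sh Vy zP.
have xP' := local_primitive_down sh' Vy' xP.
have xP2 : local_primitive (phi (p y)) (xi \o s') by rewrite -PE.
have H := pA _ _ _ ny zP' xP2.
have n1 : nbhs y (p @^-1` [set u | (xi \o s') (phi u) - (xi \o s') (phi (p y)) =
    mx_act A ((zeta \o s) u - (zeta \o s) (p y))]) by apply: (@pcont _ _ p y).
have n2 : nbhs y V by apply: open_nbhs_nbhs; split=> //; exact: sh_openV sh.
have n3 : nbhs y (Phi @^-1` V').
  by apply: Pc; apply: open_nbhs_nbhs; split=> //; exact: sh_openV sh'.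
apply: filterS3 n1 n2 n3 => z E Vz Vz'; move: E.
by rewrite /= -!PE (sh_p sh' Vz').2 (sh_p sh' Vy').2 (sh_p sh Vz).2 (sh_p sh Vy).2.
Qed.

Lemma affine_down (phi : X -> X) (Phi : Y -> Y) A : continuous Phi ->
  (forall z, p (Phi z) = phi (p z)) -> @affine_map R S S Phi A -> affine_map phi A.
Proof.
move=> Pc PE PA x zeta xi nx zP xP.
have [y yx] := cp.1 x; move: nx zP xP; rewrite -yx => nx zP xP.
have xP' : local_primitive (p (Phi y)) xi by rewrite PE.
have H := PA y _ _ nx (local_primitive_up zP) (local_primitive_up xP').
have [U [V [s [sh Vy]]]] := covering_sheet cp y.
have Uy := (sh_p sh Vy).1.
have n1 : nbhs (p y) U by apply: open_nbhs_nbhs; split=> //; exact: sh_openU sh.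
have n2 : nbhs (p y) (s @^-1` [set z | (xi \o p) (Phi z) - (xi \o p) (Phi y) =
    mx_act A ((zeta \o p) z - (zeta \o p) y)]).
  by apply: (sh_cont sh Uy); rewrite (sh_p sh Vy).2.
apply: filterS2 n1 n2 => u Uu; rewrite /= !PE (sh_s sh Uu).2.
by [].
Qed.

End PullbackTransfer.

Section Automorphisms.
Context {R : realType} {S : surface R}.
Hypothesis mS : locally_modelled S.

Record aff (phi phi' : S -> S) (A : 'M[R]_2) : Prop := {
  aff_cont : continuous phi;
  aff_cont' : continuous phi';
  aff_K : cancel phi phi';
  aff_K' : cancel phi' phi;
  aff_sing : forall x, ~ sing x -> ~ sing (phi x);
  aff_sing' : forall x, ~ sing x -> ~ sing (phi' x);
  aff_map : affine_map phi A }.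

Lemma aff_homeo phi phi' A : aff phi phi' A ->
  exists2 h : sing_homeo S, affine_with_derivative h A & hfun h = phi :> (S -> S).
Proof.
move=> a.
pose F : continuousType S S := HB.pack phi (isContinuous.Build _ _ phi (aff_cont a)).
pose F' : continuousType S S := HB.pack phi' (isContinuous.Build _ _ phi' (aff_cont' a)).
have E : F @` @sing R S = @sing R S.
  apply/seteqP; split=> [_ [x sx <-]|x sx]; last first.
    exists (phi' x); last exact: (aff_K' a).
    by apply: contrapT => /(aff_sing a); rewrite (aff_K' a).
  by apply: contrapT => /(aff_sing' a); rewrite (aff_K a).
exists (@SingHomeo R S F F' (aff_K a) (aff_K' a) E) => //.
by apply/affine_mapP => //; exact: aff_map a.
Qed.

Lemma homeo_aff (h : sing_homeo S) A : affine_with_derivative h A -> aff (hfun h) (hinv h) A.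
Proof.
move=> hA; split.
- by move=> x; exact: cts_fun.
- by move=> x; exact: cts_fun.
- exact: hfunK.
- exact: hinvK.
- move=> x nx sx; apply: nx; move: sx; rewrite -{1}(hfun_sing h) => -[y sy /(can_inj (hfunK h)) <-].
  exact: sy.
- move=> x nx sx; apply: nx; rewrite -(hinvK h x) -(hfun_sing h).
  by exists (hinv h x).
- exact/affine_mapP.
Qed.

Lemma aff_id : aff id id 1.
Proof. by split=> //; [move=> x; exact: cvg_id|move=> x; exact: cvg_id|exact: affine_map_id]. Qed.

Lemma aff_comp phi phi' A psi psi' B : aff phi phi' A -> aff psi psi' B ->
  aff (psi \o phi) (phi' \o psi') (B * A).
Proof.
move=> a b; split.
- exact: comp_continuous (aff_cont a) (aff_cont b).
- exact: comp_continuous (aff_cont' b) (aff_cont' a).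
- by move=> x; rewrite /= (aff_K b) (aff_K a).
- by move=> x; rewrite /= (aff_K' a) (aff_K' b).
- by move=> x /(aff_sing a)/(aff_sing b).
- by move=> x /(aff_sing' b)/(aff_sing' a).
- exact: (affine_map_comp mS (aff_cont a) (aff_sing a) (aff_map a) (aff_map b)).
Qed.

Lemma aff_inv phi phi' A : \det A = 1 -> aff phi phi' A -> aff phi' phi (invmx A).
Proof.
move=> dA a; split; try by case: a.
exact: (affine_map_inv (aff_K a) (aff_K' a) (aff_cont' a) (aff_sing' a) dA (aff_map a)).
Qed.

Lemma veech_aff A : veech_group S A <-> \det A = 1 /\ exists phi phi', aff phi phi' A.
Proof.
split=> -[dA].
  by move=> [h /homeo_aff a]; split=> //; exists (hfun h), (hinv h).
by move=> [phi [phi' /aff_homeo[h ? _]]]; split=> //; exists h.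
Qed.

End Automorphisms.

(** Induction on d: an element u of L with smallest positive last coordinate splits L into the
    multiples of u and the sublattice with last coordinate 0. Indices are natural numbers so that
    the type does not change; coordinates from d on are ignored. *)
Lemma lattice_quotient (m d : nat) (L : set (nat -> int)) : (0 < m)%N ->
  L (fun=> 0) -> (forall v w, L v -> L w -> L (fun i => v i - w i)) ->
  exists s : seq (nat -> int), (forall e, e \in s -> L e) /\
    forall v, L v -> exists e w, [/\ e \in s, L w &
      forall i, (i < d)%N -> v i = e i + m%:Z * w i].
Proof.
move=> m0; elim: d L => [|d IH] L L0 LB.
  exists [:: fun=> 0]; split=> [e|v Lv]; first by rewrite inE => /eqP->.
  by exists (fun=> 0), v; rewrite inE.
have LE v w : L v -> v =1 w -> L w by move=> Lv /funext<-.
have LN v : L v -> L (fun i => - v i).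
  by move=> Lv; apply: LE (LB _ _ L0 Lv) _ => i /=; rewrite sub0r.
have LD v w : L v -> L w -> L (fun i => v i + w i).
  by move=> Lv Lw; apply: LE (LB _ _ Lv (LN _ Lw)) _ => i /=; rewrite opprK.
have LM (k : int) v : L v -> L (fun i => k * v i).
  have LMn (n : nat) w : L w -> L (fun i => n%:Z * w i).
    move=> Lw; elim: n => [|n IHn]; first by apply: LE L0 _ => i; rewrite mul0r.
    by apply: LE (LD _ _ Lw IHn) _ => i /=; rewrite intS mulrDl mul1r.
  case: k => n Lv; first exact: LMn.
  by apply: LE (LN _ (LMn n.+1 v Lv)) _ => i /=; rewrite NegzE mulNr.
have [[u0 [Lu0 /eqP u0d]]|H] := pselect (exists v, L v /\ v d <> 0); last first.
  have Ld v : L v -> v d = 0 by move=> Lv; apply: contrapT => vd; apply: H; exists v.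
  have [s [sL Hs]] := IH L L0 LB; exists s; split=> // v Lv.
  have [e [w [es Lw E]]] := Hs v Lv; exists e, w; split=> // i.
  rewrite ltnS leq_eqVlt => /orP[/eqP->|/E//].
  by rewrite (Ld _ Lv) (Ld _ (sL _ es)) (Ld _ Lw) mulr0 addr0.
(* The shift by 1 restricts the search to positive last coordinates. *)
pose P n := `[< exists u, L u /\ u d = n.+1%:Z >].
have exP : exists n, P n.
  exists (`|u0 d|.-1)%N; apply/asboolP.
  rewrite prednK ?absz_gt0// abszE; have [_|_] := ger0P (u0 d); first by exists u0.
  by exists (fun i => - u0 i); split=> //; exact: LN.
have /ex_minnP[n /asboolP[u [Lu ud]] min] := exP.
have c0 : n.+1%:Z != 0 by [].
have dvd v : L v -> v d = (v d %/ n.+1%:Z)%Z * n.+1%:Z.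
  move=> Lv; have := divz_eq (v d) n.+1; set q := (_ %/ _)%Z => E.
  have Lr := LB _ _ Lv (LM q _ Lu).
  suff r0 : (v d %% n.+1)%Z = 0 by move: E; rewrite r0 addr0.
  have := modz_ge0 (v d) c0; have := ltz_mod (v d) c0.
  case Er : (v d %% n.+1)%Z => [[|r]|//]// rn _.
  have : P r.
    apply/asboolP; exists (fun i => v i - q * u i); split=> //.
    by rewrite /= ud -Er {1}E; ring.
  move=> /min; rewrite leqNgt; by move: rn; rewrite ger0_norm// ltz_nat ltnS => ->.
have [] := IH [set v | L v /\ v d = 0].
- by split.
- by move=> v w [Lv vd] [Lw wd]; split; [exact: LB | rewrite vd wd subrr].
move=> s [sL Hs].
exists [seq (fun i => e i + r%:Z * u i) | e <- s, r <- iota 0 m]; split.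
  move=> _ /allpairsP[[e r] /= [es _ ->]].
  by apply: (LD e) (LM _ _ Lu); have [] := sL _ es.
move=> v Lv; pose q := (v d %/ n.+1%:Z)%Z; have vd : v d = q * n.+1%:Z := dvd v Lv.
have Lv' : L (fun i => v i - q * u i) := LB _ _ Lv (LM q _ Lu).
have [|e [w [es [Lw wd] E]]] := Hs (fun i => v i - q * u i).
  by split=> //; rewrite ud vd subrr.
have mz : m%:Z != 0 by rewrite -lt0n in m0 *; case: (m) m0.
have qE := divz_eq q m; have r0 := modz_ge0 q mz.
have rm : ((q %% m)%Z < m%:Z) by have := ltz_mod q mz; rewrite ger0_norm.
exists (fun i => e i + (q %% m)%Z * u i), (fun i => w i + (q %/ m)%Z * u i); split.
- apply/allpairsP; exists (e, `|(q %% m)%Z|%N); split=> //=.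
    by rewrite mem_iota add0n -ltz_nat gez0_abs.
  by apply/funext => i; rewrite gez0_abs.
- exact: LD Lw (LM _ _ Lu).
move=> i; rewrite ltnS leq_eqVlt => /orP[/eqP->|/E].
  rewrite vd wd ud (sL _ es).2 {1}qE; ring.
move=> /eqP; rewrite subr_eq => /eqP->; rewrite {1}qE; ring.
Qed.

(** * The deck group as a lattice *)

Section DeckGroup.
Context {R : realType} {X : surface R} {Y : topologicalType}.
Variable p : continuousType Y X.
Hypothesis hX : translation_surface X.
Context {d : nat} {f : 'I_d -> cochain R X}.
Hypothesis fZ : forall i, H1Z (f i).
Hypothesis ac : abelian_cover p f.
Local Notation S := (pullback p).

Let cp : covering p. Proof. by have [] := ac. Qed.
Let cY : connected [set: Y]. Proof. by have [] := ac. Qed.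
Let mX : locally_modelled X := surface_model hX.
Let mS : locally_modelled S := pullback_model hX cp.
Let hY : hausdorff_space Y := covering_hausdorff cp (ts_hausdorff hX).
Let fH i : @H1 R X (f i). Proof. by have [] := fZ i. Qed.
Let Ypath (y z : Y) : joined R y z := @all_joined R S mS cY y z.
Let Yloc := @locally_joined R S mS.

Lemma surface_map_lift (phi : continuousType X X) y0 y1 :
  (forall i g, f i (loop_map phi g) = f i g) -> p y1 = phi (p y0) ->
  exists Phi : Y -> Y, [/\ continuous Phi, Phi y0 = y1 & forall z, p (Phi z) = phi (p z)].
Proof. move=> h1 h2; exact: (map_lift Ypath cp hY ac Yloc h1 h2). Qed.

Lemma lift_eq (Phi Psi : Y -> Y) y : continuous Phi -> continuous Psi ->
  (forall z, p (Phi z) = p (Psi z)) -> Phi y = Psi y -> Phi = Psi.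
Proof.
move=> c1 c2 E Ey; apply/funext => z.
exact: (@lift_unique X Y p cp hY Y setT Phi Psi y cY c1 c2 (fun t _ => E t) I Ey).
Qed.

(** Invertibility is not demanded: it follows from transitivity on the fibres and uniqueness of
    lifts. *)
Definition deck (de : Y -> Y) := continuous de /\ forall z, p (de z) = p z.

Lemma deck_id : deck id.
Proof. by split=> // z; exact: cvg_id. Qed.

Lemma deck_comp de ep : deck de -> deck ep -> deck (de \o ep).
Proof.
by move=> [c1 E1] [c2 E2]; split=> [|z]; [exact: comp_continuous c2 c1 | rewrite /= E1 E2].
Qed.

Lemma deck_iter n de : deck de -> deck (iter n de).
Proof.
move=> dd; elim: n => [|n IH]; first exact: deck_id.
exact: (deck_comp dd IH).
Qed.

Lemma deck_eq de ep y : deck de -> deck ep -> de y = ep y -> de = ep.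
Proof. by move=> [c1 E1] [c2 E2]; apply: lift_eq => // z; rewrite E1 E2. Qed.

Lemma deck_trans y y' : p y = p y' -> exists2 de, deck de & de y = y'.
Proof.
pose F : continuousType X X := HB.pack (@id X) (isContinuous.Build _ _ id (fun x => @cvg_id _ _)).
move=> E; have [||Phi [Pc Py PE]] := @surface_map_lift F y y'.
- by move=> i g; apply: (H1_ext (fH i)).
- by rewrite /= E.
- by exists Phi.
Qed.

Lemma deck_inv de : deck de -> exists de', [/\ deck de', cancel de de' & cancel de' de].
Proof.
move=> dd; have [y _] : exists y : Y, True.
  by have [_ [x _]] := ts_form_neq0 hX; have [y _] := cp.1 x; exists y.
have [ep de' E] := @deck_trans (de y) y (dd.2 y); exists ep.
have K1 : ep \o de = id by apply: (@deck_eq _ _ y) => //; [exact: deck_comp|exact: deck_id].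
have K2 : de \o ep = id.
  apply: (@deck_eq _ _ (de y)); [exact: deck_comp|exact: deck_id|by rewrite /= E].
by split=> // z; [have := congr1 (@^~ z) K1 | have := congr1 (@^~ z) K2].
Qed.

Lemma deck_aff de : deck de -> exists2 de', deck de' & @aff R S de de' 1.
Proof.
move=> dd; have [de' [dd' K K']] := deck_inv dd; exists de' => //; split=> //.
- exact: dd.1.
- exact: dd'.1.
- by move=> x; rewrite /= dd.2.
- by move=> x; rewrite /= dd'.2.
- by apply: (affine_up hX cp dd.1 dd.2); exact: affine_map_id.
Qed.

Variable y0 : Y.

(** The embedding of the deck group into the integer vectors of length d, as a relation that leaves
    free the choice of the loop g. *)
Definition winding (de : Y -> Y) (v : 'I_d -> int) :=
  exists2 g : loop R X, lifts p y0 g (de y0) & forall i, f i g = (v i)%:~R.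

Lemma winding_ex de : deck de -> exists v, winding de v.
Proof.
move=> dd; have [|g L] := @loop_between _ _ _ p Ypath y0 (de y0); first by rewrite dd.2.
exists (fun i => Num.floor (f i g)), g => // i.
by rewrite floorK//; have [_] := fZ i.
Qed.

Lemma winding_inj de ep v : deck de -> deck ep -> winding de v -> winding ep v -> de = ep.
Proof.
move=> dd de' [g L E] [g' L' E']; apply: (@deck_eq _ _ y0) => //.
by apply/(lifts_eq cp hY fH ac L L') => i; rewrite E E'.
Qed.

Lemma winding_comp de ep v w : deck de -> winding de v -> winding ep w ->
  winding (de \o ep) (fun i => v i + w i).
Proof.
move=> dd [g L E] [g' L' E'].
have L2 : lifts p (de y0) g' (de (ep y0)).
  exact: (@lifts_map R X Y p de id y0 g' (ep y0) dd.1 dd.2 L').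
have g0 : g 0 = g' 0 by rewrite -(lifts_p L').1 -(lifts_p L).1.
have [h hc] := cat_ex g0; exists h; first exact: lifts_cat hc L L2.
by move=> i; rewrite ((fH i).2 _ _ _ hc) E E' intrD.
Qed.

Lemma winding_id : winding id (fun=> 0).
Proof.
exists (loop_map p (path_loop (@cst_continuous R Y y0) (erefl y0))).
  by exists (cst y0); split=> //; exact: cst_continuous.
by move=> i; apply: (H1_cst (x := p y0) (fH i)).
Qed.

Lemma winding_inv de de' v : deck de -> deck de' -> cancel de de' -> winding de v ->
  winding de' (fun i => - v i).
Proof.
move=> dd dd' K [g L E]; exists (loop_rev g); last by move=> i; rewrite H1_rev// E mulrNz.
have := @lifts_map R X Y p de' id _ _ _ dd'.1 dd'.2 (lifts_rev L).
by rewrite K.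
Qed.

Lemma winding_iter de v n : deck de -> winding de v ->
  winding (iter n de) (fun i => n%:Z * v i).
Proof.
move=> dd W; elim: n => [|n IH].
  have -> : (fun i => 0%:Z * v i) = (fun=> 0) by apply/funext => i; rewrite mul0r.
  exact: winding_id.
have -> : (fun i => n.+1%:Z * v i) = (fun i => v i + n%:Z * v i).
  by apply/funext => i; rewrite intS mulrDl mul1r.
exact: (winding_comp dd W IH).
Qed.

Lemma deck_quotient m : (0 < m)%N -> exists s : seq (Y -> Y), (forall e, e \in s -> deck e) /\
  forall de, deck de -> exists e ep, [/\ e \in s, deck ep & de = iter m ep \o e].
Proof.
move=> m0.
pose L (v : nat -> int) := exists2 de, deck de & winding de (fun i => v i).
have [||s [sL Hs]] := @lattice_quotient m d L m0.
- by exists id; [exact: deck_id | exact: winding_id].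
- move=> v w [de dd V] [ep de' W]; have [ep' [dep' K _]] := deck_inv de'.
  exists (de \o ep'); first exact: deck_comp.
  exact: (winding_comp dd V (winding_inv de' dep' K W)).
have ex (v : nat -> int) : exists de, L v -> deck de /\ winding de (fun i => v i).
  have [[de dd V]|nL] := pselect (L v); first by exists de.
  by exists id => /nL.
have [D DP] := fun_choice ex; exists (map D s); split.
  by move=> _ /mapP[v vs ->]; exact: (DP _ (sL _ vs)).1.
move=> de dd; have [v V] := winding_ex dd.
(* The vector is padded with 0 from index d on. *)
pose v' (i : nat) : int := if insub i is Some j then v j else 0.
have vv' : v = (fun i => v' i) by apply/funext => i; rewrite /v' valK.
have [|e [w [es [ep de' W] E]]] := Hs v'; first by exists de => //; rewrite -vv'.
have [dDe We] := DP _ (sL _ es).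
exists (D e), ep; split=> //; first exact: map_f.
apply: (winding_inj dd (deck_comp (deck_iter m de') dDe) V).
have -> : v = (fun i => m%:Z * w i + e i).
  by apply/funext => i; rewrite {1}vv' E ?ltn_ord// addrC.
exact: (winding_comp (deck_iter m de') (winding_iter m de' W) We).
Qed.

End DeckGroup.

Lemma seq_choice (T U : eqType) (P : T -> U -> Prop) (s : seq T) : exists s' : seq U,
  (forall u, u \in s' -> exists2 x, x \in s & P x u) /\
  forall x, x \in s -> (exists u, P x u) -> exists2 u, u \in s' & P x u.
Proof.
elim: s => [|x s [s' [H1 H2]]]; first by exists [::].
have [[u Pu]|nP] := pselect (exists u, P x u); last first.
  exists s'; split=> [u /H1[y ys Py]|y]; first by exists y; rewrite ?inE ?ys ?orbT.
  by rewrite inE => /orP[/eqP->|/H2].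
exists (u :: s'); split=> [v|y].
  rewrite inE => /orP[/eqP->|/H1[y ys Py]]; first by exists x; rewrite ?mem_head.
  by exists y; rewrite ?inE ?ys ?orbT.
rewrite inE => /orP[/eqP-> _|/H2 H /H[v vs Pv]]; first by exists u; rewrite ?mem_head.
by exists v; rewrite ?inE ?vs ?orbT.
Qed.

(** * Translations that fix a point *)

Section Stabilisers.
Context {R : realType} {S : surface R}.
Local Notation C := (cplx R).
Hypothesis mS : locally_modelled S.
Hypothesis hS : hausdorff_space S.
Hypothesis cS : connected [set: S].

Lemma level_finite (K : set S) (zeta : S -> C) a : compact K ->
  (forall y, K y -> local_primitive y zeta) ->
  (forall y, K y -> zeta y = a -> ~ sing y) ->
  exists s : seq S, forall y, K y -> zeta y = a -> y \in s.
Proof.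
move=> Kc Kp Kr.
have loc y : exists2 N, nbhs y N & K y -> forall z, N z -> zeta z = a -> z = y.
  have [Ky|nK] := pselect (K y); last by exists setT => //; exact: filterT.
  have [ya|ya] := pselect (zeta y = a).
    have [U nU Ui] := prim_inj mS (Kr y Ky ya) (Kp y Ky).
    exists U => // _ z Uz za; apply: Ui => //; first exact: nbhs_singleton nU.
    by rewrite za ya.
  exists [set z | zeta z <> a] => [|_ z]//.
  have cz := prim_at_continuous mS (local_primitive_prim_at (Kp y Ky)).
  have n1 : nbhs (zeta y) [set w | w <> a].
    apply/nbhs_cplx; exists (cabs (a - zeta y)) => [|w wy wa].
      by rewrite cabs_gt0 subr_eq0 eq_sym; apply/eqP.
    by move: wy; rewrite wa ltxx.
  exact: cz n1.
have [N NP] : exists N : S -> set S, forall y, nbhs y (N y) /\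
    (K y -> forall z, N y z -> zeta z = a -> z = y).
  apply: (fun_choice (P := fun y U => nbhs y U /\ (K y -> forall z, U z -> zeta z = a -> z = y))).
  by move=> y; have [U nU UP] := loc y; exists U.
have [s [sK Hs]] := compact_finite_cover Kc (fun y _ => (NP y).1).
exists s => y Ky ya; have [x xs Nxy] := Hs y Ky.
by rewrite ((NP x).2 _ y Nxy ya)//; exact: sK.
Qed.

Lemma primitive_nonconstant (x : S) (V : set S) zeta : nbhs x V ->
  (forall y, V y -> local_primitive y zeta) ->
  exists y, [/\ V y, ~ sing y & zeta y <> zeta x].
Proof.
move=> nV Vp; have [r0 [kap [h M0]]] := mS x.
have [r [rp rr HV]] := disc_shrink_in M0 nV; have M := disc_shrink M0 rp rr.
have inB (t : R) : 0 <= t -> t < r -> cball 0 r (toC t 0).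
  by move=> t0 tr; rewrite /cball /= subr0 cabs_toC ger0_norm.
have tn0 (t : R) : 0 < t -> toC t 0 != 0 by move=> t0; rewrite toC_eq0 (gt_eqF t0).
have r20 : 0 < r / 2 by lra.
have B1 := inB (r / 2) ltac:(lra) ltac:(lra).
have [n1 _] := dm_reg M B1 (tn0 _ r20).
have [E1|] := pselect (zeta (kap (toC (r / 2) 0)) = zeta x); last first.
  by move=> E1; exists (kap (toC (r / 2) 0)); split=> //; exact: HV.
(* If the first candidate has the same value as x, then zeta, injective near this regular point,
   differs at a slightly displaced one. *)
have [U nU Ui] := prim_inj mS n1 (Vp _ (HV _ B1)).
have /nbhs_cplx[e e0 He] := (nbhs_model U M B1).1 nU.
pose u := Num.min (e / 2) (r / 4).
have u0 : 0 < u by rewrite lt_min; apply/andP; split; lra.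
have ue : u <= e / 2 by rewrite ge_min lexx.
have ur : u <= r / 4 by rewrite ge_min lexx orbT.
have B2 := inB (r / 2 + u) ltac:(lra) ltac:(lra).
have [n2 _] := dm_reg M B2 (tn0 (r / 2 + u) ltac:(lra)).
exists (kap (toC (r / 2 + u) 0)); split=> //; first exact: HV.
move=> E2; have /(dm_inj M B2 B1) : kap (toC (r / 2 + u) 0) = kap (toC (r / 2) 0).
  apply: Ui; last by rewrite E1 E2.
    apply: He; have -> : toC (r / 2 + u) 0 - toC (r / 2) 0 = toC u 0.
      by congr Complex; rewrite /=; ring.
    by rewrite cabs_toC ger0_norm; lra.
  exact: nbhs_singleton nU.
by move=> /(congr1 (@reC R)) /=; lra.
Qed.

(** Such a translation preserves zeta near x, so it keeps y in its level set, which is finite in the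
    compact closure of W. As y is regular, the image of y determines the translation. The point x
    itself may be a cone point with nontrivial rotations. *)
Lemma translation_stabiliser (x : S) : exists s : seq (S -> S),
  forall t t', aff t t' 1 -> t x = x -> t \in s.
Proof.
have [W [zeta [c [gO _]]]] := good_nbhd_ex mS hS (@filterT S (nbhs x) _).
have c0 := gn_gt0 gO.
have OP y : W y -> local_primitive y zeta.
  by move=> Oy; apply: (gn_prim gO); exact: subset_closure.
have zc := prim_at_continuous mS (local_primitive_prim_at (OP _ (gn_x gO))).
have nD : nbhs x (W `&` zeta @^-1` cball (zeta x) (c / 4)).
  apply: filterI; first by apply: open_nbhs_nbhs; split; [exact: gn_open gO|exact: gn_x gO].
  by apply: zc; apply: cball_nbhs; lra.
have [V [Vo Vx Vc VD _]] := connected_nbhd mS nD.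
have VP y : V y -> local_primitive y zeta by move=> /VD[/OP].
have [y [Vy ny zy]] := primitive_nonconstant (open_nbhs_nbhs (conj Vo Vx)) VP.
have Kr z : closure W z -> zeta z = zeta y -> ~ sing z.
  by move=> Oz zE; apply: (gn_reg gO Oz); apply/eqP => zx; apply: zy; rewrite -zE zx.
have [s Hs] := level_finite (gn_compact gO) (gn_prim gO) Kr.
have [s' [_ Hs']] := seq_choice (fun z t => (exists t', aff t t' 1) /\ t y = z) s.
exists s' => t t' a tx.
have [Wty E] : W (t y) /\ zeta (t y) - zeta (t x) = mx_act 1 (zeta y - zeta x).
  (* The identity matrix has [frob] equal to 2 <= 2 ^+ 2, and 2 * (c / 4) = c / 2. *)
  apply: (@trapping _ _ _ mS mS t 1 x V zeta x W zeta c (c / 4) 2) => //.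
  - exact: aff_cont a.
  - exact: aff_map a.
  - by rewrite /frob !mxE /=; lra.
  - by move=> u /VD[].
  - by lra.
  - by rewrite tx; exact: gn_x gO.
  - by rewrite tx subrr cabs0; lra.
have tE : zeta (t y) = zeta y by move: E; rewrite mx_act1 tx => /addIr.
have tys := Hs _ (subset_closure Wty) tE.
have [|u us [[u' b] uy]] := Hs' _ tys; first by exists t; split=> //; exists t'.
suff -> : t = u by [].
apply: (affine_map_eq mS mS hS cS (aff_cont a) (aff_cont b) (aff_sing a) (aff_sing b)
  (aff_map a) (aff_map b) ny).
by rewrite uy.
Qed.

End Stabilisers.

(** * The Veech group of the cover modulo that of the base *)

Section Cosets.
Context {R : realType} {X : surface R} {Y : topologicalType}.
Variable p : continuousType Y X.
Hypothesis hX : translation_surface X.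
Context {d : nat} {f : 'I_d -> cochain R X}.
Hypothesis fZ : forall i, H1Z (f i).
Hypothesis ac : abelian_cover p f.
Local Notation S := (pullback p).

Let cp : covering p. Proof. by have [] := ac. Qed.
Let cY : connected [set: Y]. Proof. by have [] := ac. Qed.
Let mX : locally_modelled X := surface_model hX.
Let mS : locally_modelled S := pullback_model hX cp.
Let hY : hausdorff_space Y := covering_hausdorff cp (ts_hausdorff hX).

Lemma deckV de : deck p de -> exists de', [/\ deck p de', cancel de de' & cancel de' de].
Proof. exact: (deck_inv hX fZ ac). Qed.

Lemma deck_translation de : deck p de -> exists2 de', deck p de' & @aff R S de de' 1.
Proof. exact: (deck_aff hX fZ ac). Qed.

Lemma aff_inv1 (t t' : Y -> Y) : @aff R S t t' 1 -> @aff R S t' t 1.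
Proof.
by move=> a; have := aff_inv (det1 _ _) a; rewrite -[invmx 1]/(1^-1) invr1.
Qed.

(** A translation sends y, which lies over a singularity, over one of finitely many singularities.
    After composition with a deck transformation and a representative it fixes y, and the stabiliser
    of y is finite. *)
Lemma translation_quotient : (exists x : X, sing x) -> exists s : seq (Y -> Y),
  (forall e, e \in s -> exists e', @aff R S e e' 1) /\
  forall t t', @aff R S t t' 1 -> exists de e, [/\ deck p de, e \in s & t = de \o e].
Proof.
move=> [x0 sx0]; have [y yx] := cp.1 x0; have sy : @sing R S y by rewrite /= yx.
have [sx sxE] := (finite_seqP _).1 (ts_sing_finite hX).
have [s1 [s1P Hs1]] := seq_choice (fun x t => (exists t', @aff R S t t' 1) /\ p (t y) = x) sx.
have [s2 Hs2] := translation_stabiliser mS hY cY y.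
pose s := [seq e <- [seq a \o b | a <- s1, b <- s2] | `[< exists e', @aff R S e e' 1 >]].
exists s; split=> [e|t t' a].
  by rewrite mem_filter => /andP[/asboolP].
have : sing (p (t y)).
  apply: contrapT => n; have := aff_sing' a n.
  by rewrite (aff_K a).
rewrite sxE /= => /Hs1[|u us [[u' b] uy]]; first by exists t; split=> //; exists t'.
have [de dd deE] := deck_trans hX fZ ac uy.
have [de' dd' ad] := deck_translation dd.
have ad' := aff_inv1 ad; have b' := aff_inv1 b.
have := aff_comp mS a (aff_comp mS ad' b'); rewrite !mulr1 => c.
have cs : (u' \o de') \o t \in s2.
  by apply: (Hs2 _ _ c); rewrite /= -deE (aff_K ad) (aff_K b).
have E : t = de \o (u \o ((u' \o de') \o t)).
  by apply/funext => z; rewrite /= (aff_K' b) (aff_K' ad).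
exists de, (u \o ((u' \o de') \o t)); split=> //.
rewrite mem_filter; apply/andP; split; last first.
  by apply/allpairsP; exists (u, (u' \o de') \o t).
apply/asboolP; have := aff_comp mS c b; rewrite mulr1 => c'.
by eexists; exact: c'.
Qed.

Lemma aff_iter t t' n : @aff R S t t' 1 -> @aff R S (iter n t) (iter n t') 1.
Proof.
move=> a; elim: n => [|n IH]; first exact: aff_id.
have := aff_comp mS IH a; rewrite mulr1.
suff -> : iter n t' \o t' = iter n.+1 t' by [].
by apply/funext => z; rewrite /= -iterSr.
Qed.

(* Pigeonhole principle on the cosets of the powers of t. *)
Lemma translation_power (s : seq (Y -> Y)) t t' :
  (forall u u', @aff R S u u' 1 -> exists de e, [/\ deck p de, e \in s & u = de \o e]) ->
  @aff R S t t' 1 -> deck p (iter (size s)`! t).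
Proof.
move=> Hs a; pose k := size s.
have ex (j : 'I_k.+1) : exists de_e : (Y -> Y) * (Y -> Y),
    [/\ deck p de_e.1, de_e.2 \in s & iter j t = de_e.1 \o de_e.2].
  by have [de [e H]] := Hs _ _ (aff_iter j a); exists (de, e).
have [F FP] := fun_choice ex.
have idx (j : 'I_k.+1) : (index (F j).2 s < k)%N by rewrite index_mem; have [] := FP j.
pose c (j : 'I_k.+1) : 'I_k := Ordinal (idx j).
have /injectivePn[i0 [j0 ij0 cij]] : ~~ injectiveb c.
  by apply/negP => /injectiveP /leq_card; rewrite !card_ord ltnn.
wlog ij : i0 j0 ij0 cij / (i0 < j0)%N.
  move=> H; have : i0 != j0 :> nat by [].
  by rewrite neq_ltn => /orP[|]; [exact: H | apply: H; rewrite // eq_sym].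
have [di ei iE] := FP i0; have [dj ej jE] := FP j0.
have E2 : (F i0).2 = (F j0).2.
  have cv : index (F i0).2 s = index (F j0).2 s := congr1 val cij.
  by rewrite -(nth_index (F i0).2 ei) cv nth_index.
have [de' [dd' K K']] := deckV di.
pose r := (j0 - i0)%N; have r0 : (0 < r)%N by rewrite subn_gt0.
have rk : (r <= k)%N by rewrite (leq_trans (leq_subr _ _))// -ltnS.
have ai := aff_iter i0 a.
have dr : deck p (iter r t).
  suff -> : iter r t = (F j0).1 \o de' by exact: deck_comp.
  apply/funext => z; rewrite -[in LHS](aff_K' ai z) -iterD subnK ?(ltnW ij)//.
  rewrite jE /= -E2; congr ((F j0).1 _).
  by rewrite -[in RHS](aff_K' ai z) iE /= K.
(* The exponent r found by the pigeonhole depends on t; the factorial is a common multiple of all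
   possible ones. *)
have /dvdnP[q ->] : (r %| k`!)%N by apply: dvdn_fact; rewrite r0.
suff -> : iter (q * r) t = iter q (iter r t) by exact: deck_iter.
by apply/funext => z; elim: (q) => //= n <-; rewrite mulSn iterD.
Qed.

(** Since psi normalises the deck group, p after psi is constant on the fibres of p, so it induces a
    map of the base, and psi' induces its inverse. *)
Lemma descend psi psi' A : \det A = 1 -> @aff R S psi psi' A ->
  (forall de, deck p de -> deck p (psi \o de \o psi')) ->
  (forall de, deck p de -> deck p (psi' \o de \o psi)) -> veech_group X A.
Proof.
move=> dA a n1 n2.
(* An arbitrary set-theoretic section, with no continuity. By [down] the induced maps do not depend
   on it, and local sections then give their continuity. *)
have [sg sgP] := fun_choice cp.1.
have down (q q' : Y -> Y) : cancel q q' -> (forall de, deck p de -> deck p (q \o de \o q')) ->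
    forall z, p (q (sg (p z))) = p (q z).
  move=> K n z; have [de dd <-] := deck_trans hX fZ ac (esym (sgP (p z))).
  by have := (n _ dd).2 (q z); rewrite /= K.
have D1 := down _ _ (aff_K a) n1; have D2 := down _ _ (aff_K' a) n2.
have cont (q : Y -> Y) : continuous q -> (forall z, p (q (sg (p z))) = p (q z)) ->
    continuous (fun x => p (q (sg x))).
  move=> qc E x A' nA; have [y yx] := cp.1 x.
  have [U [V [s [sh Vy]]]] := covering_sheet cp y; have Uy := (sh_p sh Vy).1.
  have n0 : nbhs (p y) U by apply: open_nbhs_nbhs; split=> //; exact: sh_openU sh.
  have n3 : nbhs (p y) (s @^-1` ((p \o q) @^-1` A')).
    apply: (sh_cont sh Uy); rewrite (sh_p sh Vy).2.
    apply: (comp_continuous qc (@pcont _ _ p)).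
    by rewrite -E yx.
  rewrite -yx; apply: filterS2 n0 n3 => u Uu.
  by rewrite /= -E (sh_s sh Uu).2.
pose phi x := p (psi (sg x)); pose phi' x := p (psi' (sg x)).
have b : aff phi phi' A.
  split.
  - exact: cont (aff_cont a) D1.
  - exact: cont (aff_cont' a) D2.
  - by move=> x; rewrite /phi' /phi D2 (aff_K a) sgP.
  - by move=> x; rewrite /phi' /phi D1 (aff_K' a) sgP.
  - by move=> x nx; apply: (aff_sing a); rewrite /= sgP.
  - by move=> x nx; apply: (aff_sing' a); rewrite /= sgP.
  - by apply: (affine_down hX cp (aff_cont a) _ (aff_map a)) => z; rewrite /phi D1.
by apply/veech_aff; split=> //; exists phi, phi'.
Qed.

Lemma veech_cover_cosets : (exists x : X, sing x) \/ d = 0%N -> exists s : seq 'M[R]_2,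
  forall A, veech_group S A -> exists m h, [/\ m \in s, veech_group X h & A = m * h].
Proof.
have [_ [x0 _]] := ts_form_neq0 hX; have [y0 _] := cp.1 x0.
have det1 : \det (1 : 'M[R]_2) = 1 by rewrite det1.
case=> [sX|d0]; last first.
  exists [:: 1] => A /veech_aff[dA [phi [phi' a]]].
  exists 1, A; split; rewrite ?mem_head ?mul1r//.
  (* There are no winding coordinates, so the deck group is trivial and every automorphism
     normalises it. *)
  have triv de : deck p de -> de = id.
    move=> dd; have [v V] := winding_ex hX fZ ac y0 dd.
    have [w W] := winding_ex hX fZ ac y0 (deck_id p).
    apply: (winding_inj hX fZ ac dd (deck_id p) V).
    by have -> : v = w by apply/funext => i; exfalso; move: (i); rewrite d0 => -[].
  have nrm (q q' : Y -> Y) : cancel q' q -> forall de, deck p de -> deck p (q \o de \o q').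
    move=> K de /triv->; have -> : q \o id \o q' = id by apply/funext => z; rewrite /= K.
    exact: deck_id.
  exact: (descend dA a (nrm _ _ (aff_K' a)) (nrm _ _ (aff_K a))).
have [s1 [s1A Hs1]] := translation_quotient sX.
pose m := (size s1)`!; have m0 : (0 < m)%N by exact: fact_gt0.
have [s0 [s0D Hs0]] := deck_quotient hX fZ ac y0 m0.
(* Representatives of all translations modulo m-th powers of deck transformations. *)
pose s2 := [seq a \o b | a <- s0, b <- s1].
(* t belongs to the conjugate of the deck group by phi. *)
pose conj (phi phi' t : Y -> Y) := deck p (phi' \o t \o phi).
have conjA (phi phi' : Y -> Y) A t t' : \det A = 1 -> @aff R S phi phi' A ->
    @aff R S t t' 1 -> @aff R S (phi' \o t \o phi) (phi' \o t' \o phi) 1.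
  move=> dA a b; have := aff_comp mS a (aff_comp mS b (aff_inv dA a)).
  by rewrite mulr1 (invmx_detE dA).2.
have powP (phi phi' : Y -> Y) A de : \det A = 1 -> @aff R S phi phi' A -> deck p de ->
    conj phi phi' (iter m de).
  move=> dA a dd; have [de' _ ad] := deck_translation dd.
  have := translation_power Hs1 (conjA _ _ _ _ _ dA a ad); rewrite -/m /conj.
  suff -> : forall n, iter n (phi' \o de \o phi) = phi' \o iter n de \o phi by [].
  elim=> [|n IH]; apply/funext => z /=; first by rewrite (aff_K a).
  by rewrite IH /= (aff_K' a).
have conjM (phi phi' t u : Y -> Y) : cancel phi' phi ->
    conj phi phi' t -> conj phi phi' u -> conj phi phi' (t \o u).
  move=> K ct cu; rewrite /conj.
  suff -> : phi' \o (t \o u) \o phi = (phi' \o t \o phi) \o (phi' \o u \o phi).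
    exact: deck_comp.
  by apply/funext => z; rewrite /= K.
have conjE (phi phi' psi psi' : Y -> Y) A B t t' : \det A = 1 -> \det B = 1 ->
    @aff R S phi phi' A -> @aff R S psi psi' B ->
    (forall e, e \in s2 -> conj phi phi' e -> conj psi psi' e) ->
    @aff R S t t' 1 -> conj phi phi' t -> conj psi psi' t.
  move=> dA dB a b same c.
  have [de [e1 [dd e1s tE]]] := Hs1 _ _ c.
  have [e0 [ep [e0s de' dE]]] := Hs0 _ dd.
  have [ep' [dep' K K']] := deckV de'.
  have es2 : e0 \o e1 \in s2 by apply/allpairsP; exists (e0, e1).
  have tE' : t = iter m ep \o (e0 \o e1) by rewrite tE dE.
  have eE : e0 \o e1 = iter m ep' \o t.
    rewrite tE'; apply/funext => z /=; elim: (m) (e0 _) => // n IH w.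
    by rewrite iterSr /= K.
  move=> ct; have : conj phi phi' (e0 \o e1).
    by rewrite eE; apply: conjM ct; [exact: aff_K' a | exact: powP dA a dep'].
  move=> /(same _ es2) cs; rewrite tE'.
  by apply: conjM cs; [exact: aff_K' b | exact: powP dB b de'].
have ex A : exists pp : (Y -> Y) * (Y -> Y), veech_group S A -> \det A = 1 /\ @aff R S pp.1 pp.2 A.
  have [/veech_aff[dA [phi [phi' a]]]|nA] := pselect (veech_group S A).
    by exists (phi, phi').
  by exists (id, id) => /nA.
have [P PP] := fun_choice ex.
(* This tuple of bits determines the conjugate of the deck group attached to A. One derivative B is
   kept for each attained key, and the quotient of A by B comes from an automorphism that normalises
   the deck group. *)
pose key A : (size s2).-tuple bool :=
  map_tuple (fun e => `[< conj (P A).1 (P A).2 e >]) (in_tuple s2).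
have [rep [_ Hrep]] := seq_choice (fun k A => veech_group S A /\ key A = k)
  (enum {: (size s2).-tuple bool}).
exists rep => A VA.
have [||B Bs [VB kB]] := Hrep (key A); [by rewrite mem_enum | by exists A |].
have [dA a] := PP A VA; have [dB b] := PP B VB.
have same e : e \in s2 -> conj (P A).1 (P A).2 e <-> conj (P B).1 (P B).2 e.
  move=> es; have /(congr1 val) /= /eq_in_map/(_ e es) E := kB.
  by split=> /asboolP; [rewrite -E | rewrite E] => /asboolP.
exists B, (invmx B * A); split=> //; last by rewrite mulrA (invmx_detE dB).1 mul1r.
have c := aff_comp mS a (aff_inv dB b).
apply: (descend _ c); first by rewrite det_mulmx dA mulr1; exact: invmx_det.
  move=> de dd; have [de' _ ad] := deck_translation dd.
  have ct := conjA _ _ _ _ _ _ (aff_inv dA a) ad.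
  have : conj (P B).1 (P B).2 ((P A).1 \o de \o (P A).2).
    apply: (conjE _ _ _ _ _ _ _ _ dA dB a b (fun e es => (same e es).1)).
      by apply: ct; exact: invmx_det.
    rewrite /conj; suff -> : (P A).2 \o ((P A).1 \o de \o (P A).2) \o (P A).1 = de by [].
    by apply/funext => z; rewrite /= !(aff_K a).
  by [].
move=> de dd; have [de' _ ad] := deck_translation dd.
have ct := conjA _ _ _ _ _ _ (aff_inv dB b) ad.
have : conj (P A).1 (P A).2 ((P B).1 \o de \o (P B).2).
  apply: (conjE _ _ _ _ _ _ _ _ dB dA b a (fun e es => (same e es).2)).
    by apply: ct; exact: invmx_det.
  rewrite /conj; suff -> : (P B).2 \o ((P B).1 \o de \o (P B).2) \o (P B).1 = de by [].
  by apply/funext => z; rewrite /= !(aff_K b).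
by [].
Qed.

End Cosets.

(** * Surfaces without singularities *)

Section FlatCharts.
Context {R : realType}.
Local Notation C := (cplx R).

(** A preimage of w is found by minimising the distance from F z to w over a closed disc: at an
    interior point of nonzero derivative [cderiv_dir] would improve a positive minimum. *)
Lemma inverse_branch (F h : C -> C) (r : R) : 0 < r ->
  (forall z, cball 0 r z -> cderiv F z (h z)) -> {for 0, continuous h} ->
  (forall z, cball 0 r z -> h z != 0) ->
  exists rho d (io : C -> C), [/\ 0 < rho, 0 < d, d <= r,
    forall w, cabs (w - F 0) < rho -> [/\ cball 0 d (io w), F (io w) = w & {for w, continuous io}] &
    forall z, cball 0 d z -> cabs (F z - F 0) < rho -> io (F z) = z].
Proof.
move=> r0 Fd hc hn0; have z0 := cball_center (0 : C) r0.
have [d d0 [dr Hi]] := cderiv_local_inj r0 Fd hc (hn0 _ z0).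
set m := cabs (h 0) / 2 in Hi; have m0 : 0 < m by rewrite divr_gt0// cabs_gt0 hn0.
pose q := d / 2; have q0 : 0 < q by rewrite divr_gt0.
have qd : q < d by rewrite /q; lra.
(* On the circle of radius q the distance from F z to F 0 is at least m * q = 2 * rho, so for w
   within rho of F 0 the minimum is not on the circle. *)
pose rho := m * q / 2; have rho0 : 0 < rho by rewrite divr_gt0// mulr_gt0.
have inj u v : cball 0 d u -> cball 0 d v -> F u = F v -> u = v.
  move=> uB vB E; have := Hi u v uB vB; rewrite E subrr cabs0 pmulr_rle0// => uv.
  by apply/eqP; rewrite -subr_eq0 -cabs_eq0; apply/eqP/le_anti; rewrite uv cabs_ge0.
have ex w : exists z, cabs (w - F 0) < rho -> cball 0 d z /\ F z = w.
  have [wr|nw] := pselect (cabs (w - F 0) < rho); last by exists 0.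
  have inB z : cabs z <= q -> cball 0 d z by move=> zq; rewrite /cball /= subr0 (le_lt_trans zq).
  have [||z zq Hm] := @compact_max R _ [set z : C | cabs z <= q] (fun z => - cabs (F z - w)) (@compact_cdisc R q).
  - by exists 0; rewrite /= cabs0 ltW.
  - move=> z zq; apply: continuousN; apply: cdist_continuous.
    apply: (@cderiv_continuous _ F z (h z)); apply: Fd.
    exact: cball_sub dr _ (inB z zq).
  have zB := inB z zq.
  have Hm' y : cabs y <= q -> cabs (F z - w) <= cabs (F y - w) by move=> /Hm; rewrite lerN2.
  exists z => _; split=> //; apply/eqP; rewrite -subr_eq0; apply/negPn/negP => nz.
  have zlt : cabs z < q.
    rewrite lt_neqAle zq andbT; apply/eqP => zE.
    have B0 : cball 0 d (0 : C) by exact: cball_center.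
    have := Hi z 0 zB B0; rewrite subr0 zE => Hz.
    have := Hm' 0 ltac:(by rewrite cabs0 ltW); rewrite (cabsB (F 0)) => H2.
    have H3 : cabs (F z - F 0) <= cabs (F z - w) + cabs (w - F 0) by exact: cabs_tri.
    have rE : rho * 2 = m * q by rewrite /rho; field.
    by lra.
  have hz0 := hn0 _ (cball_sub dr zB).
  have eta0 : w - F z != 0 by rewrite subr_eq0 eq_sym -subr_eq0.
  have dz : 0 < q - cabs z by rewrite subr_gt0.
  have [u [t [/andP[t0 t1] ud Hu]]] := cderiv_dir (Fd _ (cball_sub dr zB)) hz0 eta0 dz.
  have uq : cabs u <= q.
    by have := cabs_tri u z 0; rewrite !subr0; lra.
  have := Hm' u uq; rewrite (cabsB (F z)).
  have -> : F u - w = (F u - F z - toC t 0 * (w - F z)) - toC (1 - t) 0 * (w - F z).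
    have -> : toC (1 - t) 0 = 1 - toC t 0 :> C by congr Complex; rewrite /= ?subr0.
    by ring.
  have := cabs_tri (F u - F z - toC t 0 * (w - F z)) 0 (toC (1 - t) 0 * (w - F z)).
  rewrite subr0 sub0r cabsN cabsM cabs_toC ger0_norm; last by lra.
  have c0 : 0 < cabs (w - F z) by rewrite cabs_gt0.
  have tc : 0 < t * cabs (w - F z) by exact: mulr_gt0.
  move: Hu; rewrite mulrBl mul1r; lra.
have [io ioP] := fun_choice ex; exists rho, d, io.
split; [exact: rho0 | exact: d0 | exact: dr | | ]; last first.
  by move=> z zB zr; have [B E] := ioP _ zr; apply: inj B zB E.
move=> w wr; have [B E] := ioP _ wr; split; [exact: B | exact: E | ].
apply/continuous_cplxP => e e0.
exists (Num.min (rho - cabs (w - F 0)) (m * e)); first by rewrite lt_min subr_gt0 wr mulr_gt0.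
move=> w'; rewrite lt_min => /andP[w1 w2].
have wr' : cabs (w' - F 0) < rho.
  by have := cabs_tri w' w (F 0); lra.
have [B' E'] := ioP _ wr'.
have := Hi _ _ B' B; rewrite E E' => H.
by rewrite -(ltr_pM2l m0) (le_lt_trans H).
Qed.

Variable X : surface R.
Hypothesis mX : locally_modelled X.

Record flat_chart (x : X) (zeta : X -> C) (rho : R) (kap : C -> X) : Prop := {
  fc_gt0 : 0 < rho;
  fc_prim : forall u, cabs u < rho -> local_primitive (kap u) zeta;
  fc_kap : forall u, cabs u < rho -> zeta (kap u) = zeta x + u;
  fc_cont : forall u, cabs u < rho -> {for u, continuous kap};
  fc_0 : kap 0 = x;
  fc_zeta : \forall y \near x, kap (zeta y - zeta x) = y }.

Lemma flat_chart_ex x : ~ sing x -> exists zeta rho kap, flat_chart x zeta rho kap.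
Proof.
move=> nx; have [zeta Lz] := local_primitive_ex mX x.
have [r0 [kap [h M0]]] := mX x.
have [r [rp rr H]] := disc_shrink_in M0 (local_primitive_near Lz).
have M := disc_shrink M0 rp rr; have zB := cball_center (0 : C) rp.
have Hd z : cball 0 r z -> cderiv (zeta \o kap) z (h z).
  by move=> zB'; apply/(dm_prim M zeta zB'); apply: local_primitive_prim_at; exact: H.
have [l hl] := dm_holo M zB.
have hn0 z : cball 0 r z -> h z != 0.
  move=> zB'; have [->|z0] := eqVneq z 0; first exact: dm_sing M nx.
  by have [] := dm_reg M zB' z0.
have [rho [d [io [rho0 d0 dr ioP ioK]]]] := inverse_branch rp Hd (cderiv_continuous hl) hn0.
have k0 : zeta (kap 0) = zeta x by rewrite (dm_0 M).
have sh u : cabs u < rho -> cabs (zeta x + u - (zeta \o kap) 0) < rho.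
  by move=> ur; rewrite /= k0 addrAC subrr add0r.
exists zeta, rho, (fun u => kap (io (zeta x + u))); split=> //.
- by move=> u /sh/ioP[B _ _]; apply: H; exact: cball_sub dr _ B.
- by move=> u /sh/ioP[_ E _].
- move=> u /sh/ioP[B _ c].
  have c1 : {for u, continuous (fun u : C => zeta x + u)}.
    by apply/continuous_cplxP => e e0; exists e => // w; rewrite opprD addrACA subrr add0r.
  have c2 : {for io (zeta x + u), continuous kap} := dm_cont M (cball_sub dr B).
  exact: (continuous_comp (continuous_comp c1 c) c2).
- rewrite addr0 -k0; have := ioK 0 (cball_center _ d0); rewrite subrr cabs0 => -> //.
  exact: dm_0 M.
have n1 : nbhs x (kap @` cball 0 d).
  apply: open_nbhs_nbhs; split; first exact: disc_image_open M dr.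
  by exists 0; [exact: cball_center | exact: dm_0 M].
have n2 : nbhs x (zeta @^-1` cball (zeta x) rho).
  by apply: (prim_at_continuous mX (local_primitive_prim_at Lz)); exact: cball_nbhs.
apply: filterS2 n1 n2 => _ [z zd <-] zr; congr kap.
by rewrite addrC subrK; apply: ioK => //; rewrite /= k0.
Qed.

End FlatCharts.

Section Development.
Context {R : realType} {X : surface R}.
Local Notation C := (cplx R).
Hypothesis mX : locally_modelled X.

(** D is a developing map of the path: the integral of the 1-form along a, up to an additive
    constant. *)
Definition devel (a : R -> X) (D : R -> C) := forall t, 0 <= t <= 1 ->
  exists2 zeta, local_primitive (a t) zeta &
    \forall s \near t, 0 <= s <= 1 -> zeta (a s) - zeta (a t) = D s - D t.

Lemma devel_any a D t xi : continuous a -> devel a D -> 0 <= t <= 1 ->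
  local_primitive (a t) xi ->
  \forall s \near t, 0 <= s <= 1 -> xi (a s) - xi (a t) = D s - D t.
Proof.
move=> ca dv t01 Lx; have [zeta Lz H] := dv t t01.
have n1 : nbhs t (a @^-1` [set y | xi y - zeta y = xi (a t) - zeta (a t)]).
  by apply: ca; exact: prim_near_cst.
apply: filterS2 n1 H => s /= E H s01; rewrite -(H s01).
by apply/eqP; rewrite subr_eq addrAC -subr_eq opprK; apply/eqP; move: E => /eqP;
  rewrite subr_eq => /eqP ->; ring.
Qed.

Lemma devel_shift (a : R -> X) D D' k : (forall t, 0 <= t <= 1 -> D t = D' t + k) ->
  devel a D -> devel a D'.
Proof.
move=> E dv t t01; have [zeta Lz H] := dv t t01; exists zeta => //.
by apply: filterS H => s H s01; rewrite H// !E//; ring.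
Qed.

Hypothesis hX : hausdorff_space X.
Hypothesis nosing : forall x : X, ~ sing x.

Lemma devel_inj (a b : R -> X) D t0 : continuous a -> continuous b -> devel a D -> devel b D ->
  0 <= t0 <= 1 -> a t0 = b t0 -> forall t, 0 <= t <= 1 -> a t = b t.
Proof.
move=> ca cb da db t01 E0.
suff H : forall t, `[0, (1 : R)]%classic t -> a t = b t.
  by move=> t t01'; apply: H; rewrite /= in_itv.
apply: (@coincidence R X _ a b t0 hX) => //.
- exact: segment_connected.
- move=> t; rewrite /= in_itv /= => t01' E.
  have [zeta Lz H] := da t t01'.
  have Lz' : local_primitive (b t) zeta by rewrite -E.
  have H' := devel_any cb db t01' Lz'.
  have [U nU Ui] := prim_inj mX (@nosing (a t)) Lz.
  have n1 : nbhs t (a @^-1` U) := ca t _ nU.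
  have n2 : nbhs t (b @^-1` U) by apply: cb; rewrite -E.
  apply: filterS2 (filterI n1 n2) (filterI H H') => s [Ua Ub] [Ha Hb].
  rewrite in_itv /= => s01; apply: Ui => //.
  by have := Ha s01; rewrite -(Hb s01) E => /addIr.
Qed.

End Development.

Section FlatFlow.
Context {R : realType} {X : surface R}.
Local Notation C := (cplx R).
Hypothesis mX : locally_modelled X.
Hypothesis hX : hausdorff_space X.
Hypothesis cX : compact [set: X].
Hypothesis nosing : forall x : X, ~ sing x.

(* On a flat torus, psi x u is the translate of x by a small vector u. *)
Record flat_flow (r : R) (psi : X -> C -> X) : Prop := {
  fl_gt0 : 0 < r;
  fl_0 : forall x, psi x 0 = x;
  fl_chart : forall x, exists zeta : X -> C, forall u, cabs u < r ->
    zeta (psi x u) = zeta x + u;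
  fl_prim : forall x u, cabs u < r -> exists zeta, [/\ local_primitive x zeta,
    local_primitive (psi x u) zeta &
    \forall y \near x & v \near u, zeta (psi y v) = zeta y + v];
  fl_cont : forall x u, cabs u < r -> forall A, nbhs (psi x u) A ->
    \forall y \near x & v \near u, A (psi y v);
  fl_near : forall x, \forall y \near x,
    (exists2 u, cabs u < r & psi x u = y) /\ (exists2 u, cabs u < r & psi y u = x) }.

(** By compactness finitely many charts suffice, so one radius r serves all points, and psi moves y
    in a chart chosen for y. This choice is not continuous, and the crux is [indep]: in two charts
    the translates of y by the same segment have the same development and start, hence coincide. *)
Lemma flat_flow_ex : exists r psi, flat_flow r psi.
Proof.
have ex x : exists k : (X -> C) * R * (C -> X), flat_chart x k.1.1 k.1.2 k.2.
  by have [zeta [rho [kap H]]] := flat_chart_ex mX (@nosing x); exists (zeta, rho, kap).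
have [k kP] := fun_choice ex; pose Z x := (k x).1.1; pose rho x := (k x).1.2; pose kap x := (k x).2.
have {kP} kP x : flat_chart x (Z x) (rho x) (kap x) := kP x.
pose base x y := Z x y - Z x x.
pose good (x y : X) := \forall y' \near y, kap x (base x y') = y' /\ cabs (base x y') < rho x / 2.
have goodx x : nbhs x [set y | good x y].
  apply: nbhs_interior; apply: filterI; first exact: fc_zeta (kP x).
  have Lx : local_primitive x (Z x).
    by have := fc_prim (kP x) (u := 0); rewrite cabs0 (fc_0 (kP x)); apply; exact: fc_gt0 (kP x).
  have n : nbhs (Z x x) (cball (Z x x) (rho x / 2)).
    by apply: cball_nbhs; rewrite divr_gt0// (fc_gt0 (kP x)).
  exact: (prim_at_continuous mX (local_primitive_prim_at Lx) n).
have [s [_ Hs]] := compact_finite_cover cX (fun x _ => goodx x).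
have [r r0 rs] : exists2 r : R, 0 < r & forall x, x \in s -> r <= rho x / 2.
  elim: (s) => [|x s' [r r0 H]]; first by exists 1.
  exists (Num.min r (rho x / 2)); first by rewrite lt_min r0 divr_gt0// (fc_gt0 (kP x)).
  move=> y; rewrite inE => /orP[/eqP->|/H yr]; first by rewrite ge_min lexx orbT.
  by rewrite ge_min yr.
have exc y : exists x, x \in s /\ good x y by have [x xs g] := Hs y I; exists x.
have [c cP] := fun_choice exc.
have gP x y : good x y -> kap x (base x y) = y /\ cabs (base x y) < rho x / 2.
  by move=> /nbhs_singleton.
have small x y u : x \in s -> good x y -> cabs u < r -> cabs (base x y + u) < rho x.
  by move=> xs /gP[_ b] ur; have := rs x xs; have := cabsD (base x y) u; lra.
have kZ x y u : x \in s -> good x y -> cabs u < r -> Z x (kap x (base x y + u)) = Z x y + u.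
  by move=> xs g ur; rewrite (fc_kap (kP x))//; [rewrite /base; ring | exact: small].
have kL x y u : x \in s -> good x y -> cabs u < r -> local_primitive (kap x (base x y + u)) (Z x).
  by move=> xs g ur; apply: (fc_prim (kP x)); exact: small.
have indep x x' y u : x \in s -> x' \in s -> good x y -> good x' y -> cabs u < r ->
    kap x (base x y + u) = kap x' (base x' y + u).
  move=> xs xs' g g' ur; pose v (t : R) : C := cline 0 u (clamp 0 1 t).
  have vr t : cabs (v t) < r.
    have /andP[c0 c1] : 0 <= clamp 0 1 t <= 1 by apply: clamp_itv; exact: ler01.
    by rewrite /v /cline add0r subr0 cabsM cabs_toC ger0_norm// (le_lt_trans _ ur)// ler_piMl// cabs_ge0.
  have vc : continuous v.
    by apply: comp_continuous; [exact: clamp_continuous | exact: cline_continuous].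
  pose a x t := kap x (base x y + v t).
  have ac x1 : x1 \in s -> good x1 y -> continuous (a x1).
    move=> x1s g1 t; have c1 : {for v t, continuous (fun u : C => base x1 y + u)}.
      apply/continuous_cplxP => e e0; exists e => // w.
      by move: (base x1 y) (v t) => b vt; have -> : b + w - (b + vt) = w - vt by ring.
    have c2 := fc_cont (kP x1) (small _ _ _ x1s g1 (vr t)).
    exact: (continuous_comp (vc t) (continuous_comp c1 c2)).
  have ad x1 : x1 \in s -> good x1 y -> devel (a x1) v.
    move=> x1s g1 t _; exists (Z x1); first exact: kL.
    by near=> t' => _; rewrite /a !kZ//; ring.
  have i1 : 0 <= (1 : R) <= 1 by rewrite ler01 lexx.
  have i0 : 0 <= (0 : R) <= 1 by rewrite ler01 lexx.
  have v1 : v 1 = u by rewrite /v clamp_id// cline1.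
  have v0 : v 0 = 0 by rewrite /v clamp_id// cline0.
  have := devel_inj mX hX nosing (ac x xs g) (ac x' xs' g') (ad x xs g) (ad x' xs' g') i0 _ i1.
  rewrite /a v1 v0 !addr0; apply.
  by rewrite (gP x y g).1 (gP x' y g').1.
pose psi y u := kap (c y) (base (c y) y + u).
have psiE x y u : x \in s -> good x y -> cabs u < r -> psi y u = kap x (base x y + u).
  by move=> xs g ur; have [cs cg] := cP y; exact: indep.
have near_good x y : good x y -> \forall y' \near y, good x y' by exact: nbhs_interior.
have near_r u : cabs u < r -> \forall v \near u, cabs v < r.
  move=> ur; apply/nbhs_cplx; exists (r - cabs u); first by rewrite subr_gt0.
  by move=> w wu; have := cabs_tri w u 0; rewrite !subr0; lra.
have baseL x y : x \in s -> good x y -> local_primitive y (Z x).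
  by move=> xs g; have := kL x y 0 xs g; rewrite cabs0 addr0 (gP x y g).1; apply.
exists r, psi; split=> //.
- by move=> x; rewrite /psi addr0; have [_ /gP[]] := cP x.
- by move=> x; have [cs cg] := cP x; exists (Z (c x)) => u ur; rewrite /psi kZ.
- move=> x u ur; have [cs cg] := cP x; exists (Z (c x)); split.
  + exact: baseL.
  + exact: kL.
  + near=> y v; have gy : good (c x) y by near: y; exact: near_good.
    have vr : cabs v < r by near: v; exact: near_r.
    by rewrite (psiE (c x))// kZ.
- move=> x u ur A nA; have [cs cg] := cP x.
  have c2 := fc_cont (kP (c x)) (small _ _ _ cs cg ur).
  have /nbhs_cplx[e e0 He] : nbhs (base (c x) x + u) (kap (c x) @^-1` A) := c2 _ nA.
  have zc := prim_at_continuous mX (local_primitive_prim_at (baseL _ _ cs cg)).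
  have e2 : 0 < e / 2 by rewrite divr_gt0.
  near=> y v; have gy : good (c x) y by near: y; exact: near_good.
  have vr : cabs v < r by near: v; exact: near_r.
  rewrite (psiE (c x))//; apply: He.
  have h1 : cball (Z (c x) x) (e / 2) (Z (c x) y).
    by near: y; apply: zc; exact: cball_nbhs.
  have h2 : cball u (e / 2) v by near: v; exact: cball_nbhs.
  have -> : base (c x) y + v - (base (c x) x + u) = (Z (c x) y - Z (c x) x) + (v - u).
    by rewrite /base; ring.
  by have := cabsD (Z (c x) y - Z (c x) x) (v - u); move: h1 h2; rewrite /cball /=; lra.
- move=> x; have [cs cg] := cP x.
  have zc := prim_at_continuous mX (local_primitive_prim_at (baseL _ _ cs cg)).
  near=> y; have gy : good (c x) y by near: y; exact: near_good.
  have h1 : cball (Z (c x) x) r (Z (c x) y) by near: y; apply: zc; exact: cball_nbhs.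
  split; [exists (Z (c x) y - Z (c x) x) => // | exists (Z (c x) x - Z (c x) y)].
  + rewrite /psi; have -> : base (c x) x + (Z (c x) y - Z (c x) x) = base (c x) y.
      by rewrite /base; ring.
    by have [] := gP _ _ gy.
  + by rewrite cabsB.
  + rewrite (psiE (c x))//; last by rewrite cabsB.
    have -> : base (c x) y + (Z (c x) x - Z (c x) y) = base (c x) x by rewrite /base; ring.
    by have [] := gP _ _ cg.
Unshelve. all: by end_near. Qed.

End FlatFlow.

Section SmallPeriods.
Context {R : realType} {X : surface R}.
Local Notation C := (cplx R).
Hypothesis mX : locally_modelled X.
Hypothesis hX : hausdorff_space X.
Hypothesis nosing : forall x : X, ~ sing x.
Variables (r : R) (psi : X -> C -> X).
Hypothesis fl : flat_flow r psi.

Lemma psi_comp (T : topologicalType) (a : T -> X) (v : T -> C) : continuous a -> continuous v ->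
  (forall t, cabs (v t) < r) -> continuous (fun t => psi (a t) (v t)).
Proof.
move=> ca cv vr t A nA; have [[P Q] /= [nP nQ] PQ] := fl_cont fl (vr t) nA.
have n1 : nbhs t (a @^-1` P) := ca t _ nP.
have n2 : nbhs t (v @^-1` Q) := cv t _ nQ.
by apply: filterS2 n1 n2 => s Ps Qs; exact: (PQ (a s, v s)).
Qed.

Lemma psi_devel (a : R -> X) D v : continuous a -> continuous v ->
  (forall t, cabs (v t) < r) -> devel a D ->
  devel (fun t => psi (a t) (v t)) (fun t => D t + v t).
Proof.
move=> ca cv vr da t t01; have [zeta [L1 L2 H]] := fl_prim fl (a t) (vr t).
exists zeta => //; have [[P Q] /= [nP nQ] PQ] := H.
have n1 : nbhs t (a @^-1` P) := ca t _ nP.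
have n2 : nbhs t (v @^-1` Q) := cv t _ nQ.
have E0 := PQ (a t, v t) (conj (nbhs_singleton nP) (@nbhs_singleton C _ _ nQ)).
apply: filterS3 n1 n2 (devel_any mX ca da t01 L1) => s Ps Qs Hs s01.
have /= -> := PQ (a s, v s) (conj Ps Qs); rewrite {}E0 /=.
by rewrite -[D s](subrK (D t)) -Hs//; ring.
Qed.

Lemma flow_step (g : loop R X) D (de : R -> C) : continuous de ->
  (forall t, de (t + 1) = de t) -> (forall t, cabs (de t) < r) -> devel g D ->
  exists g' : loop R X, [/\ freely_homotopic g g', forall t, g' t = psi (g t) (de t) &
    devel g' (fun t => D t + de t)].
Proof.
move=> dc dp dr dv.
have pc : continuous (fun t => psi (g t) (de t)) := psi_comp (lcont g) dc dr.
have pp t : psi (g (t + 1)) (de (t + 1)) = psi (g t) (de t) by rewrite lfun_per dp.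
exists (@Loop R X (mk_cont pc) pp); split=> //; last exact: psi_devel (lcont g) dc dr dv.
pose e (s : R) : C := cline 0 1 (clamp 0 1 s).
have ec : continuous e := comp_continuous (@clamp_continuous R 0 1) (@cline_continuous R 0 1).
have eE s : cabs (e s) <= 1.
  have /andP[c0 c1] : 0 <= clamp 0 1 s <= 1 by apply: clamp_itv; exact: ler01.
  by rewrite /e /cline add0r subr0 mulr1 cabs_toC ger0_norm.
have c1 : continuous (fun st : R * R => g st.2).
  have c2 : continuous (@snd R R) by move=> st; exact: cvg_snd.
  exact: comp_continuous c2 (lcont g).
have c2 : continuous (fun st : R * R => e st.1 * de st.2).
  move=> st; apply: cvgM.
    by apply: (@continuous_comp _ _ _ (@fst R R) e); [exact: cvg_fst | exact: ec].
  by apply: (@continuous_comp _ _ _ (@snd R R) de); [exact: cvg_snd | exact: dc].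
exists (fun st => psi (g st.2) (e st.1 * de st.2)); split.
- apply: psi_comp c1 c2 _ => st; rewrite cabsM (le_lt_trans _ (dr st.2))//.
  by rewrite ler_piMl ?cabs_ge0.
- by move=> s t; rewrite /= lfun_per dp.
- by move=> t; rewrite /= /e clamp_id ?lexx ?ler01// cline0 mul0r (fl_0 fl).
- by move=> t; rewrite /= /e clamp_id ?lexx ?ler01// cline1 mul1r.
Qed.

(* The loop is deformed, by translations, into one with constant velocity; a
   straight loop with a small period is constant. *)
Lemma small_period f (g : loop R X) D : @H1 R X f -> continuous D -> devel g D ->
  cabs (D 1 - D 0) < r -> f g = 0.
Proof.
move=> fH cD dv; set w := D 1 - D 0 => wr.
(* The deviation of the development from a straight segment; it vanishes at both ends, so it can be
   made periodic. *)
pose e (t : R) : C := D t - D 0 - cline 0 w t.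
have ec : continuous e.
  move=> t; apply: cvgB; last exact: cline_continuous.
  by apply: cvgB; [exact: cD | exact: cvg_cst].
have e0 : e 0 = 0 by rewrite /e cline0 !subrr.
have e1 : e 1 = 0 by rewrite /e cline1 subrr.
have e01 : e 0 = e 1 by rewrite e0 e1.
have [||m _ Hm] := @compact_max R _ `[(0 : R), 1]%classic (fun t => cabs (e t)) (@segment_compact _ _ _).
- by exists 0; rewrite /= in_itv /= lexx ler01.
- by move=> t _; apply: continuous_comp; [exact: ec | exact: cabs_continuous].
have [N MN] : exists N : nat, cabs (e m) / r < N.+1%:R.
  exists (Num.bound (cabs (e m) / r)); rewrite (lt_trans (archi_boundP _)) ?ltr_nat//.
  by rewrite divr_ge0 ?cabs_ge0// ltW// (fl_gt0 fl).
have r0 := fl_gt0 fl; have N0 : 0 < N.+1%:R :> R by [].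
(* The deviation is removed in N + 1 equal steps, each shorter than the radius r of the flow. *)
pose k : C := toC (- N.+1%:R^-1) 0.
pose de t : C := k * e (frac t).
have dec : continuous de.
  by move=> t; apply: cvgMr; apply: (frac_continuous ec e01).
have dep t : de (t + 1) = de t by rewrite /de frac_period.
have der t : cabs (de t) < r.
  rewrite /de cabsM cabs_toC normrN ger0_norm ?invr_ge0// mulrC ltr_pdivrMr// mulrC.
  rewrite -ltr_pdivrMr// (le_lt_trans _ MN)// ler_pM2r ?invr_gt0//.
  by apply: Hm; rewrite /= in_itv /= frac_itv.
have it n : exists h : loop R X, f h = f g /\ devel h (fun t => D t + de t *+ n).
  elim: n => [|n [h [fh dh]]].
    by exists g; split=> //; apply: (@devel_shift _ _ _ _ _ 0) dv => t _; rewrite mulr0n !addr0.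
  have [h' [hh' _ dh']] := flow_step dec dep der dh.
  exists h'; split; first by rewrite -fh; apply/esym/fH.1.
  by apply: (@devel_shift _ _ _ _ _ 0) dh' => t _; rewrite addr0 mulrSr addrA.
have [h [<- dh]] := it N.+1.
pose v (t : R) : C := cline 0 w (clamp 0 1 t).
have vc : continuous v := comp_continuous (@clamp_continuous R 0 1) (@cline_continuous R 0 w).
have vr t : cabs (v t) < r.
  have /andP[c0 c1] : 0 <= clamp 0 1 t <= 1 by apply: clamp_itv; exact: ler01.
  rewrite /v /cline add0r subr0 cabsM cabs_toC ger0_norm// (le_lt_trans _ wr)//.
  by rewrite ler_piMl// cabs_ge0.
have kN : k *+ N.+1 = -1.
  have -> : k *+ N.+1 = k * N.+1%:R by rewrite mulr_natr.
  have -> : N.+1%:R = toC N.+1%:R 0 :> C by rewrite -[RHS]/(real_complex R _) rmorph_nat.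
  rewrite /k; have -> : toC (- N.+1%:R^-1) 0 * toC N.+1%:R 0 = toC (- N.+1%:R^-1 * N.+1%:R) 0 :> C.
    by congr Complex; rewrite /= ?mulr0 ?mul0r ?subr0 ?addr0.
  by rewrite mulNr mulVf ?gt_eqF//; congr Complex; rewrite /= ?oppr0.
have dhv : devel h v.
  apply: (@devel_shift _ _ _ _ _ (D 0)) dh => t t01.
  rewrite /de -mulrnAl kN mulN1r /v clamp_id//.
  move: t01 => /andP[t0]; rewrite le_eqVlt => /orP[/eqP->|t1].
    by rewrite frac1 e0 oppr0 addr0 cline1 /w subrK.
  by rewrite frac_id// /e; ring.
pose b t := psi (h 0) (v t).
have cc : continuous (fun _ : R => h 0) by exact: cst_continuous.
have d0 : devel (fun=> h 0) (fun=> 0).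
  move=> t _; have [zeta Lz] := local_primitive_ex mX (h 0); exists zeta => //.
  by near=> s => _; rewrite !subrr.
have db : devel b v.
  by apply: (@devel_shift _ _ _ _ _ 0) (psi_devel cc vc vr d0) => t _; rewrite add0r addr0.
have v1 : v 1 = w by rewrite /v clamp_id ?cline1// ler01 lexx.
have v0 : v 0 = 0 by rewrite /v clamp_id ?cline0// ler01 lexx.
have bc : continuous b := psi_comp cc vc vr.
have i1 : 0 <= (1 : R) <= 1 by rewrite ler01 lexx.
have i0 : 0 <= (0 : R) <= 1 by rewrite ler01 lexx.
have b0 : h 0 = b 0 by rewrite /b v0 (fl_0 fl).
have hb := devel_inj mX hX nosing (lcont h) bc dhv db i0 b0.
(* The loop is now the straight translate of h 0 along w. It closes up inside a chart in which
   translation by u adds u, so w vanishes. *)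
have w0 : w = 0.
  have [zeta Hz] := fl_chart fl (h 0).
  have := hb 1 i1; rewrite loop01 b0 /b v1 v0 => /(congr1 zeta).
  by rewrite !Hz ?cabs0// addr0 => /eqP; rewrite eq_sym -subr_eq0 addrAC subrr add0r => /eqP.
pose h0 := @path_loop R X (fun=> h 0) cc erefl.
rewrite (@H1_ext R X f h h0 fH); first exact: (H1_cst (x := h 0) fH).
apply: loop_eq => t t01; rewrite hb// path_loopE// /b /v w0 /cline subrr mulr0 addr0.
exact: fl_0 fl _.
Unshelve. all: by end_near. Qed.

End SmallPeriods.

Section Dirichlet.
Context {R : realType}.

(** Dirichlet's pigeonhole: two multiples of a have fractional parts in the same cell of side 1 / N
    < e, and their difference is the required multiple. *)
Lemma simultaneous_approximation n (a : 'I_n -> R) (e : R) : 0 < e ->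
  exists (q : nat) (m : 'I_n -> int), (0 < q)%N /\ forall k, `|q%:R * a k - (m k)%:~R| < e.
Proof.
move=> e0; pose N := Num.bound e^-1.
have Ne : e^-1 < N%:R by apply: archi_boundP; rewrite invr_ge0 ltW.
have N0 : 0 < N%:R :> R by rewrite (lt_trans _ Ne)// invr_gt0.
pose code (q : nat) : {ffun 'I_n -> 'I_N.+1} :=
  [ffun k => inord `|Num.floor (N%:R * frac (q%:R * a k))|%N].
have inf : infinite_set [set: nat] by exact: infinite_nat.
have [q1 [q2 [_ _ q12 cq]]] := pigeonhole code inf.
wlog lt12 : q1 q2 q12 cq / (q2 < q1)%N.
  move=> H; have /eqP := q12; rewrite neq_ltn => /orP[lt|lt].
    by apply: (H q2 q1) => // E; apply: q12.
  exact: (H q1 q2).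
exists (q1 - q2)%N, (fun k => Num.floor (q1%:R * a k) - Num.floor (q2%:R * a k)).
split=> [|k]; first by rewrite subn_gt0.
have -> : (q1 - q2)%:R * a k - (Num.floor (q1%:R * a k) - Num.floor (q2%:R * a k))%:~R =
    frac (q1%:R * a k) - frac (q2%:R * a k).
  by rewrite natrB ?(ltnW lt12)// intrB /frac; ring.
have := congr1 (fun c : {ffun 'I_n -> 'I_N.+1} => val (c k)) cq; rewrite !ffunE /=.
have fl0 q : 0 <= N%:R * frac (q%:R * a k) by rewrite mulr_ge0 ?ler0n// (andP (frac_itv _)).1.
have flN q : (`|Num.floor (N%:R * frac (q%:R * a k))| <= N)%N.
  have H0 : 0 <= Num.floor (N%:R * frac (q%:R * a k)) by rewrite floor_ge0.
  rewrite -lez_nat gez0_abs// -(ler_int R) (le_trans (floor_bounds _).1)//.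
  by rewrite ler_piMr ?ler0n// (andP (frac_itv _)).2.
rewrite !inordK ?ltnS// => E.
have {E} E : Num.floor (N%:R * frac (q1%:R * a k)) = Num.floor (N%:R * frac (q2%:R * a k)).
  by rewrite -[LHS]gez0_abs ?floor_ge0// -[RHS]gez0_abs ?floor_ge0// E.
have [l1 u1] := floor_bounds (N%:R * frac (q1%:R * a k)).
have [l2 u2] := floor_bounds (N%:R * frac (q2%:R * a k)).
rewrite E in l1 u1.
have H : `|N%:R * (frac (q1%:R * a k) - frac (q2%:R * a k))| < 1.
  by rewrite mulrBr ltr_norml; apply/andP; split; lra.
move: H; rewrite normrM ger0_norm ?ler0n// -ltr_pdivlMl// mulr1 => /lt_trans; apply.
by rewrite invf_plt ?posrE.
Qed.

Local Notation C := (cplx R).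

(* If the additive relation is discrete at 0, real relations between periods
   follow from integral ones by simultaneous approximation. *)
Lemma discrete_relation n (a : 'I_n -> R) (w : 'I_n -> C) (c : 'I_n -> R) (r : R) : 0 < r ->
  (forall m : 'I_n -> int, cabs (\sum_k toC (m k)%:~R 0 * w k) < r ->
     \sum_k (m k)%:~R * c k = 0) ->
  \sum_k toC (a k) 0 * w k = 0 -> \sum_k a k * c k = 0.
Proof.
move=> r0 H aw; pose W := \sum_k cabs (w k); pose B := \sum_k `|c k|.
have W0 : 0 <= W by apply: sumr_ge0 => k _; exact: cabs_ge0.
have B0 : 0 <= B by apply: sumr_ge0 => k _; exact: normr_ge0.
apply/eqP; rewrite -normr_le0; apply/ler_addgt0Pl => e e0; rewrite addr0.
(* The first bound makes the integral combination of the w k smaller than r, the second makes the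
   error on the side of the c k at most e. *)
pose d := Num.min (r / (W + 1)) (e / (B + 1)).
have d0 : 0 < d by rewrite lt_min !divr_gt0// ltr_wpDl.
have [q [m [q0 Hm]]] := simultaneous_approximation a d0.
have toCB (x y : R) : toC x 0 - toC y 0 = toC (x - y) 0 :> C.
  by congr Complex; rewrite /= ?subr0.
have toCM (x y : R) : toC x 0 * toC y 0 = toC (x * y) 0 :> C.
  by congr Complex; rewrite /= ?mulr0 ?mul0r ?subr0 ?addr0.
have csum (I : Type) (s : seq I) (F : I -> C) : cabs (\sum_(k <- s) F k) <= \sum_(k <- s) cabs (F k).
  elim/big_rec2: _ => [|k x y _ xy]; first by rewrite cabs0.
  by rewrite (le_trans (cabsD _ _))// lerD2l.
have mw : \sum_k toC (m k)%:~R 0 * w k = \sum_k toC ((m k)%:~R - q%:R * a k) 0 * w k.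
  under [RHS]eq_bigr => k _ do rewrite -toCB -toCM mulrBl -mulrA.
  by rewrite sumrB -mulr_sumr aw mulr0 subr0.
have small : cabs (\sum_k toC (m k)%:~R 0 * w k) < r.
  rewrite mw; apply: le_lt_trans (csum _ _ _) _.
  apply: (@le_lt_trans _ _ (d * W)).
    rewrite mulr_sumr ler_sum// => k _; rewrite cabsM cabs_toC distrC.
    by rewrite ler_wpM2r ?cabs_ge0// ltW.
  apply: (@le_lt_trans _ _ (r / (W + 1) * W)); first by rewrite ler_wpM2r// ge_min lexx.
  by rewrite mulrAC ltr_pdivrMr ?ltr_wpDl// ltr_pM2l// ltrDl.
have := H m small => mc.
have qac : q%:R * \sum_k a k * c k = \sum_k (q%:R * a k - (m k)%:~R) * c k.
  under [RHS]eq_bigr => k _ do rewrite mulrBl -mulrA.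
  by rewrite sumrB mc subr0 mulr_sumr.
have : `|q%:R * \sum_k a k * c k| <= e.
  rewrite qac; apply: le_trans (ler_norm_sum _ _ _) _.
  apply: (@le_trans _ _ (d * B)).
    by rewrite mulr_sumr ler_sum// => k _; rewrite normrM ler_wpM2r// ltW.
  apply: (@le_trans _ _ (e / (B + 1) * B)); first by rewrite ler_wpM2r// ge_min lexx orbT.
  by rewrite mulrAC ler_pdivrMr ?ltr_wpDl// ler_pM2l// lerDl.
apply: le_trans; rewrite normrM ger0_norm ?ler0n// ler_peMl//.
by rewrite ler1n.
Qed.

End Dirichlet.

Section Torus.
Context {R : realType} {X : surface R}.
Local Notation C := (cplx R).
Hypothesis hX : translation_surface X.
Hypothesis nosing : forall x : X, ~ sing x.

Let mX : locally_modelled X := surface_model hX.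

(** The pairs formed by the period and the value of f on one loop at x. They are closed under
    integral combinations, but the value is not known beforehand to be a function of the period. *)
Definition period_loop (f : cochain R X) (x : X) (w : C) (c : R) :=
  exists (g : loop R X) D, [/\ g 0 = x, continuous D, devel g D, D 1 - D 0 = w & f g = c].

Lemma is_period_loop f (g : loop R X) w : is_period g w -> period_loop f (g 0) w (f g).
Proof.
move=> [D HD ->]; exists g, D; split=> // t.
  have [zeta [k [Lz H]]] := HD t; have zc := prim_at_continuous mX (local_primitive_prim_at Lz).
  have c1 : {for t, continuous (zeta \o g)} by apply: continuous_comp => //; exact: lcont.
  have c2 : {for t, continuous (fun s => zeta (g s) + k)}.
    by apply: cvgD; [exact: c1 | exact: cvg_cst].
  move=> A; rewrite (nbhs_singleton H) => nA.
  have n1 : nbhs t ((fun s => zeta (g s) + k) @^-1` A) := c2 _ nA.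
  by apply: filterS2 H n1 => s /= ->.
move=> _; have [zeta [k [Lz H]]] := HD t; exists zeta => //.
have E := nbhs_singleton H; apply: filterS H => s -> _; rewrite E; ring.
Qed.

Variable f : cochain R X.
Hypothesis fH : @H1 R X f.

Lemma period_loop0 x : period_loop f x 0 0.
Proof.
have cc : continuous (fun _ : R => x) by exact: cst_continuous.
exists (path_loop cc erefl), (fun=> 0); split; rewrite ?subrr//.
- exact: cst_continuous.
- move=> t _; have [zeta Lz] := local_primitive_ex mX x; exists zeta => //.
  by near=> s => _; rewrite !subrr.
- exact: (H1_cst (x := x) fH).
Unshelve. all: by end_near. Qed.

Lemma period_loopN x w c : period_loop f x w c -> period_loop f x (- w) (- c).
Proof.
move=> [g [D [g0 Dc dv Dw fg]]]; exists (loop_rev g), (fun t => D (1 - t)).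
have ic : continuous (fun t : R => 1 - t).
  by move=> t; apply: cvgB; [exact: cvg_cst | exact: cvg_id].
split.
- by rewrite loop_revE subr0 loop01.
- exact: comp_continuous ic Dc.
- move=> t /andP[t0 t1]; have t01 : 0 <= 1 - t <= 1 by apply/andP; split; lra.
  have [zeta Lz H] := dv _ t01; exists zeta; first by rewrite loop_revE.
  have n1 : nbhs t ((fun s : R => 1 - s) @^-1` [set s : R | 0 <= s <= 1 ->
      zeta (g s) - zeta (g (1 - t)) = D s - D (1 - t)]) := ic t _ H.
  apply: filterS n1 => s H' /andP[s0 s1]; rewrite !loop_revE; apply: H'.
  by apply/andP; split; lra.
- by rewrite subrr subr0 -Dw opprB.
- by rewrite H1_rev// fg.
Qed.

Lemma period_loopD x w w' c c' : period_loop f x w c -> period_loop f x w' c' ->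
  period_loop f x (w + w') (c + c').
Proof.
move=> [g1 [D1 [g10 D1c dv1 D1w fg1]]] [g2 [D2 [g20 D2c dv2 D2w fg2]]].
have g12 : g1 0 = g2 0 by rewrite g10 g20.
have [g gc] := cat_ex g12; have [_ gE] := gc.
pose D2' t : C := D2 t + (D1 1 - D2 0).
have D2'c : continuous D2' by move=> t; apply: cvgD; [exact: D2c | exact: cvg_cst].
have D12 : D1 1 = D2' 0 by rewrite /D2' addrC subrK.
exists g, (pcat D1 D2'); split.
- by have [] := gE 0 ltac:(by rewrite lexx ler01); rewrite mul0r g10.
- exact (@pcat_continuous R C D1 D2' D1c D2'c D12).
- move=> t /andP[t0 t1].
  have e1 s : 0 <= s -> s <= 1 / 2 -> g s = g1 (2 * s) /\ pcat D1 D2' s = D1 (2 * s).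
    move=> s0 s1; have s01 : 0 <= 2 * s <= 1 by apply/andP; split; lra.
    by rewrite -(gE _ s01).1 /pcat subr_ge0 s1; split=> //; congr (g _); field.
  have e2 s : 1 / 2 <= s -> s <= 1 -> g s = g2 (2 * s - 1) /\ pcat D1 D2' s = D2' (2 * s - 1).
    move=> s0 s1; have s01 : 0 <= 2 * s - 1 <= 1 by apply/andP; split; lra.
    rewrite -(gE _ s01).2; split; first by congr (g _); field.
    rewrite /pcat subr_ge0; case: ifPn => // s2; have -> : s = 1 / 2 by lra.
    transitivity (D1 1); first by congr D1; field.
    by rewrite D12; congr D2'; field.
  have [zeta Lz] := local_primitive_ex mX (g t); exists zeta => //.
  have n1 : t <= 1 / 2 -> \forall s \near t, 0 <= s <= 1 / 2 ->
      zeta (g s) - zeta (g t) = pcat D1 D2' s - pcat D1 D2' t.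
    move=> t2; have [E1 E2] := e1 t t0 t2.
    have t01 : 0 <= 2 * t <= 1 by apply/andP; split; lra.
    have Lz' : local_primitive (g1 (2 * t)) zeta by rewrite -E1.
    have mc : {for t, continuous (fun s : R => 2 * s)} by apply: cvgMr; exact: cvg_id.
    have n : nbhs t ((fun s : R => 2 * s) @^-1` [set s : R | 0 <= s <= 1 ->
        zeta (g1 s) - zeta (g1 (2 * t)) = D1 s - D1 (2 * t)]).
      by have H := devel_any mX (lcont g1) dv1 t01 Lz'; apply: mc; exact: H.
    apply: filterS n => s H /andP[s0 s1]; have [F1 F2] := e1 s s0 s1.
    by rewrite E1 E2 F1 F2; apply: H; apply/andP; split; lra.
  have n2 : 1 / 2 <= t -> \forall s \near t, 1 / 2 <= s <= 1 ->
      zeta (g s) - zeta (g t) = pcat D1 D2' s - pcat D1 D2' t.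
    move=> t2; have [E1 E2] := e2 t t2 t1.
    have t01 : 0 <= 2 * t - 1 <= 1 by apply/andP; split; lra.
    have Lz' : local_primitive (g2 (2 * t - 1)) zeta by rewrite -E1.
    have mc : {for t, continuous (fun s : R => 2 * s - 1)}.
      by apply: cvgB; [apply: cvgMr; exact: cvg_id | exact: cvg_cst].
    have n : nbhs t ((fun s : R => 2 * s - 1) @^-1` [set s : R | 0 <= s <= 1 ->
        zeta (g2 s) - zeta (g2 (2 * t - 1)) = D2 s - D2 (2 * t - 1)]).
      by have H := devel_any mX (lcont g2) dv2 t01 Lz'; apply: mc; exact: H.
    apply: filterS n => s H /andP[s0 s1]; have [F1 F2] := e2 s s0 s1.
    rewrite E1 E2 F1 F2 /D2' H; first by ring.
    by apply/andP; split; lra.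
  have [t2|t2|t2] := ltgtP t (1 / 2).
  + have n3 : nbhs t [set s : R | s < 1 / 2].
      by apply: open_nbhs_nbhs; split=> //; exact: open_lt.
    apply: filterS2 (n1 (ltW t2)) n3 => s H s2 /andP[s0 _]; apply: H.
    by rewrite s0 ltW.
  + have n3 : nbhs t [set s : R | 1 / 2 < s].
      by apply: open_nbhs_nbhs; split=> //; exact: open_gt.
    apply: filterS2 (n2 (ltW t2)) n3 => s H s2 /andP[_ s1]; apply: H.
    by rewrite s1 ltW.
  + have t2' : 1 / 2 <= t by rewrite t2.
    have t2'' : t <= 1 / 2 by rewrite t2.
    apply: filterS2 (n1 t2'') (n2 t2') => s H H' /andP[s0 s1].
    by have [s2|s2] := leP s (1 / 2); [apply: H | apply: H']; apply/andP; split=> //; exact: ltW.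
- by rewrite pcat0 pcat1 /D2' -D1w -D2w; ring.
- by rewrite (fH.2 _ _ _ gc) fg1 fg2.
Qed.

Lemma period_loop_int x w c (m : int) : period_loop f x w c ->
  period_loop f x (toC m%:~R 0 * w) (m%:~R * c).
Proof.
move=> L; have P (n : nat) : period_loop f x (toC n%:R 0 * w) (n%:R * c).
  elim: n => [|n IH].
    by have -> : toC 0%:R 0 = 0 :> C by []; rewrite !mul0r; exact: period_loop0.
  have -> : toC n.+1%:R 0 = 1 + toC n%:R 0 :> C.
    by congr Complex; rewrite /= ?addr0// -nat1r.
  by rewrite -nat1r !mulrDl !mul1r; exact: period_loopD.
case: m => n; first exact: P.
have -> : toC (Negz n)%:~R 0 = - toC n.+1%:R 0 :> C.
  by congr Complex; rewrite /= ?oppr0// NegzE mulrNz.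
by rewrite NegzE mulrNz !mulNr; apply: period_loopN; exact: P.
Qed.

Lemma period_loop_sum x n (w : 'I_n -> C) (c : 'I_n -> R) :
  (forall k, period_loop f x (w k) (c k)) -> period_loop f x (\sum_k w k) (\sum_k c k).
Proof.
move=> L; elim/big_rec2: _ => [|k y z _ H]; first exact: period_loop0.
exact: period_loopD.
Qed.

Variables (r : R) (psi : X -> C -> X).
Hypothesis fl : flat_flow r psi.

(** Loops with different base points have to be concatenated; the flow carries them to a common base
    point, preserving the period and the free homotopy class. *)
Lemma period_loop_move x y w c : period_loop f x w c -> period_loop f y w c.
Proof.
have step z u : cabs u < r -> period_loop f z w c -> period_loop f (psi z u) w c.
  move=> ur [g [D [g0 Dc dv Dw fg]]].
  have uc : continuous (fun _ : R => u) by exact: cst_continuous.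
  have [g' [gg' g'E dv']] := flow_step mX fl uc (fun=> erefl) (fun=> ur) dv.
  exists g', (fun t => D t + u); split.
  - by rewrite g'E g0.
  - by move=> t; apply: cvgD; [exact: Dc | exact: cvg_cst].
  - exact dv'.
  - by rewrite -Dw; ring.
  - by rewrite -fg; apply/esym/fH.1.
move=> Lx; suff H : [set: X] `<=` [set y | period_loop f y w c] by exact: H.
apply: (@connected_clopen X setT _ x) => //.
- exact: ts_connected hX.
- move=> z _ Lz; apply: filterS (fl_near fl z) => z' [[u ur <-] _] _.
  exact: step.
- move=> z _ nLz; apply: filterS (fl_near fl z) => z' [_ [u ur E]] _ Lz'.
  by apply: nLz; rewrite -E; exact: step.
Qed.

Lemma small_period_loop x w c : period_loop f x w c -> cabs w < r -> c = 0.
Proof.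
move=> [g [D [_ Dc dv <- <-]]].
exact: (small_period mX (ts_hausdorff hX) nosing fl fH Dc dv).
Qed.

End Torus.

(** For a fixed h, the principle on small periods is applied to the class [I ^~ h], not to f. The
    real relation between the periods then gives the same relation between the numbers I (g k) h,
    whose combination is f h. *)
Lemma torus_holonomy (R : realType) (X : surface R) (f : cochain R X) :
  translation_surface X -> (forall x : X, ~ sing x) -> hol_is X f 0 -> f = 0.
Proof.
move=> hX nosing [n [a [g [per [[I [_ IH _] fE] perP per0]]]]].
have mX := surface_model hX.
have [r [psi fl]] := flat_flow_ex mX (ts_hausdorff hX) (ts_compact hX) nosing.
have [_ [x0 _]] := ts_form_neq0 hX.
apply/funext => h; rewrite fE.
apply: (discrete_relation (fl_gt0 fl) _ (esym per0)) => m.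
apply: (small_period_loop hX nosing (IH h) fl (x := x0)).
apply: period_loop_sum => // k; apply: period_loop_int => //.
by apply: (period_loop_move hX (IH h) fl); apply: is_period_loop.
Qed.

(** * Kernels of the cohomological representation *)

Section Representation.
Context {R : realType} {X : surface R} {G : set 'M[R]_2}.
Variable psi : 'M[R]_2 -> sing_homeo X.
Hypothesis sG : subgroup G.
Hypothesis d1 : forall g, G g -> \det g = 1.
Hypothesis hpsi : cohomology_representation G psi.

Lemma coh_act_inj (phi : sing_homeo X) f e : @H1 R X f -> @H1 R X e ->
  coh_act phi f = coh_act phi e -> f = e.
Proof.
move=> fH eH E; apply/funext => g.
have back : loop_map (hinv phi) (loop_map (hfun phi) g) =1 g by move=> t; exact: hfunK.
by rewrite -(H1_ext fH back) -(H1_ext eH back); exact: (congr1 (@^~ _) E).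
Qed.

Lemma coh_act_sum (phi : sing_homeo X) n (u : 'I_n -> cochain R X) :
  coh_act phi (\sum_j u j) = \sum_j coh_act phi (u j).
Proof.
by apply/funext => g; rewrite /coh_act !fct_sumE.
Qed.

Section Kernel.
Variable F : set (cochain R X).
Hypothesis FH : F `<=` @H1 R X.
Hypothesis Finv : rep_invariant G psi F.

(** The map chosen for the derivative 1 may be a nontrivial translation, but its action on F is both
    idempotent and injective. *)
Lemma coh_act1 f : F f -> coh_act (psi 1) f = f.
Proof.
move=> Ff; have G1 : G 1 by case: sG.
apply: (@coh_act_inj (psi 1)); [exact/FH/Finv | exact: FH |].
by rewrite -(hpsi.2 1 1 f G1 G1 (FH Ff)) mulr1.
Qed.

Lemma ker_rep_subgroup : subgroup (ker_rep G psi F).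
Proof.
have [G1 GM GV] := sG; split.
- by split=> // f /coh_act1.
- move=> g h [Gg Hg] [Gh Hh]; split=> [|f Ff]; first exact: GM.
  by rewrite hpsi.2 ?Hh ?Hg//; exact: FH.
- move=> g [Gg Hg]; split=> [|f Ff]; first exact: GV.
  rewrite -[in LHS](Hg f Ff) -hpsi.2 //; [|exact: GV|exact: FH].
  by rewrite (invmx_detE (d1 Gg)).2; exact: coh_act1.
Qed.

Lemma ker_rep_normal : normal_in G (ker_rep G psi F).
Proof.
have [G1 GM GV] := sG; move=> g k Gg [Gk Hk]; split=> [|f Ff].
  by apply: (GM); [exact: GM | exact: GV].
have Ff' : F (coh_act (psi (invmx g)) f) by apply: Finv => //; exact: GV.
rewrite hpsi.2; [|exact: GM|exact: GV|exact: FH].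
rewrite (hpsi.2 g k)//; last exact: FH.
rewrite Hk// -hpsi.2//; [|exact: GV|exact: FH].
by rewrite (invmx_detE (d1 Gg)).1; exact: coh_act1.
Qed.

End Kernel.

(** The factor G accounts for n = 0, where the intersection is the set of all matrices. *)
Lemma ker_rep_sum n (F : 'I_n -> set (cochain R X)) : (forall j, F j 0) ->
  ker_rep G psi (sum_space F) = G `&` \bigcap_j ker_rep G psi (F j).
Proof.
move=> F0; apply/seteqP; split=> g [Gg H]; split=> //.
  move=> j _; split=> // f Ff; apply: H.
  exists (fun i => if i == j then f else 0).
    by move=> i; case: eqP => [->|].
  by rewrite -big_mkcond big_pred1_eq.
move=> _ [u uF ->]; rewrite coh_act_sum; apply: eq_bigr => j _.
by have [_ ->] := H j I.
Qed.

End Representation.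

(** Starts the induction over the subspaces, where the empty intersection of kernels is G itself. *)
Lemma nonelementary_nontrivial (R : realType) (G : set 'M[R]_2) :
  (forall g, G g -> \det g = 1) -> non_elementary G -> exists2 g, G g & g <> 1.
Proof.
move=> d1 /(non_elementaryP d1) /(_ [:: (1, 0)])[v [v0 H] _].
apply: contrapT => triv.
have v2 : 0 < nrm2 v by rewrite nrm2_gt0.
have f2 : 0 < frob (1 : 'M[R]_2) by apply: frob_gt0; exact: det1.
have [|g Gg] := H (nrm2 v / frob (1 : 'M[R]_2) / 2); first by rewrite !divr_gt0.
have -> : g = 1 by apply: contrapT => g1; apply: triv; exists g.
rewrite ract1 mulrAC divfK ?gt_eqF//; lra.
Qed.

Section CoverVeechGroup.
Context {R : realType} {X : surface R} {Y : topologicalType}.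
Variable p : continuousType Y X.
Hypothesis hX : translation_surface X.
Context {d : nat} {f : 'I_d -> cochain R X}.
Hypothesis fZ : forall i, H1Z (f i).
Hypothesis ac : abelian_cover p f.

(** Both the map and its inverse preserve the classes, so both lift; with matching base points the
    two composites lift the identity and fix a point, hence are the identity. *)
Lemma lift_affine (phi : sing_homeo X) A : \det A = 1 -> affine_with_derivative phi A ->
  (forall i, coh_act phi (f i) = f i) -> veech_group (pullback p) A.
Proof.
move=> dA phiA fphi; have a := homeo_aff phiA; have [cp _ _] := ac.
have fH i : @H1 R X (f i) by have [] := fZ i.
have f1 i g : f i (loop_map (hinv phi) g) = f i g by exact: (congr1 (@^~ g) (fphi i)).
have f2 i g : f i (loop_map (hfun phi) g) = f i g.
  by rewrite -f1; apply: (H1_ext (fH i)) => t; exact: hfunK.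
have [_ [x0 _]] := ts_form_neq0 hX; have [y0 _] := cp.1 x0.
have [y1 py1] := cp.1 (hfun phi (p y0)).
have [Phi [Pc P0 PE]] := surface_map_lift hX ac f2 py1.
have py0 : p y0 = hinv phi (p y1) by rewrite py1 hfunK.
have [Psi [Qc Q0 QE]] := surface_map_lift hX ac f1 py0.
have idc : continuous (@id Y) by move=> y; exact: cvg_id.
have K1 : Psi \o Phi = id.
  apply: (lift_eq hX ac (y := y0) (comp_continuous Pc Qc) idc) => [z|]; rewrite /= ?P0//.
  by rewrite QE PE hfunK.
have K2 : Phi \o Psi = id.
  apply: (lift_eq hX ac (y := y1) (comp_continuous Qc Pc) idc) => [z|]; rewrite /= ?Q0//.
  by rewrite PE QE hinvK.
apply/veech_aff; split=> //; exists Phi, Psi; split=> //.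
- by move=> z; exact: (congr1 (@^~ z) K1).
- by move=> z; exact: (congr1 (@^~ z) K2).
- by move=> z nz; rewrite /= PE; exact: (aff_sing a).
- by move=> z nz; rewrite /= QE; exact: (aff_sing' a).
- exact: (affine_up hX cp Pc PE (aff_map a)).
Qed.

End CoverVeechGroup.

(** * The kind of the kernel and of the Veech group of the cover *)

Theorem theorem2 (R : realType) (X : surface R) (hX : translation_surface X)
  (G : set 'M[R]_2) (hG : subgroup G) (hGV : G `<=` veech_group X)
  (hGfin : finite_index G (veech_group X))
  (hGtf : torsion_free G) (hGne : non_elementary G)
  (psi : 'M[R]_2 -> sing_homeo X) (hpsi : cohomology_representation G psi)
  (d : nat) (f : 'I_d -> cochain R X)
  (hfZ : forall i, H1Z (f i)) (hfprim : forall i, primitive_class (f i))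
  (hfind : lin_indep f) (hfhol : forall i, hol_is X (f i) 0)
  (Y : topologicalType) (p : continuousType Y X) (hp : abelian_cover p f)
  (n : nat) (F : 'I_n -> set (cochain R X))
  (hFhol : forall j, F j `<=` ker_hol X)
  (hFint : forall j, integer_subspace (F j))
  (hFinv : forall j, rep_invariant G psi (F j))
  (hFirr : forall j, irreducible_over_Z G psi (F j))
  (hFdir : direct_sum F)
  (hfF : forall i, sum_space F (f i))
  (hK : forall j, exists2 g, ker_rep G psi (F j) g & g <> 1) :
  let K := ker_rep G psi (sum_space F) in
  K = G `&` \bigcap_j ker_rep G psi (F j) /\
  (first_kind G -> first_kind K /\ first_kind (veech_group (pullback p))) /\
  (second_kind G -> second_kind K /\ second_kind (veech_group (pullback p))).
Proof.
move=> K.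
have d1 g : G g -> \det g = 1 by move=> /hGV[].
have Gfin : frob_finite G.
  move=> C; apply: sub_finite_set (veech_frob_finite hX C).
  by move=> g [/hGV ? ?]; split.
have ne := non_elementaryP d1 hGne.
have FH j : F j `<=` @H1 R X by move=> e /hFhol[].
have KE : K = G `&` \bigcap_j ker_rep G psi (F j).
  by apply: (ker_rep_sum psi (G := G)) => j; have [] := hFint j.
(* Intersections over finite lists of indices, so that non-triviality follows by adding one kernel
   at a time with [normal_inter]. *)
pose Ks (s : seq 'I_n) := G `&` [set g | forall j, j \in s -> ker_rep G psi (F j) g].
have KsP s : [/\ subgroup (Ks s), normal_in G (Ks s) & exists2 g, Ks s g & g <> 1].
  elim: s => [|j s [sS nS tS]].
    have -> : Ks [::] = G by apply/seteqP; split=> g; [case | split].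
    split=> //; last exact: nonelementary_nontrivial.
    by have [G1 GM GV] := hG => g k Gg Gk; apply: (GM); [exact: GM | exact: GV].
  have sK := ker_rep_subgroup hG d1 hpsi (FH j) (hFinv j).
  have nK := ker_rep_normal hG d1 hpsi (FH j) (hFinv j).
  have KI : Ks (j :: s) = ker_rep G psi (F j) `&` Ks s.
    apply/seteqP; split=> g.
      by move=> [Gg H]; split; [apply: H; rewrite mem_head | split=> // i si; apply: H; rewrite inE si orbT].
    by move=> [Kg [Gg H]]; split=> // i; rewrite inE => /orP[/eqP->|/H].
  have KG : ker_rep G psi (F j) `<=` G by move=> g [].
  have SG : Ks s `<=` G by move=> g [].
  rewrite KI; split.
  - have [K1 KM KV] := sK; have [S1 SM SV] := sS; split.
    + by split.
    + by move=> g h [? ?] [? ?]; split; [exact: KM | exact: SM].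
    + by move=> g [? ?]; split; [exact: KV | exact: SV].
  - by move=> g k Gg [? ?]; split; [exact: nK | exact: nS].
  - exact: (normal_inter hG d1 Gfin hGtf ne sK KG nK sS SG nS (hK j) tS).
have [sK nK [k Kk k1]] : [/\ subgroup K, normal_in G K & exists2 g, K g & g <> 1].
  suff -> : K = Ks (enum 'I_n) by exact: KsP.
  rewrite KE; apply/seteqP; split=> g [Gg H]; split=> // j _; first exact: H.
  by apply: H; rewrite mem_enum.
have KG : K `<=` G by move=> g [].
have GK := normal_limdir hG d1 Gfin hGtf ne sK KG nK Kk k1.
have dK g : K g -> \det g = 1 by move=> /KG/d1.
have dV g : veech_group (pullback p) g -> \det g = 1 by case.
have KV : K `<=` veech_group (pullback p).
  move=> g Kg; apply: (lift_affine hX hfZ hp (dK _ Kg) (hpsi.1 g (KG g Kg))) => i.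
  by have [_] := Kg; apply; exact: hfF.
have mono (A B : set 'M[R]_2) u : A `<=` B -> limdir A u -> limdir B u.
  by move=> AB [u0 H]; split=> // e /H[g /AB]; exists g.
split=> //; split.
  move=> /(first_kindP d1) G1; split; [apply/(first_kindP dK) | apply/(first_kindP dV)].
    by move=> u /G1/GK.
  by move=> u /G1/GK; exact: mono.
move=> G2; have nG : ~ (forall u, u != 0 -> limdir G u) by move=> H; apply: G2; apply/(first_kindP d1).
split.
  move=> /(first_kindP dK) K1; apply: nG => u /K1; exact: mono.
(* Without singularities all f i vanish by [torus_holonomy], and linear independence then leaves no
   index. *)
have sd : (exists x : X, sing x) \/ d = 0%N.
  have [sX|nsX] := pselect (exists x : X, sing x); [by left | right].
  have nosing (x : X) : ~ sing x by move=> sx; apply: nsX; exists x.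
  have f0 i : f i = 0 by exact: torus_holonomy hX nosing (hfhol i).
  case: d f f0 hfind {hfZ hfprim hfhol hp hfF KV} => // d' f' f0' ind.
  have : (1 : R) = 0.
    apply: (ind (fun=> 1) _ ord0); apply: big1 => i _.
    by rewrite f0' scaler0.
  by move=> /eqP; rewrite oner_eq0.
have [s1 Hs1] := veech_cover_cosets hX hfZ hp sd.
have [s2 Hs2] := hGfin.
move=> /(first_kindP dV); apply: (@limdir_union R G hG d1 Gfin ne [seq a * b | a <- s1, b <- s2]) => //.
move=> A /Hs1[m [h [ms /Hs2[r [g [rs Gg ->]]] ->]]].
exists (m * r), g; split=> //; last by rewrite mulrA.
by apply/allpairsP; exists (m, r).
Qed.
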